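(* Let $\Delta G_{n,m}=\widetilde G_{n,m}-G_{n,m}$ be the difference between the inchworm Monte Carlo solution and the deterministic solution defined in the context. Assume (H1) and (H3) of the context. Then there is a polynomial $P_2$ of degree $\bar M-1$, independent of $h$, such that for every sufficiently small time step $h$ and every sufficiently large $N_s$, for all $0\le m\le n\le 2N-1$: (Bias estimation) $$\|\mathbb{E}(\Delta G_{n+1,m})\| \le 4\theta_2^2\, \bar{\alpha}(t_{n-m+1})\,\bar{\gamma}(t_{n-m+1})\, e^{3 \theta_1 \sqrt{P_1(t_{n-m+1})}\, t_{n-m+1}}\cdot \frac{h}{N_s},$$ (Numerical error estimation) $$[\mathbb{E}(\|\Delta G_{n+1,m}\|^2)]^{1/2} \le \theta_2 \sqrt{\bar{\gamma}(t_{n-m+1})}\; e^{ \theta_1 \sqrt{P_1(t_{n-m+1})}\, t_{n-m+1}} \cdot \sqrt{\frac{h}{N_s}} .$$ Here $\theta_1=353$, $\theta_2=\sqrt{34}$, and $$\bar\alpha(t)=16P_2(t)\,(10t+16t^2+5t^3+\tfrac14t^4),\qquad \bar\gamma(t)=2\mathscr W\mathscr G\mathscr L^{1/2}\sum_{\substack{M=1\\ M\text{ odd}}}^{\bar M}\frac{(\mathscr W\mathscr G\mathscr L^{1/2}t)^M}{(M-1)!!},$$ $$P_1(t)=2\mathscr W^2\mathscr G\mathscr L+3\mathscr W^3\mathscr G^2\mathscr L^{3/2}(1+t)\sum_{\substack{M=3\\ M\text{ odd}}}^{\bar M}\frac{(M-1)M}{(M-3)!!}(2\mathscr W\mathscr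 G\mathscr L^{1/2}t)^{M-2}.$$
   Context: **Problem.** Fix $t>0$, an odd integer $\bar M\ge1$, Hermitian matrices $H_s,W_s,O_s\in\mathbb C^{2\times2}$ with $\|O_s\|=1$, and a function $B:\{(\tau_2,\tau_1):0\le\tau_1\le\tau_2\le2t\}\to\mathbb C$. Throughout $\|\cdot\|$ is the Frobenius norm of $2\times2$ matrices and $I=\mathrm{Id}$ the $2\times 2$ identity. For $\vec s=(s_M,\dots,s_1)$, $\#\{\vec s<t\}$ is the number of components less than $t$, and $\int_{b>\vec s>a}d\vec s=\int_a^b\int_a^{s_M}\cdots\int_a^{s_2}ds_1\cdots ds_M$. For even $m$ and $s_m>\dots>s_1$, $\mathcal L(s_m,\dots,s_1)=\sum_{\mathfrak q}\prod_{(s_k,s_j)\in\mathfrak q}B(s_k,s_j)$, where $\mathfrak q$ runs over all linked pairings of $\{s_1,\dots,s_m\}$ (pairs written with $j<k$); a pairing is linked if, drawing each pair as an arc above the line, the union of the arcs is connected, i.e. the graph on the arcs in which $(s_k,s_j),(s_{k'},s_{j'})$ are adjacent when $j<j'<k<k'$ or $j'<j<k'<k$ is connected. **Exact solution.** $G_{\rm e}(s_{\rm f},s_{\rm i})\in\mathbb C^{2\times2}$, $0\le s_{\rm i}\le s_{\rm f}\le2t$, solves, for $s_{\rm i}\in[0,2t]\setminus\{t\}$, $s_{\rm f}\in[s_{\rm i},2t]\setminus\{t\}$, $$\frac{\partial G_{\rm e}(s_{\rm f},s_{\rm i})}{\partial s_{\rm f}}=\mathrm{sgn}(s_{\rm f}-t)\Big[\mathrm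 iH_sG_{\rm e}(s_{\rm f},s_{\rm i})+\sum_{M\le\bar M,\,M\text{ odd}}\mathrm i^{M+1}\int_{s_{\rm f}>\vec s>s_{\rm i}}(-1)^{\#\{\vec s<t\}}W_sG_{\rm e}(s_{\rm f},s_M)W_sG_{\rm e}(s_M,s_{M-1})W_s\cdots W_sG_{\rm e}(s_1,s_{\rm i})\,\mathcal L(s_{\rm f},\vec s)\,d\vec s\Big],$$ with $G_{\rm e}(s',s')=\mathrm{Id}$ and jump conditions $\lim_{s_{\rm f}\to t^+}G_{\rm e}(s_{\rm f},s_{\rm i})=O_s\lim_{s_{\rm f}\to t^-}G_{\rm e}(s_{\rm f},s_{\rm i})$, $\lim_{s_{\rm i}\to t^-}G_{\rm e}(s_{\rm f},s_{\rm i})=\lim_{s_{\rm i}\to t^+}G_{\rm e}(s_{\rm f},s_{\rm i})O_s$. **Mesh and interpolation.** $h=t/N\le1$, $t_j=jh$, $j=0,\dots,2N$ (so $t_N=t$). Given $2\times2$ matrices $G_{j,k}$ for $m\le k<j\le n$, and $G_{j,j}=\mathrm{Id}$, $I_hG(s_{\rm f},s_{\rm i})$ on $t_m\le s_{\rm i}\le s_{\rm f}\le t_n$ is the continuous piecewise linear interpolant with $I_hG(t_j,t_k)=G_{j,k}$ on the triangular mesh obtained by cutting the grid squares $[t_j,t_{j+1}]\times[t_k,t_{k+1}]$ by lines parallel to $s_{\rm f}=s_{\rm i}$. Because of the jumps the index $N$ stands for two one-sided copies $N^-,N^+$ (limits from below/above $t$), with $G_{N^+,k}=O_sG_{N^-,k}$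 ($k<N$), $G_{j,N^-}=G_{j,N^+}O_s$ ($j>N$), $G_{N^\pm,N^\pm}=\mathrm{Id}$, $G_{N^+,N^-}=O_s$; interpolation is done separately in the regions $s_{\rm f}<t$; $s_{\rm i}<t<s_{\rm f}$; $t<s_{\rm i}$, using in each the one-sided nodal values belonging to that region. Also $\mathrm{sgn}(t_{N^-}-t)=-1$, $\mathrm{sgn}(t_{N^+}-t)=1$. **Deterministic scheme.** $G_{m,m}=\mathrm{Id}$ and for $0\le m\le n\le2N-1$ $$G^*_{n+1,m}=(I+\mathrm{sgn}(t_n-t)\mathrm iH_sh)G_{n,m}+K_1h,$$ $$G_{n+1,m}=(I+\tfrac12\mathrm{sgn}(t_n-t)\mathrm iH_sh)G_{n,m}+\tfrac12\mathrm{sgn}(t_{n+1}-t)\mathrm iH_sh\,G^*_{n+1,m}+\tfrac12(K_1+K_2)h,$$ where $K_1=F_1(\boldsymbol g_{n,m})$, $K_2=F_2(\boldsymbol g^*_{n,m})$, $\boldsymbol g_{n,m}=(G_{j,k})_{m\le k<j\le n}$, $\boldsymbol g^*_{n,m}=(\boldsymbol g_{n,m};G_{n+1,n},\dots,G_{n+1,m+1},G^*_{n+1,m})$, $$F_1(\boldsymbol g_{n,m})=\mathrm{sgn}(t_n-t)\sum_{M\le\bar M,\,M\text{ odd}}\mathrm i^{M+1}\int_{t_n>\vec s>t_m}(-1)^{\#\{\vec s<t\}}W_sI_hG(t_n,s_M)W_s\cdots W_sI_hG(s_1,t_m)\mathcal L(t_n,\vec s)\,d\vec s,$$ and $F_2(\boldsymbol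 g^*_{n,m})$ is the same expression with $t_n$ replaced by $t_{n+1}$ and $I_h$ by $I_h^*$, the interpolant on $t_m\le s_{\rm i}\le s_{\rm f}\le t_{n+1}$ with nodal values $G_{j,k}$ except value $G^*_{n+1,m}$ at $(t_{n+1},t_m)$. When $n=N-1$, $G^*_{n+1,m},G_{n+1,m}$ mean $G^*_{N^-,m},G_{N^-,m}$ and $\mathrm{sgn}(t_{n+1}-t)=-1$; when $n=N$, $G_{n,m}$ means $G_{N^+,m}$ and $\mathrm{sgn}(t_n-t)=1$. **Inchworm Monte Carlo scheme.** $\widetilde G,\widetilde G^*$ are given by the same recursion and conventions with $K_1,K_2$ replaced by $$\widetilde K_1=\frac{\mathrm{sgn}(t_n-t)}{N_s}\sum_{i=1}^{N_s}\sum_{M\le\bar M,\,M\text{ odd}}\mathrm i^{M+1}\frac{(t_n-t_m)^M}{M!}(-1)^{\#\{\vec s_M^{(i)}<t\}}W_sI_h\widetilde G(t_n,s_M^{(i)})W_s\cdots W_sI_h\widetilde G(s_1^{(i)},t_m)\mathcal L(t_n,\vec s_M^{(i)}),$$ with $\vec s^{(i)}_M$ drawn uniformly from $[t_m,t_n]^M$ and sorted increasingly as $s^{(i)}_1<\dots<s_M^{(i)}$, and $\widetilde K_2$ the same with $t_n$ replaced by $t_{n+1}$, $I_h$ by $I_h^*$ (using $\widetilde G^*_{n+1,m}$ at $(t_{n+1},t_m)$), and fresh samples $\vec s_M^{*(i)}$ from $[t_m,t_{n+1}]^M$; all draws (over $i$, both stages and all $(n,m)$) are independent. **Assumptions.**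 (H1) There is a constant $\mathscr G$ (independent of $h$, $N_s$) with $\|G_{\rm e}(s_{\rm f},s_{\rm i})\|\le\mathscr G$ for all $0\le s_{\rm i}\le s_{\rm f}\le2t$ and $\|G_{j,k}\|,\|\widetilde G_{j,k}\|\le\mathscr G$ for all mesh indices (including $N^\pm$). (H3) $\|H_s\|\le\mathscr H$, $\|W_s\|\le\mathscr W$, $|B|\le\mathscr L$, with constants $\mathscr H,\mathscr W,\mathscr L$ (so $|\mathcal L(s_m,\dots,s_1)|\le(m-1)!!\,\mathscr L^{m/2}$). ''Sufficiently small $h$, sufficiently large $N_s$'' means that there exist thresholds $h_0>0$, $N_0$ such that the assertion holds for all $h=t/N\le h_0$, $N_s\ge N_0$. *)

(* Defs.v *)
From HB Require Import structures.
From mathcomp Require Import all_boot all_order all_algebra.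
From mathcomp Require Import complex.
From mathcomp Require Import all_classical all_reals all_analysis.

Set Implicit Arguments.
Unset Strict Implicit.
Unset Printing Implicit Defensive.

Import Order.TTheory GRing.Theory Num.Theory.
Import numFieldNormedType.Exports.

Local Open Scope classical_set_scope.
Local Open Scope ring_scope.
Local Open Scope complex_scope.

Section MatrixNormAndIntegral.
Variable R : realType.

Definition frobenius (A : 'M[R[i]]_2) : R :=
  Num.sqrt (\sum_i \sum_j (complex.Re (A i j) ^+ 2 + complex.Im (A i j) ^+ 2)).

Definition mx_integral d (T : measurableType d) (mu : {measure set T -> \bar R})
    (D : set T) (f : T -> 'M[R[i]]_2) : 'M[R[i]]_2 :=
  \matrix_(i, j)
    ((\int[mu]_(x in D) complex.Re (f x i j)) +i*
     (\int[mu]_(x in D) complex.Im (f x i j))).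

(* [simplex_int M a b f] is
   \int_a^b \int_a^{s_M} ... \int_a^{s_2} f [:: s_1; ...; s_M] ds_1 ... ds_M :
   the outermost variable is the largest one, s_M, placed last in the list. *)
Fixpoint simplex_int (M : nat) (a b : R) (f : seq R -> 'M[R[i]]_2)
    : 'M[R[i]]_2 :=
  if M is M'.+1 then
    mx_integral (@lebesgue_measure R) `[a, b]
      (fun sM => simplex_int M' a sM (fun s => f (rcons s sM)))
  else f [::].

End MatrixNormAndIntegral.

Section LinkedPairings.
Variable m : nat.
Implicit Types (a b : 'I_m * 'I_m) (q : {set 'I_m * 'I_m}).

(* A pairing is the set of its arcs (j, k), j < k. *)
Definition pairing q : bool :=
  [forall a in q, (a.1 < a.2)%N] &&
  [forall i : 'I_m, #|[set a in q | (i == a.1) || (i == a.2)]| == 1%N].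

Definition crossing a b : bool :=
  ((a.1 < b.1 < a.2) && (a.2 < b.2))%N || ((b.1 < a.1 < b.2) && (b.2 < a.2))%N.

Definition linked q : bool :=
  [forall a in q, forall b in q,
     connect (fun c e => [&& c \in q, e \in q & crossing c e]) a b].

End LinkedPairings.

(* Times are listed in increasing order; [B] takes the later time first. *)
Definition linked_sum (R : realType) (B : R -> R -> R[i]) (s : seq R) : R[i] :=
  \sum_(q : {set 'I_(size s) * 'I_(size s)} | pairing q && linked q)
    \prod_(a in q) B s`_(a.2) s`_(a.1).

(* Data of the problem: [horizon] is t, [max_order] is \bar M. *)
Record model (R : realType) := Model {
  horizon : R;
  max_order : nat;
  Hs : 'M[R[i]]_2;
  Ws : 'M[R[i]]_2;
  Os : 'M[R[i]]_2;
  corr : R -> R -> R[i]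
}.

Section Dyson.
Variables (R : realType) (D : model R).
Local Notation t := (horizon D).
Local Notation W := (Ws D).
Local Notation B := (corr D).

(* W G(y, s_M) W G(s_M, s_(M-1)) W ... W G(s_1, x) for s = [:: s_1; ...; s_M] *)
Fixpoint chain (Pt : Type) (G : Pt -> Pt -> 'M[R[i]]_2) (x : Pt) (s : seq Pt)
    (y : Pt) : 'M[R[i]]_2 :=
  if s is s1 :: s' then chain G s1 s' y *m (W *m G s1 x) else W *m G y x.

(* The integrand of order [size s].  The propagator [G] takes arguments in an
   abstract type [Pt] of points, [loc] sending a time to a point; [x] and [y]
   are the points of the initial time and of the final time [sf]. *)
Definition dyson_term (Pt : Type) (G : Pt -> Pt -> 'M[R[i]]_2) (loc : R -> Pt)
    (x y : Pt) (sf : R) (s : seq R) : 'M[R[i]]_2 :=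
  ((-1) ^+ count (fun r => r < t) s * linked_sum B (rcons s sf)) *:
    chain G x (map loc s) y.

Definition exact_rhs (G : R -> R -> 'M[R[i]]_2) (sf si : R) : 'M[R[i]]_2 :=
  (Num.sg (sf - t))%:C *:
   ('i%C *: (Hs D *m G sf si) +
    \sum_(1 <= M < (max_order D).+1 | odd M)
      'i%C ^+ M.+1 *: simplex_int M si sf (dyson_term G id si sf sf)).

Definition mx_cvg (F : set_system R) (f : R -> 'M[R[i]]_2) (L : 'M[R[i]]_2) :=
  (fun x => frobenius (f x - L)) @ F --> (0 : R).

Definition triangle : set (R * R) :=
  [set x | [/\ 0 <= x.2, x.2 <= x.1 & x.1 <= 2 * t]].

Definition measurable_corr : Prop :=
  measurable_fun triangle (fun x => complex.Re (B x.1 x.2)) /\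
  measurable_fun triangle (fun x => complex.Im (B x.1 x.2)).

Definition measurable_propagator (G : R -> R -> 'M[R[i]]_2) : Prop :=
  forall i j,
    measurable_fun triangle (fun x => complex.Re (G x.1 x.2 i j)) /\
    measurable_fun triangle (fun x => complex.Im (G x.1 x.2 i j)).

(* The derivative in the final time is taken relatively to [si, 2t], hence is
   one-sided at the end points. *)
Definition exact_solution (G : R -> R -> 'M[R[i]]_2) : Prop :=
  [/\ measurable_propagator G,
      (forall s, 0 <= s <= 2 * t -> G s s = 1%:M),
      (forall si sf, 0 <= si <= 2 * t -> si <> t -> si <= sf <= 2 * t ->
         sf <> t ->
         mx_cvg (within [set y | [/\ y <> sf, si <= y & y <= 2 * t]] (nbhs sf))
           (fun y => ((y - sf)^-1)%:C *: (G y si - G sf si))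
           (exact_rhs G sf si)),
      (forall si, 0 <= si < t -> exists L,
         mx_cvg (t^'-) (G ^~ si) L /\ mx_cvg (t^'+) (G ^~ si) (Os D *m L)) &
      (forall sf, t < sf <= 2 * t -> exists L,
         mx_cvg (t^'+) (G sf) L /\ mx_cvg (t^'-) (G sf) (L *m Os D))].

End Dyson.

(* Mesh nodes are numbered 0, ..., 2N+1, with N standing for the copy N^- of the
   mesh index N and N+1 for the copy N^+; mesh indices beyond N are shifted by
   one. *)
Section Mesh.
Variables (R : realType) (D : model R) (N : nat).
Local Notation t := (horizon D).
Local Notation h := (t / N%:R).

Definition mesh_index (p : nat) : nat := if (p <= N)%N then p else p.-1.

Definition node_time (p : nat) : R := (mesh_index p)%:R * h.

Definition node_sgn (p : nat) : R[i] := if (p <= N)%N then -1 else 1.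

(* A point of the mesh is a pair (c, l): the point at the fraction l of the cell
   from node c to node c+1; node c itself is (c, 0).  [locate p s] is the point
   of time s, seen from a final node p: it lies to the right of t only if p
   does. *)
Definition locate (p : nat) (s : R) : nat * R :=
  let c := Num.truncn (s / h) in
  (if (p <= N)%N || (s < t) then c else c.+1, s / h - c%:R).

(* On the square with cells j (final time) and k (initial time), the two
   triangles are separated by l = u. *)
Definition interp (g : nat -> nat -> 'M[R[i]]_2) (x y : nat * R)
    : 'M[R[i]]_2 :=
  let: (j, l) := x in let: (k, u) := y in
  if u <= l then
    (1 - l)%:C *: g j k + (l - u)%:C *: g j.+1 k + u%:C *: g j.+1 k.+1
  else
    (1 - u)%:C *: g j k + (u - l)%:C *: g j k.+1 + l%:C *: g j.+1 k.+1.

Definition mesh_term (p q : nat) (g : nat -> nat -> 'M[R[i]]_2) (s : seq R)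
    : 'M[R[i]]_2 :=
  dyson_term D (interp g) (locate p) (q, 0) (p, 0) (node_time p) s.

(* Exact quadrature between the initial node q and the final node p. *)
Definition exact_sum (p q : nat) (g : nat -> nat -> 'M[R[i]]_2)
    : 'M[R[i]]_2 :=
  node_sgn p *: \sum_(1 <= M < (max_order D).+1 | odd M)
    'i%C ^+ M.+1 *: simplex_int M (node_time q) (node_time p) (mesh_term p q g).

(* Monte Carlo quadrature; [x i M] is the sorted i-th sample of order M. *)
Definition mc_sum (Ns : nat) (x : nat -> nat -> seq R) (p q : nat)
    (g : nat -> nat -> 'M[R[i]]_2) : 'M[R[i]]_2 :=
  (node_sgn p / Ns%:R) *: \sum_(0 <= i < Ns)
    \sum_(1 <= M < (max_order D).+1 | odd M)
      ('i%C ^+ M.+1 * ((node_time p - node_time q) ^+ M / M`!%:R)%:C) *: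
        mesh_term p q g (x i M).

Definition set_node (g : nat -> nat -> 'M[R[i]]_2) (j k : nat)
    (A : 'M[R[i]]_2) : nat -> nat -> 'M[R[i]]_2 :=
  fun j' k' => if (j' == j) && (k' == k) then A else g j' k'.

Section Scheme.
(* [K1 p q g] and [K2 p q g] are the slopes of the two stages of the step from
   node p to node p+1, for the initial node q and the nodal values g. *)
Variables K1 K2 : nat -> nat -> (nat -> nat -> 'M[R[i]]_2) -> 'M[R[i]]_2.

Definition predictor (p q : nat) (g : nat -> nat -> 'M[R[i]]_2)
    : 'M[R[i]]_2 :=
  (1%:M + (node_sgn p * 'i%C * h%:C) *: Hs D) *m g p q + h%:C *: K1 p q g.

Definition corrector (p q : nat) (g : nat -> nat -> 'M[R[i]]_2)
    : 'M[R[i]]_2 :=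
  let Gstar := predictor p q g in
  (1%:M + (2^-1 * node_sgn p * 'i%C * h%:C) *: Hs D) *m g p q
  + (2^-1 * node_sgn p.+1 * 'i%C * h%:C) *: (Hs D *m Gstar)
  + (2^-1 * h%:C) *: (K1 p q g + K2 p q (set_node g p.+1 q Gstar)).

(* Value at the nodes (p+1, q), from the values g at the pairs of nodes (j, k)
   with j - k < p + 1 - q. *)
Definition next_value (p q : nat) (g : nat -> nat -> 'M[R[i]]_2)
    : 'M[R[i]]_2 :=
  if q == N then g p.+1 N.+1 *m Os D
  else if p == N then Os D *m g N q
  else corrector p q g.

(* [propagators l] holds the values at the pairs of nodes (j, k) with
   j - k <= l; on its other arguments it is meaningless. *)
Fixpoint propagators (l : nat) : nat -> nat -> 'M[R[i]]_2 :=
  if l is l'.+1 then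
    fun j k => if (j - k <= l')%N then propagators l' j k
               else next_value j.-1 k (propagators l')
  else fun _ _ => 1%:M.

Definition scheme (j k : nat) : 'M[R[i]]_2 := propagators (j - k) j k.

End Scheme.

Definition det_scheme : nat -> nat -> 'M[R[i]]_2 :=
  scheme (fun p q g => exact_sum p q g) (fun p q g => exact_sum p.+1 q g).

End Mesh.

(* (b, p, q, i, M, c) is the c-th coordinate of the i-th sample of order M, in
   stage b (false: K1, true: K2) of the step from node p to node p+1 with initial
   node q. *)
Notation draw := (bool * nat * nat * nat * nat * nat)%type.

Section MonteCarlo.
Variables (R : realType) (D : model R) (N Ns : nat).

(* Steps leaving node N or starting at node N are given by the jump
   conditions and use no sample. *)
Definition used_draw (a : draw) : bool :=
  let: (b, p, q, i, M, c) := a in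
  [&& (q <= p <= 2 * N)%N, p != N, q != N, (i < Ns)%N,
      odd M, (M <= max_order D)%N & (c < M)%N].

Definition draw_lower (a : draw) : R :=
  let: (b, p, q, i, M, c) := a in node_time D N q.

Definition draw_upper (a : draw) : R :=
  let: (b, p, q, i, M, c) := a in node_time D N (if b then p.+1 else p).

Definition sorted_sample (x : draw -> R) (b : bool) (p q i M : nat) : seq R :=
  sort (fun r s => r <= s) [seq x (b, p, q, i, M, c) | c <- iota 0 M].

Definition mc_scheme (x : draw -> R) : nat -> nat -> 'M[R[i]]_2 :=
  scheme D N
    (fun p q g => mc_sum D N Ns (sorted_sample x false p q) p q g)
    (fun p q g => mc_sum D N Ns (sorted_sample x true p q) p.+1 q g).

Section Laws.
Variables (d : measure_display) (T : measurableType d) (P : probability T R).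

(* Uniform law on [a, b], the point mass at a when a = b. *)
Definition uniform_law (X : T -> R) (a b : R) : Prop :=
  (forall (ab : a < b) (A : set R), measurable A ->
     P (X @^-1` A) = uniform_prob ab A) /\
  (a = b -> forall A : set R, measurable A -> P (X @^-1` A) = \d_a A).

Definition mutually_independent (I : eqType) (J : pred I) (X : I -> T -> R) :=
  forall (s : seq I) (A : I -> set R), uniq s -> all J s ->
    (forall i, measurable (A i)) ->
    P (\bigcap_(i in [set` s]) (X i @^-1` A i)) =
    (\prod_(i <- s) P (X i @^-1` A i))%E.

Definition valid_draws (X : draw -> T -> R) : Prop :=
  [/\ (forall a, used_draw a -> measurable_fun setT (X a)),
      (forall a, used_draw a ->
         uniform_law (X a) (draw_lower a) (draw_upper a)) &
      mutually_independent used_draw X].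

End Laws.

End MonteCarlo.

Fixpoint double_fact (n : nat) : nat :=
  if n is n'.+2 then (n * double_fact n')%N else 1%N.

Section Constants.
Variables (R : realType) (Mbar : nat) (cG cW cL : R).

Definition theta1 : R := 353.
Definition theta2 : R := Num.sqrt 34.

Definition alpha_bar (P2 : {poly R}) (x : R) : R :=
  16 * P2.[x] * (10 * x + 16 * x ^+ 2 + 5 * x ^+ 3 + 4^-1 * x ^+ 4).

Definition gamma_bar (x : R) : R :=
  2 * cW * cG * Num.sqrt cL *
  \sum_(1 <= M < Mbar.+1 | odd M)
    (cW * cG * Num.sqrt cL * x) ^+ M / (double_fact (M - 1)%N)%:R.

Definition P1 (x : R) : R :=
  2 * cW ^+ 2 * cG * cL +
  3 * cW ^+ 3 * cG ^+ 2 * Num.sqrt cL ^+ 3 * (1 + x) *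
  \sum_(3 <= M < Mbar.+1 | odd M)
    ((M - 1) * M)%N%:R / (double_fact (M - 3)%N)%:R *
    (2 * cW * cG * Num.sqrt cL * x) ^+ (M - 2)%N.

End Constants.

(* Submission.v *)
Require Import Defs.
From HB Require Import structures.
From mathcomp Require Import all_boot all_order all_algebra.
From mathcomp Require Import complex.
From mathcomp Require Import all_classical all_reals all_analysis.
From mathcomp Require Import measurable_realfun.
From mathcomp Require Import ring lra zify.
Import Order.TTheory GRing.Theory Num.Theory.
Import numFieldNormedType.Exports.
Local Open Scope classical_set_scope.
Local Open Scope ring_scope.
Set Implicit Arguments.
Unset Strict Implicit.
Unset Printing Implicit Defensive.

(* Clamping every draw to its interval changes the scheme on a null set only, so all
   expectations may be computed under the law Q of the draws, on the product space of
   the coordinates, where independence says that a block of coordinates can be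
   resampled without changing an expectation.  Since m sorted uniform draws are
   distributed as a uniform point of the simplex, the exact quadrature is the mean of the
   single-sample estimator.  In the step from node p to node p+1 the difference of the
   two slopes splits into a noise, which has mean zero and is orthogonal to whatever
   depends on earlier draws only, and a drift, the exact quadrature of the previous
   error.  As the Heun factor is unitary up to h^4, the error splits into a martingale
   part, whose mean squares add up to O(h / Ns), and a part controlled by a Gronwall
   argument with the weight exp (kappa * gap), kappa = 100 sqrt P1: averaging
   exp (kappa |u - v|) over a uniform time v gains a factor 1 / (kappa * tau), which makes
   the drift rate at most 3 P1 / kappa.  For the bias the noise disappears and the
   quadrature is expanded to first order, the remainder being quadratic in the error,
   hence O(h / Ns). *)

(** * Complex 2x2 matrices as real vectors *)

(** Adding the noises by the triangle inequality would only give 1 / sqrt Ns; the extra factor sqrt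
    h comes from orthogonality. It is available along a fixed initial node q: the noise propagated
    to (p, q) stems from draws of gap less than p - q, while the next noise stems from draws of gap
    exactly p - q. The drift mixes all inner pairs of nodes and is correlated with everything, so
    for it only Minkowski's inequality is used. The exponent must be of order z = sqrt P1 times the
    gap. An unweighted Gronwall argument has rate P1 times the gap and ends with z^2 in the
    exponent; with the weight the rate is P1 / kappa, in balance with the growth kappa of the weight
    when kappa is of order sqrt P1. The spare exponent 353 - 100 pays for the polynomial prefactors,
    provided that these are functions of z. The norm of H must stay out of the exponent: the defect
    of unitarity accumulates to O(h) over the whole interval and is absorbed by the threshold on h.
    In the bias bound P2 is free apart from its degree, so crude constants, even exponential in the
    horizon, may be hidden in its coefficients. *)

Section MatrixNorm.
Variable R : realType.
Local Notation C := R[i].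
Local Notation M := 'M[R[i]]_2.
Implicit Types (A B X Y : M) (k : bool * ('I_2 * 'I_2)).

Definition co k A : R :=
  if k.1 then complex.Re (A k.2.1 k.2.2) else complex.Im (A k.2.1 k.2.2).

(** The real part of the Hermitian Frobenius product. The real form suffices: only the skewness of
    iH and the orthogonality of noises are read off from it, and it reduces expectations of matrices
    to eight real ones. *)
Definition ip A B : R := \sum_k co k A * co k B.

Lemma mx_co A B : (forall k, co k A = co k B) -> A = B.
Proof.
move=> AB; apply/matrixP => i j; apply/eqP; rewrite eq_complex.
have := AB (true, (i, j)); have := AB (false, (i, j)); rewrite /co /= => -> ->.
by rewrite !eqxx.
Qed.

Lemma coD k A B : co k (A + B) = co k A + co k B.
Proof. by rewrite /co; case: k => -[] [i j] /=; rewrite mxE; case: (A i j) (B i j) => ? ? [? ?]. Qed.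

Lemma coN k A : co k (- A) = - co k A.
Proof. by rewrite /co; case: k => -[] [i j] /=; rewrite mxE; case: (A i j). Qed.

Lemma co0 k : co k 0 = 0.
Proof. by rewrite /co; case: k => -[] [i j] /=; rewrite mxE. Qed.

Lemma coZr k (c : R) A : co k (c%:C%C *: A) = c * co k A.
Proof.
rewrite /co; case: k => -[] [i j] /=; rewrite mxE; case: (A i j) => a b /=.
  by rewrite mul0r subr0.
by rewrite mul0r addr0.
Qed.

Lemma co_sum (I : Type) (r : seq I) (P : pred I) (F : I -> M) k :
  co k (\sum_(i <- r | P i) F i) = \sum_(i <- r | P i) co k (F i).
Proof. by rewrite (big_morph (co k) (coD k) (co0 k)). Qed.

Lemma ipC A B : ip A B = ip B A.
Proof. by apply: eq_bigr => k _; rewrite mulrC. Qed.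

Lemma ipDl A B X : ip (A + B) X = ip A X + ip B X.
Proof. by rewrite -big_split; apply: eq_bigr => k _; rewrite coD mulrDl. Qed.

Lemma ipDr A B X : ip X (A + B) = ip X A + ip X B.
Proof. by rewrite ipC ipDl !(ipC X). Qed.

Lemma ipZl (c : R) A X : ip (c%:C%C *: A) X = c * ip A X.
Proof. by rewrite /ip mulr_sumr; apply: eq_bigr => k _; rewrite coZr mulrA. Qed.

Lemma ipZr (c : R) A X : ip X (c%:C%C *: A) = c * ip X A.
Proof. by rewrite ipC ipZl ipC. Qed.

Lemma ipNl A X : ip (- A) X = - ip A X.
Proof. by rewrite /ip -sumrN; apply: eq_bigr => k _; rewrite coN mulNr. Qed.

Lemma ipNr A X : ip X (- A) = - ip X A.
Proof. by rewrite ipC ipNl ipC. Qed.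

Lemma ip0l A : ip 0 A = 0.
Proof. by rewrite /ip big1// => k _; rewrite co0 mul0r. Qed.

Lemma ip_ge0 A : 0 <= ip A A.
Proof. by apply: sumr_ge0 => k _; rewrite -expr2 sqr_ge0. Qed.

Lemma froE A : frobenius A = Num.sqrt (ip A A).
Proof.
rewrite /frobenius /ip; congr Num.sqrt.
rewrite -(pair_bigA _ (fun b ij => co (b, ij) A * co (b, ij) A)) /= big_bool /=.
rewrite -big_split /= pair_bigA /=.
by apply: eq_bigr => -[i j] _ /=; rewrite /co /= !expr2.
Qed.

Lemma fro_ge0 A : 0 <= frobenius A.
Proof. by rewrite froE sqrtr_ge0. Qed.

Lemma fro_sqr A : frobenius A ^+ 2 = ip A A.
Proof. by rewrite froE sqr_sqrtr// ip_ge0. Qed.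

Lemma fro0 : frobenius (0 : M) = 0.
Proof. by rewrite froE ip0l sqrtr0. Qed.

Lemma fro_eq0 A : frobenius A = 0 -> A = 0.
Proof.
move=> A0; have : ip A A = 0 by rewrite -fro_sqr A0 expr0n.
move/eqP; rewrite psumr_eq0; last by move=> k _; rewrite -expr2 sqr_ge0.
move=> /allP A0k; apply: mx_co => k; rewrite co0.
by have := A0k k (mem_index_enum _); rewrite mulf_eq0 orbb => /eqP.
Qed.

Lemma ip_le A B : ip A B <= frobenius A * frobenius B.
Proof.
have [A0|A0] := eqVneq (frobenius A) 0; first by rewrite (fro_eq0 A0) fro0 ip0l mul0r.
have [B0|B0] := eqVneq (frobenius B) 0; first by rewrite (fro_eq0 B0) fro0 ipC ip0l mulr0.
have Ap : 0 < frobenius A by rewrite lt_neqAle eq_sym A0 fro_ge0.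
have Bp : 0 < frobenius B by rewrite lt_neqAle eq_sym B0 fro_ge0.
(* Expanding this square gives 2 a b (a b - c). *)
have := ip_ge0 ((frobenius B)%:C%C *: A - (frobenius A)%:C%C *: B).
rewrite ipDl !ipDr !ipNl !ipNr !ipZl !ipZr -!fro_sqr (ipC B A).
set a := frobenius A in Ap *; set b := frobenius B in Bp *; set c := ip A B => H.
have ab : 0 < a * b by rewrite mulr_gt0.
suff : 0 <= (a * b) * (a * b - c) by rewrite pmulr_rge0// subr_ge0.
by nra.
Qed.

Lemma froN A : frobenius (- A) = frobenius A.
Proof. by rewrite !froE ipNl ipNr opprK. Qed.

Lemma fro_le_sqr A (c : R) : 0 <= c -> ip A A <= c ^+ 2 -> frobenius A <= c.
Proof. by move=> c0 ?; rewrite -(ler_pXn2r (_ : 0 < 2)%N) ?nnegrE ?fro_ge0// fro_sqr. Qed.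

Lemma froD A B : frobenius (A + B) <= frobenius A + frobenius B.
Proof.
apply: fro_le_sqr; first by rewrite addr_ge0 ?fro_ge0.
rewrite ipDl !ipDr -!fro_sqr (ipC B A).
by have := ip_le A B; nra.
Qed.

Lemma fro_sum (I : Type) (r : seq I) (P : pred I) (F : I -> M) :
  frobenius (\sum_(i <- r | P i) F i) <= \sum_(i <- r | P i) frobenius (F i).
Proof.
elim/big_rec2 : _ => [|i y x _ h]; first by rewrite fro0.
by apply: le_trans (froD _ _) _; rewrite lerD2l.
Qed.

Lemma co_le_fro k A : `|co k A| <= frobenius A.
Proof.
rewrite -(ler_pXn2r (_ : 0 < 2)%N) ?nnegrE ?fro_ge0// fro_sqr real_normK ?num_real//.
rewrite /ip (bigD1 k)//= -expr2 lerDl.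
by apply: sumr_ge0 => j _; rewrite -expr2 sqr_ge0.
Qed.

Let nn (z : C) : R := complex.Re z ^+ 2 + complex.Im z ^+ 2.

Let nn_ge0 z : 0 <= nn z. Proof. by rewrite addr_ge0 ?sqr_ge0. Qed.

Lemma ip_entries A : ip A A = \sum_i \sum_j nn (A i j).
Proof. by rewrite -fro_sqr /frobenius sqr_sqrtr//; apply: sumr_ge0 => i _; apply: sumr_ge0 => j _; exact: nn_ge0. Qed.

(** Lagrange's identity: the gap between the two sides is the squared modulus of a conj(d) - c
    conj(b). *)
Let nn_le (a b c d : C) : nn (a * b + c * d) <= (nn a + nn c) * (nn b + nn d).
Proof.
case: a b c d => [a a'] [b b'] [c c'] [d d']; rewrite /nn /= -subr_ge0.
rewrite [leRHS](_ : _ = (a * d + a' * d' - (c * b + c' * b')) ^+ 2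
   + (a' * d - a * d' - (c' * b - c * b')) ^+ 2); first by rewrite addr_ge0 ?sqr_ge0.
by ring.
Qed.

Lemma froM A B : frobenius (A *m B) <= frobenius A * frobenius B.
Proof.
apply: fro_le_sqr; first by rewrite mulr_ge0 ?fro_ge0.
rewrite exprMn !fro_sqr !ip_entries !big_ord_recl !big_ord0 !addr0 !mxE.
rewrite !big_ord_recl !big_ord0 !addr0.
rewrite (_ : lift ord0 ord0 = 1 :> 'I_2); last exact: val_inj.
have h := nn_le; have p := nn_ge0.
have := h (A 0 0) (B 0 0) (A 0 1) (B 1 0).
have := h (A 0 0) (B 0 1) (A 0 1) (B 1 1).
have := h (A 1 0) (B 0 0) (A 1 1) (B 1 0).
have := h (A 1 0) (B 0 1) (A 1 1) (B 1 1).
lra.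
Qed.

Lemma froZ (c : C) A : frobenius (c *: A) = Normc.normc c * frobenius A.
Proof.
have c0 : 0 <= Normc.normc c by case: c => ? ?; rewrite sqrtr_ge0.
rewrite !froE !ip_entries.
have -> : \sum_i \sum_j nn ((c *: A) i j) = Normc.normc c ^+ 2 * \sum_i \sum_j nn (A i j).
  rewrite mulr_sumr; apply: eq_bigr => i _; rewrite mulr_sumr; apply: eq_bigr => j _.
  rewrite mxE; case: c c0 (A i j) => a b _ [u v]; rewrite /nn /= sqr_sqrtr ?addr_ge0 ?sqr_ge0//.
  by ring.
by rewrite sqrtrM ?sqr_ge0// sqrtr_sqr ger0_norm.
Qed.

Lemma normc_ge0 (c : C) : 0 <= Normc.normc c.
Proof. by case: c => ? ?; rewrite sqrtr_ge0. Qed.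

Lemma normcR (c : R) : Normc.normc c%:C%C = `|c|.
Proof. by rewrite /= expr0n /= addr0 sqrtr_sqr. Qed.

Lemma froZr (c : R) A : frobenius (c%:C%C *: A) = `|c| * frobenius A.
Proof. by rewrite froZ normcR. Qed.

Lemma normc_i : Normc.normc 'i%C = 1 :> R.
Proof. by rewrite /= expr0n expr1n add0r sqrtr1. Qed.

Lemma normcX (c : C) n : Normc.normc (c ^+ n) = Normc.normc c ^+ n.
Proof. by elim: n => [|n ih]; rewrite ?expr0 ?Normc.normc1// !exprS Normc.normcM ih. Qed.

Lemma fro1 : frobenius (1%:M : M) = Num.sqrt 2.
Proof.
rewrite /frobenius !big_ord_recl !big_ord0 !mxE /= !expr0n /= !expr1n !addr0 !add0r.
by congr Num.sqrt; ring.
Qed.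

Lemma ipE A B : ip A B =
  \sum_i \sum_j (complex.Re (A i j) * complex.Re (B i j) + complex.Im (A i j) * complex.Im (B i j)).
Proof.
rewrite pair_bigA /= /ip.
rewrite -(pair_bigA _ (fun b ij => co (b, ij) A * co (b, ij) B)) /= big_bool /=.
by rewrite -big_split /=.
Qed.

Lemma ip_herm H X Y : H \is hermsymmx -> ip X (H *m Y) = ip (H *m X) Y.
Proof.
move=> /is_hermitianmxP; rewrite expr0 scale1r => HH.
have Hij i j : H i j = (complex.Re (H j i) +i* - complex.Im (H j i))%C.
  by rewrite {1}HH !mxE; case: (H j i).
rewrite !ipE !big_ord_recl !big_ord0 !addr0 !mxE !big_ord_recl !big_ord0 !addr0.
rewrite (_ : lift ord0 ord0 = 1 :> 'I_2); last exact: val_inj.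
have := Hij 0 0; have := Hij 1 0; have := Hij 1 1; rewrite (_ : ord0 = 0 :> 'I_2)//.
case: (H 0 0) (H 0 1) (H 1 0) (H 1 1) => [a a'] [b b'] [c c'] [e e'] /= [e0] [-> ->] [a0].
have -> : a' = 0 by lra.
have -> : e' = 0 by lra.
case: (X 0 0) (X 0 1) (X 1 0) (X 1 1) => [? ?] [? ?] [? ?] [? ?].
case: (Y 0 0) (Y 0 1) (Y 1 0) (Y 1 1) => [? ?] [? ?] [? ?] [? ?] /=.
by ring.
Qed.

Lemma ip_i A B : ip A ('i%C *: B) = - ip ('i%C *: A) B.
Proof.
rewrite !ipE -sumrN; apply: eq_bigr => i _; rewrite -sumrN; apply: eq_bigr => j _.
by rewrite !mxE; case: (A i j) (B i j) => a a' [b b'] /=; ring.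
Qed.

Lemma ip_herm_skew H X : H \is hermsymmx -> ip X ('i%C *: (H *m X)) = 0.
Proof.
move=> hH; have : ip X ('i%C *: (H *m X)) = - ip X ('i%C *: (H *m X)).
  by rewrite {1}ip_i ip_herm// -scalemxAr ipC.
lra.
Qed.

(** The adjoint of 1 + izH is 1 - izH. This moves the half step off the first-stage noise, onto the
    factor that does not see its draws. *)
Lemma ip_adj H X Y (z : R) : H \is hermsymmx ->
  ip X (Y + z%:C%C *: ('i%C *: (H *m Y))) = ip (X - z%:C%C *: ('i%C *: (H *m X))) Y.
Proof.
by move=> hH; rewrite ipDr ipZr ip_i ip_herm// -scalemxAr ipDl ipNl ipZl mulrN.
Qed.

(* The one-step matrix 1 + izH - z^2H^2/2 is unitary up to order z^4. *)
Lemma fro_heun H X (z : R) : H \is hermsymmx ->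
  ip (X + z%:C%C *: ('i%C *: (H *m X)) - (z ^+ 2 / 2)%:C%C *: (H *m (H *m X)))
     (X + z%:C%C *: ('i%C *: (H *m X)) - (z ^+ 2 / 2)%:C%C *: (H *m (H *m X))) =
  ip X X + z ^+ 4 / 4 * ip (H *m (H *m X)) (H *m (H *m X)).
Proof.
move=> hH; set Z := H *m X.
have e1 : ip X ('i%C *: Z) = 0 by exact: ip_herm_skew.
have e2 : ip (H *m Z) ('i%C *: Z) = 0.
  by rewrite -ip_herm// -scalemxAr ip_herm_skew.
have e3 : ip X (H *m Z) = ip Z Z by rewrite ip_herm.
have e4 : ip ('i%C *: Z) ('i%C *: Z) = ip Z Z by rewrite -!fro_sqr froZ normc_i mul1r.
rewrite !ipDl !ipDr !ipNl !ipNr !ipZl !ipZr (ipC ('i%C *: Z) X) (ipC (H *m Z) X).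
rewrite (ipC ('i%C *: Z) (H *m Z)) !e1 !e2 !e3 !e4.
by field.
Qed.

(** No term of first order in z: over gap / h steps with |z| = h the growth is exp (h cH^4 gap), so
    the norm of H disappears from the final exponent once h is small. *)
Lemma fro_step H X (z cH : R) : H \is hermsymmx -> frobenius H <= cH -> `|z| <= 1 ->
  frobenius (X + z%:C%C *: ('i%C *: (H *m X)) - (z ^+ 2 / 2)%:C%C *: (H *m (H *m X))) <=
  (1 + `|z| ^+ 2 * cH ^+ 4) * frobenius X.
Proof.
move=> hH Hc z1; have c0 : 0 <= cH by exact: le_trans (fro_ge0 H) Hc.
apply: fro_le_sqr; first by rewrite mulr_ge0 ?fro_ge0// addr_ge0// mulr_ge0 ?exprn_ge0.
rewrite fro_heun// -!fro_sqr.
have h1 : frobenius (H *m (H *m X)) ^+ 2 <= cH ^+ 4 * frobenius X ^+ 2.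
  rewrite (_ : cH ^+ 4 * _ = (cH * (cH * frobenius X)) ^+ 2); last by ring.
  rewrite ler_pXn2r ?nnegrE ?fro_ge0// ?mulr_ge0 ?fro_ge0//.
  apply: le_trans (froM _ _) _; apply: ler_pM; rewrite ?fro_ge0//.
  by apply: le_trans (froM _ _) _; apply: ler_pM; rewrite ?fro_ge0.
have z4 : z ^+ 4 <= `|z| ^+ 2.
  rewrite -[leLHS]ger0_norm ?normrX; last by rewrite (_ : 4 = 2 * 2)%N// exprM sqr_ge0.
  by rewrite ler_wiXn2l ?normr_ge0.
set F := frobenius X in h1 *; set G := frobenius (H *m (H *m X)) in h1 *.
have F0 : 0 <= F by exact: fro_ge0.
have {h1} : z ^+ 4 * G ^+ 2 <= `|z| ^+ 2 * (cH ^+ 4 * F ^+ 2).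
  by apply: ler_pM => //; rewrite ?sqr_ge0// (_ : 4 = 2 * 2)%N// exprM sqr_ge0.
have : 0 <= `|z| ^+ 2 * (cH ^+ 4 * F ^+ 2) by rewrite !mulr_ge0 ?exprn_ge0.
have : 0 <= (`|z| ^+ 2 * cH ^+ 4 * F) ^+ 2 by rewrite sqr_ge0.
rewrite exprMn mulrDl mul1r. set u := `|z| ^+ 2 * cH ^+ 4.
rewrite (mulrA _ (cH ^+ 4)) -/u !exprMn. nra.
Qed.

Lemma fro_stage H X (z cH : R) : frobenius H <= cH ->
  frobenius (X + z%:C%C *: ('i%C *: (H *m X))) <= (1 + `|z| * cH) * frobenius X.
Proof.
move=> Hc; apply: le_trans (froD _ _) _; rewrite froZr froZ normc_i mul1r mulrDl mul1r lerD2l -mulrA.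
by rewrite ler_wpM2l// (le_trans (froM _ _))// ler_wpM2r ?fro_ge0.
Qed.

End MatrixNorm.

(** * Counting linked pairings *)

Section LinkedSumBound.
Variable R : realType.

Section Pairings.
Variable m : nat.
Implicit Types (S : {set 'I_m}) (q : {set 'I_m * 'I_m}) (a : 'I_m * 'I_m).

Definition touch (i : 'I_m) a := (i == a.1) || (i == a.2).

(** Pairings of a subset of the points, so that an induction can delete both ends of an arc while
    the ambient index type stays fixed. *)
Definition pairOn S : {set {set 'I_m * 'I_m}} :=
  [set q : {set 'I_m * 'I_m} | [forall a in q, (a.1 < a.2)%N] &&
    [forall i : 'I_m, #|[set a in q | touch i a]| == (i \in S) :> nat]].

Definition arc (i j : 'I_m) : 'I_m * 'I_m := if (i < j)%N then (i, j) else (j, i).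

Lemma touch_arc i j k : touch k (arc i j) = (k == i) || (k == j).
Proof. by rewrite /touch /arc; case: ifP => _ //=; rewrite orbC. Qed.

Lemma pairOn_arc S q i : q \in pairOn S -> i \in S ->
  exists2 j, j \in S :\ i & arc i j \in q.
Proof.
rewrite inE => /andP[/forallP q1 /forallP q2] iS.
have := q2 i; rewrite iS => /cards1P[a aE].
have : a \in [set a in q | touch i a] by rewrite aE finset.set11.
rewrite inE => /andP[aq ia].
have a12 : (a.1 < a.2)%N by have /implyP := q1 a; exact.
have inS k : touch k a -> k \in S.
  move=> ka; have := q2 k; case: (k \in S) => //; rewrite cards_eq0 => /eqP/finset.setP/(_ a).
  by rewrite !inE aq ka.
case/orP : ia => /eqP ia.
  exists a.2; last by rewrite /arc ia a12 -surjective_pairing.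
  rewrite !inE inS /touch ?eqxx ?orbT// andbT ia.
  by apply: contraTneq a12 => ->; rewrite ltnn.
exists a.1; last by rewrite /arc ia ltnNge (ltnW a12)/= -surjective_pairing.
rewrite !inE inS /touch ?eqxx ?orbT// andbT ia.
by apply: contraTneq a12 => ->; rewrite ltnn.
Qed.

Lemma pairOn_del S q i j : q \in pairOn S -> arc i j \in q -> i != j ->
  q :\ arc i j \in pairOn (S :\: [set i; j]).
Proof.
rewrite !inE => /andP[/forallP q1 /forallP q2] aq ij.
apply/andP; split.
  by apply/forallP => a; apply/implyP; rewrite !inE => /andP[_ ?]; have /implyP := q1 a; exact.
apply/forallP => k; rewrite !inE.
have := q2 k; rewrite (cardsD1 (arc i j)) !inE aq touch_arc /=.
set A := [set a in q | touch k a] :\ arc i j.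
have -> : [set a in q :\ arc i j | touch k a] = A by apply/finset.setP => a; rewrite !inE andbA.
case: ((k == i) || (k == j)) => /=; last by rewrite add0n.
by case: (k \in S).
Qed.

(** A chosen point of S has |S| - 1 possible partners, and deleting its arc leaves a pairing of |S|
    - 2 points: the recursion of the double factorial. Each arc weighs b^2, one b for each end. *)
Lemma pairOn_sum (b : R) S : 0 <= b ->
  \sum_(q in pairOn S) b ^+ (#|q|.*2) <= (double_fact #|S|.-1)%:R * b ^+ #|S|.
Proof.
move=> b0; have [n] := ubnP #|S|; elim: n S => // n ih S; rewrite ltnS => Sn.
have [->|[i iS]] := finset.set_0Vmem S.
  rewrite cards0 /= expr0 mulr1.
  have sub : pairOn (finset.set0 : {set 'I_m}) \subset [set (finset.set0 : {set 'I_m * 'I_m})]%SET.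
    apply/fintype.subsetP => q qS; suff -> : q = finset.set0 by rewrite finset.inE.
    apply/finset.setP => a; rewrite inE; apply/negbTE/negP => aq.
    move: qS; rewrite inE => /andP[_ /forallP/(_ a.1)].
    rewrite inE cards_eq0 => /eqP/finset.setP/(_ a).
    by rewrite !inE aq /touch eqxx.
  apply: (@le_trans _ _ (\sum_(q in [set (finset.set0 : {set 'I_m * 'I_m})]%SET) b ^+ (#|q|.*2))).
    rewrite [leRHS](bigID (mem (pairOn (finset.set0 : {set 'I_m}))))/=.
    rewrite [leLHS](eq_bigl (fun q => (q \in [set (finset.set0 : {set 'I_m * 'I_m})]%SET) && (q \in pairOn (finset.set0 : {set 'I_m})))); last first.
      by move=> q; rewrite andbC; case: (boolP (q \in pairOn (finset.set0 : {set 'I_m}))) => // /(fintype.subsetP sub) ->.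
    by rewrite lerDl; apply: sumr_ge0 => q _; rewrite exprn_ge0.
  by rewrite big_set1 cards0 expr0.
have [c cE] : exists c, #|S| = c.+1 by exists #|S|.-1; rewrite prednK// card_gt0; apply/finset.set0Pn; exists i.
have cD : #|S :\ i| = c by have := cardsD1 i S; rewrite iS cE => -[].
(* Marking a partner j of i only adds nonnegative terms; after the exchange of sums j is fixed
   first. *)
apply: (@le_trans _ _ (\sum_(q in pairOn S) \sum_(j in S :\ i | arc i j \in q) b ^+ (#|q|.*2))).
  apply: ler_sum => q qS; have [j jS jq] := pairOn_arc qS iS.
  rewrite (bigD1 j) /=; last by rewrite jS.
  by rewrite lerDl; apply: sumr_ge0 => ? _; rewrite exprn_ge0.
rewrite (exchange_big_dep (mem (S :\ i)))/=; last by move=> q j _ /andP[].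
apply: (@le_trans _ _ (\sum_(j in S :\ i) (double_fact c.-2)%:R * b ^+ c.+1)).
  apply: ler_sum => j jS; set a := arc i j.
  have ij : i != j by move: jS; rewrite !inE eq_sym => /andP[].
  set S' := S :\: [set i; j].
  have S'E : #|S'| = c.-1.
    have -> : S' = (S :\ i) :\ j.
      by apply/finset.setP => k; rewrite !inE negb_or; case: (k == i); case: (k == j).
    by have := cardsD1 j (S :\ i); rewrite jS cD => ->.
  have c0 : (0 < c)%N by rewrite -cD card_gt0; apply/finset.set0Pn; exists j.
  have aS' q : q \in pairOn S' -> a \notin q.
    rewrite inE => /andP[_ /forallP/(_ i)]; rewrite !inE eqxx /= cards_eq0 => /eqP/finset.setP/(_ a).
    by rewrite !inE touch_arc eqxx andbT => ->.
  (* Every pairing through the arc [a] is [a] added to a pairing of the remaining points, and the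
     latter never contains [a], so the addition is injective. *)
  apply: (@le_trans _ _ (\sum_(q in [set a |: q' | q' in pairOn S']%SET) b ^+ (#|q|.*2))).
    rewrite [leRHS](bigID (fun q => (q \in pairOn S) && (a \in q)))/=.
    rewrite [leLHS](eq_bigl (fun q => (q \in [set a |: q' | q' in pairOn S']%SET) &&
       ((q \in pairOn S) && (a \in q)))); last first.
      move=> q; rewrite jS /=; case: (boolP ((q \in pairOn S) && (a \in q))); rewrite ?andbF// andbT.
      move=> /andP[qS aq]; apply/esym/finset.imsetP; exists (q :\ a); first exact: pairOn_del.
      by rewrite finset.setD1K.
    by rewrite lerDl; apply: sumr_ge0 => q _; rewrite exprn_ge0.
  rewrite big_imset /=; last first.
    move=> q q' /aS' aq /aS' aq' /finset.setP e; apply/finset.setP => x; have := e x; rewrite !inE.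
    by have [->|//] := eqVneq x a; rewrite (negbTE aq) (negbTE aq').
  rewrite (eq_bigr (fun q => b ^+ 2 * b ^+ (#|q|.*2))); last first.
    by move=> q /aS' aq; rewrite cardsU1 aq /= add1n doubleS -exprD.
  rewrite -mulr_sumr.
  have Sn' : (c.-1 < n)%N by move: Sn; rewrite cE; lia.
  have h := ih S'; rewrite S'E in h; have {}h := h Sn'.
  rewrite (_ : c.+1 = 2 + c.-1)%N ?exprD; last by rewrite addSn add1n prednK.
  by rewrite mulrCA ler_wpM2l ?exprn_ge0.
rewrite sumr_const cD cE /= -[leLHS]mulr_natl mulrA -natrM ler_wpM2r ?exprn_ge0//.
by rewrite ler_nat; case: c {cE cD} => [|[|c]].
Qed.

End Pairings.

(** Linked pairings are bounded by all pairings. Writing cL as a square of its root distributes the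
    bound over the points, so that it combines with one factor W per point. *)
Lemma linked_sum_le (B : R -> R -> R[i]) (cL : R) (s : seq R) : 0 <= cL ->
  (forall i j, (i < j)%N -> (j < size s)%N -> Normc.normc (B s`_j s`_i) <= cL) ->
  Normc.normc (linked_sum B s) <= (double_fact (size s).-1)%:R * Num.sqrt cL ^+ size s.
Proof.
move=> c0 Bs.
apply: (@le_trans _ _ (\sum_(q in @pairOn (size s) [set: 'I_(size s)]) Num.sqrt cL ^+ (#|q|.*2))); last first.
  by have := @pairOn_sum (size s) _ [set: 'I_(size s)] (sqrtr_ge0 cL); rewrite cardsT card_ord.
apply: (@le_trans _ _ (\sum_(q in @pairOn (size s) [set: 'I_(size s)]) if linked q then Normc.normc (\prod_(a in q) B s`_(a.2) s`_(a.1)) else 0)).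
  rewrite /linked_sum -big_mkcondr.
  rewrite [in leLHS](eq_bigl (fun q => (q \in @pairOn (size s) [set: 'I_(size s)]) && linked q)); last first.
    by move=> q; rewrite !inE /pairing; congr ((_ && _) && _); apply: eq_forallb => i; rewrite inE.
  apply: (big_rec2 (fun x y => Normc.normc x <= y)) => [|q y x _ h]; first by rewrite Normc.normc0.
  by apply: le_trans (le_normcD _ _) _; rewrite lerD2l.
apply: ler_sum => q; rewrite inE => /andP[/forallP q1 _].
case: ifP => _; last by rewrite exprn_ge0 ?sqrtr_ge0.
rewrite -mul2n exprM sqr_sqrtr// -prodr_const.
rewrite (big_morph (@Normc.normc R) (@Normc.normcM R) (@Normc.normc1 R)).
apply: ler_prod => a aq; rewrite normc_ge0 /=.
by apply: Bs => //; have /implyP := q1 a; exact.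
Qed.

End LinkedSumBound.

(** * Bounded random variables *)

Section BoundedMeasurable.
Context d (T : measurableType d) (R : realType).
Implicit Types f g : T -> R.

(** Boundedness rather than integrability: the class is stable under products and is integrable for
    every probability, hence all rules below are free of side conditions. *)
Definition bm f := measurable_fun setT f /\ exists c, forall x, `|f x| <= c.

Lemma bm_cst c : bm (fun _ => c).
Proof. by split; [exact: measurable_cst|exists `|c|]. Qed.

Lemma bmD f g : bm f -> bm g -> bm (fun x => f x + g x).
Proof.
move=> [mf [a fa]] [mg [b gb]]; split; first exact: measurable_funD.
by exists (a + b) => x; rewrite (le_trans (ler_normD _ _))// lerD.
Qed.

Lemma bmM f g : bm f -> bm g -> bm (fun x => f x * g x).
Proof.
move=> [mf [a fa]] [mg [b gb]]; split; first exact: measurable_funM.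
by exists (a * b) => x; rewrite normrM ler_pM.
Qed.

Lemma bmN f : bm f -> bm (fun x => - f x).
Proof.
by move=> [mf [a fa]]; split; [exact: measurableT_comp|exists a => x; rewrite normrN].
Qed.

Lemma bmB f g : bm f -> bm g -> bm (fun x => f x - g x).
Proof. by move=> bf bg; apply: bmD => //; exact: bmN. Qed.

Lemma bm_sum (I : eqType) (r : seq I) (F : I -> T -> R) :
  (forall i, i \in r -> bm (F i)) -> bm (fun x => \sum_(i <- r) F i x).
Proof.
elim: r => [|i r ih] h.
  by rewrite (_ : (fun _ => _) = (fun=> 0)); [exact: bm_cst|apply/funext => x; rewrite big_nil].
rewrite (_ : (fun _ => _) = (fun x => F i x + \sum_(j <- r) F j x)); last first.
  by apply/funext => x; rewrite big_cons.
apply: bmD; first by apply: h; rewrite mem_head.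
by apply: ih => j jr; apply: h; rewrite in_cons jr orbT.
Qed.

Definition Ex (mu : probability T R) f : R := \int[mu]_x f x.

Variable mu : probability T R.
Local Notation E := (Ex mu).

Lemma ae_imply (A B : T -> Prop) : (forall x, A x -> B x) ->
  {ae mu, forall x, A x} -> {ae mu, forall x, B x}.
Proof. by move=> AB; apply: filterS. Qed.

Lemma ae_all (I : eqType) (l : seq I) (A : I -> T -> Prop) :
  (forall i, i \in l -> {ae mu, forall x, A i x}) ->
  {ae mu, forall x, forall i, i \in l -> A i x}.
Proof.
elim: l => [|i l ih] h; first by apply: aeW => x i.
have h1 := h i (mem_head _ _).
have h2 : {ae mu, forall x, forall j, j \in l -> A j x}.
  by apply: ih => j jl; apply: h; rewrite in_cons jl orbT.
by apply: filterS2 h1 h2 => x h1 h2 j; rewrite in_cons => /orP[/eqP ->//|]; exact: h2.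
Qed.

Lemma bm_integrable f : bm f -> mu.-integrable setT (EFin \o f).
Proof.
move=> [mf [c fc]]; apply: measurable_bounded_integrable => //.
  by rewrite -ge0_fin_numE// fin_num_measure.
exists c; split; first exact: num_real.
by move=> M cM x _; exact: le_trans (fc x) (ltW cM).
Qed.

Lemma Ex_fin f : bm f -> (\int[mu]_x (f x)%:E)%E = (E f)%:E.
Proof.
by move=> bf; rewrite /Ex /Rintegral fineK//; apply: integrable_fin_num => //; exact: bm_integrable.
Qed.

Lemma ExD f g : bm f -> bm g -> E (fun x => f x + g x) = E f + E g.
Proof. by move=> bf bg; apply: RintegralD => //; exact: bm_integrable. Qed.

Lemma ExB f g : bm f -> bm g -> E (fun x => f x - g x) = E f - E g.
Proof. by move=> bf bg; apply: RintegralB => //; exact: bm_integrable. Qed.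

Lemma ExZ c f : bm f -> E (fun x => c * f x) = c * E f.
Proof. by move=> bf; apply: RintegralZl => //; exact: bm_integrable. Qed.

Lemma ExN f : bm f -> E (fun x => - f x) = - E f.
Proof.
move=> bf; rewrite -mulN1r -ExZ//; congr (Ex mu _).
by apply/funext => x; rewrite mulN1r.
Qed.

Lemma Ex_cst c : E (fun _ => c) = c.
Proof.
have h : fine (mu setT) = 1 by rewrite probability_setT.
by rewrite /Ex Rintegral_cst//; transitivity (c * fine (mu setT)); rewrite // h mulr1.
Qed.

Lemma Ex_sum (I : eqType) (r : seq I) (F : I -> T -> R) :
  (forall i, i \in r -> bm (F i)) -> E (fun x => \sum_(i <- r) F i x) = \sum_(i <- r) E (F i).
Proof.
elim: r => [|i r ih] h.
  rewrite big_nil -[RHS](Ex_cst 0); congr (Ex mu _).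
  by apply/funext => x; rewrite big_nil.
have hr j : j \in r -> bm (F j) by move=> jr; apply: h; rewrite in_cons jr orbT.
rewrite big_cons -(ih hr) -ExD; last exact: bm_sum.
  by congr (Ex mu _); apply/funext => x; rewrite big_cons.
by apply: h; rewrite mem_head.
Qed.

Lemma Ex_le f g : bm f -> bm g -> (forall x, f x <= g x) -> E f <= E g.
Proof. by move=> bf bg fg; apply: le_Rintegral => // ; exact: bm_integrable. Qed.

Lemma Ex_ge0 f : (forall x, 0 <= f x) -> 0 <= E f.
Proof. by move=> f0; exact: Rintegral_ge0. Qed.

Lemma Ex_ae_le f g : bm f -> bm g -> {ae mu, forall x, f x <= g x} -> E f <= E g.
Proof.
move=> bf bg fg; have [_ [c fc]] := bf; have [_ [c' gc]] := bg.
(* The shift makes both functions nonnegative, where almost everywhere comparison of integrals is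
   available. *)
suff : E (fun x => f x + (c + c')) <= E (fun x => g x + (c + c')).
  by rewrite !ExD ?Ex_cst ?lerD2r//; exact: bm_cst.
have bf' : bm (fun x => f x + (c + c')) by apply: bmD => //; exact: bm_cst.
have bg' : bm (fun x => g x + (c + c')) by apply: bmD => //; exact: bm_cst.
rewrite -lee_fin -!Ex_fin//; apply: ae_ge0_le_integral => //.
- move=> x _; rewrite lee_fin; have := fc x; have := gc x.
  by rewrite !ler_norml => /andP[? ?] /andP[? ?]; lra.
- by apply/measurable_EFinP; case: bf'.
- move=> x _; rewrite lee_fin; have := fc x; have := gc x.
  by rewrite !ler_norml => /andP[? ?] /andP[? ?]; lra.
- by apply/measurable_EFinP; case: bg'.
- by apply: filterS fg => x fgx _; rewrite lee_fin lerD2r.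
Qed.

Lemma Ex_ae_eq f g : bm f -> bm g -> {ae mu, forall x, f x = g x} -> E f = E g.
Proof.
by move=> bf bg fg; apply/eqP; rewrite eq_le; apply/andP; split; apply: Ex_ae_le => //;
  apply: filterS fg => x ->.
Qed.

Lemma Ex_norm f : bm f -> `|E f| <= E (fun x => `|f x|).
Proof.
move=> bf; apply: le_normr_Rintegral => //; exact: bm_integrable.
Qed.

Lemma bm_norm f : bm f -> bm (fun x => `|f x|).
Proof.
move=> [mf [c fc]]; split; first exact: measurableT_comp.
by exists c => x; rewrite normr_id.
Qed.

Lemma Ex_bound f c : bm f -> (forall x, `|f x| <= c) -> `|E f| <= c.
Proof.
move=> bf fc; rewrite (le_trans (Ex_norm bf))// -[leRHS](Ex_cst c).
by apply: Ex_le => //; [exact: bm_norm|exact: bm_cst].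
Qed.

End BoundedMeasurable.

(** * Fubini for bounded functions *)

Section FubiniBounded.
Context d1 d2 (T1 : measurableType d1) (T2 : measurableType d2) (R : realType).
Variables (m1 : probability T1 R) (m2 : probability T2 R).
Implicit Types f : T1 -> T2 -> R.

Definition bm2 f := bm (fun z : T1 * T2 => f z.1 z.2).

Lemma bm2_r f x : bm2 f -> bm (f x).
Proof.
move=> [mf [c fc]]; split; last by exists c => y; exact: (fc (x, y)).
exact: (measurableT_comp mf (measurable_pair1 _)).
Qed.

Lemma bm2_l f y : bm2 f -> bm (f ^~ y).
Proof.
move=> [mf [c fc]]; split; last by exists c => x; exact: (fc (x, y)).
exact: (measurableT_comp mf (measurable_pair2 _)).
Qed.

Lemma bm_Ex2 f : bm2 f -> bm (fun x => Ex m2 (f x)).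
Proof.
move=> bf; have [mf [c fc]] := bf; split; last first.
  by exists c => x; apply: Ex_bound; [exact: bm2_r|move=> y; exact: (fc (x, y))].
have bi := bm_integrable (m1 \x m2)%E bf.
have := measurable_fubini_F bi.
move=> h; apply/measurable_EFinP; rewrite (_ : EFin \o _ = fubini_F m2 (EFin \o (fun z : T1 * T2 => f z.1 z.2)))//.
by apply/funext => x /=; rewrite /fubini_F /= Ex_fin//; exact: bm2_r.
Qed.

Lemma bm_Ex1 f : bm2 f -> bm (fun y => Ex m1 (f ^~ y)).
Proof.
move=> bf; have [mf [c fc]] := bf; split; last first.
  by exists c => x; apply: Ex_bound; [exact: bm2_l|move=> y; exact: (fc (y, x))].
have bi := bm_integrable (m1 \x m2)%E bf.
have := measurable_fubini_G bi.
move=> h; apply/measurable_EFinP; rewrite (_ : EFin \o _ = fubini_G m1 (EFin \o (fun z : T1 * T2 => f z.1 z.2)))//.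
by apply/funext => x /=; rewrite /fubini_G /= Ex_fin//; exact: bm2_l.
Qed.

Lemma Ex_prod f : bm2 f ->
  Ex (m1 \x m2)%E (fun z => f z.1 z.2) = Ex m1 (fun x => Ex m2 (f x)).
Proof.
move=> bf; have bi := bm_integrable (m1 \x m2)%E bf.
have := integral12_prod_meas1 bi; rewrite /fubini_F /Ex /Rintegral => <-.
congr fine; apply: eq_integral => x _.
by rewrite /= -/(Ex m2 (f x)) Ex_fin//; exact: bm2_r.
Qed.

Lemma Ex_fubini f : bm2 f ->
  Ex m1 (fun x => Ex m2 (f x)) = Ex m2 (fun y => Ex m1 (f ^~ y)).
Proof.
move=> bf; rewrite -Ex_prod//.
have bi := bm_integrable (m1 \x m2)%E bf.
have := integral21_prod_meas1 bi; rewrite /fubini_G /Ex /Rintegral => <-.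
congr fine; apply: eq_integral => x _.
by rewrite /= -/(Ex m1 (f ^~ x)) Ex_fin//; exact: bm2_l.
Qed.

End FubiniBounded.

(** * Measurability of sorted lists *)

Section MeasurableLists.
Variable R : realType.

(** Quantifying over all positions is harmless: past the end the default is a constant function. *)
Definition mseq d (V : measurableType d) (ls : seq (V -> R)) :=
  forall i, measurable_fun setT (nth (fun=> 0) ls i).

Definition evs (V : Type) (ls : seq (V -> R)) (x : V) : seq R := [seq g x | g <- ls].

(* Joint measurability of [phi u [:: s_1; ...; s_n]] in u and s_1, ..., s_n,
   tested along all measurable substitutions. *)
Definition jmeas n d (U : measurableType d) (phi : U -> seq R -> R) :=
  forall d' (V : measurableType d') (v : V -> U) (ls : seq (V -> R)),
    measurable_fun setT v -> size ls = n -> mseq ls ->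
    measurable_fun setT (fun x => phi (v x) (evs ls x)).

Lemma mseq_nil d (V : measurableType d) : mseq ([::] : seq (V -> R)).
Proof. by move=> i; rewrite nth_nil; exact: measurable_cst. Qed.

Lemma mseq_cons d (V : measurableType d) (g : V -> R) ls :
  measurable_fun setT g -> mseq ls -> mseq (g :: ls).
Proof. by move=> mg ml [|i] //=; exact: ml. Qed.

Lemma mseq_behead d (V : measurableType d) (g : V -> R) ls : mseq (g :: ls) ->
  measurable_fun setT g /\ mseq ls.
Proof. by move=> h; split; [exact: (h 0%N)|move=> i; exact: (h i.+1)]. Qed.

Lemma mseq_rcons d (V : measurableType d) (g : V -> R) ls :
  measurable_fun setT g -> mseq ls -> mseq (rcons ls g).
Proof.
move=> mg; elim: ls => [|g' ls ih] /=; first by move=> _; apply: mseq_cons => //; exact: mseq_nil.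
by move=> /mseq_behead[mg' ml]; apply: mseq_cons => //; exact: ih.
Qed.

Lemma evs_rcons (V : Type) (ls : seq (V -> R)) g x : evs (rcons ls g) x = rcons (evs ls x) (g x).
Proof. by rewrite /evs map_rcons. Qed.

Lemma nth_evs (V : Type) (ls : seq (V -> R)) x i : nth 0 (evs ls x) i = nth (fun=> 0) ls i x.
Proof. by elim: ls i => [|g ls ih] [|i] //=. Qed.

Lemma jmeas_rcons n d (U : measurableType d) (phi : U -> seq R -> R) :
  jmeas n.+1 phi -> jmeas n (fun (z : U * R) l => phi z.1 (rcons l z.2)).
Proof.
move=> h d' V v ls mv sl ml.
have m1 : measurable_fun setT (fst \o v) by exact: measurableT_comp.
have m2 : measurable_fun setT (snd \o v) by exact: measurableT_comp.
have := h d' V (fst \o v) (rcons ls (snd \o v)) m1.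
rewrite size_rcons sl => /(_ erefl (mseq_rcons m2 ml)).
by apply: eq_measurable_fun => x _; rewrite evs_rcons.
Qed.

(** Insertion into a sorted list, with min and max in place of a case distinction: every entry of
    the result is then visibly a measurable function of r and of the entries of l. *)
Fixpoint bins (r : R) (l : seq R) : seq R :=
  if l is y :: l' then Num.min r y :: bins (Num.max r y) l' else [:: r].

Lemma bins_rcons_le r l y : sorted <=%R (rcons l y) -> r <= y ->
  bins r (rcons l y) = rcons (bins r l) y.
Proof.
elim: l r => [|z l ih] r /=; first by move=> _ ry; rewrite (min_idPl ry) (max_idPr ry).
move=> s ry; rewrite ih//; first exact: path_sorted s.
rewrite ge_max ry /=.
by have /allP/(_ y) := order_path_min le_trans s; apply; rewrite mem_rcons mem_head.
Qed.

Lemma bins_rcons_ge r l y : sorted <=%R (rcons l y) -> y <= r ->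
  bins r (rcons l y) = rcons (rcons l y) r.
Proof.
elim: l => [|z l ih] /=; first by move=> _ ry; rewrite (min_idPr ry) (max_idPl ry).
move=> s yr; have zy : z <= y.
  by have /allP/(_ y) := order_path_min le_trans s; apply; rewrite mem_rcons mem_head.
rewrite (min_idPr (le_trans zy yr)) (max_idPl (le_trans zy yr)) ih//.
exact: path_sorted s.
Qed.

Lemma perm_bins r l : perm_eq (bins r l) (r :: l).
Proof.
elim: l r => //= y l ih r; have [ry|yr] := leP r y.
  by rewrite perm_cons ih.
apply: (@perm_trans _ (y :: r :: l)); first by rewrite perm_cons ih.
by rewrite -[_ :: _ :: _]/([:: y; r] ++ l) -[X in perm_eq _ X]/([:: r; y] ++ l) perm_cat2r (perm_catC [:: y]).
Qed.

Lemma path_bins z r l : z <= r -> path <=%R z l -> path <=%R z (bins r l).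
Proof.
elim: l z r => [|y l ih] z r /= zr; first by rewrite zr.
move=> /andP[zy p]; rewrite le_min zr zy /=.
have [ry|yr] := leP r y; first by apply: ih => //; rewrite (path_le le_trans ry).
by apply: ih => //; exact: ltW.
Qed.

Lemma sorted_bins r l : sorted <=%R l -> sorted <=%R (bins r l).
Proof.
case: l => //= y l p; have [ry|/ltW yr] := leP r y; last exact: path_bins.
by apply: path_bins => //; exact: (path_le le_trans ry p).
Qed.

(** Insertion sort gives both the measurability of sorting and the possibility of peeling off one
    draw from a sorted sample. *)
Lemma sortE (l : seq R) : sort <=%R l = foldr bins [::] l.
Proof.
have s : sorted <=%R (foldr bins [::] l) by elim: l => //= y l; exact: sorted_bins.
apply: (sorted_eq le_trans le_anti) => //; first exact/sort_sorted/le_total.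
rewrite perm_sort; elim: l {s} => //= y l ih.
by rewrite perm_sym (perm_trans (perm_bins _ _))// perm_cons perm_sym.
Qed.

Lemma mseq_bins d (V : measurableType d) (g : V -> R) ls :
  measurable_fun setT g -> mseq ls ->
  exists ls', [/\ mseq ls', size ls' = (size ls).+1 & forall x, evs ls' x = bins (g x) (evs ls x)].
Proof.
elim: ls g => [|y ls ih] g mg ml.
  by exists [:: g]; split => //; apply: mseq_cons => //; exact: mseq_nil.
have [my {}ml] := mseq_behead ml.
have [] := ih (g \max y) _ ml; first exact: measurable_maxr.
move=> ls' [ml' sl el]; exists ((g \min y) :: ls'); split => /=.
- by apply: mseq_cons => //; exact: measurable_minr.
- by rewrite sl.
- by move=> x; rewrite el.
Qed.

Lemma mseq_sort d (V : measurableType d) (ls : seq (V -> R)) : mseq ls ->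
  exists ls', [/\ mseq ls', size ls' = size ls & forall x, evs ls' x = sort <=%R (evs ls x)].
Proof.
elim: ls => [_|y ls ih /mseq_behead[my ml]].
  by exists [::]; split => //; exact: mseq_nil.
have [ls1 [m1 s1 e1]] := ih ml.
have [ls' [m' s' e']] := mseq_bins my m1.
exists ls'; split=> //=; first by rewrite s' s1.
by move=> x; rewrite e' e1 !sortE.
Qed.

End MeasurableLists.

(** * Integrals over ordered points under an atomless law *)

Section OrderedIntegral.
Variables (R : realType) (U : probability (measurableTypeR R) R).

(** A simplex integral in which the varying domains are replaced by cut-offs under one fixed law, so
    that Fubini applies directly. *)
Fixpoint usint (n : nat) (s : R) (f : seq R -> R) : R :=
  if n is n'.+1 then
    Ex U (fun r => if r <= s then usint n' r (fun l => f (rcons l r)) else 0)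
  else f [::].

Lemma usint_ext n s f g :
  (forall l, size l = n -> sorted <=%R (rcons l s) -> f l = g l) ->
  usint n s f = usint n s g.
Proof.
elim: n s f g => [|n ih] s f g fg /=; first exact: fg.
congr (Ex U _); apply/funext => r; case: ifP => // rs.
apply: ih => l sl so; apply: fg; first by rewrite size_rcons sl.
case: l {sl} so => [|x l] /=; first by rewrite rs.
by rewrite !rcons_path last_rcons rs andbT => ->.
Qed.

Lemma bm_if d (V : measurableType d) (b : V -> bool) (f : V -> R) c : measurable_fun setT b ->
  measurable_fun setT f -> (forall x, `|f x| <= c) ->
  measurable_fun setT (fun x => if b x then f x else 0) /\
  forall x, `|if b x then f x else 0| <= c.
Proof.
move=> mb mf fc; split; first by apply: measurable_fun_ifT.
by move=> x; case: ifP => // _; rewrite normr0; exact: le_trans (fc x).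
Qed.

Lemma usint_bm n d (V : measurableType d) (phi : V -> seq R -> R) (beta : V -> R) c :
  jmeas n phi -> (forall u l, `|phi u l| <= c) -> measurable_fun setT beta ->
  measurable_fun setT (fun u => usint n (beta u) (phi u)) /\
  forall u, `|usint n (beta u) (phi u)| <= c.
Proof.
elim: n d V phi beta => [|n ih] d V phi beta mphi phic mb.
  split=> [|u]; last exact: phic.
  exact: (mphi _ V id [::] (@measurable_id _ _ _) erefl (@mseq_nil R _ V)).
pose psi (z : V * measurableTypeR R) l := phi z.1 (rcons l z.2).
have [mpsi psic] := ih _ _ psi snd (jmeas_rcons mphi) (fun u l => phic _ _) measurable_snd.
have mle : measurable_fun setT (fun z : V * measurableTypeR R => z.2 <= beta z.1).
  by apply: measurable_fun_ler => //; exact: measurableT_comp.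
have [mif cif] := bm_if mle mpsi psic.
have b2 : bm2 (fun (u : V) (r : measurableTypeR R) =>
    if r <= beta u then usint n r (fun l => phi u (rcons l r)) else 0).
  by split => //; exists c.
(* Measurability of a partial integral does not involve a measure on V, but [bm_Ex2] asks for one; a
   Dirac mass serves. *)
have [? _] := bm_Ex2 (\d_point : probability V R) U b2.
split=> // u; apply: Ex_bound => [|r]; first exact: bm2_r b2.
exact: (cif (u, r)).
Qed.

Definition nice n (f : seq R -> R) :=
  @jmeas R n _ unit (fun _ => f) /\ exists c, forall l, `|f l| <= c.

Lemma nice_rcons n f r : nice n.+1 f -> nice n (fun l => f (rcons l r)).
Proof.
move=> [mf [c fc]]; split; last by exists c => l.
move=> d V v ls mv sl ml.
have := mf d V v (rcons ls (fun=> r)) mv; rewrite size_rcons sl => /(_ erefl).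
move=> /(_ (mseq_rcons (measurable_cst _) ml)).
by apply: eq_measurable_fun => x _; rewrite evs_rcons.
Qed.

Lemma nice_jmeas n f : nice n f -> forall d (V : measurableType d),
  jmeas n (fun (_ : V) => f).
Proof.
move=> [mf _] d V d' V' v ls mv sl ml.
exact: (mf d' V' (fun=> tt) ls (measurable_cst _) sl ml).
Qed.

Lemma jmeas_bins n f : nice n.+1 f -> @jmeas R n _ (measurableTypeR R) (fun r l => f (bins r l)).
Proof.
move=> nf d V v ls mv sl ml.
have [ls' [ml' sl' el]] := mseq_bins mv ml.
have := nice_jmeas nf (@measurable_id _ V setT) (ls := ls').
rewrite sl' sl => /(_ erefl ml').
by apply: eq_measurable_fun => x _; rewrite el.
Qed.

Hypothesis atomless : forall r, U [set r] = 0%E.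

(** Ties between two points are null; this is the only use of atomlessness. *)
Lemma Ex_lt_le (g : R -> R) r : bm (g : measurableTypeR R -> R) ->
  Ex U (fun q => if q < r then g q else 0) = Ex U (fun q => if q <= r then g q else 0).
Proof.
move=> [mg [c gc]].
have b1 : bm (fun q : measurableTypeR R => if q < r then g q else 0).
  have [? ?] := bm_if (measurable_fun_ltr (@measurable_id _ _ setT) (measurable_cst r)) mg gc.
  by split=> //; exists c.
have b2 : bm (fun q : measurableTypeR R => if q <= r then g q else 0).
  have [? ?] := bm_if (measurable_fun_ler (@measurable_id _ _ setT) (measurable_cst r)) mg gc.
  by split=> //; exists c.
have ae : {ae U, forall q, (if q < r then g q else 0) = (if q <= r then g q else 0)}.
  exists [set r]; split; [exact: measurable_set1|exact: atomless|].
  by move=> q /=; rewrite le_eqVlt; have [->//|] := eqVneq q r; rewrite orFb.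
exact: Ex_ae_eq.
Qed.

(* The new point [r] falls into one of the n+1 gaps of a sorted list. *)
Lemma usint_bins n s f : nice n.+1 f ->
  Ex U (fun r => if r <= s then usint n s (fun l => f (bins r l)) else 0) =
  n.+1%:R * usint n.+1 s f.
Proof.
elim: n s f => [|n ih] s f nf; first by rewrite mul1r.
have [mf [c fc]] := nf.
pose A (r q : R) := usint n q (fun l => f (bins r (rcons l q))).
have mid := @measurable_id _ (measurableTypeR R) setT.
have fstm : measurable_fun setT (fst : measurableTypeR R * measurableTypeR R -> R) by exact: measurable_fst.
have sndm : measurable_fun setT (snd : measurableTypeR R * measurableTypeR R -> R) by exact: measurable_snd.
have jA : @jmeas R n _ (measurableTypeR R * measurableTypeR R)%type
    (fun z l => f (bins z.1 (rcons l z.2))).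
  exact: (@jmeas_rcons R n _ (measurableTypeR R) _ (jmeas_bins nf)).
have [mA cA] := usint_bm jA (fun _ _ => fc _) sndm.
pose Phi r q := if (r <= s) && (q <= s) then A r q else 0.
have mrs : measurable_fun setT (fun z : measurableTypeR R * measurableTypeR R => z.1 <= s).
  exact: measurable_fun_ler.
have mqs : measurable_fun setT (fun z : measurableTypeR R * measurableTypeR R => z.2 <= s).
  exact: measurable_fun_ler.
have mrq : measurable_fun setT (fun z : measurableTypeR R * measurableTypeR R => z.1 <= z.2).
  exact: measurable_fun_ler.
have mqr : measurable_fun setT (fun z : measurableTypeR R * measurableTypeR R => z.2 < z.1).
  exact: measurable_fun_ltr.
have [mPhi cPhi] := bm_if (measurable_and mrs mqs) mA cA.
have [mP1 cP1] := bm_if mrq mPhi cPhi.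
have [mP2 cP2] := bm_if mqr mPhi cPhi.
have b1 : @bm2 _ _ (measurableTypeR R) (measurableTypeR R) R (fun r q => if r <= q then Phi r q else 0).
  by split => //; exists c.
have b2 : @bm2 _ _ (measurableTypeR R) (measurableTypeR R) R (fun r q => if q < r then Phi r q else 0).
  by split => //; exists c.
(* Split on the position of r relative to the largest listed point q. Below q, induction on the
   points under q yields n.+1 copies; above q, the point r is the new maximum and yields the last
   copy. *)
transitivity (Ex U (fun r => Ex U (fun q => (if r <= q then Phi r q else 0) +
     (if q < r then Phi r q else 0)))).
  congr (Ex U _); apply/funext => r; rewrite /=.
  case: ifP => rs; last first.
    rewrite -[LHS](Ex_cst U 0); congr (Ex U _); apply/funext => q.
    by rewrite /Phi rs /= !if_same addr0.
  congr (Ex U _); apply/funext => q; rewrite /Phi rs /=.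
  by case: ifP => _; case: leP => _; rewrite ?addr0 ?add0r.
transitivity (Ex U (fun r => Ex U (fun q => if r <= q then Phi r q else 0)) +
   Ex U (fun r => Ex U (fun q => if q < r then Phi r q else 0))).
  rewrite -ExD; [|exact: bm_Ex2 b1|exact: bm_Ex2 b2].
  congr (Ex U _); apply/funext => r; apply: ExD; [exact: bm2_r b1|exact: bm2_r b2].
have uE : usint n.+2 s f = Ex U (fun q => if q <= s then usint n.+1 q (fun l => f (rcons l q)) else 0) by [].
rewrite -[n.+2]addn1 natrD mulrDl mul1r; congr (_ + _).
  rewrite Ex_fubini// addn1 uE.
  have bS : bm (fun q : measurableTypeR R => if q <= s then usint n.+1 q (fun l => f (rcons l q)) else 0).
    have [] := @usint_bm n.+1 _ (measurableTypeR R) (fun q l => f (rcons l q)) id c _ (fun _ _ => fc _) mid.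
      move=> d V v ls mv sl ml.
      have := nice_jmeas nf (@measurable_id _ V setT) (ls := rcons ls v).
      rewrite size_rcons sl => /(_ erefl (mseq_rcons mv ml)).
      by apply: eq_measurable_fun => x _; rewrite evs_rcons.
    move=> m1 c1.
    have [? ?] := bm_if (measurable_fun_ler mid (measurable_cst s)) m1 c1.
    by split=> //; exists c.
  rewrite -(ExZ U _ bS); congr (Ex U _); apply/funext => q.
  case: ifP => qs; last first.
    rewrite mulr0 -[RHS](Ex_cst U 0); congr (Ex U _); apply/funext => r.
    by rewrite /Phi qs andbF if_same.
  rewrite -(ih q _ (nice_rcons q nf)); congr (Ex U _); apply/funext => r.
  case: ifP => // rq; rewrite /Phi (le_trans rq qs) qs /=.
  by apply: usint_ext => l _ sl; rewrite bins_rcons_le.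
rewrite addn1 uE; congr (Ex U _); apply/funext => r.
case: ifP => rs; last first.
  by rewrite -[RHS](Ex_cst U 0); congr (Ex U _); apply/funext => q; rewrite /Phi rs /= if_same.
rewrite [RHS](_ : _ = Ex U (fun q : measurableTypeR R => if q <= r then (fun q => usint n q (fun l => f (rcons (rcons l q) r))) q else 0))//.
rewrite -(Ex_lt_le (g := fun q => usint n q (fun l => f (rcons (rcons l q) r)))); last first.
  have nfr := nice_rcons r nf.
  have [] := @usint_bm n _ (measurableTypeR R) (fun q l => f (rcons (rcons l q) r)) id c _ (fun _ _ => fc _) mid.
    move=> d V v ls mv sl ml.
    have := nice_jmeas nfr (@measurable_id _ V setT) (ls := rcons ls v).
    rewrite size_rcons sl => /(_ erefl (mseq_rcons mv ml)).
    by apply: eq_measurable_fun => x _; rewrite evs_rcons.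
  by move=> ? ?; split=> //; exists c.
congr (Ex U _); apply/funext => q; case: ifP => // qr.
rewrite /Phi rs (le_trans (ltW qr) rs) /=.
by apply: usint_ext => l _ sl; rewrite bins_rcons_ge// ltW.
Qed.

End OrderedIntegral.

(** * Change of variables *)

Section Transfer.
Context d1 d2 (T1 : measurableType d1) (T2 : measurableType d2) (R : realType).

Lemma Ex_transfer (P : probability T1 R) (Q : probability T2 R) (phi : T1 -> T2) (f : T2 -> R) :
  measurable_fun setT phi ->
  (forall A, measurable A -> Q A = P (phi @^-1` A)) ->
  bm f -> Ex Q f = Ex P (f \o phi).
Proof.
move=> mphi QP bf.
have bfp : bm (f \o phi) by have [mf [c fc]] := bf; split; [exact: measurableT_comp|exists c => x /=].
have ip : P.-integrable (phi @^-1` setT) ((EFin \o f) \o phi).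
  by rewrite preimage_setT; exact: (bm_integrable P bfp).
have mf : measurable_fun setT (EFin \o f) by apply/measurable_EFinP; case: bf.
have := integral_pushforward mphi mf ip measurableT; rewrite preimage_setT => e.
rewrite /Ex /Rintegral; congr fine; rewrite -[RHS]e.
by apply: eq_measure_integral => A mA _; exact: QP.
Qed.

Lemma image_law (P : probability T1 R) (phi : T1 -> T2) : measurable_fun setT phi ->
  exists Q : probability T2 R, forall A, Q A = P (phi @^-1` A).
Proof.
move=> mphi; pose mixin := isMeasurableFun.Build _ _ _ _ _ mphi.
pose X : {mfun T1 >-> T2} := MeasurableFun.Pack (MeasurableFun.Class mixin).
by exists (distribution P X).
Qed.

End Transfer.

(** * Independent coordinates *)

Section Cylinders.
Variables (R : realType) (I : eqType) (J : pred I).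
Implicit Types (s : seq I) (A : I -> set R) (F : pred I).

Definition cyl s A : set (I -> R) := [set x | forall a, a \in s -> A a (x a)].

Definition cyls : set (set (I -> R)) :=
  [set C | exists s A, [/\ all J s, (forall a, measurable (A a)) & C = cyl s A]].

(** Only coordinates in J generate the sigma-algebra, since only the used draws are random variables
    with a prescribed law. *)
Definition sample_space : measurableType _ := g_sigma_algebraType cyls.

Lemma cyl_measurable s A : all J s -> (forall a, measurable (A a)) ->
  @measurable _ sample_space (cyl s A).
Proof. by move=> Js mA; apply: sub_sigma_algebra; exists s, A. Qed.

Lemma cyl_cat s s' A A' : cyl s A `&` cyl s' A' =
  cyl (s ++ s') (fun a => (if a \in s then A a else setT) `&` (if a \in s' then A' a else setT)).
Proof.
apply/seteqP; split=> [x [h h'] a|x h] /=.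
  rewrite mem_cat => _; split; case: ifP => // ?; [exact: h|exact: h'].
split=> a /= as_; have := h a; rewrite mem_cat as_ ?orbT => /(_ isT) [] //.
Qed.

Lemma cyls_setI : setI_closed cyls.
Proof.
move=> _ _ [s [A [Js mA ->]]] [s' [A' [Js' mA' ->]]]; rewrite cyl_cat.
eexists _, _; split; last by [].
  by rewrite all_cat Js.
by move=> a; apply: measurableI; case: ifP.
Qed.

Lemma cyl_undup s A : cyl (undup s) A = cyl s A.
Proof. by apply/seteqP; split=> x h a as_; apply: h; rewrite ?mem_undup// -mem_undup. Qed.

Lemma cyl0 : cyl [::] (fun=> setT) = setT.
Proof. by apply/seteqP; split. Qed.

Lemma measurable_coord a : J a -> measurable_fun setT (fun x : sample_space => x a).
Proof.
move=> Ja _ B mB; rewrite setTI (_ : _ @^-1` _ = cyl [:: a] (fun=> B)).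
  by apply: cyl_measurable => //=; rewrite Ja.
by apply/seteqP; split=> [x Bx b|x] /=; [rewrite inE => /eqP ->|apply; rewrite mem_head].
Qed.

Lemma measurable_sample d (V : measurableType d) (f : V -> sample_space) :
  (forall a, J a -> measurable_fun setT (fun x => f x a)) -> measurable_fun setT f.
Proof.
move=> mf; have H0 := @measurability _ _ V sample_space setT f cyls; apply: H0 => // _ [_ [s [A [Js mA ->]]] <-].
rewrite setTI (_ : _ @^-1` _ = \big[setI/setT]_(a <- s) ((fun x => f x a) @^-1` (A a))); last first.
  apply/seteqP; split=> x; rewrite /cyl /=.
    elim: s {Js} => [_|a s ih h]; rewrite ?big_nil// big_cons; split; first exact: h (mem_head _ _).
    by apply: ih => b bs; apply: h; rewrite in_cons bs orbT.
  elim: s {Js} => //= a s ih; rewrite big_cons => -[h1 h2] b; rewrite in_cons => /orP[/eqP ->//|].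
  exact: ih.
rewrite big_seq; apply: bigsetI_measurable => a as_.
by rewrite -[X in measurable X]setTI; apply: mf => //; exact: (allP Js).
Qed.

Definition merge F (x y : I -> R) : I -> R := fun a => if F a then y a else x a.

Lemma measurable_merge F :
  measurable_fun setT (fun z : sample_space * sample_space => merge F z.1 z.2 : sample_space).
Proof.
apply: measurable_sample => a Ja; rewrite /merge; case: (F a).
  exact: (measurableT_comp (measurable_coord Ja) measurable_snd).
exact: (measurableT_comp (measurable_coord Ja) measurable_fst).
Qed.

Variable Q : probability sample_space R.

Definition independent_coords :=
  forall s A, uniq s -> all J s -> (forall a, measurable (A a)) ->
    Q (cyl s A) = (\prod_(a <- s) Q (cyl [:: a] A))%E.

Hypothesis indep : independent_coords.

(** Cylinders are stable under intersection and generate, so it is enough to compare on them. There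
    the product measure is the product of the coordinates outside F and of those inside F, which by
    independence is the value of Q. *)
Lemma merge_law F C : measurable C ->
  Q C = (Q \x Q)%E ((fun z : sample_space * sample_space => merge F z.1 z.2 : sample_space) @^-1` C).
Proof.
move=> mC.
have [m2 m2E] := image_law (Q \x Q)%E (measurable_merge F); rewrite -m2E.
have mE : @measurable _ sample_space = <<s cyls >> by [].
have H := @measure_unique _ R sample_space cyls (fun=> setT) mE cyls_setI _ _ Q m2.
apply: H => //.
  - by move=> _; exists [::], (fun=> setT); split => //; rewrite cyl0.
  - by rewrite bigcup_const//; exists 0%N.
  - move=> _ [s [A [Js mA ->]]]; apply: etrans (esym (m2E (cyl s A))).
    set u := undup s.
    have Ju : all J u by apply/allP => a; rewrite mem_undup; exact: (allP Js).
    have e1 : Q (cyl s A) = (\prod_(a <- u) Q (cyl [:: a] A))%E.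
      by rewrite -(cyl_undup s) indep// undup_uniq.
    apply: etrans e1 _; rewrite -cyl_undup -/u.
    rewrite (_ : _ @^-1` _ = cyl [seq a <- u | ~~ F a] A `*` cyl [seq a <- u | F a] A); last first.
      apply/seteqP; split=> [[x y]|[x y]]; rewrite /cyl /merge /=.
        move=> h; split=> a; rewrite mem_filter => /andP[Fa /h].
          by rewrite (negbTE Fa).
        by rewrite Fa.
      move=> [h1 h2] a au; case: ifP => Fa; first by apply: h2; rewrite mem_filter Fa.
      by apply: h1; rewrite mem_filter Fa.
    have Jf G : all J [seq a <- u | G a].
      by apply/allP => a; rewrite mem_filter => /andP[_]; exact: (allP Ju).
    have e2 G : Q (cyl [seq a <- u | G a] A) = (\prod_(a <- u | G a) Q (cyl [:: a] A))%E.
      by rewrite indep ?filter_uniq ?undup_uniq// big_filter.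
    have e3 := product_measure1E Q Q (cyl_measurable (Jf (fun a => ~~ F a)) mA) (cyl_measurable (Jf F) mA).
    apply: etrans (esym (etrans e3 (congr2 mule (e2 _) (e2 _)))).
    by rewrite (bigID F)/= muleC.
  - by move=> _; rewrite -ge0_fin_numE// fin_num_measure.
Qed.

(* Fresh copies of the coordinates in [F] do not change the expectation. *)
Lemma Ex_merge F (f : sample_space -> R) : bm f ->
  Ex Q f = Ex Q (fun x => Ex Q (fun y => f (merge F x y))).
Proof.
move=> bf; have [mf [c fc]] := bf.
have mm := measurable_merge F.
rewrite (@Ex_transfer _ _ _ _ _ (Q \x Q)%E Q _ f mm (@merge_law F) bf).
have b2 : @bm2 _ _ sample_space sample_space R (fun x y => f (merge F x y)).
  by split; [exact: (measurableT_comp mf mm)|exists c => z; exact: fc].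
by rewrite -Ex_prod.
Qed.

End Cylinders.

(** * Uniform order statistics and simplex integrals *)

Section OrderStatistics.
Variables (R : realType) (I : eqType) (J : pred I).
Local Notation E := (sample_space R J).
Variables (Q : probability E R) (U : probability (measurableTypeR R) R).
Hypothesis indep : independent_coords Q.
Hypothesis atomless : forall r, U [set r] = 0%E.

Definition has_law (a : I) := forall A : set R, measurable A -> Q [set x | A (x a)] = U A.

Lemma Ex_coord a (g : R -> R) : J a -> has_law a -> bm (g : measurableTypeR R -> R) ->
  Ex Q (fun x => g (x a)) = Ex U g.
Proof.
move=> Ja la bg.
have m : measurable_fun setT (fun x : E => x a : measurableTypeR R) by exact: measurable_coord.
rewrite (@Ex_transfer _ _ _ _ _ Q U _ g m _ bg)// => A mA.
by rewrite -la.
Qed.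

Lemma mseq_coords (s : seq I) : all J s -> @mseq R _ E [seq (fun x : E => x i) | i <- s].
Proof.
elim: s => [|i l ih] /=; first by move=> _; exact: mseq_nil.
by move=> /andP[Ji Jl]; apply: mseq_cons; [exact: measurable_coord|exact: ih].
Qed.

Lemma nice_bins n (f : seq R -> R) r : nice n.+1 f -> nice n (fun l => f (bins r l)).
Proof.
move=> nf; have [_ [c fc]] := nf; split; last by exists c.
move=> d V v ls mv sl ml.
exact: (jmeas_bins nf (v := fun=> r) (measurable_cst _) sl ml).
Qed.

(** Peel off the first draw: induction turns the others into an ordered integral, and [usint_bins]
    inserts the draw among them, which accounts for the next factor of the factorial. The upper
    limit b is void almost surely. *)
Lemma order_statistics s b f : uniq s -> all J s -> (forall a, a \in s -> has_law a) ->
  {ae U, forall r, r <= b} -> nice (size s) f ->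
  Ex Q (fun x => f (sort <=%R [seq x a | a <- s])) = (size s)`!%:R * usint U (size s) b f.
Proof.
move=> us Js ls aeb; elim: s us Js ls f => [|a s ih].
  by move=> _ _ _ f _; rewrite /= fact0 mul1r Ex_cst.
move=> /= /andP[as_ us] /andP[Ja Js] ls f nf.
have ls' c : c \in s -> has_law c by move=> cs; apply: ls; rewrite in_cons cs orbT.
have [mf [c fc]] := nf.
have mid := @measurable_id _ (measurableTypeR R) setT.
have bphi : bm (fun x : E => f (sort <=%R (x a :: [seq x a0 | a0 <- s]))).
  split; last by exists c.
  have ms : @mseq R _ E [seq (fun x : E => x i) | i <- a :: s] by apply: mseq_coords; rewrite /= Ja.
  have [ls1 [m1 s1 e1]] := mseq_sort ms.
  have := mf _ E (fun=> tt) ls1 (measurable_cst _).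
  rewrite s1 /= size_map => /(_ erefl m1).
  apply: eq_measurable_fun => x _; rewrite e1 /= /evs.
  by rewrite -map_comp.
(* Resampling all coordinates other than a amounts to conditioning on the draw a. *)
rewrite (Ex_merge indep (predC1 a) bphi).
have -> : (fun x : E => Ex Q (fun y : E => f (sort <=%R (merge (predC1 a) x y a :: [seq merge (predC1 a) x y a0 | a0 <- s])))) =
    (fun x : E => (size s)`!%:R * usint U (size s) b (fun l => f (bins (x a) l))).
  apply/funext => x; rewrite -(ih us Js ls' _ (nice_bins (x a) nf)).
  congr (Ex Q _); apply/funext => y; congr f.
  rewrite !sortE /= {1}/merge /= eqxx /=; congr (bins _ (foldr _ _ _)).
  apply/eq_in_map => i is_; rewrite /merge /=; case: eqVneq => // e.
  by move: as_; rewrite -e is_.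
have [mu cu] := usint_bm U (jmeas_bins nf) (fun _ _ => fc _) (measurable_cst b).
have bu : bm (fun r : measurableTypeR R => usint U (size s) b (fun l => f (bins r l))).
  by split => //; exists c.
rewrite (@Ex_coord a (fun r => (size s)`!%:R * usint U (size s) b (fun l => f (bins r l)))) //; last 2 first.
  - by apply: ls; rewrite mem_head.
  - by apply: bmM => //; exact: bm_cst.
rewrite ExZ// factS natrM mulrAC -usint_bins// mulrC; congr (_ * _).
apply: Ex_ae_eq => //.
  have [? ?] := bm_if (measurable_fun_ler mid (measurable_cst b)) mu cu.
  by split=> //; exists c.
case: aeb => N [mN N0 sN]; exists N; split => // r /= h.
by apply: sN => /= rb; apply: h; rewrite rb.
Qed.

End OrderStatistics.

(** * Uniform law and Lebesgue integral *)

Section Uniform.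
Variables (R : realType) (a b : R) (ab : a < b).
Local Notation U := (uniform_prob ab : probability (measurableTypeR R) R).
Local Notation mu := (@lebesgue_measure R).

Lemma Ex_uniform (g : measurableTypeR R -> R) : bm g ->
  \int[mu]_(r in `[a, b]) g r = (b - a) * Ex U g.
Proof.
move=> bg; have [mg [c gc]] := bg.
have fin : (mu `[a, b] < +oo)%E by rewrite lebesgue_measure_itv /= lte_fin ab ltry.
have bdi (f : measurableTypeR R -> R) k : measurable_fun setT f -> (forall r, `|f r| <= k) ->
    mu.-integrable `[a, b] (EFin \o f).
  move=> mf fk; apply: measurable_bounded_integrable => //; first exact: measurable_funTS.
  by exists k; split; [exact: num_real|move=> M kM x _; exact: le_trans (fk x) (ltW kM)].
(* [integral_uniform] concerns nonnegative functions; the shift by the bound of g is undone at the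
   end. *)
have bg' : bm (fun r => g r + c) by apply: bmD => //; exact: bm_cst.
have [mg' [c' gc']] := bg'.
have g0 r : (0 <= (g r + c)%:E)%E by rewrite lee_fin; have := gc r; rewrite ler_norml => /andP[? _]; lra.
have mg1 : measurable_fun setT (fun r : measurableTypeR R => (g r + c)%:E).
  exact/measurable_EFinP.
have := integral_uniform ab mg1 g0.
rewrite (Ex_fin U bg') ExD ?Ex_cst//; last exact: bm_cst.
have -> : (\int[mu]_(x in `[a, b]) (g x + c)%:E = (\int[mu]_(x in `[a, b]) g x + c * (b - a))%:E)%E.
  have i1 := bdi _ _ mg gc; have i2 := bdi _ _ (measurable_cst c) (fun _ => lexx `|c|).
  have -> : c * (b - a) = \int[mu]_(x in `[a, b]) c.
    have e : fine (mu `[a, b]) = b - a by rewrite lebesgue_measure_itv /= lte_fin ab.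
    by rewrite Rintegral_cst//; transitivity (c * fine (mu `[a, b])); rewrite // e.
  rewrite -RintegralD// /Rintegral fineK//.
  by apply: integrable_fin_num => //; exact: bdi mg' gc'.
move=> e0; have {e0} e : Ex U g + c = (b - a)^-1 * (\int[mu]_(x in `[a, b]) g x + c * (b - a)).
  by apply: EFin_inj; rewrite EFinM; exact: e0.
have ba : b - a != 0 by rewrite subr_eq0 gt_eqF.
rewrite (_ : Ex U g = (b - a)^-1 * (\int[mu]_(x in `[a, b]) g x + c * (b - a)) - c); last by rewrite -e addrK.
by field.
Qed.

End Uniform.

(** * Simplex integrals *)

Section SimplexIntegral.
Variable R : realType.
Local Notation mu := (@lebesgue_measure R).

Fixpoint sint (n : nat) (a b : R) (f : seq R -> R) : R :=
  if n is n'.+1 then \int[mu]_(r in `[a, b]) sint n' a r (fun l => f (rcons l r))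
  else f [::].

Lemma co_simplex_int n a b (f : seq R -> 'M[R[i]]_2) k :
  co k (simplex_int n a b f) = sint n a b (fun l => co k (f l)).
Proof.
elim: n b f => //= n ih b f.
rewrite [LHS](_ : _ = \int[mu]_(r in `[a, b]) co k (simplex_int n a r (fun l => f (rcons l r)))).
  by apply: eq_Rintegral => r _; rewrite ih.
by rewrite /mx_integral /co; case: k {ih} => -[] [i j] /=; rewrite mxE.
Qed.

(* [path <=%R a (rcons l b)] says that the list [l] is sorted and lies in [a, b]. *)
Lemma sint_ext n a b f g :
  (forall l, size l = n -> path <=%R a (rcons l b) -> f l = g l) -> a <= b ->
  sint n a b f = sint n a b g.
Proof.
elim: n b f g => [|n ih] b f g fg ab /=; first by apply: fg => //=; rewrite ab.
apply: eq_Rintegral => r; rewrite inE /= in_itv /= => /andP[ar rb].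
apply: ih => // l sl pl; apply: fg; first by rewrite size_rcons sl.
by rewrite rcons_path last_rcons rb andbT.
Qed.

Lemma sint_singleton n a f : sint n.+1 a a f = 0.
Proof.
by rewrite /= set_itv1 Rintegral_set1.
Qed.

Variables (a b : R) (ab : a < b).
Local Notation U := (uniform_prob ab : probability (measurableTypeR R) R).

Lemma uniform_atomless r : U [set r] = 0%E.
Proof.
have := dominates_uniform_prob ab; move/null_content_dominatesP => h.
by apply: h; [exact: measurable_set1|exact: lebesgue_measure_set1].
Qed.

Lemma uniform_itv : U `[a, b]%classic = 1%E.
Proof. by rewrite /= /uniform_prob; exact: integral_uniform_pdf1. Qed.

Lemma uniform_ae : {ae U, forall r, a <= r <= b}.
Proof.
exists (~` `[a, b]%classic); split; first exact: measurableC.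
  have h := probability_setC U (measurable_itv `[a, b] : measurable (`[a, b]%classic : set (measurableTypeR R))).
  by apply: etrans h _; rewrite uniform_itv subee.
by move=> r /=; rewrite in_itv /= => ?.
Qed.

(** Each integral over [a, r] is an integral over [a, b] with a cut-off, at the price of one factor
    b - a. *)
Lemma sint_usint n s f : nice n f -> a <= s <= b ->
  sint n a s f = (b - a) ^+ n * usint U n s f.
Proof.
elim: n s f => [|n ih] s f nf /andP[as_ sb]; first by rewrite /= mul1r.
have [mf [c fc]] := nf.
pose g (r : measurableTypeR R) := if r <= s then usint U n r (fun l => f (rcons l r)) else 0.
have mid := @measurable_id _ (measurableTypeR R) setT.
have bg : bm g.
  have [] := @usint_bm R U n _ (measurableTypeR R) (fun q l => f (rcons l q)) id c _ (fun _ _ => fc _) mid.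
    move=> d V v ls mv sl ml.
    have := nice_jmeas nf (@measurable_id _ V setT) (ls := rcons ls v).
    rewrite size_rcons sl => /(_ erefl (mseq_rcons mv ml)).
    by apply: eq_measurable_fun => x _; rewrite evs_rcons.
  move=> m1 c1.
  have [? ?] := bm_if (measurable_fun_ler mid (measurable_cst s)) m1 c1.
  by split=> //; exists c.
have fin : (mu `[a, b]%classic < +oo)%E by rewrite lebesgue_measure_itv /= lte_fin ab ltry.
rewrite exprS -mulrA mulrCA.
have -> : usint U n.+1 s f = Ex U g by [].
rewrite -(Ex_uniform ab bg) -RintegralZl//; last first.
  have [mg [c' gc]] := bg; apply: measurable_bounded_integrable => //.
    exact: measurable_funTS.
  by exists c'; split; [exact: num_real|move=> M kM x _; exact: le_trans (gc x) (ltW kM)].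
rewrite [LHS]/= (_ : `[a, s]%classic = `[a, b]%classic `&` `[a, s]%classic); last first.
  apply/seteqP; split=> r /=; rewrite !in_itv /=; last by case.
  by move=> /andP[-> rs]; rewrite rs (le_trans rs sb).
rewrite Rintegral_mkcondr; apply: eq_Rintegral => r; rewrite inE /= in_itv /= => /andP[ar rb].
rewrite patchE /g; case: ifPn; rewrite ?inE /= ?in_itv /= ?ar /=.
  by move=> rs; rewrite rs ih ?ar//; exact: nice_rcons.
by rewrite notin_setE /= in_itv /= ar /= => /negP/negbTE ->; rewrite mulr0.
Qed.

End SimplexIntegral.

(** Arithmetic of the doubled node: a cell index c becomes a node number, shifted by one beyond t
    when the final node lies beyond t. The node N, which is the copy from below, is met only if it
    is the final node. *)
Lemma cell_facts N q p c : (mesh_index N q <= c <= mesh_index N p)%N -> (q <= p)%N -> q <> N ->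
  let c' := if (p <= N)%N || (c < N)%N then c else c.+1 in
  [/\ (q <= c' <= p)%N, (c < mesh_index N p)%N -> (c' < p)%N /\ c' <> N,
    c' = N -> p = N & mesh_index N c' = c].
Proof.
rewrite /mesh_index; case: (leqP p N) => pN /=.
  rewrite (_ : (q <= N)%N = (q <= p)%N || (q <= N)%N); last by case: (leqP q p) => //; lia.
  move=> + qp qN; rewrite qp /= => H; rewrite (_ : (c <= N)%N); last lia.
  by split => //; lia.
by case: (ltnP c N) => cN; case: ifP => qN' H qp qN; split; (try (case: ifP)); lia.
Qed.

(** * Mesh and interpolation *)

Section MeshGeometry.
Variables (R : realType) (D : model R) (N : nat).
Hypotheses (t_gt0 : 0 < horizon D) (N_gt0 : (0 < N)%N).
Local Notation t := (horizon D).
Local Notation h := (t / N%:R).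
Local Notation M := 'M[R[i]]_2.
Local Notation mi := (mesh_index N).

Lemma step_gt0 : 0 < h. Proof. by rewrite divr_gt0// ltr0n. Qed.

Lemma mi_le j k : (j <= k)%N -> (mi j <= mi k)%N.
Proof. by rewrite /mesh_index; case: ifP; case: ifP; lia. Qed.

Lemma miS j : j <> N -> mi j.+1 = (mi j).+1.
Proof. by rewrite /mesh_index => ?; case: ifP; case: ifP; lia. Qed.

Definition tm (x : nat * R) : R := ((mi x.1)%:R + x.2) * h.

Lemma tm_node p : tm (p, 0) = node_time D N p.
Proof. by rewrite /tm addr0. Qed.

Lemma node_time_le p p' : (p <= p')%N -> node_time D N p <= node_time D N p'.
Proof. by move=> pp; rewrite /node_time ler_wpM2r ?(ltW step_gt0)// ler_nat mi_le. Qed.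

Lemma node_time_ge0 p : 0 <= node_time D N p.
Proof. by rewrite /node_time mulr_ge0// ltW// step_gt0. Qed.

(** The last two clauses keep interpolation from crossing the jump: nodes N and N.+1 carry the same
    time, and a point strictly inside the fictitious cell between them is excluded. *)
Definition pt (q p : nat) (x : nat * R) : Prop :=
  [/\ (q <= x.1 <= p)%N, 0 <= x.2 < 1, x.2 != 0 -> (x.1 < p)%N /\ x.1 <> N
    & x.1 = N -> p = N].

Lemma pt_node q p c : (q <= c <= p)%N -> (c = N -> p = N) -> pt q p (c, 0).
Proof. by move=> qcp cN; split => //=; rewrite ?lexx ?ltr01// eqxx. Qed.

Lemma pt_locate q p s : (q <= p)%N -> q <> N ->
  node_time D N q <= s <= node_time D N p ->
  pt q p (locate D N p s) /\ tm (locate D N p s) = s.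
Proof.
move=> qp qN /andP[qs sp]; have h0 := step_gt0.
have hsh : s / h * h = s by rewrite divfK// gt_eqF.
have sh0 : 0 <= s / h by rewrite divr_ge0 ?(ltW h0)// (le_trans (node_time_ge0 q)).
rewrite /locate; set c := Num.truncn (s / h).
have /andP[c1 c2] : c%:R <= s / h < c.+1%:R by exact: truncn_itv.
have l01 : 0 <= s / h - c%:R < 1.
  by rewrite subr_ge0 c1 ltrBlDr -[1 + _]/(1 + c%:R) addrC natr1.
have qc : (mi q <= c)%N.
  rewrite -ltnS -(ltr_nat R); apply: le_lt_trans c2.
  by rewrite ler_pdivlMr.
have cp : (c <= mi p)%N.
  rewrite -(ler_nat R); apply: le_trans c1 _.
  by rewrite ler_pdivrMr.
have cl : s / h - c%:R != 0 -> (c < mi p)%N.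
  move=> ne; rewrite ltn_neqAle cp andbT; apply: contraNneq ne => cE.
  by rewrite cE subr_eq0 eq_le ler_pdivrMr// sp /= -cE.
have tN : N%:R * h = t by rewrite mulrC divfK// pnatr_eq0 -lt0n.
have st : (s < t) = (c < N)%N.
  apply/idP/idP => [st|cN].
    rewrite -(ltr_nat R); apply: le_lt_trans c1 _.
    by rewrite ltr_pdivrMr// tN.
  have : s / h < N%:R by apply: lt_le_trans c2 _; rewrite ler_nat.
  by rewrite ltr_pdivrMr// tN.
have [] := @cell_facts N q p c _ qp qN; first by rewrite qc cp.
rewrite -st; set c' := if _ then _ else _ => h1 h2 h3 h4.
split; first by split => //= ne; exact: h2 (cl ne).
by rewrite /tm /= h4 addrC subrK.
Qed.

(** Two different node numbers share a mesh index only if they are N and N.+1, and both cannot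
    occur: N forces p = N, which puts N.+1 out of range. *)
Lemma pt_order q p x y : pt q p x -> pt q p y -> tm y <= tm x -> (y.1 <= x.1)%N.
Proof.
case: x y => [j l] [k u] [/= jr l01 jl jN] [/= kr u01 ku kN].
rewrite /tm /= ler_pM2r ?step_gt0// => H.
have : (mi k)%:R < (mi j).+1%:R :> R by rewrite -natr1; lra.
rewrite ltr_nat ltnS => H1.
have [//|jk] := leqP k j.
have : mi j = mi k by apply/eqP; rewrite eqn_leq H1 mi_le// ltnW.
move: jk jN kN jr kr; rewrite /mesh_index; clear.
by case: ifP => ?; case: ifP; lia.
Qed.

(** The interpolant as a list of weighted nodes: estimates on either triangle of a cell become
    statements on convex combinations. *)
Definition inodes (x y : nat * R) : seq (R * (nat * nat)) :=
  let: (j, l) := x in let: (k, u) := y in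
  if u <= l then [:: (1 - l, (j, k)); (l - u, (j.+1, k)); (u, (j.+1, k.+1))]
  else [:: (1 - u, (j, k)); (u - l, (j, k.+1)); (l, (j.+1, k.+1))].

Lemma interpE g x y :
  interp g x y = \sum_(n <- inodes x y) n.1%:C%C *: g n.2.1 n.2.2 :> M.
Proof.
by case: x y => [j l] [k u]; rewrite /interp /inodes; case: ifP => _;
  rewrite !big_cons big_nil /= addr0 addrA.
Qed.

(** Nodes of zero weight are exempt, because at a mesh point the formula mentions neighbours that
    may lie outside the mesh. Interpolation enlarges the gap of a pair by at most h. *)
Definition good_pair (q p : nat) (x y : nat * R) : Prop :=
  \sum_(n <- inodes x y) n.1 = 1 /\
  forall n, n \in inodes x y -> 0 <= n.1 /\
    (n.1 != 0 -> (q <= n.2.2)%N /\ (n.2.2 <= n.2.1 <= p)%N /\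
       ((mi n.2.1)%:R - (mi n.2.2)%:R) * h <= tm x - tm y + h).

Lemma pt_good q p x y : pt q p x -> pt q p y -> tm y <= tm x -> good_pair q p x y.
Proof.
move=> px py yx; have kj := pt_order px py yx.
case: x y kj px py yx => [j l] [k u] /= kj [/= jr l01 jl jN] [/= kr u01 ku kN].
rewrite /tm /= ler_pM2r ?step_gt0// => H.
have h0 := step_gt0.
have gap a b : a <= b + 1 -> a * h <= b * h + h.
  by move=> ab; rewrite -[in X in _ + X](mul1r h) -mulrDl ler_pM2r.
have mj : l != 0 -> (mi j.+1)%:R = (mi j)%:R + 1 :> R.
  by move=> /jl[_ ?]; rewrite miS// -natr1.
have mk : u != 0 -> (mi k.+1)%:R = (mi k)%:R + 1 :> R.
  by move=> /ku[_ ?]; rewrite miS// -natr1.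
have [qk kp] := andP kr; have [qj jp] := andP jr.
(* With equal cells, l < u would put x before y. Hence the node (j, k.+1) still lies on or below the
   diagonal. *)
have kjS : l < u -> (k < j)%N.
  move=> lu; rewrite ltn_neqAle kj andbT; apply: contraTneq lu => e.
  by rewrite -leNgt; move: H; rewrite e; lra.
have qk1 := leqW qk; have kj1 := leqW kj.
rewrite /good_pair /inodes /tm /=; case: ifP => ul; split;
  try by rewrite !big_cons big_nil /=; ring.
- move=> n; rewrite !inE -mulrBl => /or3P[] /eqP -> /=.
  + split=> [|_]; first by lra.
    by rewrite qk kj jp; do 2 (split=> //); apply: gap; lra.
  + split=> [|ne]; first by lra.
    have l0 : l != 0 by apply: contra_neq ne => l0; lra.
    have [jp1 _] := jl l0.
    by rewrite qk kj1 jp1; do 2 (split=> //); apply: gap; rewrite mj//; lra.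
  + split=> [|ne]; first by lra.
    have u0 : u != 0 by [].
    have l0 : l != 0 by apply: contra_neq ne => l0; lra.
    have [jp1 _] := jl l0; have [_ _] := ku u0.
    by rewrite qk1 ltnS kj jp1; do 2 (split=> //); apply: gap; rewrite mj// mk//; lra.
- have {}ul : l < u by rewrite ltNge ul.
  have kj' := kjS ul.
  have u0 : u != 0 by rewrite gt_eqF//; lra.
  have [_ _] := ku u0.
  move=> n; rewrite !inE -mulrBl => /or3P[] /eqP -> /=.
  + split=> [|_]; first by lra.
    by rewrite qk kj jp; do 2 (split=> //); apply: gap; lra.
  + split=> [|ne]; first by lra.
    by rewrite qk1 kj' jp; do 2 (split=> //); apply: gap; rewrite mk//; lra.
  + split=> [|ne]; first by lra.
    have [jp1 _] := jl ne.
    by rewrite qk1 ltnS kj jp1; do 2 (split=> //); apply: gap; rewrite mj// mk//; lra.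
Qed.

(* [all_adj P x s y]: P holds for (s_1, x), (s_2, s_1), ..., (y, s_M), the pairs
   of arguments of the propagators in [chain]. *)
Fixpoint all_adj (T : Type) (P : T -> T -> Prop) (x : T) (s : seq T) (y : T) : Prop :=
  if s is s1 :: s' then P s1 x /\ all_adj P s1 s' y else P y x.

Lemma all_adj_mesh q p s : (q <= p)%N -> q <> N ->
  path <=%R (node_time D N q) (rcons s (node_time D N p)) ->
  all_adj (good_pair q p) (q, 0) [seq locate D N p r | r <- s] (p, 0).
Proof.
move=> qp qN H.
have pq : pt q p (q, 0) by apply: pt_node; [rewrite leqnn|].
have pp : pt q p (p, 0) by apply: pt_node; rewrite ?qp ?leqnn.
have tq : node_time D N q <= tm (q, 0) by rewrite tm_node.
rewrite -(tm_node q) in H; elim: s (q, 0) pq tq H => [|r s ih] x px qx /=.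
  by rewrite andbT => H; apply: pt_good; rewrite // tm_node.
move=> /andP[xr H].
have rp : r <= node_time D N p.
  by have /allP := order_path_min le_trans H; apply; rewrite mem_rcons mem_head.
have [pr tr] : pt q p (locate D N p r) /\ tm (locate D N p r) = r.
  by apply: pt_locate => //; rewrite rp (le_trans qx xr).
split; first by apply: pt_good; rewrite // tr.
by apply: ih; rewrite ?tr// (le_trans qx).
Qed.

Lemma good_interp_congr q p g g' x y : good_pair q p x y ->
  (forall j k, (q <= k)%N -> (k <= j <= p)%N -> g j k = g' j k :> M) ->
  interp g x y = interp g' x y.
Proof.
move=> [_ gp] gg; rewrite !interpE big_seq [RHS]big_seq; apply: eq_bigr => n nn.
have [_ H] := gp n nn; have [->|ne] := eqVneq n.1 0; first by rewrite !scale0r.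
by have [? [? _]] := H ne; rewrite gg.
Qed.

Lemma good_interp_le q p g x y G : good_pair q p x y ->
  (forall j k, (q <= k)%N -> (k <= j <= p)%N -> frobenius (g j k : M) <= G) ->
  frobenius (interp g x y) <= G.
Proof.
move=> [s1 gp] gG; rewrite interpE; apply: le_trans (fro_sum _ _ _) _.
rewrite -[leRHS]mul1r -s1 mulr_suml big_seq [leRHS]big_seq; apply: ler_sum => n nn.
have [n0 H] := gp n nn; rewrite froZr ger0_norm//.
have [->|ne] := eqVneq n.1 0; first by rewrite !mul0r.
by have [? [? _]] := H ne; rewrite ler_wpM2l// gG.
Qed.

Lemma chain_congr (Pt : Type) (P : Pt -> Pt -> Prop) (G G' : Pt -> Pt -> M) x s y :
  all_adj P x s y -> (forall a b, P a b -> G a b = G' a b) ->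
  chain D G x s y = chain D G' x s y.
Proof.
move=> H GG; elim: s x H => [|r s ih] x /=; first by move=> ?; rewrite GG.
by move=> [? ?]; rewrite ih// GG.
Qed.

Lemma chain_le (Pt : Type) (P : Pt -> Pt -> Prop) (G : Pt -> Pt -> M) x s y (c w : R) :
  frobenius (Ws D) <= w ->
  all_adj P x s y -> (forall a b, P a b -> frobenius (G a b) <= c) ->
  frobenius (chain D G x s y) <= (w * c) ^+ (size s).+1.
Proof.
move=> Ww H Gc; have w0 : 0 <= w by exact: le_trans (fro_ge0 _) Ww.
have st a b : P a b -> frobenius (Ws D *m G a b) <= w * c.
  by move=> /Gc ?; apply: le_trans (froM _ _) _; apply: ler_pM; rewrite ?fro_ge0.
elim: s x H => [|r s ih] x /=; first by rewrite expr1; exact: st.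
move=> [/st h1 /ih h2]; apply: le_trans (froM _ _) _; rewrite exprSr.
by apply: ler_pM; rewrite ?fro_ge0.
Qed.

End MeshGeometry.

(** * Random matrices *)

Section MatrixL2.
Context d (T : measurableType d) (R : realType).
Local Notation M := 'M[R[i]]_2.
Implicit Types f g : T -> M.

Definition mbm f := forall k, bm (fun x => co k (f x)).

Lemma mbm_cst A : mbm (fun _ => A). Proof. by move=> k; exact: bm_cst. Qed.

Lemma mbmD f g : mbm f -> mbm g -> mbm (fun x => f x + g x).
Proof.
move=> bf bg k; rewrite (_ : (fun _ => _) = (fun x => co k (f x) + co k (g x))); first exact: bmD.
by apply/funext => x; rewrite coD.
Qed.

Lemma mbmN f : mbm f -> mbm (fun x => - f x).
Proof.
move=> bf k; rewrite (_ : (fun _ => _) = (fun x => - co k (f x))); first exact: bmN.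
by apply/funext => x; rewrite coN.
Qed.

Lemma mbmB f g : mbm f -> mbm g -> mbm (fun x => f x - g x).
Proof. by move=> bf bg; apply: mbmD => //; exact: mbmN. Qed.

Lemma coM k (A B : M) : co k (A *m B) = \sum_l
  (if k.1 then co (true, (k.2.1, l)) A * co (true, (l, k.2.2)) B
             - co (false, (k.2.1, l)) A * co (false, (l, k.2.2)) B
          else co (true, (k.2.1, l)) A * co (false, (l, k.2.2)) B
             + co (false, (k.2.1, l)) A * co (true, (l, k.2.2)) B).
Proof.
case: k => b [i j]; rewrite /co /= !mxE !big_ord_recl !big_ord0 !addr0.
by case: b => /=; case: (A i _) (B _ j) (A i _) (B _ j) => [? ?] [? ?] [? ?] [? ?].
Qed.

Lemma mbmM f g : mbm f -> mbm g -> mbm (fun x => f x *m g x).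
Proof.
move=> bf bg k; rewrite (_ : (fun _ => _) = (fun x => \sum_l
  (if k.1 then co (true, (k.2.1, l)) (f x) * co (true, (l, k.2.2)) (g x)
             - co (false, (k.2.1, l)) (f x) * co (false, (l, k.2.2)) (g x)
          else co (true, (k.2.1, l)) (f x) * co (false, (l, k.2.2)) (g x)
             + co (false, (k.2.1, l)) (f x) * co (true, (l, k.2.2)) (g x)))); last first.
  by apply/funext => x; rewrite coM.
apply: bm_sum => l _; case: k.1; first by apply: bmB; apply: bmM.
by apply: bmD; apply: bmM.
Qed.

Lemma mbmZ (c : R[i]) f : mbm f -> mbm (fun x => c *: f x).
Proof.
move=> bf; rewrite (_ : (fun _ => _) = (fun x => (c%:M : M) *m f x)).
  by apply: mbmM => //; exact: mbm_cst.
by apply/funext => x; rewrite mul_scalar_mx.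
Qed.

Lemma mbm_sum (I : eqType) (r : seq I) (F : I -> T -> M) :
  (forall i, i \in r -> mbm (F i)) -> mbm (fun x => \sum_(i <- r) F i x).
Proof.
move=> h k; rewrite (_ : (fun _ => _) = (fun x => \sum_(i <- r) co k (F i x))).
  by apply: bm_sum => i ir; exact: h.
by apply/funext => x; rewrite co_sum.
Qed.

Lemma bm_ip f g : mbm f -> mbm g -> bm (fun x => ip (f x) (g x)).
Proof. by move=> bf bg; apply: bm_sum => k _; apply: bmM. Qed.

Lemma mbm_bound f c : (forall k, measurable_fun setT (fun x => co k (f x))) ->
  (forall x, frobenius (f x) <= c) -> mbm f.
Proof.
by move=> mf fc k; split => //; exists c => x; exact: le_trans (co_le_fro _ _) (fc x).
Qed.

Variable mu : probability T R.

Definition nrm2 f := Num.sqrt (Ex mu (fun x => ip (f x) (f x))).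

Definition Em f : M := mx_integral mu setT f.

Lemma co_Em k f : co k (Em f) = Ex mu (fun x => co k (f x)).
Proof. by rewrite /Em /mx_integral /co /Ex; case: k => -[] [i j] /=; rewrite mxE. Qed.

Lemma nrm2_ge0 f : 0 <= nrm2 f. Proof. exact: sqrtr_ge0. Qed.

Lemma nrm2_sqr f : nrm2 f ^+ 2 = Ex mu (fun x => ip (f x) (f x)).
Proof. by rewrite sqr_sqrtr// Ex_ge0// => x; exact: ip_ge0. Qed.

Lemma nrm2_lc (a b : R) f g : mbm f -> mbm g ->
  Ex mu (fun x => ip (a%:C%C *: f x + b%:C%C *: g x) (a%:C%C *: f x + b%:C%C *: g x)) =
  a ^+ 2 * nrm2 f ^+ 2 + 2 * (a * b) * Ex mu (fun x => ip (f x) (g x)) + b ^+ 2 * nrm2 g ^+ 2.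
Proof.
move=> bf bg; have bff := bm_ip bf bf; have bfg := bm_ip bf bg; have bgg := bm_ip bg bg.
rewrite !nrm2_sqr -!ExZ// -!ExD; try by [apply: bmM => //; exact: bm_cst
  |apply: bmD; apply: bmM => //; exact: bm_cst].
congr (Ex mu _); apply/funext => x.
by rewrite !ipDl !ipDr !ipZl !ipZr (ipC (g x) (f x)); ring.
Qed.

Lemma Ex_ip_le f g : mbm f -> mbm g -> Ex mu (fun x => ip (f x) (g x)) <= nrm2 f * nrm2 g.
Proof.
move=> bf bg; set c := Ex _ _; set a := nrm2 f; set b := nrm2 g.
have a0 : 0 <= a by exact: nrm2_ge0.
have b0 : 0 <= b by exact: nrm2_ge0.
have H u v : 0 <= u ^+ 2 * a ^+ 2 + 2 * (u * v) * c + v ^+ 2 * b ^+ 2.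
  by rewrite -nrm2_lc//; apply: Ex_ge0 => x; exact: ip_ge0.
rewrite leNgt; apply/negP => abc.
have c0 : 0 < c by apply: le_lt_trans abc; rewrite mulr_ge0.
(* For a vanishing norm the quadratic form is affine in one variable, and the chosen value makes it
   negative; otherwise (b, - a) is the minimising direction. *)
have [az|az] := eqVneq a 0.
  have := H ((b ^+ 2 + 1) / c) (-1); rewrite az (_ : 2 * _ * c = - (2 * (b ^+ 2 + 1))); last by field; lra.
  by have := sqr_ge0 b; nra.
have [bz|bz] := eqVneq b 0.
  have := H (-1) ((a ^+ 2 + 1) / c); rewrite bz (_ : 2 * _ * c = - (2 * (a ^+ 2 + 1))); last by field; lra.
  by have := sqr_ge0 a; nra.
have ab : 0 < a * b by rewrite mulr_gt0// lt_neqAle eq_sym ?az ?bz.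
by have := H b (- a); nra.
Qed.

Lemma nrm2D f g : mbm f -> mbm g -> nrm2 (fun x => f x + g x) <= nrm2 f + nrm2 g.
Proof.
move=> bf bg; rewrite -(ler_pXn2r (_ : 0 < 2)%N) ?nnegrE ?addr_ge0 ?nrm2_ge0// nrm2_sqr.
have := nrm2_lc 1 1 bf bg.
rewrite (_ : (fun _ => _) = (fun x => ip (f x + g x) (f x + g x))); last first.
  by apply/funext => x; rewrite !scale1r.
by move=> ->; have := Ex_ip_le bf bg; nra.
Qed.

Lemma Ex_ip_cross f g : mbm f -> mbm g -> Ex mu (fun x => ip (f x) (g x)) = 0 ->
  nrm2 (fun x => f x + g x) ^+ 2 = nrm2 f ^+ 2 + nrm2 g ^+ 2.
Proof.
move=> bf bg fg0; rewrite nrm2_sqr.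
have := nrm2_lc 1 1 bf bg.
rewrite (_ : (fun _ => _) = (fun x => ip (f x + g x) (f x + g x))); last first.
  by apply/funext => x; rewrite !scale1r.
by move=> ->; rewrite fg0; ring.
Qed.

Lemma nrm2_le_ae f g c : 0 <= c -> mbm f -> mbm g ->
  {ae mu, forall x, frobenius (f x) <= c * frobenius (g x)} -> nrm2 f <= c * nrm2 g.
Proof.
move=> c0 bf bg fg; rewrite -(ler_pXn2r (_ : 0 < 2)%N) ?nnegrE ?mulr_ge0 ?nrm2_ge0//.
rewrite exprMn !nrm2_sqr -ExZ; last exact: bm_ip.
apply: Ex_ae_le; [exact: bm_ip|by apply: bmM; [exact: bm_cst|exact: bm_ip]|].
apply: filterS fg => x fgx; rewrite -!fro_sqr -exprMn.
by rewrite ler_pXn2r ?nnegrE ?mulr_ge0 ?fro_ge0.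
Qed.

Lemma nrm2_le f g c : 0 <= c -> mbm f -> mbm g ->
  (forall x, frobenius (f x) <= c * frobenius (g x)) -> nrm2 f <= c * nrm2 g.
Proof. by move=> c0 bf bg fg; apply: nrm2_le_ae => //; exact: aeW. Qed.

Lemma nrm2_bound f c : 0 <= c -> mbm f -> {ae mu, forall x, frobenius (f x) <= c} -> nrm2 f <= c.
Proof.
move=> c0 bf fc; rewrite -(ler_pXn2r (_ : 0 < 2)%N) ?nnegrE ?nrm2_ge0//.
rewrite nrm2_sqr -(Ex_cst mu (c ^+ 2)); apply: Ex_ae_le; [exact: bm_ip|exact: bm_cst|].
by apply: filterS fc => x fcx; rewrite -fro_sqr ler_pXn2r ?nnegrE ?fro_ge0.
Qed.

Lemma nrm2_eq0 : nrm2 (fun=> 0) = 0.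
Proof.
rewrite /nrm2 (_ : (fun _ => _) = (fun=> 0)) ?Ex_cst ?sqrtr0//.
by apply/funext => x; rewrite ip0l.
Qed.

Lemma nrm2_sum (I : eqType) (r : seq I) (F : I -> T -> M) :
  (forall i, i \in r -> mbm (F i)) ->
  nrm2 (fun x => \sum_(i <- r) F i x) <= \sum_(i <- r) nrm2 (F i).
Proof.
elim: r => [|i r ih] h.
  rewrite big_nil (_ : (fun _ => _) = (fun=> 0)) ?nrm2_eq0//.
  by apply/funext => x; rewrite big_nil.
have hr j : j \in r -> mbm (F j) by move=> jr; apply: h; rewrite in_cons jr orbT.
have hi : mbm (F i) by apply: h; rewrite mem_head.
rewrite big_cons (_ : (fun _ => _) = (fun x => F i x + \sum_(j <- r) F j x)); last first.
  by apply/funext => x; rewrite big_cons.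
apply: le_trans (nrm2D hi (mbm_sum hr)) _.
by rewrite lerD2l ih.
Qed.

Lemma nrm2Z (c : R[i]) f : mbm f -> nrm2 (fun x => c *: f x) <= Normc.normc c * nrm2 f.
Proof.
move=> bf; apply: nrm2_le => //; [exact: normc_ge0|exact: mbmZ|].
by move=> x; rewrite froZ.
Qed.

Lemma nrm2Ml f g c : 0 <= c -> mbm f -> mbm g -> {ae mu, forall x, frobenius (f x) <= c} ->
  nrm2 (fun x => f x *m g x) <= c * nrm2 g.
Proof.
move=> c0 bf bg fc; apply: nrm2_le_ae => //; first exact: mbmM.
apply: filterS fc => x fcx; apply: le_trans (froM _ _) _.
by rewrite ler_wpM2r ?fro_ge0.
Qed.

Lemma nrm2Mr f g c : 0 <= c -> mbm f -> mbm g -> {ae mu, forall x, frobenius (f x) <= c} ->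
  nrm2 (fun x => g x *m f x) <= c * nrm2 g.
Proof.
move=> c0 bf bg fc; apply: nrm2_le_ae => //; first exact: mbmM.
apply: filterS fc => x fcx; apply: le_trans (froM _ _) _.
by rewrite mulrC ler_wpM2r ?fro_ge0.
Qed.

Lemma EmD f g : mbm f -> mbm g -> Em (fun x => f x + g x) = Em f + Em g.
Proof.
move=> bf bg; apply: mx_co => k; rewrite coD !co_Em -ExD//.
by congr (Ex mu _); apply/funext => x; rewrite coD.
Qed.

Lemma Em_cst A : Em (fun=> A) = A.
Proof. by apply: mx_co => k; rewrite co_Em Ex_cst. Qed.

Lemma EmN f : mbm f -> Em (fun x => - f x) = - Em f.
Proof.
move=> bf; apply: mx_co => k; rewrite coN !co_Em -ExN//.
by congr (Ex mu _); apply/funext => x; rewrite coN.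
Qed.

Lemma EmB f g : mbm f -> mbm g -> Em (fun x => f x - g x) = Em f - Em g.
Proof. by move=> bf bg; rewrite EmD ?EmN//; exact: mbmN. Qed.

Lemma Em_sum (I : eqType) (r : seq I) (F : I -> T -> M) :
  (forall i, i \in r -> mbm (F i)) -> Em (fun x => \sum_(i <- r) F i x) = \sum_(i <- r) Em (F i).
Proof.
move=> h; apply: mx_co => k; rewrite co_sum co_Em.
rewrite (_ : (fun _ => _) = (fun x => \sum_(i <- r) co k (F i x))); last first.
  by apply/funext => x; rewrite co_sum.
rewrite Ex_sum; last by move=> i ir; exact: h.
by apply: eq_bigr => i _; rewrite co_Em.
Qed.

Lemma EmMl A f : mbm f -> Em (fun x => A *m f x) = A *m Em f.
Proof.
move=> bf; apply: mx_co => k; rewrite co_Em coM.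
rewrite (_ : (fun _ => _) = (fun x => \sum_l
  (if k.1 then co (true, (k.2.1, l)) A * co (true, (l, k.2.2)) (f x)
             - co (false, (k.2.1, l)) A * co (false, (l, k.2.2)) (f x)
          else co (true, (k.2.1, l)) A * co (false, (l, k.2.2)) (f x)
             + co (false, (k.2.1, l)) A * co (true, (l, k.2.2)) (f x)))); last first.
  by apply/funext => x; rewrite coM.
have bc c k' : bm (fun x => c * co k' (f x)) by apply: bmM => //; exact: bm_cst.
rewrite Ex_sum; last by move=> l _; case: k.1; [exact: bmB|exact: bmD].
apply: eq_bigr => l _; rewrite !co_Em -!ExZ//.
by case: k.1; rewrite ?ExB ?ExD.
Qed.

Lemma EmMr A f : mbm f -> Em (fun x => f x *m A) = Em f *m A.
Proof.
move=> bf; apply: mx_co => k; rewrite co_Em coM.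
rewrite (_ : (fun _ => _) = (fun x => \sum_l
  (if k.1 then co (true, (l, k.2.2)) A * co (true, (k.2.1, l)) (f x)
             - co (false, (l, k.2.2)) A * co (false, (k.2.1, l)) (f x)
          else co (false, (l, k.2.2)) A * co (true, (k.2.1, l)) (f x)
             + co (true, (l, k.2.2)) A * co (false, (k.2.1, l)) (f x)))); last first.
  apply/funext => x; rewrite coM; apply: eq_bigr => l _.
  by case: k.1; rewrite !(mulrC (co _ (f x))).
have bc c k' : bm (fun x => c * co k' (f x)) by apply: bmM => //; exact: bm_cst.
rewrite Ex_sum; last by move=> l _; case: k.1; [exact: bmB|exact: bmD].
apply: eq_bigr => l _; rewrite !co_Em !(mulrC (Ex _ _)) -!ExZ//.
by case: k.1; rewrite ?ExB ?ExD.
Qed.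

Lemma EmZ (c : R[i]) f : mbm f -> Em (fun x => c *: f x) = c *: Em f.
Proof.
move=> bf; rewrite -mul_scalar_mx -EmMl//; congr (Em _).
by apply/funext => x; rewrite mul_scalar_mx.
Qed.

Lemma ip_Em f A : mbm f -> ip A (Em f) = Ex mu (fun x => ip A (f x)).
Proof.
move=> bf; rewrite /ip Ex_sum; last by move=> k _; apply: bmM => //; exact: bm_cst.
by apply: eq_bigr => k _; rewrite co_Em ExZ.
Qed.

Lemma nrm2_cst A : nrm2 (fun=> A) = frobenius A.
Proof. by rewrite /nrm2 Ex_cst froE. Qed.

Lemma fro_Em_le f : mbm f -> frobenius (Em f) <= nrm2 f.
Proof.
move=> bf; have [->|e0] := eqVneq (frobenius (Em f)) 0; first exact: nrm2_ge0.
have ep : 0 < frobenius (Em f) by rewrite lt_neqAle eq_sym e0 fro_ge0.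
rewrite -(ler_pM2l ep) -expr2 fro_sqr ip_Em// -[in leRHS](nrm2_cst (Em f)).
by apply: Ex_ip_le => //; exact: mbm_cst.
Qed.

End MatrixL2.

(** * Minkowski's integral inequality *)

Section MinkowskiIntegral.
Context d1 d2 (T1 : measurableType d1) (T2 : measurableType d2) (R : realType).
Local Notation M := 'M[R[i]]_2.
Variables (m1 : probability T1 R) (m2 : probability T2 R).
Implicit Types f : T1 -> T2 -> M.

Definition mbm2 f := mbm (fun z : T1 * T2 => f z.1 z.2).

Lemma mbm2_r f x : mbm2 f -> mbm (f x).
Proof. by move=> bf k; exact: (@bm2_r _ _ _ _ _ (fun x y => co k (f x y)) x (bf k)). Qed.

Lemma mbm2_l f y : mbm2 f -> mbm (f ^~ y).
Proof. by move=> bf k; exact: (@bm2_l _ _ _ _ _ (fun x y => co k (f x y)) y (bf k)). Qed.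

Lemma mbm_Em2 f : mbm2 f -> mbm (fun x => Em m2 (f x)).
Proof.
move=> bf k; rewrite (_ : (fun _ => _) = (fun x => Ex m2 (fun y => co k (f x y)))).
  exact: (@bm_Ex2 _ _ _ _ _ m1 m2 (fun x y => co k (f x y)) (bf k)).
by apply/funext => x; rewrite co_Em.
Qed.

Lemma mbm2_fst (f : T1 -> M) : mbm f -> mbm2 (fun x _ => f x).
Proof.
move=> bf k; have [m [c fc]] := bf k; split; last by exists c => z; exact: fc.
exact: (measurableT_comp m measurable_fst).
Qed.

Lemma Em_fubini f : mbm2 f -> Em m1 (fun x => Em m2 (f x)) = Em m2 (fun y => Em m1 (f ^~ y)).
Proof.
move=> bf; apply: mx_co => k; rewrite !co_Em.
transitivity (Ex m1 (fun x => Ex m2 (fun y => co k (f x y)))).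
  by congr (Ex m1 _); apply/funext => x; rewrite co_Em.
rewrite (@Ex_fubini _ _ _ _ _ m1 m2 (fun x y => co k (f x y)) (bf k)).
by congr (Ex m2 _); apply/funext => x; rewrite co_Em.
Qed.

(** Duality: test the average g against itself, exchange the integrals, and apply Cauchy-Schwarz at
    fixed y. A random sample may thus be frozen while the error is measured in mean square. *)
Lemma nrm2_Em_le f (b : T2 -> R) : mbm2 f -> bm b -> (forall y, nrm2 m1 (f ^~ y) <= b y) ->
  nrm2 m1 (fun x => Em m2 (f x)) <= Ex m2 b.
Proof.
move=> bf bb fb; set g := fun x => Em m2 (f x).
have bg : mbm g by exact: mbm_Em2.
have [->|e0] := eqVneq (nrm2 m1 g) 0.
  by apply: Ex_ge0 => y; apply: le_trans (fb y); exact: nrm2_ge0.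
have ep : 0 < nrm2 m1 g by rewrite lt_neqAle eq_sym e0 nrm2_ge0.
have b2 : mbm2 (fun x _ => g x) by exact: mbm2_fst.
have bip : bm2 (fun x y => ip (g x) (f x y)) by exact: (bm_ip b2 bf).
rewrite -(ler_pM2l ep) -expr2 nrm2_sqr.
rewrite (_ : (fun _ => _) = (fun x => Ex m2 (fun y => ip (g x) (f x y)))); last first.
  by apply/funext => x; rewrite -ip_Em//; exact: mbm2_r.
rewrite Ex_fubini// -ExZ//; apply: Ex_le; [exact: bm_Ex1|by apply: bmM => //; exact: bm_cst|].
move=> y; apply: le_trans (Ex_ip_le _ bg (mbm2_l _ bf)) _.
by rewrite ler_pM2l.
Qed.

End MinkowskiIntegral.

(** * Measurable families of matrices *)

Section MatrixMeasurability.
Context d (U : measurableType d) (R : realType).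
Local Notation M := 'M[R[i]]_2.
Implicit Types f g : U -> M.

Definition mmeas f := forall k, measurable_fun setT (fun x => co k (f x)).

Lemma mmeas_cst A : mmeas (fun=> A). Proof. by move=> k; exact: measurable_cst. Qed.

Lemma mmeasD f g : mmeas f -> mmeas g -> mmeas (fun x => f x + g x).
Proof.
move=> mf mg k; rewrite (_ : (fun _ => _) = (fun x => co k (f x) + co k (g x))).
  exact: measurable_funD.
by apply/funext => x; rewrite coD.
Qed.

Lemma mmeasM f g : mmeas f -> mmeas g -> mmeas (fun x => f x *m g x).
Proof.
move=> bf bg k; rewrite (_ : (fun _ => _) = (fun x => \sum_l
  (if k.1 then co (true, (k.2.1, l)) (f x) * co (true, (l, k.2.2)) (g x)
             - co (false, (k.2.1, l)) (f x) * co (false, (l, k.2.2)) (g x)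
          else co (true, (k.2.1, l)) (f x) * co (false, (l, k.2.2)) (g x)
             + co (false, (k.2.1, l)) (f x) * co (true, (l, k.2.2)) (g x)))); last first.
  by apply/funext => x; rewrite coM.
apply: measurable_sum => l; case: k.1.
  by apply: measurable_funB; apply: measurable_funM.
by apply: measurable_funD; apply: measurable_funM.
Qed.

Lemma mmeas_sum (I : Type) (r : seq I) (F : I -> U -> M) :
  (forall i, mmeas (F i)) -> mmeas (fun x => \sum_(i <- r) F i x).
Proof.
move=> h; elim: r => [|i r ih].
  rewrite (_ : (fun _ => _) = (fun=> 0)); first exact: mmeas_cst.
  by apply/funext => x; rewrite big_nil.
rewrite (_ : (fun _ => _) = (fun x => F i x + \sum_(j <- r) F j x)); first exact: mmeasD.
by apply/funext => x; rewrite big_cons.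
Qed.

Lemma mmeas_if (b : U -> bool) f g : measurable_fun setT b -> mmeas f -> mmeas g ->
  mmeas (fun x => if b x then f x else g x).
Proof.
move=> mb mf mg k; rewrite (_ : (fun _ => _) = (fun x => if b x then co k (f x) else co k (g x))).
  exact: measurable_fun_ifT.
by apply/funext => x; case: (b x).
Qed.

Lemma mmeas_real (f : U -> R) : measurable_fun setT f -> mmeas (fun x => (f x)%:C%C%:M).
Proof.
move=> mf k; rewrite (_ : (fun _ => _) = (fun x => f x * co k (1%:M : M))).
  by apply: measurable_funM => //; exact: measurable_cst.
by apply/funext => x; rewrite -coZr scalemx1.
Qed.

Lemma mmeas_complex (f g : U -> R) : measurable_fun setT f -> measurable_fun setT g ->
  mmeas (fun x => ((f x +i* g x)%C : R[i])%:M).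
Proof.
move=> mf mg; rewrite (_ : (fun _ => _) =
   (fun x => (f x)%:C%C%:M + ('i%C : R[i])%:M *m (g x)%:C%C%:M)).
  by apply: mmeasD; [exact: mmeas_real|apply: mmeasM; [exact: mmeas_cst|exact: mmeas_real]].
apply/funext => x; rewrite -scalar_mxM -raddfD /=; congr (_%:M); apply/eqP.
by rewrite eq_complex /= !(mul0r, mul1r, mulr0, subr0, addr0, add0r) !eqxx.
Qed.

Lemma mmeasZ (c : U -> R[i]) f : mmeas (fun x => (c x)%:M) -> mmeas f -> mmeas (fun x => c x *: f x).
Proof.
move=> mc mf; rewrite (_ : (fun _ => _) = (fun x => (c x)%:M *m f x)); first exact: mmeasM.
by apply/funext => x; rewrite mul_scalar_mx.
Qed.

(** Needed because the interpolation cell is itself a function of the sample. *)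
Lemma mmeas_index (c : U -> nat) (F : nat -> U -> M) : measurable_fun setT c ->
  (forall n, mmeas (F n)) -> mmeas (fun x => F (c x) x).
Proof.
move=> mc mF k _ B mB; rewrite setTI.
rewrite (_ : _ @^-1` B = \bigcup_n ((c @^-1` [set n]) `&` ((fun x => co k (F n x)) @^-1` B))).
  apply: bigcupT_measurable => n; apply: measurableI.
    by rewrite -[X in measurable X]setTI; exact: mc.
  by rewrite -[X in measurable X]setTI; exact: mF.
by apply/seteqP; split=> [x Bx|x [n _ [/= <-]]] //=; exists (c x).
Qed.

Lemma measurable_truncn (f : U -> R) : measurable_fun setT f ->
  measurable_fun setT (fun x => Num.truncn (f x)).
Proof.
move=> mf _ B _; rewrite setTI.
rewrite (_ : _ @^-1` B = \bigcup_(n in B) ((fun x => Num.truncn (f x) == n) @^-1` [set true])); last first.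
  apply/seteqP; split=> [x Bx|x [n Bn /= /eqP e]] /=; last by rewrite e.
  by exists (Num.truncn (f x)); rewrite //= eqxx.
rewrite bigcup_mkcond; apply: bigcupT_measurable => n; case: ifP => _; last exact: measurable0.
rewrite (_ : (fun x => _) = (fun x => ((n == 0%N) || (n%:R <= f x)) && (f x < n.+1%:R))); last first.
  apply/funext => x; have [f0|f0] := leP 0 (f x).
    by rewrite truncn_eq//; case: n => [|n] //=; rewrite ?mulr0n f0.
  rewrite (_ : Num.truncn (f x) = 0)%N; last by apply/truncn0Pn; rewrite -ltNge; lra.
  case: n => [|n]; first by rewrite eqxx /=; apply/esym; lra.
  have : 0 <= n.+1%:R :> R by [].
  by rewrite /= => ?; apply/esym/negP => /andP[? _]; lra.
rewrite -[X in measurable X]setTI.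
suff : measurable_fun setT (fun x => ((n == 0%N) || (n%:R <= f x)) && (f x < n.+1%:R)) by apply.
apply: measurable_and; last by apply: measurable_fun_ltr => //; exact: measurable_cst.
by apply: measurable_or; [exact: measurable_cst|apply: measurable_fun_ler => //; exact: measurable_cst].
Qed.

End MatrixMeasurability.

Lemma path_rcons_le (R : realType) (x y r : R) l :
  path <=%R x (rcons l y) -> r \in x :: l -> r <= y.
Proof.
elim: l x r => [|z l ih] x r /=; first by rewrite andbT inE => ? /eqP ->.
move=> /andP[xz p]; rewrite in_cons => /orP[/eqP ->|]; last exact: ih p.
by apply: le_trans xz _; apply: ih p _; rewrite mem_head.
Qed.

Lemma linked_sumE (R : realType) (B : R -> R -> R[i]) (s : seq R) n : size s = n ->
  linked_sum B s = \sum_(q : {set 'I_n * 'I_n} | pairing q && linked q)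
    \prod_(a in q) B s`_(a.2) s`_(a.1).
Proof. by move=> <-. Qed.

(** * Measurability of the integrand *)

Section MeshTermMeasurability.
Context d (U : measurableType d) (R : realType) (D : model R) (N : nat).
Hypotheses (t_gt0 : 0 < horizon D) (N_gt0 : (0 < N)%N) (B_meas : measurable_corr D).
Local Notation t := (horizon D).
Local Notation h := (t / N%:R).
Local Notation M := 'M[R[i]]_2.

Lemma measurable_triangle : measurable (triangle D).
Proof.
rewrite (_ : triangle D = (fun x : R * R => [&& 0 <= x.2, x.2 <= x.1 & x.1 <= 2 * t]) @^-1` [set true]).
  rewrite -[X in measurable X]setTI.
  suff : measurable_fun setT (fun x : R * R => [&& 0 <= x.2, x.2 <= x.1 & x.1 <= 2 * t]) by apply.
  have m1 : measurable_fun setT (fst : R * R -> R) by exact: measurable_fst.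
  have m2 : measurable_fun setT (snd : R * R -> R) by exact: measurable_snd.
  apply: measurable_and; first by apply: measurable_fun_ler => //; exact: measurable_cst.
  by apply: measurable_and; apply: measurable_fun_ler => //; exact: measurable_cst.
by apply/seteqP; split=> x /=; [move=> [-> -> ->]|move=> /and3P[]].
Qed.

Lemma mmeas_corr (f g : U -> R) : measurable_fun setT f -> measurable_fun setT g ->
  (forall u, 0 <= g u) -> (forall u, g u <= f u) -> (forall u, f u <= 2 * t) ->
  mmeas (fun u => (corr D (f u) (g u))%:M : M).
Proof.
move=> mf mg g0 gf ft; have [mr mi_] := B_meas.
have mp : measurable_fun setT (fun u => (f u, g u)) by exact: measurable_fun_pair.
have sub : (fun u => (f u, g u)) @` setT `<=` triangle D.
  by move=> _ [u _ <-]; split => /=.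
have h1 := measurable_comp measurable_triangle sub mr mp.
have h2 := measurable_comp measurable_triangle sub mi_ mp.
have := mmeas_complex h1 h2.
rewrite (_ : (fun _ => _) = (fun u => (corr D (f u) (g u))%:M))//.
by apply/funext => u /=; case: (corr D _ _).
Qed.

Lemma mmeas_linked_sum (ls : seq (U -> R)) : mseq ls ->
  (forall u, path <=%R 0 (evs ls u)) -> (forall u, all (fun r => r <= 2 * t) (evs ls u)) ->
  mmeas (fun u => (linked_sum (corr D) (evs ls u))%:M : M).
Proof.
move=> ml pl al; set n := size ls.
have sz u : size (evs ls u) = n by rewrite size_map.
have srt u : sorted <=%R (evs ls u) by exact: path_sorted (pl u).
have nb u i : (i < n)%N -> 0 <= (evs ls u)`_i <= 2 * t.
  move=> i_n; have /allP h1 := order_path_min le_trans (pl u).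
  have /allP h2 := al u; have i_in : (evs ls u)`_i \in evs ls u by rewrite mem_nth// sz.
  by rewrite h1//= h2.
rewrite (_ : (fun _ => _) = (fun u => \sum_(q <- [seq q <- index_enum {set 'I_n * 'I_n} | pairing q && linked q])
   if pairing q then \prod_(a <- enum q) ((corr D (evs ls u)`_(a.2) (evs ls u)`_(a.1))%:M : M) else 0)); last first.
  apply/funext => u; rewrite (linked_sumE _ (sz u)) raddf_sum /= big_filter.
  apply: eq_bigr => q /andP[-> _].
  rewrite -big_enum /=.
  by elim: (enum q) => [|a l ih]; rewrite ?big_nil// !big_cons -ih; exact: scalar_mxM.
apply: mmeas_sum => q; case: (boolP (pairing q)) => pq; last exact: mmeas_cst.
have : all (fun a : 'I_n * 'I_n => (a.1 < a.2)%N) (enum q).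
  apply/allP => a; rewrite mem_enum => aq.
  by move: pq => /andP[/forallP/(_ a)/implyP/(_ aq)].
elim: (enum q) => [_|a l ih /= /andP[a12 al']].
  rewrite (_ : (fun _ => _) = (fun=> 1)); first exact: mmeas_cst.
  by apply/funext => u; rewrite big_nil.
rewrite (_ : (fun _ => _) = (fun u => (corr D (evs ls u)`_(a.2) (evs ls u)`_(a.1))%:M *m
   \prod_(a <- l) ((corr D (evs ls u)`_(a.2) (evs ls u)`_(a.1))%:M : M))); last first.
  by apply/funext => u; rewrite big_cons.
apply: mmeasM; last exact: ih.
have mn i : measurable_fun setT (fun u => (evs ls u)`_i).
  by have := ml i; apply: eq_measurable_fun => u _; rewrite nth_evs.
apply: mmeas_corr => // u.
- by have /andP[] := nb u a.1 (ltn_ord _).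
- by apply: (sorted_leq_nth le_trans lexx) => //; rewrite ?inE ?sz ?ltn_ord// ltnW.
- by have /andP[] := nb u a.2 (ltn_ord _).
Qed.

Definition mpoint (x : U -> nat * R) := measurable_fun setT (fst \o x) /\ measurable_fun setT (snd \o x).

Lemma mpoint_locate p (s : U -> R) : measurable_fun setT s -> mpoint (fun u => locate D N p (s u)).
Proof.
move=> ms; have msh : measurable_fun setT (fun u => s u / h).
  by apply: measurable_funM => //; exact: measurable_cst.
have mc := measurable_truncn msh.
split; rewrite /comp /locate /=.
  apply: measurable_fun_ifT => //; last exact: (measurableT_comp (f := S)).
  by apply: measurable_or; [exact: measurable_cst|apply: measurable_fun_ltr => //; exact: measurable_cst].
apply: measurable_funB => //.
exact: (measurableT_comp (f := fun n : nat => n%:R : R)).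
Qed.

Lemma mmeas_interp (g : U -> nat -> nat -> M) x y : (forall j k, mmeas (fun u => g u j k)) ->
  mpoint x -> mpoint y -> mmeas (fun u => interp (g u) (x u) (y u)).
Proof.
move=> mg [mj ml] [mk mu].
have idx a b : mmeas (fun u => g u (a + (x u).1)%N (b + (y u).1)%N).
  apply: (mmeas_index (F := fun j u => g u (a + j)%N (b + (y u).1)%N) mj) => j.
  by apply: (mmeas_index (F := fun k u => g u (a + j)%N (b + k)%N) mk) => k.
have mr (f : U -> R) a b : measurable_fun setT f ->
    mmeas (fun u => (f u)%:C%C *: g u (a + (x u).1)%N (b + (y u).1)%N).
  by move=> mf; apply: mmeasZ => //; exact: mmeas_real.
rewrite (_ : (fun _ => _) = (fun u => if (y u).2 <= (x u).2 then
   (1 - (x u).2)%:C%C *: g u (0 + (x u).1)%N (0 + (y u).1)%N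
   + ((x u).2 - (y u).2)%:C%C *: g u (1 + (x u).1)%N (0 + (y u).1)%N
   + (y u).2%:C%C *: g u (1 + (x u).1)%N (1 + (y u).1)%N
  else (1 - (y u).2)%:C%C *: g u (0 + (x u).1)%N (0 + (y u).1)%N
   + ((y u).2 - (x u).2)%:C%C *: g u (0 + (x u).1)%N (1 + (y u).1)%N
   + (x u).2%:C%C *: g u (1 + (x u).1)%N (1 + (y u).1)%N)); last first.
  by apply/funext => u; rewrite /interp; case: (x u) (y u) => [? ?] [? ?].
have m1 := @measurable_cst _ _ U R setT 1.
apply: mmeas_if; first exact: measurable_fun_ler.
  by apply: mmeasD; [apply: mmeasD|]; apply: mr => //; exact: measurable_funB.
by apply: mmeasD; [apply: mmeasD|]; apply: mr => //; exact: measurable_funB.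
Qed.

Lemma mmeas_chain (g : U -> nat -> nat -> M) p x y (ls : seq (U -> R)) :
  (forall j k, mmeas (fun u => g u j k)) -> mseq ls -> mpoint x -> mpoint y ->
  mmeas (fun u => chain D (interp (g u)) (x u) [seq locate D N p r | r <- evs ls u] (y u)).
Proof.
move=> mg; elim: ls x => [|s ls ih] x /=.
  by move=> _ mx my; apply: mmeasM; [exact: mmeas_cst|exact: (mmeas_interp mg my mx)].
move=> /mseq_behead[ms ml] mx my.
have mls := mpoint_locate p ms.
apply: mmeasM; first exact: (ih (fun u => locate D N p (s u)) ml mls my).
by apply: mmeasM; [exact: mmeas_cst|exact: (mmeas_interp mg mls mx)].
Qed.

Lemma mmeas_mesh_term (g : U -> nat -> nat -> M) p q (ls : seq (U -> R)) :
  (q <= p)%N -> q <> N -> (p <= (2 * N).+1)%N ->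
  (forall j k, (q <= k)%N -> (k <= j <= p)%N -> mmeas (fun u => g u j k)) -> mseq ls ->
  (forall u, path <=%R (node_time D N q) (rcons (evs ls u) (node_time D N p))) ->
  mmeas (fun u => mesh_term D N p q (g u) (evs ls u)).
Proof.
move=> qp qN pN mg ml good.
(* Nodes outside this triangle are only read with weight zero; replacing their values by 0 makes all
   entries measurable. *)
pose g' u j k := if (q <= k)%N && (k <= j <= p)%N then g u j k else 0.
have mg' j k : mmeas (fun u => g' u j k).
  by rewrite /g'; case: (boolP ((q <= k)%N && (k <= j <= p)%N)) => [/andP[? ?]|_]; [exact: mg|exact: mmeas_cst].
rewrite (_ : (fun _ => _) = (fun u => mesh_term D N p q (g' u) (evs ls u))); last first.
  apply/funext => u; rewrite /mesh_term /dyson_term; congr (_ *: _).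
  apply: chain_congr (all_adj_mesh t_gt0 N_gt0 qp qN (good u)) _ => a b gab.
  by apply: good_interp_congr gab _ => j k ? ?; rewrite /g' !ifT//; apply/andP.
rewrite /mesh_term /dyson_term; apply: mmeasZ; last first.
  by apply: mmeas_chain => //; split; exact: measurable_cst.
rewrite (_ : (fun _ => _) = (fun x => ((-1) ^+ count (fun r => r < t) (evs ls x))%:M *m
    (linked_sum (corr D) (rcons (evs ls x) (node_time D N p)))%:M)); last first.
  by apply/funext => u; rewrite scalar_mxM.
apply: mmeasM.
  elim: ls ml {good} => [|s ls ih] /=; first by move=> _; exact: mmeas_cst.
  move=> /mseq_behead[ms ml].
  rewrite (_ : (fun _ => _) = (fun x => (if s x < t then (-1)%:M else 1%:M) *m
    ((-1) ^+ count (fun r => r < t) (evs ls x))%:M)); last first.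
    by apply/funext => u; rewrite exprD scalar_mxM; case: ifP; rewrite ?expr1 ?expr0.
  apply: mmeasM; last exact: ih.
  apply: mmeas_if; [|exact: mmeas_cst|exact: mmeas_cst].
  by apply: measurable_fun_ltr => //; exact: measurable_cst.
have e u : rcons (evs ls u) (node_time D N p) = evs (rcons ls (fun=> node_time D N p)) u.
  by rewrite evs_rcons.
rewrite (_ : (fun _ => _) = (fun u => (linked_sum (corr D) (evs (rcons ls (fun=> node_time D N p)) u))%:M)); last first.
  by apply/funext => u; rewrite e.
have tp : node_time D N p <= 2 * t.
  rewrite /node_time (_ : 2 * t = (2 * N)%:R * h); last first.
    by rewrite natrM -mulrA [N%:R * _]mulrC divfK// pnatr_eq0 -lt0n.
  rewrite ler_wpM2r ?(ltW (step_gt0 t_gt0 N_gt0))// ler_nat /mesh_index; case: ifP; lia.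
apply: mmeas_linked_sum.
- by apply: mseq_rcons => //; exact: measurable_cst.
- by move=> u; rewrite -e; apply: (path_le le_trans _ (good u)); exact: node_time_ge0.
- move=> u; rewrite -e all_rcons tp /=; apply/allP => r rin; apply: le_trans tp.
  by apply: path_rcons_le (good u) _; rewrite in_cons rin orbT.
Qed.

End MeshTermMeasurability.

Lemma fact_double n : (n.+1)`! = (double_fact n.+1 * double_fact n)%N.
Proof.
elim: n => // n ih; rewrite factS ih mulnA mulnAC.
by [].
Qed.

Lemma double_fact_gt0 n : (0 < double_fact n)%N.
Proof.
have [m] := ubnP n; elim: m n => // m ih [|[|n]] // nm.
by rewrite /= muln_gt0 /= ih//; lia.
Qed.

(** * The single-sample estimator *)

Section Estimator.
Variables (R : realType) (D : model R) (N : nat) (cW cL : R).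
Hypotheses (t_gt0 : 0 < horizon D) (N_gt0 : (0 < N)%N) (B_meas : measurable_corr D).
Hypotheses (W_le : frobenius (Ws D) <= cW) (cL_ge0 : 0 <= cL)
  (B_le : forall s1 s2 : R, 0 <= s1 -> s1 <= s2 -> s2 <= 2 * horizon D ->
       Normc.normc (corr D s2 s1) <= cL).
Local Notation t := (horizon D).
Local Notation Mbar := (max_order D).
Local Notation M := 'M[R[i]]_2.
Local Notation nt := (node_time D N).
Local Notation orders := [seq m <- index_iota 1 Mbar.+1 | odd m].

Definition est (p q : nat) (g : nat -> nat -> M) (x : nat -> seq R) : M :=
  node_sgn R N p *: \sum_(m <- orders)
    ('i%C ^+ m.+1 * ((nt p - nt q) ^+ m / m`!%:R)%:C%C) *: mesh_term D N p q g (x m).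

Lemma mc_sumE Ns x p q g :
  mc_sum D N Ns x p q g = (Ns%:R^-1)%:C%C *: \sum_(i <- index_iota 0 Ns) est p q g (x i).
Proof.
rewrite /mc_sum mulrC -scalerA; congr (_ *: _).
  by rewrite fmorphV rmorph_nat.
by rewrite scaler_sumr; apply: eq_bigr => i _; rewrite /est big_filter.
Qed.

Definition good_list (p q : nat) (s : seq R) := path <=%R (nt q) (rcons s (nt p)).

Lemma node_time_le2 p : (p <= (2 * N).+1)%N -> nt p <= 2 * t.
Proof.
move=> pN; have N0 : N%:R != 0 :> R by rewrite pnatr_eq0 -lt0n.
rewrite /node_time (_ : 2 * t = (2 * N)%:R * (t / N%:R)); last first.
  by rewrite natrM -mulrA [N%:R * _]mulrC divfK.
rewrite ler_wpM2r ?(ltW (step_gt0 t_gt0 N_gt0))// ler_nat.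
by move: pN; clear; rewrite /mesh_index; case: ifP; lia.
Qed.

(* Weight of one coupling, w = cW sqrt cL: a product of M + 1 matrices W carries (M + 1) / 2
   factors B. *)
Definition wt := cW * Num.sqrt cL.

Lemma cW_ge0 : 0 <= cW. Proof. exact: le_trans (fro_ge0 _) W_le. Qed.

Lemma wt_ge0 : 0 <= wt. Proof. by rewrite mulr_ge0 ?sqrtr_ge0 ?cW_ge0. Qed.

Lemma linked_bound p q s : (p <= (2 * N).+1)%N -> good_list p q s ->
  Normc.normc (linked_sum (corr D) (rcons s (nt p))) <=
    (double_fact (size s))%:R * Num.sqrt cL ^+ (size s).+1.
Proof.
move=> pN gs; have := @linked_sum_le R (corr D) cL (rcons s (nt p)) cL_ge0.
rewrite size_rcons /=; apply => i j ij js.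
have srt : sorted <=%R (rcons s (nt p)) by exact: path_sorted gs.
have js' : (j < size (rcons s (nt p)))%N by rewrite size_rcons.
have is' : (i < size (rcons s (nt p)))%N by exact: ltn_trans js'.
apply: B_le.
- have /allP := order_path_min le_trans gs.
  move=> /(_ _ (mem_nth 0 is')); apply: le_trans.
  exact: node_time_ge0.
- by apply: (sorted_leq_nth le_trans lexx) => //; exact: ltnW.
- apply: le_trans (node_time_le2 pN).
  have := mem_nth 0 js'; rewrite mem_rcons in_cons => /orP[/eqP ->//|jin].
  by apply: path_rcons_le gs _; rewrite in_cons jin orbT.
Qed.

Lemma mesh_term_le p q g s G : (q <= p)%N -> q <> N -> (p <= (2 * N).+1)%N ->
  good_list p q s ->
  (forall j k, (q <= k)%N -> (k <= j <= p)%N -> frobenius (g j k) <= G) ->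
  frobenius (mesh_term D N p q g s) <= (double_fact (size s))%:R * (wt * G) ^+ (size s).+1.
Proof.
move=> qp qN pN gs gG.
have G0 : 0 <= G by apply: le_trans (fro_ge0 _) (gG q q _ _); rewrite ?leqnn ?qp.
rewrite /mesh_term /dyson_term froZ Normc.normcM normcX.
rewrite (_ : Normc.normc (-1) = 1); last by rewrite normcN Normc.normc1.
rewrite expr1n mul1r.
have h1 := linked_bound pN gs.
have h2 := chain_le W_le (all_adj_mesh t_gt0 N_gt0 qp qN gs)
  (fun a b gab => good_interp_le gab gG).
rewrite size_map in h2.
apply: le_trans (ler_pM (normc_ge0 _) (fro_ge0 _) h1 h2) _.
by rewrite -mulrA -exprMn /wt mulrA [Num.sqrt _ * _]mulrC.
Qed.

(* Bounds the slopes over a time gap [tau] when the propagators are bounded by [G]: the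
   (m-1)!! comes from m!! linked pairings divided by the m! of the volume of the simplex. *)
Definition sig (G tau : R) : R :=
  \sum_(m <- orders) (wt * G) ^+ m.+1 * tau ^+ m / (double_fact (m - 1)%N)%:R.

Lemma order_pos m : m \in orders -> (0 < m)%N /\ odd m /\ (m <= Mbar)%N.
Proof. by rewrite mem_filter mem_index_iota => /andP[-> /andP[-> ?]]. Qed.

Lemma double_fact_ratio m : (0 < m)%N ->
  (double_fact m)%:R / m`!%:R = (double_fact (m - 1)%N)%:R^-1 :> R.
Proof.
case: m => // m _; rewrite subn1 /= fact_double natrM.
have h1 : (double_fact m.+1)%:R != 0 :> R by rewrite pnatr_eq0 -lt0n double_fact_gt0.
have h2 : (double_fact m)%:R != 0 :> R by rewrite pnatr_eq0 -lt0n double_fact_gt0.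
by rewrite invfM mulrA divff// mul1r.
Qed.

Lemma normc_sgn p : Normc.normc (node_sgn R N p) = 1.
Proof. by rewrite /node_sgn; case: ifP => _; rewrite ?normcN Normc.normc1. Qed.

Lemma normc_weight p q m : (q <= p)%N ->
  Normc.normc ('i%C ^+ m.+1 * ((nt p - nt q) ^+ m / m`!%:R)%:C%C : R[i]) =
  (nt p - nt q) ^+ m / m`!%:R.
Proof.
move=> qp; rewrite Normc.normcM normcX normc_i expr1n mul1r normcR ger0_norm//.
by rewrite divr_ge0// exprn_ge0// subr_ge0 node_time_le.
Qed.

Definition good_sample p q (x : nat -> seq R) :=
  forall m, m \in orders -> size (x m) = m /\ good_list p q (x m).

Lemma est_le p q g x G : (q <= p)%N -> q <> N -> (p <= (2 * N).+1)%N -> good_sample p q x ->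
  (forall j k, (q <= k)%N -> (k <= j <= p)%N -> frobenius (g j k) <= G) ->
  frobenius (est p q g x) <= sig G (nt p - nt q).
Proof.
move=> qp qN pN gx gG; rewrite /est froZ normc_sgn mul1r.
apply: le_trans (fro_sum _ _ _) _; rewrite /sig big_seq [leRHS]big_seq; apply: ler_sum => m mo.
have [m0 [om mM]] := order_pos mo; have [sm gm] := gx m mo.
rewrite froZ normc_weight//.
apply: le_trans (ler_wpM2l _ (mesh_term_le qp qN pN gm gG)) _.
  by rewrite divr_ge0// exprn_ge0// subr_ge0 node_time_le.
by rewrite sm -double_fact_ratio// le_eqVlt; apply/orP; left; apply/eqP; ring.
Qed.

Lemma est_congr p q g g' x : (q <= p)%N -> q <> N -> good_sample p q x ->
  (forall j k, (q <= k)%N -> (k <= j <= p)%N -> g j k = g' j k) ->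
  est p q g x = est p q g' x.
Proof.
move=> qp qN gx gg; rewrite /est; congr (_ *: _); rewrite big_seq [RHS]big_seq.
apply: eq_bigr => m mo; have [sm gm] := gx m mo; congr (_ *: _).
rewrite /mesh_term /dyson_term; congr (_ *: _).
apply: chain_congr (all_adj_mesh t_gt0 N_gt0 qp qN gm) _ => a b gab.
exact: good_interp_congr gab gg.
Qed.

Section Samples.
Variable Ns : nat.
Local Notation J := (used_draw D N Ns).
Local Notation E := (sample_space R J).

Definition clip (a : draw) (r : R) : R :=
  Num.max (draw_lower D N a) (Num.min (draw_upper D N a) r).

(** After clamping, every point of the sample space gives samples inside their intervals, so
    measurability and bounds of the slopes hold pointwise. *)
Definition clipped (x : draw -> R) (a : draw) : R := clip a (x a).

(* The final node of stage [b] of the step from [p] to [p.+1]. *)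
Definition final (b : bool) (p : nat) : nat := if b then p.+1 else p.

Lemma measurable_clip a : measurable_fun setT (clip a).
Proof.
apply: measurable_maxr; first exact: measurable_cst.
by apply: measurable_minr; [exact: measurable_cst|exact: measurable_id].
Qed.

Lemma good_sorted (l : seq R) p q : (q <= p)%N -> all (fun r => nt q <= r <= nt p) l ->
  good_list p q (sort <=%R l).
Proof.
move=> qp al; rewrite /good_list.
have : all (fun r => nt q <= r <= nt p) (sort <=%R l) by rewrite all_sort.
have : sorted <=%R (sort <=%R l) by exact: sort_sorted le_total _.
case: (sort _ l) => [|r s] /=; first by rewrite node_time_le.
move=> srs /andP[/andP[-> rp] sp] /=; rewrite rcons_path srs /=.
have : last r s \in r :: s by exact: mem_last.
by rewrite in_cons => /orP[/eqP ->//|/(allP sp)/andP[]].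
Qed.

Lemma clip_itv a r : draw_lower D N a <= draw_upper D N a ->
  draw_lower D N a <= clip a r <= draw_upper D N a.
Proof. by move=> lu; rewrite /clip le_max lexx /= ge_max lu ge_min lexx. Qed.

Lemma good_blk x b p q i : (q <= p)%N ->
  good_sample (final b p) q (sorted_sample (clipped x) b p q i).
Proof.
move=> qp m _; rewrite /sorted_sample; split; first by rewrite size_sort size_map size_iota.
have qf : (q <= final b p)%N by rewrite /final; case: (b) => //; exact: leqW.
apply: good_sorted => //; apply/allP => _ /mapP[c _ ->].
have := @clip_itv (b, p, q, i, m, c) (x (b, p, q, i, m, c)).
by apply; rewrite /= node_time_le.
Qed.

Definition usable (p q i : nat) := [&& (q <= p <= 2 * N)%N, p != N, q != N & (i < Ns)%N].

Lemma usable_draw b p q i m c : usable p q i -> m \in orders -> (c < m)%N -> J (b, p, q, i, m, c).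
Proof.
move=> /and4P[h1 h2 h3 h4] /order_pos[_ [h5 h6]] cm.
by rewrite /used_draw h1 h2 h3 h4 h5 h6 cm.
Qed.

Lemma usable_facts b p q i : usable p q i ->
  [/\ (q <= p)%N, (q <= final b p)%N, q <> N, p <> N & (final b p <= (2 * N).+1)%N].
Proof.
move=> /and4P[/andP[qp pN] /eqP pn /eqP qn _]; split => //.
  by rewrite /final; case: (b) => //; exact: leqW.
by rewrite /final; case: (b) => //; exact: leqW.
Qed.

Lemma mseq_blk d (V : measurableType d) (X : V -> E) b p q i m :
  measurable_fun setT X -> usable p q i -> m \in orders ->
  exists ls, [/\ mseq ls, size ls = m & forall u, evs ls u = sorted_sample (clipped (X u)) b p q i m].
Proof.
move=> mX us mo.
pose F c u := clipped (X u) (b, p, q, i, m, c).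
have mF c : (c < m)%N -> measurable_fun setT (F c).
  move=> cm; have Ja := usable_draw b us mo cm.
  apply: (measurableT_comp (measurable_clip _)).
  exact: (measurableT_comp (measurable_coord Ja) mX).
have mls : mseq [seq F c | c <- iota 0 m].
  have : all (fun c => c < m)%N (iota 0 m) by apply/allP => c; rewrite mem_iota.
  elim: (iota 0 m) => [|c l ih] /=; first by move=> _; exact: mseq_nil.
  by move=> /andP[cm cl]; apply: mseq_cons; [exact: mF|exact: ih].
have [ls [ml sl el]] := mseq_sort mls.
exists ls; split=> //; first by rewrite sl size_map size_iota.
by move=> u; rewrite el /evs -map_comp.
Qed.

Lemma mmeas_est d (V : measurableType d) (g : V -> nat -> nat -> M) (X : V -> E) b p q i :
  measurable_fun setT X -> usable p q i ->
  (forall j k, (q <= k)%N -> (k <= j <= final b p)%N -> mmeas (fun u => g u j k)) ->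
  mmeas (fun u => est (final b p) q (g u) (sorted_sample (clipped (X u)) b p q i)).
Proof.
move=> mX us mg; have [qp qf qN pN fN] := usable_facts b us.
rewrite /est; apply: mmeasZ; first exact: mmeas_cst.
rewrite (_ : (fun _ => _) = (fun x => \sum_(m <- orders) if m \in orders then
  ('i%C ^+ m.+1 * ((nt (final b p) - nt q) ^+ m / m`!%:R)%:C%C) *:
   mesh_term D N (final b p) q (g x) (sorted_sample (clipped (X x)) b p q i m) else 0)); last first.
  by apply/funext => x; rewrite big_seq [RHS]big_seq; apply: eq_bigr => m ->.
apply: mmeas_sum => m; case: (boolP (m \in orders)) => mo; last exact: mmeas_cst.
apply: mmeasZ; first exact: mmeas_cst.
have [ls [ml sl el]] := mseq_blk b mX us mo.
rewrite (_ : (fun _ => _) = (fun u => mesh_term D N (final b p) q (g u) (evs ls u))); last first.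
  by apply/funext => u; rewrite el.
apply: mmeas_mesh_term => // u.
by have [_] := @good_blk (X u) b p q i qp m mo; rewrite el.
Qed.

End Samples.
End Estimator.

(** * The scheme as a recursion *)

Section SchemeRecursion.
Variables (R : realType) (D : model R) (N : nat).
Local Notation M := 'M[R[i]]_2.
Local Notation h := (horizon D / N%:R).
Local Notation slope := (nat -> nat -> (nat -> nat -> M) -> M).
Implicit Types (K : slope) (g : nat -> nat -> M).

Definition agree (q p : nat) g g' :=
  forall j k, (q <= k)%N -> (k <= j <= p)%N -> g j k = g' j k.

Lemma propagatorsE K1 K2 l j k : (j - k <= l)%N ->
  propagators D N K1 K2 l j k = scheme D N K1 K2 j k.
Proof.
rewrite /scheme; elim: l => [|l ih] /=; first by case: (j - k)%N.
by case: ifP => [/ih //|jk] jkl; rewrite (_ : (j - k)%N = l.+1) /= ?jk//; lia.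
Qed.

Lemma scheme_diag K1 K2 k : scheme D N K1 K2 k k = 1%:M.
Proof. by rewrite /scheme subnn. Qed.

Lemma scheme_next K1 K2 p q : (q <= p)%N ->
  scheme D N K1 K2 p.+1 q = next_value D N K1 K2 p q (propagators D N K1 K2 (p - q)).
Proof. by move=> qp; rewrite /scheme subSn//= subSn// ltnn. Qed.

Definition slopes_agree K1 K2 K1' K2' p q :=
  (forall g g', agree q p g g' -> K1 p q g = K1' p q g') /\
  (forall g g', agree q p.+1 g g' -> K2 p q g = K2' p q g').

(** A step reads nodes of gap at most p - q only: in the second stage the corner, of larger gap,
    holds the predictor and not a nodal value. *)
Lemma next_value_congr K1 K2 K1' K2' p q g g' : (q <= p)%N ->
  (p != N -> q != N -> slopes_agree K1 K2 K1' K2' p q) ->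
  (forall j k, (q <= k)%N -> (k <= j <= p.+1)%N -> (j - k <= p - q)%N -> g j k = g' j k) ->
  next_value D N K1 K2 p q g = next_value D N K1' K2' p q g'.
Proof.
move=> qp H gg; rewrite /next_value.
have e1 : g p q = g' p q by apply: gg; rewrite ?leqnn ?qp//=.
case: eqVneq => [qN|qN].
  by rewrite gg// ?subSS -?qN//; lia.
case: eqVneq => [pN|pN]; first by rewrite -pN e1.
have [H1 H2] := H pN qN.
have e2 : K1 p q g = K1' p q g'.
  apply: H1 => j k qk /andP[kj jp]; apply: gg => //; first by rewrite kj leqW.
  by move: qk kj jp; clear; lia.
rewrite /corrector /predictor e1 e2; congr (_ + _); congr (_ *: (_ + _)).
apply: H2 => j k qk kjp; rewrite /set_node; case: ifP => // /negbT ne.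
apply: gg => //; move: ne qk kjp; clear; lia.
Qed.

Lemma scheme_step K1 K2 p q : (q <= p)%N ->
  (p != N -> q != N -> slopes_agree K1 K2 K1 K2 p q) ->
  scheme D N K1 K2 p.+1 q = next_value D N K1 K2 p q (scheme D N K1 K2).
Proof.
move=> qp H; rewrite (scheme_next _ _ qp); apply: (next_value_congr qp H) => j k _ _ jk.
by rewrite propagatorsE.
Qed.

(** Values of gap at most L are determined by the slopes of steps of gap less than L. This serves to
    track which draws a value depends on, and to compare the clamped scheme with the given one. *)
Lemma scheme_congr K1 K2 K1' K2' P L :
  (forall p q, (q <= p <= P)%N -> (p - q < L)%N -> p != N -> q != N ->
     slopes_agree K1 K2 K1' K2' p q) ->
  forall j k, (k <= j <= P.+1)%N -> (j - k <= L)%N ->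
    scheme D N K1 K2 j k = scheme D N K1' K2' j k.
Proof.
move=> H j k; have [n] := ubnP (j - k).
elim: n j k => [j k|n ih j k jkn /andP[kj jP] jkL].
  by rewrite ltn0 => jk; case: (notF jk).
have [e|ne] := eqVneq j k; first by rewrite e !scheme_diag.
case: j kj jP jkL ne jkn => [|p] kj jP jkL ne jkn.
  by exfalso; move: ne kj; clear; lia.
have kp : (k <= p)%N by move: kj ne; clear; lia.
rewrite !(scheme_next _ _ kp); apply: (next_value_congr kp) => [pN qN|j' k' qk kj' jk'].
  by apply: H pN qN; [rewrite kp; move: jP|move: jkL kp]; clear; lia.
rewrite (propagatorsE _ _ jk') (propagatorsE _ _ jk'); apply: ih; move: jk' kj' jkn jkL kp jP; clear; lia.
Qed.

Definition stage (z : R) (X : M) : M := X + z%:C%C *: ('i%C *: (Hs D *m X)).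

Definition heun (z : R) (X : M) : M :=
  X + z%:C%C *: ('i%C *: (Hs D *m X)) - (z ^+ 2 / 2)%:C%C *: (Hs D *m (Hs D *m X)).

Definition sgn_step (p : nat) : R := (if (p <= N)%N then -1 else 1) * h.

Lemma node_sgnE p : node_sgn R N p = (if (p <= N)%N then -1 else 1 : R)%:C%C.
Proof. by rewrite /node_sgn; case: ifP => _; apply/eqP; rewrite eq_complex /= ?oppr0 !eqxx. Qed.

Lemma predictorE K1 p q g :
  predictor D N K1 p q g = stage (sgn_step p) (g p q) + h%:C%C *: K1 p q g.
Proof.
rewrite /predictor /stage /sgn_step node_sgnE; move: (if _ then _ else _) (h) => s z.
have -> : s%:C%C * 'i%C * z%:C%C = (s * z)%:C%C * 'i%C :> R[i] by rewrite rmorphM mulrAC.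
by rewrite mulmxDl mul1mx -scalemxAl -scalerA.
Qed.

(** Away from the jump both ends of the step have the same sign. Substituting the predictor then
    completes the two half steps to the second-order Taylor polynomial [heun], and puts [stage] in
    front of the first slope. *)
Lemma correctorE K1 K2 p q g : p != N ->
  corrector D N K1 K2 p q g = heun (sgn_step p) (g p q)
    + (h / 2)%:C%C *: stage (sgn_step p) (K1 p q g)
    + (h / 2)%:C%C *: K2 p q (set_node g p.+1 q (predictor D N K1 p q g)).
Proof.
move=> pN; rewrite /corrector.
have -> : node_sgn R N p.+1 = node_sgn R N p.
  by rewrite /node_sgn; move: pN; clear; case: ifP; case: ifP => //; lia.
set K := K2 p q _; rewrite predictorE {}/K; set K := K2 p q _; set X := g p q; set Y := K1 p q g.
rewrite /heun /stage node_sgnE /sgn_step; set s : R := if _ then _ else _.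
have s2 : s * s = 1 by rewrite /s; case: ifP => _; rewrite ?mulrNN mulr1.
move: s s2 (h) => s s2 z.
have half : (2^-1 : R[i]) = (2^-1)%:C%C by rewrite fmorphV rmorph_nat.
have ii : 'i%C * 'i%C = -1 :> R[i] by rewrite -expr2 sqr_i.
rewrite mulmxDl mul1mx -!scalemxAl !mulmxDr -!scalemxAr !scalerDr !scalerA half.
set HX := Hs D *m X; set HY := Hs D *m Y; set HHX := Hs D *m HX.
have c1 : (2^-1)%:C%C * s%:C%C * 'i%C * z%:C%C + (2^-1)%:C%C * s%:C%C * 'i%C * z%:C%C =
   (s * z)%:C%C * 'i%C :> R[i].
  rewrite -half -mulr2n -mulr_natl [(s * z)%:C%C]rmorphM.
  have h2 : (2 : R[i]) != 0 by rewrite pnatr_eq0.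
  by field.
have c2 : (2^-1)%:C%C * s%:C%C * 'i%C * z%:C%C * ((s * z)%:C%C * 'i%C) = - ((s * z) ^+ 2 / 2)%:C%C :> R[i].
  rewrite -half (_ : ((s * z) ^+ 2 / 2)%:C%C = s%:C%C * z%:C%C * (s%:C%C * z%:C%C) * 2^-1 :> R[i]).
    rewrite [(s * z)%:C%C]rmorphM -mulN1r -ii; ring.
  by rewrite half !rmorphM.
have c3 : (2^-1)%:C%C * z%:C%C = (z / 2)%:C%C :> R[i] by rewrite -rmorphM mulrC.
have c4 : (2^-1)%:C%C * s%:C%C * 'i%C * z%:C%C * z%:C%C = (z / 2)%:C%C * ((s * z)%:C%C * 'i%C) :> R[i].
  by rewrite -c3 [(s * z)%:C%C]rmorphM; ring.
rewrite c2 c3 c4 -c1 scaleNr scalerDl.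
clearbody HHX; clearbody HX HY K; apply/matrixP => i j; rewrite !mxE.
by rewrite -[(z / 2)%:C%C * _ * 'i%C]mulrA -c1; ring.
Qed.

Lemma stageB z X Y : stage z (X - Y) = stage z X - stage z Y.
Proof. by rewrite /stage mulmxBr !scalerBr opprD addrACA. Qed.

Lemma stageD z X Y : stage z (X + Y) = stage z X + stage z Y.
Proof. by rewrite /stage mulmxDr !scalerDr addrACA. Qed.

Lemma heunD z X Y : heun z (X + Y) = heun z X + heun z Y.
Proof.
have E (a b c d e f : M) : a + b + (c + d) - (e + f) = (a + c - e) + (b + d - f).
  by rewrite opprD (addrACA a b) (addrACA (a + c)).
by rewrite /heun !mulmxDr !scalerDr E.
Qed.

Lemma heunN z X : heun z (- X) = - heun z X.
Proof. by rewrite /heun !mulmxN !scalerN 2!opprD opprK. Qed.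

Lemma heunB z X Y : heun z (X - Y) = heun z X - heun z Y.
Proof. by rewrite heunD heunN. Qed.

Lemma normr_sgn_step p : 0 < horizon D -> (0 < N)%N -> `|sgn_step p| = h.
Proof.
move=> t0 N0; rewrite /sgn_step normrM [`|h|]ger0_norm ?(ltW (step_gt0 t0 N0))//.
by case: ifP => _; rewrite ?normrN normr1 mul1r.
Qed.

End SchemeRecursion.

(** * Differences of products of propagators *)

Fixpoint adj_sum (R : realType) (T : Type) (phi : T -> T -> R) (x : T) (s : seq T) (y : T) : R :=
  if s is s1 :: s' then phi s1 x + adj_sum phi s1 s' y else phi y x.

(** Consecutive pairs are bounded by all pairs. The right-hand side is symmetric in the points, so a
    sorted sample may be replaced by the unsorted draws, whose laws are known. *)
Lemma adj_sum_pairs (R : realType) (phi : R -> R -> R) a s b : (forall u v, 0 <= phi u v) ->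
  (0 < size s)%N ->
  adj_sum phi a s b <= \sum_(u <- s) phi u a + \sum_(u <- s) phi b u +
    \sum_(u <- s) \sum_(v <- s) phi u v.
Proof.
move=> p0; case: s => // s1 s _ /=.
have s0 (r : seq R) (f : R -> R) : (forall u, 0 <= f u) -> 0 <= \sum_(u <- r) f u.
  by move=> f0; apply: sumr_ge0.
have H x r : adj_sum phi x r b <= \sum_(u <- x :: r) phi b u +
    \sum_(u <- x :: r) \sum_(v <- x :: r) phi u v.
  elim: r x => [|y r ih] x /=.
    by rewrite !big_cons !big_nil !addr0 lerDl.
  apply: le_trans (lerD (lexx _) (ih y)) _.
  set l := y :: r; rewrite [\sum_(u <- x :: l) phi b u]big_cons [\sum_(u <- x :: l) \sum_(v <- _) _]big_cons.
  have -> : \sum_(u <- l) \sum_(v <- x :: l) phi u v =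
      \sum_(u <- l) phi u x + \sum_(u <- l) \sum_(v <- l) phi u v.
    by rewrite -big_split; apply: eq_bigr => u _; rewrite big_cons.
  have h1 : phi y x <= \sum_(u <- l) phi u x by rewrite big_cons lerDl s0.
  have h2 : 0 <= \sum_(v <- x :: l) phi x v by exact: s0.
  have := p0 b x; lra.
rewrite -addrA; apply: lerD; last exact: H.
by rewrite big_cons lerDl s0.
Qed.

Section PathwiseDifference.
Context d (T : measurableType d) (R : realType) (mu : probability T R).
Variables (D : model R) (N : nat) (cW G : R).
Hypotheses (W_le : frobenius (Ws D) <= cW) (G_ge0 : 0 <= G).
Local Notation M := 'M[R[i]]_2.
Local Notation nrm := (nrm2 mu).

Definition bounded_ae (f : T -> M) (c : R) := {ae mu, forall x, frobenius (f x) <= c}.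

Lemma bounded_aeM f g a b : 0 <= a -> bounded_ae f a -> bounded_ae g b ->
  bounded_ae (fun x => f x *m g x) (a * b).
Proof.
move=> a0 fa gb; apply: filterS2 fa gb => x fx gx; apply: le_trans (froM _ _) _.
by apply: ler_pM; rewrite ?fro_ge0.
Qed.

Lemma bounded_ae_cst A c : frobenius A <= c -> bounded_ae (fun=> A) c.
Proof. by move=> ?; apply: aeW. Qed.

(** Bounds the mean of a product of two errors, the quadratic remainder of the bias expansion. *)
Lemma fro_Em_mul f g : mbm f -> mbm g ->
  frobenius (Em mu (fun x => f x *m g x)) <= nrm f ^+ 2 + nrm g ^+ 2.
Proof.
move=> bf bg; set A := Em mu _.
have [->|e0] := eqVneq (frobenius A) 0; first by rewrite addr_ge0 ?sqr_ge0.
have ep : 0 < frobenius A by rewrite lt_neqAle eq_sym e0 fro_ge0.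
rewrite -(ler_pM2l ep) -expr2 fro_sqr {2}/A ip_Em; last exact: mbmM.
have b1 := bm_ip bf bf; have b2 := bm_ip bg bg.
have b3 : bm (fun x => ip (f x) (f x) + ip (g x) (g x)) by exact: bmD.
rewrite !nrm2_sqr -ExD// -ExZ//; apply: Ex_le.
- by apply: bm_ip; [exact: mbm_cst|exact: mbmM].
- by apply: bmM => //; exact: bm_cst.
- move=> x; apply: le_trans (ip_le _ _) _; rewrite ler_wpM2l ?fro_ge0//.
  apply: le_trans (froM _ _) _; rewrite -!fro_sqr.
  by have := sqr_ge0 (frobenius (f x) - frobenius (g x)); have := sqr_ge0 (frobenius (f x) + frobenius (g x)); nra.
Qed.

Section Chain.
Variables (Pt : Type) (P : Pt -> Pt -> Prop) (phi : Pt -> Pt -> R).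
Variables (Ga : T -> Pt -> Pt -> M) (Gb : Pt -> Pt -> M).
Hypothesis (Ga_mbm : forall a b, P a b -> mbm (fun w => Ga w a b)).
Hypothesis (Ga_le : forall a b, P a b -> bounded_ae (fun w => Ga w a b) G).
Hypothesis (Gb_le : forall a b, P a b -> frobenius (Gb a b) <= G).
Hypothesis (dG : forall a b, P a b -> nrm (fun w => Ga w a b - Gb a b) <= phi a b).

Let cW0 : 0 <= cW. Proof. exact: le_trans (fro_ge0 _) W_le. Qed.
Let cWG : 0 <= cW * G. Proof. by rewrite mulr_ge0. Qed.

Lemma chain_mbm x s y : all_adj P x s y -> mbm (fun w => chain D (Ga w) x s y).
Proof.
elim: s x => [|r s ih] x /=; first by move=> ?; apply: mbmM; [exact: mbm_cst|exact: Ga_mbm].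
move=> [p a]; apply: mbmM; first exact: ih.
by apply: mbmM; [exact: mbm_cst|exact: Ga_mbm].
Qed.

Lemma link_ae a b : P a b -> bounded_ae (fun w => Ws D *m Ga w a b) (cW * G).
Proof. by move=> p; apply: bounded_aeM => //; [exact: bounded_ae_cst|exact: Ga_le]. Qed.

(** Telescoping: one propagator is exchanged at a time, and the remaining ones are bounded by G. *)
Lemma chain_diff x s y : all_adj P x s y ->
  nrm (fun w => chain D (Ga w) x s y - chain D Gb x s y) <=
    cW ^+ (size s).+1 * G ^+ (size s) * adj_sum phi x s y.
Proof.
have nW f : mbm f -> nrm (fun w => Ws D *m f w) <= cW * nrm f.
  move=> bf; apply: (nrm2Ml cW0 (mbm_cst _ _) bf).
  exact: bounded_ae_cst.
have mdiff a b : P a b -> mbm (fun w => Ga w a b - Gb a b).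
  by move=> p; apply: mbmB; [exact: Ga_mbm|exact: mbm_cst].
elim: s x => [|r s ih] x /=.
  move=> p; rewrite expr1 expr0 mulr1.
  rewrite (_ : (fun _ => _) = (fun w => Ws D *m (Ga w y x - Gb y x))); last first.
    by apply/funext => w; rewrite mulmxBr.
  apply: le_trans (nW _ (mdiff _ _ p)) _.
  by rewrite ler_wpM2l// dG.
move=> [p a]; have mc := chain_mbm a.
have md : mbm (fun w => chain D (Ga w) r s y - chain D Gb r s y) by apply: mbmB => //; exact: mbm_cst.
have ma : mbm (fun w => Ws D *m Ga w r x) by apply: mbmM; [exact: mbm_cst|exact: Ga_mbm].
have mb : mbm (fun w => Ws D *m (Ga w r x - Gb r x)) by apply: mbmM; [exact: mbm_cst|exact: mdiff].
rewrite (_ : (fun _ => _) = (fun w => (chain D (Ga w) r s y - chain D Gb r s y) *m (Ws D *m Ga w r x)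
   + chain D Gb r s y *m (Ws D *m (Ga w r x - Gb r x)))); last first.
  by apply/funext => w; rewrite mulmxBl !mulmxBr addrA subrK.
apply: le_trans (nrm2D mu (mbmM md ma) (mbmM (mbm_cst _ _) mb)) _.
have h1 := nrm2Mr cWG ma md (link_ae p).
have h2 : nrm (fun w => chain D Gb r s y *m (Ws D *m (Ga w r x - Gb r x))) <=
    (cW * G) ^+ (size s).+1 * nrm (fun w => Ws D *m (Ga w r x - Gb r x)).
  apply: (nrm2Ml (exprn_ge0 _ cWG) (mbm_cst _ _) mb).
  by apply: bounded_ae_cst; apply: chain_le W_le a Gb_le.
have h3 := le_trans (nW _ (mdiff _ _ p)) (ler_wpM2l cW0 (dG p)).
apply: le_trans (lerD (le_trans h1 (ler_wpM2l cWG (ih _ a)))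
  (le_trans h2 (ler_wpM2l (exprn_ge0 _ cWG) h3))) _.
by rewrite le_eqVlt; apply/orP; left; apply/eqP; rewrite !exprMn !exprS; ring.
Qed.

End Chain.

Section ChainBias.
Variables (Pt : Type) (P : Pt -> Pt -> Prop).
Variables (Ga : T -> Pt -> Pt -> M) (Gb : Pt -> Pt -> M).
Hypothesis (Ga_mbm : forall a b, P a b -> mbm (fun w => Ga w a b)).
Hypothesis (Ga_le : forall a b, P a b -> bounded_ae (fun w => Ga w a b) G).
Hypothesis (Gb_le : forall a b, P a b -> frobenius (Gb a b) <= G).

Let cW0 : 0 <= cW. Proof. exact: le_trans (fro_ge0 _) W_le. Qed.
Let cWG : 0 <= cW * G. Proof. by rewrite mulr_ge0. Qed.

Variables (beta eps : R).
Hypotheses (beta_ge0 : 0 <= beta) (eps_ge0 : 0 <= eps).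
Hypothesis (bG : forall a b, P a b -> frobenius (Em mu (fun w => Ga w a b - Gb a b)) <= beta).
Hypothesis (eG : forall a b, P a b -> nrm (fun w => Ga w a b - Gb a b) ^+ 2 <= eps).

(** The two first summands come from the linear terms of [chain_bias], the squares from its
    quadratic remainder via [chain_diff] and [fro_Em_mul]. *)
Fixpoint bias_cst (n : nat) : R :=
  if n is n'.+1 then bias_cst n' * (cW * G) + (cW * G) ^+ n'.+1 * cW +
    ((cW ^+ n * G ^+ n' * n%:R) ^+ 2 + cW ^+ 2)
  else cW.

Lemma bias_cst_ge0 n : 0 <= bias_cst n.
Proof.
elim: n => //= n ih; rewrite !addr_ge0 ?sqr_ge0 ?mulr_ge0 ?exprn_ge0//.
Qed.

(** For random A, B and fixed a, b one has AB - ab = (A - a) b + a (B - b) + (A - a)(B - b). The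
    mean of the linear terms only sees the bias; the last term is of the order of the mean square
    error. *)
Lemma chain_bias x s y : all_adj P x s y ->
  frobenius (Em mu (fun w => chain D (Ga w) x s y - chain D Gb x s y)) <=
    bias_cst (size s) * (beta + eps).
Proof.
have mdiff a b : P a b -> mbm (fun w => Ga w a b - Gb a b).
  by move=> p; apply: mbmB; [exact: Ga_mbm|exact: mbm_cst].
have be : beta <= beta + eps by rewrite lerDl.
have eb : eps <= beta + eps by rewrite lerDr.
have be0 : 0 <= beta + eps by rewrite addr_ge0.
elim: s x => [|r s ih] x /=.
  move=> p; rewrite (_ : (fun _ => _) = (fun w => Ws D *m (Ga w y x - Gb y x))); last first.
    by apply/funext => w; rewrite mulmxBr.
  rewrite EmMl; last exact: mdiff.
  apply: le_trans (froM _ _) _; apply: ler_pM; rewrite ?fro_ge0//.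
  exact: le_trans (bG p) be.
move=> [p a]; have mc := chain_mbm Ga_mbm a.
have md : mbm (fun w => chain D (Ga w) r s y - chain D Gb r s y) by apply: mbmB => //; exact: mbm_cst.
have mb : mbm (fun w => Ws D *m (Ga w r x - Gb r x)) by apply: mbmM; [exact: mbm_cst|exact: mdiff].
rewrite (_ : (fun _ => _) = (fun w => (chain D (Ga w) r s y - chain D Gb r s y) *m (Ws D *m Gb r x)
   + chain D Gb r s y *m (Ws D *m (Ga w r x - Gb r x))
   + (chain D (Ga w) r s y - chain D Gb r s y) *m (Ws D *m (Ga w r x - Gb r x)))); last first.
  apply/funext => w; rewrite addrAC -mulmxDr -mulmxDr [Gb r x + _]addrC subrK.
  by rewrite mulmxBr mulmxBl mulmxBr addrA subrK.
have c1 : mbm (fun w => (chain D (Ga w) r s y - chain D Gb r s y) *m (Ws D *m Gb r x)).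
  by apply: mbmM => //; exact: mbm_cst.
have c2 : mbm (fun w => chain D Gb r s y *m (Ws D *m (Ga w r x - Gb r x))).
  by apply: mbmM => //; exact: mbm_cst.
have c3 := mbmM md mb.
rewrite (EmD mu (mbmD c1 c2) c3) (EmD mu c1 c2).
apply: le_trans (froD _ _) _; rewrite mulrDl; apply: lerD; last first.
  apply: le_trans (fro_Em_mul md mb) _.
  apply: le_trans (_ : ((cW ^+ (size s).+1 * G ^+ size s * (size s).+1%:R) ^+ 2 + cW ^+ 2) * eps <= _); last first.
    by rewrite ler_wpM2l// addr_ge0 ?sqr_ge0.
  have sq_le (f : T -> M) (c : R) : 0 <= c -> nrm f <= c * Num.sqrt eps -> nrm f ^+ 2 <= c ^+ 2 * eps.
    move=> c0 h; rewrite -[in leRHS](sqr_sqrtr eps_ge0) -exprMn.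
    by rewrite ler_pXn2r ?nnegrE ?nrm2_ge0 ?mulr_ge0 ?sqrtr_ge0.
  have dS a0 b0 : P a0 b0 -> nrm (fun w => Ga w a0 b0 - Gb a0 b0) <= Num.sqrt eps.
    move=> p0; rewrite -(ler_pXn2r (_ : 0 < 2)%N) ?nnegrE ?nrm2_ge0 ?sqrtr_ge0//.
    by rewrite [leRHS](sqr_sqrtr eps_ge0); exact: (eG p0).
  rewrite mulrDl; apply: lerD.
    apply: sq_le; first by rewrite !mulr_ge0 ?exprn_ge0.
    apply: le_trans (chain_diff (phi := fun _ _ => Num.sqrt eps) Ga_mbm Ga_le Gb_le dS a) _.
    rewrite -[leRHS]mulrA; apply: ler_wpM2l; first by rewrite mulr_ge0 ?exprn_ge0.
    have -> : adj_sum (fun _ _ : Pt => Num.sqrt eps) r s y = (size s).+1%:R * Num.sqrt eps.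
      elim: (s) (r) => [|r' s' ih'] r0 /=; first by rewrite mul1r.
      by rewrite ih' [in RHS]mulrS mulrDl mul1r.
    by [].
  apply: sq_le => //.
  apply: le_trans (nrm2Ml cW0 (mbm_cst _ _) (mdiff _ _ p) (bounded_ae_cst W_le)) _.
  by rewrite ler_wpM2l// dS.
apply: le_trans (froD _ _) _; rewrite mulrDl; apply: lerD.
  rewrite (EmMr mu _ md); apply: le_trans (froM _ _) _; rewrite mulrAC.
  apply: ler_pM; rewrite ?fro_ge0// ?ih//.
  apply: le_trans (froM _ _) _; apply: ler_pM; rewrite ?fro_ge0//; exact: Gb_le.
rewrite (EmMl mu _ mb) (EmMl mu _ (mdiff _ _ p)); apply: le_trans (froM _ _) _; rewrite -mulrA.
apply: ler_pM; rewrite ?fro_ge0//; first exact: chain_le W_le a Gb_le.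
apply: le_trans (froM _ _) _; apply: ler_pM; rewrite ?fro_ge0//.
exact: le_trans (bG p) be.
Qed.

End ChainBias.

End PathwiseDifference.

(** * Lipschitz and first-order estimates for a fixed sample *)

Section RandomArrays.
Context d (T : measurableType d) (R : realType) (mu : probability T R).
Variables (D : model R) (N : nat) (cW cL G : R).
Hypotheses (t_gt0 : 0 < horizon D) (N_gt0 : (0 < N)%N).
Hypotheses (W_le : frobenius (Ws D) <= cW) (cL_ge0 : 0 <= cL)
  (B_le : forall s1 s2 : R, 0 <= s1 -> s1 <= s2 -> s2 <= 2 * horizon D ->
       Normc.normc (corr D s2 s1) <= cL) (G_ge0 : 0 <= G).
Local Notation M := 'M[R[i]]_2.
Local Notation nrm := (nrm2 mu).
Local Notation h := (horizon D / N%:R).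
Local Notation mi := (mesh_index N).
Local Notation nt := (node_time D N).
Local Notation Mbar := (max_order D).
Local Notation orders := [seq m <- index_iota 1 Mbar.+1 | odd m].
Local Notation wt := (wt cW cL).

Lemma mbm_fro (f : T -> M) : mbm f -> exists c, forall x, frobenius (f x) <= c.
Proof.
move=> bf; have [c cP] := choice (fun k => (bf k).2).
exists (Num.sqrt (\sum_k c k ^+ 2)) => x; rewrite froE ler_sqrt ?sumr_ge0//; last first.
  by move=> k _; exact: sqr_ge0.
apply: ler_sum => k _; rewrite -expr2 -(real_normK (num_real (co k (f x)))).
by rewrite ler_pXn2r ?nnegrE//; apply: le_trans (cP k x).
Qed.

Variables (q p : nat) (ga : T -> nat -> nat -> M).
Hypothesis ga_mbm : forall j k, (q <= k)%N -> (k <= j <= p)%N -> mbm (fun w => ga w j k).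

Lemma mbm_nodes : exists c, forall w j k, (q <= k)%N -> (k <= j <= p)%N -> frobenius (ga w j k) <= c.
Proof.
have H jk : exists c, (q <= jk.2)%N -> (jk.2 <= jk.1 <= p)%N -> forall w, frobenius (ga w jk.1 jk.2) <= c.
  have [h1|h1] := boolP (q <= jk.2)%N; last by exists 0.
  have [h2|h2] := boolP (jk.2 <= jk.1 <= p)%N; last by exists 0.
  by have [c cP] := mbm_fro (ga_mbm h1 h2); exists c.
have [c cP] := choice H.
exists (\sum_(j < p.+1) \sum_(k < p.+1) `|c (j : nat, k : nat)|) => w j k qk kjp.
have /andP[kj jp] := kjp.
have jp' : (j < p.+1)%N by [].
have kp' : (k < p.+1)%N by rewrite ltnS (leq_trans kj).
rewrite (bigD1 (Ordinal jp'))//= (bigD1 (Ordinal kp'))//= -addrA.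
apply: le_trans (cP (j, k) qk kjp w) _; apply: le_trans (ler_norm _) _.
by rewrite lerDl addr_ge0 ?sumr_ge0// => ? _; apply: sumr_ge0.
Qed.

Lemma interp_mbm a b : good_pair D N q p a b -> mbm (fun w => interp (ga w) a b).
Proof.
move=> [_ gp]; rewrite (_ : (fun _ => _) = (fun w => \sum_(n <- inodes a b) n.1%:C%C *: ga w n.2.1 n.2.2)); last first.
  by apply/funext => w; rewrite interpE.
apply: mbm_sum => n nn; have [_ H] := gp n nn; have [->|ne] := eqVneq n.1 0.
  rewrite (_ : (fun _ => _) = (fun=> 0)); first exact: mbm_cst.
  by apply/funext => w; rewrite scale0r.
by have [? [? _]] := H ne; apply: mbmZ; exact: ga_mbm.
Qed.

Variable gb : nat -> nat -> M.
Hypothesis ga_le : {ae mu, forall w, forall j k, (q <= k)%N -> (k <= j <= p)%N -> frobenius (ga w j k) <= G}.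
Hypothesis gb_le : forall j k, (q <= k)%N -> (k <= j <= p)%N -> frobenius (gb j k) <= G.

Lemma interp_ae a b : good_pair D N q p a b -> bounded_ae mu (fun w => interp (ga w) a b) G.
Proof. by move=> gp; apply: ae_imply ga_le => w gw; exact: good_interp_le gp gw. Qed.

Lemma interpB (g g' : nat -> nat -> M) a b :
  interp g a b - interp g' a b = interp (fun j k => g j k - g' j k) a b.
Proof.
by rewrite !interpE -sumrB; apply: eq_bigr => n _; rewrite scalerBr.
Qed.

Let mdiff j k : (q <= k)%N -> (k <= j <= p)%N -> mbm (fun w => ga w j k - gb j k).
Proof. by move=> ? ?; apply: mbmB; [exact: ga_mbm|exact: mbm_cst]. Qed.

Lemma est_diffE x : (q <= p)%N ->
  (fun w => est D N p q (ga w) x - est D N p q gb x) =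
  (fun w => node_sgn R N p *: \sum_(m <- orders)
    ('i%C ^+ m.+1 * ((nt p - nt q) ^+ m / m`!%:R)%:C%C *
      ((-1) ^+ count (fun r => r < horizon D) (x m) * linked_sum (corr D) (rcons (x m) (nt p)))) *:
    (chain D (interp (ga w)) (q, 0) [seq locate D N p r | r <- x m] (p, 0)
      - chain D (interp gb) (q, 0) [seq locate D N p r | r <- x m] (p, 0))).
Proof.
move=> qp; apply/funext => w; rewrite /est -scalerBr -sumrB; congr (_ *: _); apply: eq_bigr => m _.
by rewrite -scalerBr /mesh_term /dyson_term -scalerBr scalerA.
Qed.

Lemma weight_le x m : (q <= p)%N -> (p <= (2 * N).+1)%N -> good_sample D N p q x -> m \in orders ->
  Normc.normc ('i%C ^+ m.+1 * ((nt p - nt q) ^+ m / m`!%:R)%:C%C *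
      ((-1) ^+ count (fun r => r < horizon D) (x m) * linked_sum (corr D) (rcons (x m) (nt p)))) <=
  (nt p - nt q) ^+ m / (double_fact (m - 1))%:R * Num.sqrt cL ^+ m.+1.
Proof.
move=> qp pN gx mo; have [m0 _] := order_pos mo; have [sm gm] := gx m mo.
rewrite Normc.normcM normc_weight// Normc.normcM normcX normcN Normc.normc1 expr1n mul1r.
have := linked_bound t_gt0 N_gt0 cL_ge0 B_le pN gm; rewrite sm => hb.
have t0 : 0 <= (nt p - nt q) ^+ m / m`!%:R.
  by rewrite divr_ge0// exprn_ge0// subr_ge0 node_time_le.
apply: le_trans (ler_wpM2l t0 hb) _.
by rewrite -(double_fact_ratio R m0) le_eqVlt; apply/orP; left; apply/eqP; ring.
Qed.

Lemma chain_pairs_mbm x m : (q <= p)%N -> q <> N -> good_sample D N p q x -> m \in orders ->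
  mbm (fun w => chain D (interp (ga w)) (q, 0) [seq locate D N p r | r <- x m] (p, 0)
      - chain D (interp gb) (q, 0) [seq locate D N p r | r <- x m] (p, 0)).
Proof.
move=> qp qN gx mo; have [sm gm] := gx m mo; apply: mbmB; last exact: mbm_cst.
exact: (chain_mbm D (Ga := fun w => interp (ga w)) (@interp_mbm) (all_adj_mesh t_gt0 N_gt0 qp qN gm)).
Qed.

Section Diff.
Variables (c kappa : R).
Hypotheses (c_ge0 : 0 <= c) (kappa_ge0 : 0 <= kappa).
Hypothesis dG : forall j k, (q <= k)%N -> (k <= j <= p)%N ->
  nrm (fun w => ga w j k - gb j k) <= c * expR (kappa * (((mi j)%:R - (mi k)%:R) * h)).

(** A node entering the interpolation may have a gap larger by h than the pair of times, whence the
    factor exp (kappa h). *)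
Lemma interp_diff a b : good_pair D N q p a b ->
  nrm (fun w => interp (ga w) a b - interp gb a b) <=
    c * expR (kappa * h) * expR (kappa * `|tm D N a - tm D N b|).
Proof.
move=> gpab; have [s1 gp] := gpab.
rewrite (_ : (fun _ => _) = (fun w => \sum_(n <- inodes a b) n.1%:C%C *: (ga w n.2.1 n.2.2 - gb n.2.1 n.2.2))); last first.
  by apply/funext => w; rewrite interpB interpE.
have mb n : n \in inodes a b -> mbm (fun w => n.1%:C%C *: (ga w n.2.1 n.2.2 - gb n.2.1 n.2.2)).
  move=> nn; have [_ H] := gp n nn; have [->|ne] := eqVneq n.1 0.
    rewrite (_ : (fun _ => _) = (fun=> 0)); first exact: mbm_cst.
    by apply/funext => w; rewrite scale0r.
  by have [? [? _]] := H ne; apply: mbmZ; exact: mdiff.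
apply: le_trans (nrm2_sum mu mb) _.
rewrite -[leRHS]mul1r -[X in _ <= X * _]s1 mulr_suml big_seq [leRHS]big_seq; apply: ler_sum => n nn.
have [n0 H] := gp n nn; have [e|ne] := eqVneq n.1 0.
  rewrite e mul0r (_ : (fun _ => _) = (fun=> 0)) ?nrm2_eq0//.
  by apply/funext => w; rewrite scale0r.
have [qk [kjp gap]] := H ne.
apply: le_trans (nrm2Z mu _ (mdiff qk kjp)) _; rewrite normcR ger0_norm// ler_wpM2l//.
apply: le_trans (dG qk kjp) _; rewrite -mulrA ler_wpM2l// -expRD ler_expR -mulrDr ler_wpM2l//.
by apply: le_trans gap _; rewrite [leRHS]addrC lerD2r ler_norm.
Qed.

(* Lipschitz constant of the order-[m] term in each of its propagators. *)
Definition ker (tau : R) (m : nat) : R := wt ^+ m.+1 * G ^+ m * tau ^+ m / (double_fact (m - 1))%:R.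

Lemma est_diff x : (q <= p)%N -> q <> N -> (p <= (2 * N).+1)%N -> good_sample D N p q x ->
  nrm (fun w => est D N p q (ga w) x - est D N p q gb x) <=
  c * expR (kappa * h) * \sum_(m <- orders) ker (nt p - nt q) m *
    adj_sum (fun u v => expR (kappa * `|u - v|)) (nt q) (x m) (nt p).
Proof.
move=> qp qN pN gx; rewrite (est_diffE _ qp).
have ms m : m \in orders -> mbm (fun w => ('i%C ^+ m.+1 * ((nt p - nt q) ^+ m / m`!%:R)%:C%C *
      ((-1) ^+ count (fun r => r < horizon D) (x m) * linked_sum (corr D) (rcons (x m) (nt p)))) *:
    (chain D (interp (ga w)) (q, 0) [seq locate D N p r | r <- x m] (p, 0)
      - chain D (interp gb) (q, 0) [seq locate D N p r | r <- x m] (p, 0))).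
  by move=> mo; apply: mbmZ; exact: chain_pairs_mbm.
apply: le_trans (nrm2Z mu _ (mbm_sum ms)) _; rewrite normc_sgn mul1r.
apply: le_trans (nrm2_sum mu ms) _.
rewrite mulr_sumr big_seq [leRHS]big_seq; apply: ler_sum => m mo.
have [m0 _] := order_pos mo; have [sm gm] := gx m mo.
apply: le_trans (nrm2Z mu _ (chain_pairs_mbm qp qN gx mo)) _.
have aam := all_adj_mesh t_gt0 N_gt0 qp qN gm.
have h1 := weight_le qp pN gx mo.
have h2 := chain_diff W_le G_ge0 (fun a b => @interp_mbm a b) (fun a b => @interp_ae a b)
  (fun a b gab => good_interp_le gab gb_le) (fun a b => @interp_diff a b) aam.
rewrite size_map sm in h2.
apply: le_trans (ler_pM (normc_ge0 _) (nrm2_ge0 _ _) h1 h2) _.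
set A := adj_sum _ _ _ _.
(* A located point carries the time it was located from, so weights in mesh coordinates are weights
   in times. *)
have -> : A = c * expR (kappa * h) * adj_sum (fun u v => expR (kappa * `|u - v|)) (nt q) (x m) (nt p).
  suff H s X tq : nt q <= tq -> tm D N X = tq -> path <=%R tq (rcons s (nt p)) ->
      adj_sum (fun a b => c * expR (kappa * h) * expR (kappa * `|tm D N a - tm D N b|)) X
        [seq locate D N p r | r <- s] (p, 0) =
      c * expR (kappa * h) * adj_sum (fun u v => expR (kappa * `|u - v|)) tq s (nt p).
    by apply: H => //; rewrite tm_node.
  elim: s X tq => [|r s ih] X tq qx eX /=; first by rewrite tm_node eX.
  move=> /andP[qr pr].
  have rp : r <= nt p by apply: path_rcons_le pr (mem_head _ _).
  have [_ tr] : pt N q p (locate D N p r) /\ tm D N (locate D N p r) = r.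
    by apply: pt_locate => //; rewrite rp (le_trans qx qr).
  by rewrite (ih _ r) ?tr ?eX ?(le_trans qx qr)// -mulrDr.
rewrite le_eqVlt; apply/orP; left; apply/eqP.
by rewrite /ker /wt [(_ * _) ^+ _]exprMn; ring.
Qed.

End Diff.

Section Bias.
Variables (beta eps : R).
Hypotheses (beta_ge0 : 0 <= beta) (eps_ge0 : 0 <= eps).
Hypothesis bG : forall j k, (q <= k)%N -> (k <= j <= p)%N ->
  frobenius (Em mu (fun w => ga w j k - gb j k)) <= beta.
Hypothesis eG : forall j k, (q <= k)%N -> (k <= j <= p)%N ->
  nrm (fun w => ga w j k - gb j k) <= eps.

Lemma interp_bias a b : good_pair D N q p a b ->
  frobenius (Em mu (fun w => interp (ga w) a b - interp gb a b)) <= beta.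
Proof.
move=> gpab; have [s1 gp] := gpab.
rewrite (_ : (fun _ => _) = (fun w => \sum_(n <- inodes a b) n.1%:C%C *: (ga w n.2.1 n.2.2 - gb n.2.1 n.2.2))); last first.
  by apply/funext => w; rewrite interpB interpE.
have mb n : n \in inodes a b -> mbm (fun w => n.1%:C%C *: (ga w n.2.1 n.2.2 - gb n.2.1 n.2.2)).
  move=> nn; have [_ H] := gp n nn; have [->|ne] := eqVneq n.1 0.
    rewrite (_ : (fun _ => _) = (fun=> 0)); first exact: mbm_cst.
    by apply/funext => w; rewrite scale0r.
  by have [? [? _]] := H ne; apply: mbmZ; exact: mdiff.
rewrite (Em_sum mu mb); apply: le_trans (fro_sum _ _ _) _.
rewrite -[leRHS]mul1r -[X in _ <= X * _]s1 mulr_suml big_seq [leRHS]big_seq; apply: ler_sum => n nn.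
have [n0 H] := gp n nn; have [e|ne] := eqVneq n.1 0.
  rewrite e mul0r (_ : (fun _ => _) = (fun=> 0)) ?Em_cst ?fro0//.
  by apply/funext => w; rewrite scale0r.
have [qk [kjp gap]] := H ne.
by rewrite EmZ; [rewrite froZr ger0_norm// ler_wpM2l// bG|exact: mdiff].
Qed.

Lemma est_bias x : (q <= p)%N -> q <> N -> (p <= (2 * N).+1)%N -> good_sample D N p q x ->
  frobenius (Em mu (fun w => est D N p q (ga w) x - est D N p q gb x)) <=
  \sum_(m <- orders) (nt p - nt q) ^+ m / (double_fact (m - 1))%:R * Num.sqrt cL ^+ m.+1 *
    (bias_cst cW G m * (beta + eps ^+ 2)).
Proof.
move=> qp qN pN gx; rewrite (est_diffE _ qp).
have ms m : m \in orders -> mbm (fun w => ('i%C ^+ m.+1 * ((nt p - nt q) ^+ m / m`!%:R)%:C%C *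
      ((-1) ^+ count (fun r => r < horizon D) (x m) * linked_sum (corr D) (rcons (x m) (nt p)))) *:
    (chain D (interp (ga w)) (q, 0) [seq locate D N p r | r <- x m] (p, 0)
      - chain D (interp gb) (q, 0) [seq locate D N p r | r <- x m] (p, 0))).
  by move=> mo; apply: mbmZ; exact: chain_pairs_mbm.
rewrite (EmZ mu _ (mbm_sum ms)) froZ normc_sgn mul1r (Em_sum mu ms).
apply: le_trans (fro_sum _ _ _) _.
rewrite big_seq [leRHS]big_seq; apply: ler_sum => m mo.
have [m0 _] := order_pos mo; have [sm gm] := gx m mo.
rewrite (EmZ mu _ (chain_pairs_mbm qp qN gx mo)) froZ.
have aam := all_adj_mesh t_gt0 N_gt0 qp qN gm.
apply: ler_pM; rewrite ?normc_ge0 ?fro_ge0//; first exact: weight_le.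
have eS a b : good_pair D N q p a b ->
    nrm (fun w => interp (ga w) a b - interp gb a b) ^+ 2 <= eps ^+ 2.
  move=> gab; rewrite ler_pXn2r ?nnegrE ?nrm2_ge0//.
  have := @interp_diff eps 0 eps_ge0 (lexx _) _ a b gab.
  rewrite !mul0r expR0 !mulr1; apply => j k qk kjp.
  by rewrite mul0r expR0 mulr1; exact: eG.
have := chain_bias W_le G_ge0 (fun a b => @interp_mbm a b) (fun a b => @interp_ae a b)
  (fun a b gab => good_interp_le gab gb_le) beta_ge0 (sqr_ge0 eps) (fun a b => @interp_bias a b) eS aam.
by rewrite size_map sm.
Qed.

End Bias.

End RandomArrays.

(** * Exact quadrature as an expectation *)

Section ExactSumExpectation.
Variables (R : realType) (D : model R) (N Ns : nat) (cW cL : R).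
Hypotheses (t_gt0 : 0 < horizon D) (N_gt0 : (0 < N)%N) (B_meas : measurable_corr D).
Hypotheses (W_le : frobenius (Ws D) <= cW) (cL_ge0 : 0 <= cL)
  (B_le : forall s1 s2 : R, 0 <= s1 -> s1 <= s2 -> s2 <= 2 * horizon D ->
       Normc.normc (corr D s2 s1) <= cL).
Local Notation Mbar := (max_order D).
Local Notation M := 'M[R[i]]_2.
Local Notation nt := (node_time D N).
Local Notation orders := [seq m <- index_iota 1 Mbar.+1 | odd m].
Local Notation J := (used_draw D N Ns).
Local Notation E := (sample_space R J).
Variable Q : probability E R.
Hypothesis indep : independent_coords Q.
Hypothesis law : forall a (ab : draw_lower D N a < draw_upper D N a), J a ->
  forall A : set R, measurable A -> Q [set x | A (x a)] = uniform_prob ab A.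

Local Notation blk b p q i x := (sorted_sample (clipped D N x) b p q i).

Lemma nodes_bounded (g : nat -> nat -> M) q p :
  exists G, forall j k, (q <= k)%N -> (k <= j <= p)%N -> frobenius (g j k) <= G.
Proof.
exists (\sum_(j < p.+1) \sum_(k < p.+1) frobenius (g j k)) => j k _ /andP[kj jp].
have jp' : (j < p.+1)%N by [].
have kp' : (k < p.+1)%N by rewrite ltnS (leq_trans kj).
rewrite (bigD1 (Ordinal jp'))//= (bigD1 (Ordinal kp'))//= -addrA lerDl addr_ge0 ?sumr_ge0//.
  by move=> ? _; exact: fro_ge0.
by move=> ? _; apply: sumr_ge0 => ? _; exact: fro_ge0.
Qed.

(** Off the ordered lists the integrand is set to 0, because B is measurable on the triangle of
    ordered times only. *)
Lemma nice_mesh_term (g : nat -> nat -> M) k p q n : (q <= p)%N -> q <> N -> (p <= (2 * N).+1)%N ->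
  nice n (fun s => if path <=%R (nt q) (rcons s (nt p)) && (size s == n)
                   then co k (mesh_term D N p q g s) else 0).
Proof.
move=> qp qN pN; have [G gG] := nodes_bounded g q p; split; last first.
  exists (`|(double_fact n)%:R * (wt cW cL * G) ^+ n.+1|) => s.
  case: ifP => [/andP[gs /eqP sn]|_]; last by rewrite normr0.
  apply: le_trans (co_le_fro _ _) _; apply: le_trans (ler_norm _).
  by rewrite -sn; apply: mesh_term_le.
move=> d V v ls _ sl ml.
rewrite (_ : (fun _ => _) = (fun x => if path <=%R (nt q) (rcons (evs ls x) (nt p))
    then co k (mesh_term D N p q g (evs ls x)) else 0)); last first.
  by apply/funext => x; rewrite size_map sl eqxx andbT.
have mpath : measurable_fun setT (fun x => path <=%R (nt q) (rcons (evs ls x) (nt p))).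
  suff : forall y : V -> R, measurable_fun setT y ->
      measurable_fun setT (fun x => path <=%R (y x) (rcons (evs ls x) (nt p))).
    by move=> /(_ _ (measurable_cst (nt q))).
  elim: ls {sl} ml => [|s ls ih] ml y my /=.
    apply: measurable_and; last exact: measurable_cst.
    by apply: measurable_fun_ler => //; exact: measurable_cst.
  have [ms {}ml] := mseq_behead ml.
  by apply: measurable_and; [exact: measurable_fun_ler|exact: (ih ml s ms)].
pose gd x := path <=%R (nt q) (rcons (evs ls x) (nt p)).
(* Where the list is not ordered it is replaced by a constant one, which is ordered, so that the
   measurability of the integrand can be used at every point. *)
pose ls' := [seq (fun x => if gd x then f x else nt q) | f <- ls].
have ls'E x : evs ls' x = if path <=%R (nt q) (rcons (evs ls x) (nt p)) then evs ls x else nseq (size ls) (nt q).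
  rewrite /evs /ls' -map_comp /comp -/(gd x); case: (gd x) => //.
  by elim: (ls) => //= ? ? ->.
have ml' : mseq ls'.
  have mgd : measurable_fun setT gd by [].
  rewrite /ls'; move: mgd {ls'E ls'}; move: gd => gd mgd.
  elim: (ls) ml => [|f l ih] /=; first by move=> _; exact: mseq_nil.
  move=> /mseq_behead[mf ml]; apply: mseq_cons; last exact: ih.
  by apply: measurable_fun_ifT => //; exact: measurable_cst.
have good x : path <=%R (nt q) (rcons (evs ls' x) (nt p)).
  rewrite ls'E; case: ifP => // _.
  elim: (size ls) => [|m ih] /=; first by rewrite node_time_le.
  by rewrite lexx.
have := mmeas_mesh_term t_gt0 N_gt0 B_meas (g := fun _ => g) qp qN pN (fun j k _ _ => @mmeas_cst _ V R (g j k)) ml' good.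
move=> /(_ k) h; rewrite (_ : (fun _ => _) = (fun x => if path <=%R (nt q) (rcons (evs ls x) (nt p))
    then co k (mesh_term D N p q g (evs ls' x)) else 0)).
  by apply: measurable_fun_ifT => //; exact: measurable_cst.
by apply/funext => x; rewrite ls'E; case: ifP.
Qed.

Lemma law_ae (a : draw) : J a -> draw_lower D N a < draw_upper D N a ->
  {ae Q, forall x, draw_lower D N a <= x a <= draw_upper D N a}.
Proof.
move=> Ja ab; have [S [mS S0 sS]] := uniform_ae ab.
exists [set x | S (x a)]; split.
- rewrite -[X in measurable X]setTI.
  by have := measurable_coord Ja; apply.
- by apply: etrans (law ab Ja mS) _.
- by move=> x /= h; apply: sS.
Qed.

Lemma mbm_mesh_sample (g : nat -> nat -> M) b p q i m : usable N Ns p q i -> m \in orders ->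
  mbm (fun y : E => mesh_term D N (final b p) q g (blk b p q i y m)).
Proof.
move=> us mo; have [qp qf qN pN fN] := usable_facts b us.
have [ls [ml sl el]] := mseq_blk b (@measurable_id _ E setT) us mo.
have [G gG] := nodes_bounded g q (final b p).
apply: (@mbm_bound _ _ _ _ ((double_fact m)%:R * (wt cW cL * G) ^+ m.+1)).
  move=> k; rewrite (_ : (fun _ => _) = (fun u => co k (mesh_term D N (final b p) q g (evs ls u)))); last first.
    by apply/funext => u; rewrite el.
  apply: (mmeas_mesh_term t_gt0 N_gt0 B_meas (g := fun _ => g)) => // [j k' _ _|u].
    exact: mmeas_cst.
  by have [_] := @good_blk _ D N t_gt0 N_gt0 u b p q i qp m mo; rewrite el.
move=> y; have [sy gy] := @good_blk _ D N t_gt0 N_gt0 y b p q i qp m mo.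
have := mesh_term_le t_gt0 N_gt0 W_le cL_ge0 B_le qf qN fN gy gG.
by rewrite sy.
Qed.

(** The prefactor is the volume of the simplex. The nodal values g are fixed here; only the sample
    is averaged. *)
Lemma simplex_int_expect (g : nat -> nat -> M) b p q i m : usable N Ns p q i -> m \in orders ->
  simplex_int m (nt q) (nt (final b p)) (mesh_term D N (final b p) q g) =
  ((nt (final b p) - nt q) ^+ m / m`!%:R)%:C%C *:
    Em Q (fun y => mesh_term D N (final b p) q g (blk b p q i y m)).
Proof.
move=> us mo; have [qp qf qN pN fN] := usable_facts b us.
have [m0 [om mM]] := order_pos mo.
(* On a degenerate interval there is no uniform density, and both sides vanish since m > 0. *)
have [e|ne] := eqVneq (nt q) (nt (final b p)).
  apply: mx_co => k; rewrite coZr co_simplex_int -e; case: m m0 {om mM mo} => // m _.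
  by rewrite sint_singleton subrr expr0n /= !mul0r.
have ab : nt q < nt (final b p) by rewrite lt_neqAle ne node_time_le.
apply: mx_co => k; rewrite coZr co_simplex_int co_Em.
pose f s := if path <=%R (nt q) (rcons s (nt (final b p))) && (size s == m)
                   then co k (mesh_term D N (final b p) q g s) else 0.
have nf : nice m f by exact: nice_mesh_term.
rewrite (@sint_ext _ m _ _ _ f) ?(ltW ab)//; last first.
  by move=> l sl pl; rewrite /f pl sl eqxx.
rewrite (sint_usint ab) //; last by rewrite (ltW ab) lexx.
pose s := [seq (b, p, q, i, m, c) | c <- iota 0 m] : seq draw.
have Js : all J s.
  by apply/allP => a /mapP[c]; rewrite mem_iota => /andP[_ cm] ->; exact: usable_draw.
have us' : uniq s by rewrite map_inj_uniq ?iota_uniq// => c c' [].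
have ss : size s = m by rewrite size_map size_iota.
have ls a : a \in s -> has_law Q (uniform_prob ab : probability (measurableTypeR R) R) a.
  move=> as_ A mA; have Ja := allP Js a as_.
  by move: as_ => /mapP[c _ ae]; subst a; exact: (@law (b, p, q, i, m, c) ab Ja A mA).
have aeU : {ae (uniform_prob ab : probability (measurableTypeR R) R), forall r, r <= nt (final b p)}.
  have [S [mS S0 sS]] := uniform_ae ab; exists S; split => // r /= h.
  by apply: sS => /= /andP[_ ?]; exact: h.
have := order_statistics indep (uniform_atomless ab) us' Js ls aeU; rewrite ss => /(_ f nf) e.
have m_neq0 : m`!%:R != 0 :> R by rewrite pnatr_eq0 -lt0n fact_gt0.
have -> : usint (uniform_prob ab : probability (measurableTypeR R) R) m (nt (final b p)) f =
  Ex Q (fun x => f (sort <=%R [seq x a | a <- s])) / m`!%:R by rewrite e mulrC mulKf.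
rewrite mulrA mulrAC; congr (_ * _).
apply: Ex_ae_eq; [|by have := mbm_mesh_sample g b us mo k|].
  have [mf [c fc]] := nf; split; last by exists c.
  have ms : @mseq R _ E [seq (fun x : E => x a) | a <- s] by exact: mseq_coords.
  have [ls1 [m1 s1 e1]] := mseq_sort ms.
  have := mf _ E (fun=> tt) ls1 (measurable_cst _).
  rewrite s1 size_map ss => /(_ erefl m1).
  by apply: eq_measurable_fun => x _; rewrite e1 /= /evs -map_comp.
have aes : {ae Q, forall x, forall a, a \in s -> nt q <= x a <= nt (final b p)}.
  apply: ae_all => a as_; have Ja := allP Js a as_.
  by move: as_ => /mapP[c _ ae]; subst a; exact: (@law_ae (b, p, q, i, m, c) Ja ab).
apply: ae_imply aes => x xs.
have -> : sort <=%R [seq x a | a <- s] = blk b p q i x m.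
  rewrite /sorted_sample /s -map_comp; congr (sort _ _); apply/eq_in_map => c cm /=.
  rewrite /clipped /clip /=.
  have /andP[h1 h2] : nt q <= x (b, p, q, i, m, c) <= nt (final b p).
    by apply: xs; apply/mapP; exists c.
  by rewrite (min_idPr h2) (max_idPr h1).
have [sb gb] := @good_blk _ D N t_gt0 N_gt0 x b p q i qp m mo.
by rewrite /f sb eqxx andbT; move: gb; rewrite /good_list => ->.
Qed.

Lemma mbm_est_cst (g : nat -> nat -> M) b p q i : usable N Ns p q i ->
  mbm (fun y : E => est D N (final b p) q g (blk b p q i y)).
Proof.
move=> us; apply: mbmZ.
by apply: mbm_sum => m mo; apply: mbmZ; exact: mbm_mesh_sample.
Qed.

Lemma exact_sum_expect (g : nat -> nat -> M) b p q i : usable N Ns p q i ->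
  exact_sum D N (final b p) q g = Em Q (fun y => est D N (final b p) q g (blk b p q i y)).
Proof.
move=> us; rewrite /est EmZ; last first.
  by apply: mbm_sum => m mo; apply: mbmZ; exact: mbm_mesh_sample.
rewrite Em_sum; last by move=> m mo; apply: mbmZ; exact: mbm_mesh_sample.
rewrite /exact_sum -big_filter; congr (_ *: _); rewrite big_seq [RHS]big_seq.
apply: eq_bigr => m mo; rewrite EmZ; last exact: mbm_mesh_sample.
by rewrite (simplex_int_expect g b us mo) scalerA.
Qed.

End ExactSumExpectation.

(** * Integral of an exponential *)

Section ExponentialIntegral.
Variable R : realType.

Lemma integral_expR_affine (a b k c : R) : a < b -> k != 0 ->
  \int[@lebesgue_measure R]_(r in `[a, b]) expR (k * r + c) =
  (expR (k * b + c) - expR (k * a + c)) / k.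
Proof.
move=> ab k0.
have df (r : R) : is_derive r 1 (fun r => expR (k * r + c) / k) (expR (k * r + c)).
  apply: is_derive_eq; rewrite !(scaler0, addr0, add0r, scale0r) /GRing.scale /=.
  by field.
have cf : continuous (fun r : R => expR (k * r + c)).
  move=> r; apply: (@continuous_comp _ _ _ (fun r : R => k * r + c) expR).
    by apply: cvgD; [apply: cvgM; [exact: cvg_cst|exact: cvg_id]|exact: cvg_cst].
  exact: continuous_expR.
have cF : continuous (fun r : R => expR (k * r + c) / k).
  by move=> r; apply: cvgM; [exact: cf|exact: cvg_cst].
have := @continuous_FTC2 R (fun r => expR (k * r + c)) (fun r => expR (k * r + c) / k) a b ab.
rewrite /Rintegral => ->; first by rewrite /= -mulrBl.
- exact: continuous_subspaceT.
- split.
  + by move=> x _; exact: ex_derive.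
  + by apply/cvg_at_right_filter; exact: cF.
  + by apply/cvg_at_left_filter; exact: cF.
- by move=> x _; rewrite derive1E; exact: derive_val.
Qed.

End ExponentialIntegral.

(** * Averages of the exponential weight *)

Section Kernel.
Variables (R : realType) (D : model R) (N Ns : nat).
Hypotheses (t_gt0 : 0 < horizon D) (N_gt0 : (0 < N)%N).
Local Notation Mbar := (max_order D).
Local Notation M := 'M[R[i]]_2.
Local Notation nt := (node_time D N).
Local Notation orders := [seq m <- index_iota 1 Mbar.+1 | odd m].
Local Notation J := (used_draw D N Ns).
Local Notation E := (sample_space R J).
Variable Q : probability E R.
Hypothesis law : forall a (ab : draw_lower D N a < draw_upper D N a), J a ->
  forall A : set R, measurable A -> Q [set x | A (x a)] = uniform_prob ab A.
Local Notation blk b p q i x := (sorted_sample (clipped D N x) b p q i).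

Variable kappa : R.
Hypothesis kappa_gt0 : 0 < kappa.

(* Dominates exp (kappa |u - v|) uniformly in u, and integrates to 2 exp (kappa (b - a)) / kappa. *)
Definition psi (a b v : R) : R := expR (kappa * (b - v)) + expR (kappa * (v - a)).

Lemma psi_ge0 a b v : 0 <= psi a b v.
Proof. by rewrite addr_ge0 ?expR_ge0. Qed.

Lemma expR_dist_psi a b u v : a <= u <= b -> a <= v <= b -> expR (kappa * `|u - v|) <= psi a b v.
Proof.
move=> /andP[au ub] /andP[av vb]; rewrite /psi.
have [uv|vu] := leP v u.
  apply: le_trans (_ : expR (kappa * (b - v)) <= _); last by rewrite lerDl expR_ge0.
  by rewrite ler_expR ler_wpM2l ?(ltW kappa_gt0)// ger0_norm ?subr_ge0// lerD2r.
apply: le_trans (_ : expR (kappa * (v - a)) <= _); last by rewrite lerDr expR_ge0.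
by rewrite ler_expR ler_wpM2l ?(ltW kappa_gt0)// ltr0_norm ?subr_lt0// opprB lerD2l lerN2.
Qed.

(** Each draw v is paired with all the draws and with the two end points; every such distance is
    dominated by [psi] at v, which makes size s + 2 copies. *)
Lemma adj_sum_psi a b (s : seq R) l : (0 < size s)%N -> perm_eq l s ->
  all (fun r => a <= r <= b) s -> a <= b ->
  adj_sum (fun u v => expR (kappa * `|u - v|)) a l b <= (size s + 2)%:R * \sum_(v <- s) psi a b v.
Proof.
move=> s0 ps /allP al ab.
have sl : size l = size s by exact: perm_size.
have p0 (u v : R) : 0 <= expR (kappa * `|u - v|) by exact: expR_ge0.
have aa : a <= a <= b by rewrite lexx. have bb : a <= b <= b by rewrite lexx ab.
have l0 : (0 < size l)%N by rewrite sl.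
apply: le_trans (adj_sum_pairs a b p0 l0) _.
rewrite !(perm_big _ ps) /=.
have -> : \sum_(u <- s) \sum_(v <- l) expR (kappa * `|u - v|) =
    \sum_(u <- s) \sum_(v <- s) expR (kappa * `|u - v|).
  by apply: eq_bigr => u _; rewrite (perm_big _ ps).
rewrite natrD mulrDl [leRHS]addrC [2 * _]mulrDl mul1r; apply: lerD; first apply: lerD.
- rewrite big_seq [leRHS]big_seq; apply: ler_sum => u us.
  by rewrite distrC expR_dist_psi// al.
- rewrite big_seq [leRHS]big_seq; apply: ler_sum => u us.
  by rewrite expR_dist_psi// al.
have -> : (size s)%:R * \sum_(v <- s) psi a b v = \sum_(u <- s) \sum_(v <- s) psi a b v.
  by rewrite [RHS]big_const_seq count_predT iter_addr_0 mulr_natl.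
rewrite big_seq [leRHS]big_seq.
apply: ler_sum => u us; rewrite big_seq [leRHS]big_seq; apply: ler_sum => v vs.
by rewrite expR_dist_psi// al.
Qed.

Lemma bm_psi_clip a b (f : R -> R) : measurable_fun setT f -> a <= b -> (forall r, a <= f r <= b) ->
  bm ((fun r => psi a b (f r)) : measurableTypeR R -> R).
Proof.
move=> mf ab fab; split.
  rewrite /psi; apply: measurable_funD; apply: measurableT_comp => //;
    apply: measurable_funM => //; apply: measurable_funB => //; exact: measurable_cst.
exists (expR (kappa * (b - a)) *+ 2) => r; rewrite ger0_norm ?psi_ge0// mulr2n /psi.
have /andP[h1 h2] := fab r.
by apply: lerD; rewrite ler_expR ler_wpM2l ?(ltW kappa_gt0)//; rewrite ?lerD2l ?lerD2r ?lerN2.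
Qed.

(** Stated with the length of the interval as a factor: this power of the gap is supplied by the
    volume of the simplex, and no division by a small gap occurs. *)
Lemma psi_expect a : J a -> draw_lower D N a < draw_upper D N a ->
  (draw_upper D N a - draw_lower D N a) *
    Ex Q (fun x => psi (draw_lower D N a) (draw_upper D N a) (clipped D N x a)) <=
  2 * (expR (kappa * (draw_upper D N a - draw_lower D N a)) / kappa).
Proof.
move=> Ja ab; set lo := draw_lower D N a; set up := draw_upper D N a.
have bp : bm ((fun r => psi lo up (clip D N a r)) : measurableTypeR R -> R).
  apply: bm_psi_clip; [exact: measurable_clip|exact: ltW|move=> r].
  by apply: clip_itv; exact: ltW.
rewrite (@Ex_coord R draw J Q (uniform_prob ab : probability (measurableTypeR R) R) a
  (fun r => psi lo up (clip D N a r)) Ja _ bp); last by move=> A mA; exact: law.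
rewrite -(Ex_uniform ab bp).
have -> : \int[@lebesgue_measure R]_(r in `[lo, up]) psi lo up (clip D N a r) =
  \int[@lebesgue_measure R]_(r in `[lo, up]) (expR (- kappa * r + kappa * up) + expR (kappa * r + - (kappa * lo))).
  apply: eq_Rintegral => r; rewrite inE /= in_itv /= => /andP[h1 h2].
  rewrite /clip -/lo -/up (min_idPr h2) (max_idPr h1) /psi.
  by congr (expR _ + expR _); ring.
have int k c : (@lebesgue_measure R).-integrable `[lo, up] (EFin \o (fun r => expR (k * r + c))).
  apply: continuous_compact_integrable => //; first exact: segment_compact.
  apply: continuous_subspaceT => r.
  apply: (@continuous_comp _ _ _ (fun r : R => k * r + c) expR).
    by apply: cvgD; [apply: cvgM; [exact: cvg_cst|exact: cvg_id]|exact: cvg_cst].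
  exact: continuous_expR.
have k0 : kappa != 0 by rewrite gt_eqF.
rewrite RintegralD// !integral_expR_affine// ?oppr_eq0//.
have -> : - kappa * up + kappa * up = 0 by ring.
have -> : - kappa * lo + kappa * up = kappa * (up - lo) by ring.
have -> : kappa * up - kappa * lo = kappa * (up - lo) by ring.
have -> : kappa * lo - kappa * lo = 0 by ring.
rewrite expR0 invrN mulrN -mulNr opprB -mulrDl mulrA ler_wpM2r ?invr_ge0 ?(ltW kappa_gt0)//.
lra.
Qed.

End Kernel.

(** * Noise and drift *)

Section RandomSlopes.
Variables (R : realType) (D : model R) (N Ns : nat) (cW cL : R).
Hypotheses (t_gt0 : 0 < horizon D) (N_gt0 : (0 < N)%N) (B_meas : measurable_corr D).
Hypotheses (W_le : frobenius (Ws D) <= cW) (cL_ge0 : 0 <= cL)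
  (B_le : forall s1 s2 : R, 0 <= s1 -> s1 <= s2 -> s2 <= 2 * horizon D ->
       Normc.normc (corr D s2 s1) <= cL).
Local Notation Mbar := (max_order D).
Local Notation M := 'M[R[i]]_2.
Local Notation nt := (node_time D N).
Local Notation h := (horizon D / N%:R).
Local Notation mi := (mesh_index N).
Local Notation orders := [seq m <- index_iota 1 Mbar.+1 | odd m].
Local Notation J := (used_draw D N Ns).
Local Notation E := (sample_space R J).
Variable Q : probability E R.
Hypothesis indep : independent_coords Q.
Hypothesis law : forall a (ab : draw_lower D N a < draw_upper D N a), J a ->
  forall A : set R, measurable A -> Q [set x | A (x a)] = uniform_prob ab A.
Local Notation blk b p q i x := (sorted_sample (clipped D N x) b p q i).
Local Notation es := (exact_sum_expect t_gt0 N_gt0 B_meas W_le cL_ge0 B_le indep law).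
Local Notation wt := (wt cW cL).
Local Notation sig := (sig D cW cL).

Lemma mbm_est d (V : measurableType d) (g : V -> nat -> nat -> M) (X : V -> E) b p q i :
  measurable_fun setT X -> usable N Ns p q i ->
  (forall j k, (q <= k)%N -> (k <= j <= final b p)%N -> mbm (fun u => g u j k)) ->
  mbm (fun u => est D N (final b p) q (g u) (blk b p q i (X u))).
Proof.
move=> mX us mg; have [qp qf qN pN fN] := usable_facts b us.
have [G gG] := mbm_nodes mg.
apply: (@mbm_bound _ _ _ _ (sig G (nt (final b p) - nt q))).
  by apply: (mmeas_est t_gt0 N_gt0 B_meas mX us) => j k h1 h2 l; exact: (mg j k h1 h2 l).1.
move=> u; apply: (est_le t_gt0 N_gt0 W_le cL_ge0 B_le qf qN fN); last by move=> j k; exact: gG.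
exact: good_blk.
Qed.

Section Step.
Variables (b : bool) (p q : nat).
Local Notation f := (final b p).
Local Notation tau := (nt f - nt q).
Variable ga : E -> nat -> nat -> M.
Hypothesis ga_mbm : forall j k, (q <= k)%N -> (k <= j <= f)%N -> mbm (fun x => ga x j k).

Lemma mbm2_est i : usable N Ns p q i ->
  mbm2 (fun x y : E => est D N f q (ga x) (blk b p q i y)).
Proof.
move=> us.
apply: (@mbm_est _ (E * E)%type (fun z => ga z.1) (fun z => z.2)) => //.
  exact: measurable_snd.
move=> j k h1 h2; exact: (@mbm2_fst _ _ E E R (fun x => ga x j k) (ga_mbm h1 h2)).
Qed.

Lemma mbm_exact i : usable N Ns p q i -> mbm (fun x : E => exact_sum D N f q (ga x)).
Proof.
move=> us; rewrite (_ : (fun _ => _) = (fun x => Em Q (fun y => est D N f q (ga x) (blk b p q i y)))).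
  exact: mbm_Em2 (mbm2_est us).
by apply/funext => x; exact: es.
Qed.

Lemma mbm_blk i : usable N Ns p q i -> mbm (fun x : E => est D N f q (ga x) (blk b p q i x)).
Proof. by move=> us; apply: (@mbm_est _ E ga id) => //; exact: measurable_id. Qed.

Lemma exact_sum_le i (g : nat -> nat -> M) G : usable N Ns p q i ->
  (forall j k, (q <= k)%N -> (k <= j <= f)%N -> frobenius (g j k) <= G) ->
  frobenius (exact_sum D N f q g) <= sig G tau.
Proof.
move=> us gG; have [qp qf qN pN fN] := usable_facts b us.
rewrite (es g b us).
have mE := mbm_est_cst t_gt0 N_gt0 B_meas W_le cL_ge0 B_le g b us.
have bd x : frobenius (est D N f q g (blk b p q i x)) <= sig G tau.
  by apply: (est_le t_gt0 N_gt0 W_le cL_ge0 B_le qf qN fN) => //; exact: good_blk.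
apply: le_trans (fro_Em_le Q mE) _; apply: nrm2_bound => //; last by apply: aeW => x.
exact: le_trans (fro_ge0 _) (bd point).
Qed.

(** Resampling the i-th block of the stage leaves B and the nodal values unchanged, while the
    estimator averages to the exact quadrature. *)
Lemma sample_mean i (B : E -> M) : usable N Ns p q i -> mbm B ->
  (forall x y, B (merge (fun a => a.1.1 == (b, p, q, i)) x y) = B x) ->
  (forall x y j k, (q <= k)%N -> (k <= j <= f)%N ->
     ga (merge (fun a => a.1.1 == (b, p, q, i)) x y) j k = ga x j k) ->
  Ex Q (fun x => ip (B x) (est D N f q (ga x) (blk b p q i x) - exact_sum D N f q (ga x))) = 0.
Proof.
move=> us mB dB dg; have [qp qf qN pN fN] := usable_facts b us.
pose F := fun a : draw => a.1.1 == (b, p, q, i).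
have bf : bm (fun x => ip (B x) (est D N f q (ga x) (blk b p q i x) - exact_sum D N f q (ga x))).
  by apply: bm_ip => //; apply: mbmB; [exact: mbm_blk|exact: mbm_exact us].
rewrite (Ex_merge indep F bf).
rewrite -[RHS](Ex_cst Q 0); congr (Ex Q _); apply/funext => x.
have me := mbm_est_cst t_gt0 N_gt0 B_meas W_le cL_ge0 B_le (ga x) b us.
have e1 : (fun y => ip (B (merge F x y)) (est D N f q (ga (merge F x y)) (blk b p q i (merge F x y))
    - exact_sum D N f q (ga (merge F x y)))) =
  (fun y => ip (B x) (est D N f q (ga x) (blk b p q i y) - exact_sum D N f q (ga x))).
  apply/funext => y; rewrite dB.
  have gx := dg x y.
  have -> : blk b p q i (merge F x y) = blk b p q i y.
    apply/funext => m; rewrite /sorted_sample; congr (sort _ _).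
    by apply: eq_map => c; rewrite /clipped /merge /F /= eqxx.
  rewrite (est_congr t_gt0 N_gt0 qf qN (good_blk t_gt0 N_gt0 y b i qp) gx).
  suff -> : exact_sum D N f q (ga (merge F x y)) = exact_sum D N f q (ga x) by [].
  have e2 : (fun z => est D N f q (ga (merge F x y)) (blk b p q i z)) =
      (fun z => est D N f q (ga x) (blk b p q i z)).
    by apply/funext => z; exact: (est_congr t_gt0 N_gt0 qf qN (good_blk t_gt0 N_gt0 z b i qp) gx).
  exact: (etrans (es (ga (merge F x y)) b us) (etrans (congr1 (Em Q) e2) (esym (es (ga x) b us)))).
transitivity (Ex Q (fun y => ip (B x) (est D N f q (ga x) (blk b p q i y) - exact_sum D N f q (ga x)))).
  exact: (congr1 (Ex Q) e1).
have mc := @mbm_cst _ E R (exact_sum D N f q (ga x)).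
have e3 : Em Q (fun y => est D N f q (ga x) (blk b p q i y) - exact_sum D N f q (ga x)) = 0.
  by apply: (etrans (EmB Q me mc)); rewrite Em_cst; apply/eqP; rewrite subr_eq0; apply/eqP; exact: (esym (es (ga x) b us)).
apply: (etrans (esym (ip_Em Q (B x) (mbmB me mc)))).
by rewrite e3 ipC ip0l.
Qed.

Hypothesis us : forall i, (i < Ns)%N -> usable N Ns p q i.
Hypothesis Ns_gt0 : (0 < Ns)%N.
Hypothesis ga_stable : forall i x y j k, (q <= k)%N -> (k <= j <= f)%N ->
  ga (merge (fun a => a.1.1 == (b, p, q, i)) x y) j k = ga x j k.

Definition zeta i (x : E) : M := est D N f q (ga x) (blk b p q i x) - exact_sum D N f q (ga x).

Definition noise (x : E) : M :=
  mc_sum D N Ns (sorted_sample (clipped D N x) b p q) f q (ga x) - exact_sum D N f q (ga x).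

Lemma mbm_zeta i : (i < Ns)%N -> mbm (zeta i).
Proof. by move=> iN; apply: mbmB; [exact: mbm_blk (us iN)|exact: mbm_exact (us iN)]. Qed.

Lemma noiseE x : noise x = (Ns%:R^-1)%:C%C *: \sum_(i <- index_iota 0 Ns) zeta i x.
Proof.
rewrite /noise mc_sumE sumrB scalerBr; congr (_ - _).
rewrite big_const_seq count_predT size_iota subn0 iter_addr_0 -[X in _ *: X]scaler_nat scalerA.
rewrite (_ : (Ns%:R^-1)%:C%C * Ns%:R = 1) ?scale1r//.
by rewrite -(rmorph_nat (@real_complex R)) -rmorphM mulVf ?rmorph1// pnatr_eq0 -lt0n.
Qed.

Lemma mbm_noise : mbm noise.
Proof.
rewrite (_ : noise = fun x => (Ns%:R^-1)%:C%C *: \sum_(i <- index_iota 0 Ns) zeta i x).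
  by apply: mbmZ; apply: mbm_sum => i; rewrite mem_index_iota => /andP[_ iN]; exact: mbm_zeta.
by apply/funext => x; exact: noiseE.
Qed.

Lemma noise_orthogonal (B : E -> M) : mbm B ->
  (forall i x y, B (merge (fun a => a.1.1 == (b, p, q, i)) x y) = B x) ->
  Ex Q (fun x => ip (B x) (noise x)) = 0.
Proof.
move=> mB dB.
have -> : (fun x => ip (B x) (noise x)) =
  (fun x => Ns%:R^-1 * \sum_(i <- index_iota 0 Ns) ip (B x) (zeta i x)).
  apply/funext => x; rewrite noiseE ipZr; congr (_ * _).
  by rewrite ipC; elim: (index_iota _ _) => [|i r ih]; rewrite ?big_nil ?ip0l// !big_cons ipDl ih ipC.
have bi i : i \in index_iota 0 Ns -> bm (fun x => ip (B x) (zeta i x)).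
  by rewrite mem_index_iota => /andP[_ iN]; apply: bm_ip => //; exact: mbm_zeta.
rewrite ExZ; last exact: bm_sum.
rewrite Ex_sum// big_seq big1 ?mulr0// => i; rewrite mem_index_iota => /andP[_ iN].
exact: (sample_mean (us iN) mB (dB i) (ga_stable i)).
Qed.

Lemma noise_mean : Em Q noise = 0.
Proof.
apply: fro_eq0; apply/eqP; rewrite -sqrf_eq0 fro_sqr (ip_Em Q _ mbm_noise) noise_orthogonal//.
exact: mbm_cst.
Qed.

Variable G : R.
Hypothesis ga_le : {ae Q, forall x, forall j k, (q <= k)%N -> (k <= j <= f)%N -> frobenius (ga x j k) <= G}.

Lemma sig_ge0 : 0 <= sig G tau.
Proof.
have [qp qf qN pN fN] := usable_facts b (us Ns_gt0).
have G0 : {ae Q, forall x : E, 0 <= G}.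
  apply: ae_imply ga_le => x /(_ q q (leqnn _)); rewrite leqnn qf => /(_ isT).
  by apply: le_trans; exact: fro_ge0.
have {}G0 : 0 <= G.
  by have := Ex_ae_le (bm_cst _ 0) (bm_cst _ G) G0; rewrite !Ex_cst.
have w0 := wt_ge0 cL W_le.
have t0 : 0 <= tau by rewrite subr_ge0 node_time_le.
apply: sumr_ge0 => m _; apply: mulr_ge0; last by rewrite invr_ge0 ler0n.
by apply: mulr_ge0; apply: exprn_ge0 => //; exact: mulr_ge0.
Qed.

Lemma zeta_le i : (i < Ns)%N -> nrm2 Q (zeta i) <= 2 * sig G tau.
Proof.
move=> iN; have [qp qf qN pN fN] := usable_facts b (us iN).
apply: nrm2_bound; [by rewrite mulr_ge0// sig_ge0|exact: mbm_zeta|].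
apply: ae_imply ga_le => x gx; rewrite mulr_natl mulr2n.
rewrite /zeta -[- exact_sum _ _ _ _ _]opprK opprK; apply: le_trans (froD _ _) _.
rewrite froN; apply: lerD; last exact: (exact_sum_le (us iN) gx).
exact: (est_le t_gt0 N_gt0 W_le cL_ge0 B_le qf qN fN (good_blk t_gt0 N_gt0 x b i qp) gx).
Qed.

Lemma zeta_stable i n x y : i != n ->
  zeta i (merge (fun a => a.1.1 == (b, p, q, n)) x y) = zeta i x.
Proof.
move=> ni.
have [qp qf qN pN fN] := usable_facts b (us Ns_gt0).
have gx := ga_stable n x y; set x' := merge _ x y in gx *.
have eb : blk b p q i x' = blk b p q i x.
  apply/funext => m; rewrite /sorted_sample; congr (sort _ _).
  apply: eq_map => c; rewrite /clipped /x' /merge /=.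
  by rewrite !xpair_eqE !eqxx (negbTE ni).
have e2 : (fun z => est D N f q (ga x') (blk b p q 0 z)) = (fun z => est D N f q (ga x) (blk b p q 0 z)).
  by apply/funext => z; exact: (est_congr t_gt0 N_gt0 qf qN (good_blk t_gt0 N_gt0 z b 0 qp) gx).
have e3 : exact_sum D N f q (ga x') = exact_sum D N f q (ga x).
  exact: (etrans (es (ga x') b (us Ns_gt0)) (etrans (congr1 (Em Q) e2) (esym (es (ga x) b (us Ns_gt0))))).
have e4 := est_congr t_gt0 N_gt0 qf qN (good_blk t_gt0 N_gt0 x b i qp) gx.
by rewrite /zeta e3 eb e4.
Qed.

(** The terms [zeta] are mutually orthogonal, because block n does not enter the earlier ones; hence
    the mean squares add and the average gains 1 / sqrt Ns. The 2 is the trivial bound of estimator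
    minus quadrature. *)
Lemma noise_le : nrm2 Q noise <= 2 * sig G tau / Num.sqrt Ns%:R.
Proof.
have s0 := sig_ge0.
have H n : (n <= Ns)%N -> mbm (fun x => \sum_(i <- index_iota 0 n) zeta i x) /\
    nrm2 Q (fun x => \sum_(i <- index_iota 0 n) zeta i x) ^+ 2 <= n%:R * (2 * sig G tau) ^+ 2.
  elim: n => [|n ih] nN.
    rewrite (_ : (fun _ => _) = (fun=> 0)); last by apply/funext => x; rewrite big_nil.
    by split; [exact: mbm_cst|rewrite nrm2_eq0 expr0n mul0r].
  have [mS leS] := ih (ltnW nN).
  rewrite (_ : (fun _ => _) = (fun x => \sum_(i <- index_iota 0 n) zeta i x + zeta n x)); last first.
    by apply/funext => x; rewrite big_nat_recr.
  have mz := mbm_zeta nN.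
  split; first exact: mbmD.
  rewrite Ex_ip_cross//.
    rewrite -natr1 mulrDl mul1r; apply: lerD => //.
    by rewrite lerXn2r ?nnegrE ?nrm2_ge0 ?mulr_ge0//; exact: zeta_le.
  apply: (sample_mean (us nN) mS _ (ga_stable n)).
  move=> x y; apply: eq_big_seq => i; rewrite mem_index_iota => /andP[_ iN].
  by rewrite (@zeta_stable i n x y (negbT (ltn_eqF iN))).
have [mS leS] := H Ns (leqnn _).
have Nr : 0 < Ns%:R :> R by rewrite ltr0n.
rewrite (_ : noise = fun x => (Ns%:R^-1)%:C%C *: \sum_(i <- index_iota 0 Ns) zeta i x); last first.
  by apply/funext => x; exact: noiseE.
apply: le_trans (nrm2Z Q _ mS) _; rewrite normcR ger0_norm ?invr_ge0 ?ler0n//.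
have : nrm2 Q (fun x => \sum_(i <- index_iota 0 Ns) zeta i x) <= Num.sqrt Ns%:R * (2 * sig G tau).
  rewrite -(@ler_pXn2r _ 2)// ?nnegrE ?nrm2_ge0 ?mulr_ge0 ?sqrtr_ge0//.
  by rewrite exprMn (sqr_sqrtr (ltW Nr)).
move=> hh; apply: le_trans (ler_wpM2l _ hh) _; first by rewrite invr_ge0 ltW.
have s0' : Num.sqrt Ns%:R != 0 :> R by rewrite gt_eqF ?sqrtr_gt0.
rewrite le_eqVlt; apply/orP; left; apply/eqP.
rewrite -[in LHS](sqr_sqrtr (ltW Nr)) sqrtr_sqr ger0_norm ?sqrtr_ge0//.
by field.
Qed.

End Step.
End RandomSlopes.

(** * The drift in mean square and in mean *)

Section Drift.
Variables (R : realType) (D : model R) (N Ns : nat) (cW cL : R).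
Hypotheses (t_gt0 : 0 < horizon D) (N_gt0 : (0 < N)%N) (B_meas : measurable_corr D).
Hypotheses (W_le : frobenius (Ws D) <= cW) (cL_ge0 : 0 <= cL)
  (B_le : forall s1 s2 : R, 0 <= s1 -> s1 <= s2 -> s2 <= 2 * horizon D ->
       Normc.normc (corr D s2 s1) <= cL).
Local Notation Mbar := (max_order D).
Local Notation M := 'M[R[i]]_2.
Local Notation nt := (node_time D N).
Local Notation h := (horizon D / N%:R).
Local Notation mi := (mesh_index N).
Local Notation orders := [seq m <- index_iota 1 Mbar.+1 | odd m].
Local Notation J := (used_draw D N Ns).
Local Notation E := (sample_space R J).
Variable Q : probability E R.
Hypothesis indep : independent_coords Q.
Hypothesis law : forall a (ab : draw_lower D N a < draw_upper D N a), J a ->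
  forall A : set R, measurable A -> Q [set x | A (x a)] = uniform_prob ab A.
Local Notation blk b p q i x := (sorted_sample (clipped D N x) b p q i).
Local Notation es := (exact_sum_expect t_gt0 N_gt0 B_meas W_le cL_ge0 B_le indep law).
Local Notation wt := (wt cW cL).

(** The kernel [ker] with one power of tau spent on [psi_expect]. In the last factor, 2 stems from
    [psi_expect], m from the number of draws and m + 2 from [adj_sum_psi]. *)
Definition drift_rate (G tau : R) : R :=
  \sum_(m <- orders) wt ^+ m.+1 * G ^+ m * tau ^+ (m - 1) / (double_fact (m - 1))%:R *
    (2 * m%:R * (m + 2)%:R).

Variables (b : bool) (p q i : nat).
Hypothesis us : usable N Ns p q i.
Local Notation f := (final b p).
Local Notation tau := (nt f - nt q).
Variables (ga : E -> nat -> nat -> M) (gb : nat -> nat -> M) (G : R).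
Hypothesis ga_mbm : forall j k, (q <= k)%N -> (k <= j <= f)%N -> mbm (fun x => ga x j k).
Hypothesis G_ge0 : 0 <= G.
Hypothesis ga_le : {ae Q, forall x, forall j k, (q <= k)%N -> (k <= j <= f)%N -> frobenius (ga x j k) <= G}.
Hypothesis gb_le : forall j k, (q <= k)%N -> (k <= j <= f)%N -> frobenius (gb j k) <= G.

Let ed (x y : E) : M := est D N f q (ga x) (blk b p q i y) - est D N f q gb (blk b p q i y).

Let ed_mbm : mbm2 ed.
Proof.
apply: mbmB; first exact: (mbm2_est t_gt0 N_gt0 B_meas W_le cL_ge0 B_le ga_mbm us).
apply: (mbm_est t_gt0 N_gt0 B_meas W_le cL_ge0 B_le (V := (E * E)%type) (g := fun _ => gb) (X := fun z : E * E => z.2) _ us).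
  exact: measurable_snd.
by move=> j k _ _; exact: mbm_cst.
Qed.

Let drift_eq : (fun x => exact_sum D N f q (ga x) - exact_sum D N f q gb) = (fun x => Em Q (ed x)).
Proof.
apply/funext => x.
have ma := mbm_est_cst t_gt0 N_gt0 B_meas W_le cL_ge0 B_le (ga x) b us.
have mb := mbm_est_cst t_gt0 N_gt0 B_meas W_le cL_ge0 B_le gb b us.
have e1 := es (ga x) b us. have e2 := es gb b us.
have e3 := EmB Q ma mb.
by rewrite e1 e2 -e3.
Qed.

Section L2.
Variables (c kappa : R).
Hypotheses (c_ge0 : 0 <= c) (kappa_gt0 : 0 < kappa).
Hypothesis dG : forall j k, (q <= k)%N -> (k <= j <= f)%N ->
  nrm2 Q (fun x => ga x j k - gb j k) <= c * expR (kappa * (((mi j)%:R - (mi k)%:R) * h)).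

Lemma drift_le : nrm2 Q (fun x => exact_sum D N f q (ga x) - exact_sum D N f q gb) <=
  c * expR (kappa * h) * (expR (kappa * tau) / kappa * drift_rate G tau).
Proof.
have [qp qf qN pN fN] := usable_facts b us.
have ntle : nt q <= nt f by exact: node_time_le.
have w0 : 0 <= wt := wt_ge0 cL W_le.
have tau0 : 0 <= tau by rewrite subr_ge0.
have lowE m k : draw_lower D N (b, p, q, i, m, k) = nt q by [].
have upE m k : draw_upper D N (b, p, q, i, m, k) = nt f by [].
pose ps m k (y : E) := psi kappa (nt q) (nt f) (clipped D N y (b, p, q, i, m, k)).
have bps m k : m \in orders -> (k < m)%N -> bm (ps m k).
  move=> mo km.
  have Ja : J (b, p, q, i, m, k) by exact: usable_draw.
  have [mf [c0 fc]] := @bm_psi_clip _ _ kappa_gt0 (nt q) (nt f) _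
    (measurable_clip D N (b, p, q, i, m, k)) ntle (fun r => @clip_itv _ D N (b, p, q, i, m, k) r ntle).
  split; last by exists c0 => y; exact: fc.
  have mc : measurable_fun setT (fun x : E => x (b, p, q, i, m, k) : measurableTypeR R) by exact: measurable_coord.
  exact: (measurableT_comp mf mc).
have ker0 m : 0 <= ker cW cL G tau m.
  apply: mulr_ge0; last by rewrite invr_ge0 ler0n.
  by rewrite !mulr_ge0 ?exprn_ge0.
pose bb y := c * expR (kappa * h) * \sum_(m <- orders) ker cW cL G tau m *
   ((m + 2)%:R * \sum_(k <- iota 0 m) ps m k y).
have bS m : m \in orders -> bm (fun y => \sum_(k <- iota 0 m) ps m k y).
  by move=> mo; apply: bm_sum => k; rewrite mem_iota => /andP[_ km]; exact: bps.
have bT m : m \in orders -> bm (fun y => ker cW cL G tau m * ((m + 2)%:R * \sum_(k <- iota 0 m) ps m k y)).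
  by move=> mo; apply: bmM; [exact: bm_cst|apply: bmM; [exact: bm_cst|exact: bS]].
have bbb : bm bb by apply: bmM; [exact: bm_cst|exact: bm_sum].
have C0 : 0 <= c * expR (kappa * h) by rewrite mulr_ge0 ?expR_ge0.
have le_b y : nrm2 Q (ed ^~ y) <= bb y.
  have gs := good_blk t_gt0 N_gt0 y b i qp.
  apply: le_trans (est_diff t_gt0 N_gt0 W_le cL_ge0 B_le G_ge0 ga_mbm ga_le gb_le c_ge0 (ltW kappa_gt0) dG qf qN fN gs) _.
  apply: ler_wpM2l => //; rewrite big_seq [leRHS]big_seq; apply: ler_sum => m mo.
  have [m0 _] := order_pos mo.
  apply: ler_wpM2l => //.
  pose s := [seq clipped D N y (b, p, q, i, m, k) | k <- iota 0 m].
  have := @adj_sum_psi _ _ kappa_gt0 (nt q) (nt f) s (blk b p q i y m).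
  rewrite size_map size_iota big_map; apply => //.
    by rewrite /sorted_sample perm_sort perm_refl.
  by apply/allP => r /mapP[k _ ->]; exact: (@clip_itv _ D N (b, p, q, i, m, k)).
rewrite drift_eq; apply: le_trans (nrm2_Em_le Q ed_mbm bbb le_b) _.
rewrite ExZ; last exact: bm_sum.
apply: ler_wpM2l => //; rewrite Ex_sum// /drift_rate mulr_sumr big_seq [leRHS]big_seq.
apply: ler_sum => m mo; have [m0 _] := order_pos mo.
rewrite ExZ; last by apply: bmM; [exact: bm_cst|exact: bS].
rewrite ExZ; last exact: bS.
rewrite Ex_sum; last by move=> k; rewrite mem_iota => /andP[_ km]; exact: bps.
pose A := wt ^+ m.+1 * G ^+ m * tau ^+ (m - 1) / (double_fact (m - 1))%:R.
have A0 : 0 <= A.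
  apply: mulr_ge0; last by rewrite invr_ge0 ler0n.
  by rewrite !mulr_ge0 ?exprn_ge0.
have kerA : ker cW cL G tau m = A * tau.
  have tE : tau ^+ m = tau ^+ (m - 1) * tau by rewrite -exprSr -{1}(subnK m0) addn1.
  by rewrite /ker /A tE; ring.
have X0 : 0 <= expR (kappa * tau) / kappa by rewrite divr_ge0 ?expR_ge0 ?ltW.
(* The power of tau split off from the kernel is paired here with the average of the weight. *)
have sumle : tau * \sum_(k <- iota 0 m) Ex Q (ps m k) <= m%:R * (2 * (expR (kappa * tau) / kappa)).
  rewrite mulr_sumr [m in leRHS](_ : m = size (iota 0 m)); last by rewrite size_iota.
  have -> : (size (iota 0 m))%:R * (2 * (expR (kappa * tau) / kappa)) =
      \sum_(k <- iota 0 m) (2 * (expR (kappa * tau) / kappa)).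
    by rewrite [RHS]big_const_seq count_predT iter_addr_0 mulr_natl.
  rewrite big_seq [leRHS]big_seq; apply: ler_sum => k; rewrite mem_iota => /andP[_ km].
  have [e|ne] := eqVneq (nt q) (nt f).
    by rewrite -e subrr mul0r mulr_ge0// divr_ge0 ?expR_ge0 ?ltW.
  have ab : nt q < nt f by rewrite lt_neqAle ne.
  exact: (@psi_expect _ D N Ns Q law _ kappa_gt0 (b, p, q, i, m, k) (usable_draw b us mo km) ab).
rewrite kerA -/A.
have -> : A * tau * ((m + 2)%:R * \sum_(k <- iota 0 m) Ex Q (ps m k)) =
  A * (m + 2)%:R * (tau * \sum_(k <- iota 0 m) Ex Q (ps m k)) by ring.
apply: le_trans (ler_wpM2l _ sumle) _; first by rewrite mulr_ge0 ?ler0n.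
by rewrite le_eqVlt; apply/orP; left; apply/eqP; ring.
Qed.

End L2.

Section Bias.
Variables (beta eps : R).
Hypotheses (beta_ge0 : 0 <= beta) (eps_ge0 : 0 <= eps).
Hypothesis bG : forall j k, (q <= k)%N -> (k <= j <= f)%N ->
  frobenius (Em Q (fun x => ga x j k - gb j k)) <= beta.
Hypothesis eG : forall j k, (q <= k)%N -> (k <= j <= f)%N ->
  nrm2 Q (fun x => ga x j k - gb j k) <= eps.

(** By Fubini the mean over the nodal values may be taken first, at a frozen sample, where
    [est_bias] applies. *)
Lemma drift_bias : frobenius (Em Q (fun x => exact_sum D N f q (ga x) - exact_sum D N f q gb)) <=
  \sum_(m <- orders) tau ^+ m / (double_fact (m - 1))%:R * Num.sqrt cL ^+ m.+1 *
    (bias_cst cW G m * (beta + eps ^+ 2)).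
Proof.
have [qp qf qN pN fN] := usable_facts b us.
rewrite drift_eq (Em_fubini Q Q ed_mbm).
have bd y : frobenius (Em Q (ed ^~ y)) <=
  \sum_(m <- orders) tau ^+ m / (double_fact (m - 1))%:R * Num.sqrt cL ^+ m.+1 *
    (bias_cst cW G m * (beta + eps ^+ 2)).
  exact: (est_bias t_gt0 N_gt0 W_le cL_ge0 B_le G_ge0 ga_mbm ga_le gb_le beta_ge0 eps_ge0 bG eG
    qf qN fN (good_blk t_gt0 N_gt0 y b i qp)).
have mE : mbm (fun y => Em Q (ed ^~ y)).
  suff mS : mbm2 (fun y x => ed x y) by exact: mbm_Em2 mS.
  move=> k; have [mk [c0 hc]] := ed_mbm k; split; last by exists c0 => z; exact: (hc (z.2, z.1)).
  have msw : measurable_fun setT (fun z : E * E => (z.2, z.1)).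
    by apply/prod_measurable_funP; split; [exact: measurable_snd|exact: measurable_fst].
  exact: (measurableT_comp mk msw).
apply: le_trans (fro_Em_le Q mE) _; apply: nrm2_bound => //; last by apply: aeW => y; exact: bd.
exact: le_trans (fro_ge0 _) (bd point).
Qed.

End Bias.
End Drift.

(** * The scheme as a function of the draws *)

Section RandomScheme.
Variables (R : realType) (D : model R) (N Ns : nat) (cW cL : R).
Hypotheses (t_gt0 : 0 < horizon D) (N_gt0 : (0 < N)%N) (B_meas : measurable_corr D).
Hypotheses (W_le : frobenius (Ws D) <= cW) (cL_ge0 : 0 <= cL)
  (B_le : forall s1 s2 : R, 0 <= s1 -> s1 <= s2 -> s2 <= 2 * horizon D ->
       Normc.normc (corr D s2 s1) <= cL).
Hypothesis Ns_gt0 : (0 < Ns)%N.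
Local Notation Mbar := (max_order D).
Local Notation M := 'M[R[i]]_2.
Local Notation nt := (node_time D N).
Local Notation h := (horizon D / N%:R).
Local Notation orders := [seq m <- index_iota 1 Mbar.+1 | odd m].
Local Notation J := (used_draw D N Ns).
Local Notation E := (sample_space R J).
Variable Q : probability E R.
Hypothesis indep : independent_coords Q.
Hypothesis law : forall a (ab : draw_lower D N a < draw_upper D N a), J a ->
  forall A : set R, measurable A -> Q [set x | A (x a)] = uniform_prob ab A.
Local Notation blk b p q i x := (sorted_sample (clipped D N x) b p q i).
Local Notation es := (exact_sum_expect t_gt0 N_gt0 B_meas W_le cL_ge0 B_le indep law).

Definition regular p q := [&& (q <= p <= 2 * N)%N, p != N & q != N].

Lemma regular_usable p q i : regular p q -> (i < Ns)%N -> usable N Ns p q i.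
Proof. by move=> /and3P[h1 h2 h3] iN; rewrite /usable h1 h2 h3. Qed.

Lemma exact_sum_congr b p q g g' : regular p q -> agree q (final b p) g g' ->
  exact_sum D N (final b p) q g = exact_sum D N (final b p) q g'.
Proof.
move=> rg ag; have us := regular_usable rg Ns_gt0.
have [qp qf qN pN fN] := usable_facts b us.
have e2 : (fun z : E => est D N (final b p) q g (blk b p q 0 z)) =
    (fun z => est D N (final b p) q g' (blk b p q 0 z)).
  by apply/funext => z; exact: (est_congr t_gt0 N_gt0 qf qN (good_blk t_gt0 N_gt0 z b 0 qp) ag).
exact: (etrans (es g b us) (etrans (congr1 (Em Q) e2) (esym (es g' b us)))).
Qed.

Lemma mc_sum_congr b p q g g' (x x' : draw -> R) : regular p q -> agree q (final b p) g g' ->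
  (forall i, (i < Ns)%N -> blk b p q i x = blk b p q i x') ->
  mc_sum D N Ns (sorted_sample (clipped D N x) b p q) (final b p) q g =
  mc_sum D N Ns (sorted_sample (clipped D N x') b p q) (final b p) q g'.
Proof.
move=> rg ag ex; have us := regular_usable rg Ns_gt0.
have [qp qf qN pN fN] := usable_facts b us.
rewrite !mc_sumE; congr (_ *: _); apply: eq_big_seq => i; rewrite mem_index_iota => /andP[_ iN].
rewrite -(ex i iN).
exact: (est_congr t_gt0 N_gt0 qf qN (good_blk t_gt0 N_gt0 x b i qp) ag).
Qed.

Definition sloped b p q g := exact_sum D N (final b p) q g.
Definition slopem (x : draw -> R) b p q g :=
  mc_sum D N Ns (sorted_sample (clipped D N x) b p q) (final b p) q g.

Definition Gt (x : draw -> R) := scheme D N (slopem x false) (slopem x true).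
Definition Gd := scheme D N (sloped false) (sloped true).

Lemma GdE : det_scheme D N = Gd. Proof. by []. Qed.

Lemma agree_d p q : regular p q ->
  slopes_agree (sloped false) (sloped true) (sloped false) (sloped true) p q.
Proof.
by move=> rg; split => g g' ag; [exact: (@exact_sum_congr false _ _ _ _ rg ag)|exact: (@exact_sum_congr true _ _ _ _ rg ag)].
Qed.

Lemma agree_m x x' p q : regular p q ->
  (forall b i, (i < Ns)%N -> blk b p q i x = blk b p q i x') ->
  slopes_agree (slopem x false) (slopem x true) (slopem x' false) (slopem x' true) p q.
Proof.
by move=> rg ex; split => g g' ag; [exact: (@mc_sum_congr false _ _ _ _ _ _ rg ag (ex false))|exact: (@mc_sum_congr true _ _ _ _ _ _ rg ag (ex true))].
Qed.

Definition predd p q := predictor D N (sloped false) p q Gd.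
Definition predm p q x := predictor D N (slopem x false) p q (Gt x).
Definition stagem (b : bool) p q x := if b then set_node (Gt x) p.+1 q (predm p q x) else Gt x.
Definition staged (b : bool) p q := if b then set_node Gd p.+1 q (predd p q) else Gd.

Let heun_step K1 K2 (g : nat -> nat -> M) p q : regular p q ->
  scheme D N K1 K2 p.+1 q = next_value D N K1 K2 p q g ->
  scheme D N K1 K2 p.+1 q = heun D (sgn_step D N p) (g p q)
    + (h / 2)%:C%C *: stage D (sgn_step D N p) (K1 p q g)
    + (h / 2)%:C%C *: K2 p q (set_node g p.+1 q (predictor D N K1 p q g)).
Proof.
move=> /and3P[h1 h2 h3] ->; rewrite /next_value (negbTE h3) (negbTE h2).
exact: correctorE.
Qed.

Lemma Gd_step p q : regular p q -> Gd p.+1 q = heun D (sgn_step D N p) (Gd p q)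
    + (h / 2)%:C%C *: stage D (sgn_step D N p) (sloped false p q (staged false p q))
    + (h / 2)%:C%C *: sloped true p q (staged true p q).
Proof.
move=> rg; have /and3P[/andP[h1 _] h2 h3] := rg.
exact: (@heun_step (sloped false) (sloped true) Gd p q rg (scheme_step D h1 (fun _ _ => agree_d rg))).
Qed.

Lemma Gt_step x p q : regular p q -> Gt x p.+1 q = heun D (sgn_step D N p) (Gt x p q)
    + (h / 2)%:C%C *: stage D (sgn_step D N p) (slopem x false p q (stagem false p q x))
    + (h / 2)%:C%C *: slopem x true p q (stagem true p q x).
Proof.
move=> rg; have /and3P[/andP[h1 _] h2 h3] := rg.
exact: (@heun_step (slopem x false) (slopem x true) (Gt x) p q rg (scheme_step D h1 (fun _ _ => agree_m rg (fun _ _ _ => erefl)))).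
Qed.

Lemma Gd_diag k : Gd k k = 1%:M. Proof. exact: scheme_diag. Qed.
Lemma Gt_diag x k : Gt x k k = 1%:M. Proof. exact: scheme_diag. Qed.

Let initial_jump K1 K2 p : (N <= p)%N ->
  scheme D N K1 K2 p.+1 N = scheme D N K1 K2 p.+1 N.+1 *m Os D.
Proof.
move=> Np; by rewrite scheme_next// /next_value eqxx propagatorsE.
Qed.

Let final_jump K1 K2 q : (q < N)%N ->
  scheme D N K1 K2 N.+1 q = Os D *m scheme D N K1 K2 N q.
Proof.
move=> qN; by rewrite scheme_next ?(ltnW qN)// /next_value (ltn_eqF qN) eqxx propagatorsE.
Qed.

Lemma Gd_initial p : (N <= p)%N -> Gd p.+1 N = Gd p.+1 N.+1 *m Os D.
Proof. exact: initial_jump. Qed.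
Lemma Gt_initial x p : (N <= p)%N -> Gt x p.+1 N = Gt x p.+1 N.+1 *m Os D.
Proof. exact: initial_jump. Qed.
Lemma Gd_final q : (q < N)%N -> Gd N.+1 q = Os D *m Gd N q.
Proof. exact: final_jump. Qed.
Lemma Gt_final x q : (q < N)%N -> Gt x N.+1 q = Os D *m Gt x N q.
Proof. exact: final_jump. Qed.

(** Plays the role of time in the filtration of the martingale argument. *)
Definition gap (a : draw) : nat := let: (b, p, q, i, m, c) := a in (p - q)%N.

Lemma blk_merge (F : pred draw) (x y : draw -> R) b p q i :
  (forall m c, F (b, p, q, i, m, c) = false) ->
  blk b p q i (merge F x y) = blk b p q i x.
Proof.
move=> hF; apply/funext => m; rewrite /sorted_sample; congr (sort _ _).
by apply: eq_map => c; rewrite /clipped /merge hF.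
Qed.

(** The value at (j, k) is computed from steps of gap less than j - k. *)
Lemma Gt_stable (F : pred draw) l x y j k : (forall a, F a -> (l <= gap a)%N) ->
  (k <= j <= (2 * N).+1)%N -> (j - k <= l)%N -> Gt (merge F x y) j k = Gt x j k.
Proof.
move=> hF kj jk.
suff H p q : (q <= p <= 2 * N)%N -> (p - q < l)%N -> p != N -> q != N ->
    slopes_agree (slopem (merge F x y) false) (slopem (merge F x y) true)
      (slopem x false) (slopem x true) p q.
  exact: (scheme_congr D H kj jk).
move=> qp pq pN qN; have rg : regular p q by rewrite /regular qp pN qN.
apply: (agree_m rg) => b i iN; apply: blk_merge => m c; apply/negP => /hF /=.
by rewrite leqNgt pq.
Qed.

(** The predictor of a step uses the first-stage draws of that same step, hence the extra condition
    on F. *)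
Lemma predm_stable (F : pred draw) x y p q : regular p q ->
  (forall a, F a -> (p - q <= gap a)%N) ->
  (forall i m c, F (false, p, q, i, m, c) = false) ->
  predm p q (merge F x y) = predm p q x.
Proof.
move=> rg hF hF0; have /and3P[/andP[h1 h1'] h2 h3] := rg.
have gs j k : (q <= k)%N -> (k <= j <= p)%N -> Gt (merge F x y) j k = Gt x j k.
  by move=> qk kj; apply: (Gt_stable _ _ hF); lia.
have e0 : Gt (merge F x y) p q = Gt x p q by apply: (gs p q (leqnn _)); rewrite h1 leqnn.
have e1 : slopem (merge F x y) false p q (Gt (merge F x y)) = slopem x false p q (Gt x).
  by apply: (@mc_sum_congr false p q _ _ _ _ rg gs) => i iN; exact: blk_merge.
apply: (etrans (predictorE D N (slopem (merge F x y) false) p q (Gt (merge F x y)))).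
apply: (etrans _ (esym (predictorE D N (slopem x false) p q (Gt x)))).
exact: (congr2 (fun A B => stage D _ A + _%:C%C *: B) e0 e1).
Qed.

Lemma stagem_stable (F : pred draw) (b : bool) (x y : draw -> R) p q : regular p q ->
  (forall a, F a -> (p - q <= gap a)%N) ->
  (b -> forall i m c, F (false, p, q, i, m, c) = false) ->
  forall j k, (q <= k)%N -> (k <= j <= final b p)%N ->
    stagem b p q (merge F x y) j k = stagem b p q x j k.
Proof.
move=> rg hF hF0; have /and3P[/andP[h1 h1'] h2 h3] := rg.
have congr_set (g g' : nat -> nat -> M) A A' j k : A = A' ->
    (~~ ((j == p.+1) && (k == q)) -> g j k = g' j k) ->
    set_node g p.+1 q A j k = set_node g' p.+1 q A' j k.
  by move=> -> H; rewrite /set_node; case: ifP => // /negbT.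
case: b hF0 => hF0 j k qk; rewrite /final => kj; last first.
  by apply: (Gt_stable _ _ hF); move: h1 h1' qk kj; clear; lia.
apply: congr_set; first exact: (predm_stable x y rg hF (hF0 isT)).
by move=> ne; apply: (Gt_stable _ _ hF); move: h1 h1' ne qk kj; clear; lia.
Qed.

Definition noisem b p q (x : E) : M :=
  slopem x b p q (stagem b p q x) - sloped b p q (stagem b p q x).

Definition driftm b p q (x : E) : M :=
  sloped b p q (stagem b p q x) - sloped b p q (staged b p q).

(** The noise also reads the draws of its own step; this is the shift by one against
    [stagem_stable]. *)
Lemma noisem_stable (F : pred draw) (b : bool) (x y : E) p q : regular p q ->
  (forall a, F a -> ((p - q).+1 <= gap a)%N) ->
  noisem b p q (merge F x y) = noisem b p q x.
Proof.
move=> rg hF.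
have hF0 c i m l : F (c, p, q, i, m, l) = false.
  by apply/negP => /hF; rewrite /= ltnn.
have ag : agree q (final b p) (stagem b p q (merge F x y)) (stagem b p q x).
  by apply: stagem_stable => // a /hF /ltnW.
have e1 : sloped b p q (stagem b p q (merge F x y)) = sloped b p q (stagem b p q x) := exact_sum_congr rg ag.
have e2 : slopem (merge F x y) b p q (stagem b p q (merge F x y)) = slopem x b p q (stagem b p q x).
  by apply: (mc_sum_congr rg ag) => i _; exact: blk_merge.
exact: (congr2 (fun A B => A - B) e2 e1).
Qed.

Local Notation err p q x := (Gt x p q - Gd p q).

Lemma err_step p q x : regular p q ->
  err p.+1 q x = heun D (sgn_step D N p) (err p q x)
    + (h / 2)%:C%C *: stage D (sgn_step D N p) (noisem false p q x + driftm false p q x)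
    + (h / 2)%:C%C *: (noisem true p q x + driftm true p q x).
Proof.
move=> rg.
have alg z c (a b a' b' u v w u' v' w' : M) :
  a' = heun D z a + c *: stage D z u + c *: u' -> b' = heun D z b + c *: stage D z w + c *: w' ->
  a' - b' = heun D z (a - b) + c *: stage D z ((u - v) + (v - w)) + c *: ((u' - v') + (v' - w')).
  move=> -> ->; rewrite !addrA !subrK heunB stageB !scalerBr !opprD.
  by rewrite addrACA; congr (_ + _); rewrite addrACA.
exact: (alg _ _ _ _ _ _ _ _ _ _ _ _ (Gt_step x rg) (Gd_step rg)).
Qed.

Lemma pred_err p q x : predm p q x - predd p q = stage D (sgn_step D N p) (err p q x)
    + h%:C%C *: (noisem false p q x + driftm false p q x).
Proof.
have alg z c (a b a' b' u v w : M) :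
  a' = stage D z a + c *: u -> b' = stage D z b + c *: w ->
  a' - b' = stage D z (a - b) + c *: ((u - v) + (v - w)).
  by move=> -> ->; rewrite addrA subrK stageB scalerBr opprD addrACA.
exact: (alg _ _ _ _ _ _ _ _ _ (predictorE D N (slopem x false) p q (Gt x)) (predictorE D N (sloped false) p q Gd)).
Qed.

Lemma mbm_slopem b p q (g : E -> nat -> nat -> M) : regular p q ->
  (forall j k, (q <= k)%N -> (k <= j <= final b p)%N -> mbm (fun x => g x j k)) ->
  mbm (fun x : E => slopem x b p q (g x)).
Proof.
move=> rg mg; rewrite (_ : (fun _ => _) = (fun x : E => (Ns%:R^-1)%:C%C *:
    \sum_(i <- index_iota 0 Ns) est D N (final b p) q (g x) (blk b p q i x))); last first.
  by apply/funext => x; exact: mc_sumE.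
apply: mbmZ; apply: mbm_sum => i; rewrite mem_index_iota => /andP[_ iN].
exact: (mbm_blk t_gt0 N_gt0 B_meas W_le cL_ge0 B_le mg (regular_usable rg iN)).
Qed.

Lemma mbm_stage z (g : E -> M) : mbm g -> mbm (fun x => stage D z (g x)).
Proof.
by move=> mg; apply: mbmD => //; do 2 apply: mbmZ; apply: mbmM => //; exact: mbm_cst.
Qed.

Lemma mbm_heun z (g : E -> M) : mbm g -> mbm (fun x => heun D z (g x)).
Proof.
move=> mg; apply: mbmB; first exact: mbm_stage.
by apply: mbmZ; do 2 (apply: mbmM; first exact: mbm_cst).
Qed.

Lemma mbm_predm p q : regular p q ->
  (forall j k, (q <= k)%N -> (k <= j <= p)%N -> mbm (fun x : E => Gt x j k)) ->
  mbm (fun x : E => predm p q x).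
Proof.
move=> rg mG; have /and3P[/andP[h1 h1'] h2 h3] := rg.
have -> : (fun x : E => predm p q x) = (fun x : E => stage D (sgn_step D N p) (Gt x p q)
       + h%:C%C *: slopem x false p q (Gt x)).
  by apply/funext => x; exact: (predictorE D N (slopem x false) p q (Gt x)).
apply: mbmD; first by apply: mbm_stage; apply: mG => //; rewrite h1 leqnn.
by apply: mbmZ; exact: (mbm_slopem (b := false) rg mG).
Qed.

Lemma mbm_Gt j k : (k <= j <= (2 * N).+1)%N -> mbm (fun x : E => Gt x j k).
Proof.
have [l] := ubnP (j - k)%N; elim: l j k => // l ih j k jkl kj.
have [->|jk] := eqVneq j k.
  rewrite (_ : (fun _ => _) = (fun=> 1%:M)); first exact: mbm_cst.
  by apply/funext => x; rewrite Gt_diag.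
case: j jkl kj jk => [|p] jkl kj jk; first by move: kj jk; rewrite leqn0; case: k {jkl}.
have kp : (k <= p)%N by move: kj jk; clear; lia.
have [kN|kN] := eqVneq k N.
  rewrite (_ : (fun _ => _) = (fun x => Gt x p.+1 N.+1 *m Os D)); last first.
    by apply/funext => x; rewrite kN Gt_initial// -kN.
  apply: mbmM; last exact: mbm_cst.
  by apply: ih; move: jkl kj kp; rewrite kN; clear; lia.
have [pN|pN] := eqVneq p N.
  have kN' : (k < N)%N by move: kN kp; rewrite pN; clear; lia.
  rewrite (_ : (fun _ => _) = (fun x => Os D *m Gt x N k)); last first.
    by apply/funext => x; rewrite pN Gt_final.
  apply: mbmM; first exact: mbm_cst.
  by apply: ih; move: jkl kj kp; rewrite pN; clear; lia.
have rg : regular p k by rewrite /regular pN kN !andbT; move: kj kp; clear; lia.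
have mS b j' k' : (k <= k')%N -> (k' <= j' <= final b p)%N -> mbm (fun x : E => stagem b p k x j' k').
  have mG j1 k1 : (k <= k1)%N -> (k1 <= j1 <= p)%N -> mbm (fun x : E => Gt x j1 k1).
    by move=> h1 h2; apply: ih; move: jkl kj h1 h2; clear; lia.
  case: b => /= h1 h2; last exact: mG.
  rewrite /set_node; case: (boolP ((j' == p.+1) && (k' == k))) => [_|ne]; first exact: (mbm_predm rg mG).
  by apply: ih; move: ne jkl kj h1 h2; clear; lia.
rewrite (_ : (fun _ => _) = (fun x : E => heun D (sgn_step D N p) (Gt x p k)
    + (h / 2)%:C%C *: stage D (sgn_step D N p) (slopem x false p k (stagem false p k x))
    + (h / 2)%:C%C *: slopem x true p k (stagem true p k x))); last by apply/funext => x; exact: Gt_step.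
apply: mbmD; [apply: mbmD|].
- by apply: mbm_heun; apply: ih; move: jkl kj kp; clear; lia.
- by apply: mbmZ; apply: mbm_stage; apply: mbm_slopem => // j' k'; exact: (mS false).
- by apply: mbmZ; apply: mbm_slopem => // j' k'; exact: (mS true).
Qed.

Lemma mbm_stagem b p q : regular p q -> forall j k, (q <= k)%N -> (k <= j <= final b p)%N ->
  mbm (fun x : E => stagem b p q x j k).
Proof.
move=> rg; have /and3P[/andP[h1 h1'] h2 h3] := rg.
have mG j1 k1 : (q <= k1)%N -> (k1 <= j1 <= p.+1)%N -> mbm (fun x : E => Gt x j1 k1).
  by move=> h4 h5; apply: mbm_Gt; move: h1' h4 h5; clear; lia.
case: b => /= j k qk kj; last by apply: mG => //; move: kj; clear; lia.
rewrite /set_node; case: (boolP ((j == p.+1) && (k == q))) => [_|ne]; last exact: mG.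
by apply: (mbm_predm rg) => j1 k1 h4 h5; apply: mG => //; move: h5; clear; lia.
Qed.

Lemma stagemE b p q (x : draw -> R) j k :
  stagem b p q x j k = if [&& b, j == p.+1 & k == q] then predm p q x else Gt x j k.
Proof. by case: b. Qed.

Lemma stagedE b p q j k :
  staged b p q j k = if [&& b, j == p.+1 & k == q] then predd p q else Gd j k.
Proof. by case: b. Qed.

Lemma predmE p q (x : draw -> R) :
  predm p q x = stage D (sgn_step D N p) (Gt x p q) + h%:C%C *: slopem x false p q (stagem false p q x).
Proof. exact: predictorE. Qed.

Lemma preddE p q :
  predd p q = stage D (sgn_step D N p) (Gd p q) + h%:C%C *: sloped false p q (staged false p q).
Proof. exact: predictorE. Qed.

End RandomScheme.

(** * Bounds on the slopes *)

Section SlopeBounds.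
Variables (R : realType) (D : model R) (N Ns : nat) (cW cL cH : R).
Hypotheses (t_gt0 : 0 < horizon D) (N_gt0 : (0 < N)%N) (B_meas : measurable_corr D).
Hypotheses (W_le : frobenius (Ws D) <= cW) (cL_ge0 : 0 <= cL)
  (B_le : forall s1 s2 : R, 0 <= s1 -> s1 <= s2 -> s2 <= 2 * horizon D ->
       Normc.normc (corr D s2 s1) <= cL).
Hypotheses (Ns_gt0 : (0 < Ns)%N) (H_le : frobenius (Hs D) <= cH).
Local Notation Mbar := (max_order D).
Local Notation M := 'M[R[i]]_2.
Local Notation nt := (node_time D N).
Local Notation h := (horizon D / N%:R).
Local Notation mi := (mesh_index N).
Local Notation J := (used_draw D N Ns).
Local Notation E := (sample_space R J).
Variable Q : probability E R.
Hypothesis indep : independent_coords Q.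
Hypothesis law : forall a (ab : draw_lower D N a < draw_upper D N a), J a ->
  forall A : set R, measurable A -> Q [set x | A (x a)] = uniform_prob ab A.
Local Notation blk b p q i x := (sorted_sample (clipped D N x) b p q i).
Local Notation sig := (sig D cW cL).
Local Notation rate := (drift_rate D cW cL).

Lemma sig_mono G G' tau tau' : 0 <= G <= G' -> 0 <= tau <= tau' -> sig G tau <= sig G' tau'.
Proof.
move=> /andP[G0 GG] /andP[t0 tt]; have w0 := wt_ge0 cL W_le.
apply: ler_sum => m _; apply: ler_wpM2r; first by rewrite invr_ge0 ler0n.
have G0' := le_trans G0 GG. have t0' := le_trans t0 tt.
apply: ler_pM; [exact: exprn_ge0 (mulr_ge0 w0 G0)|exact: exprn_ge0| |].
  by rewrite lerXn2r ?nnegrE ?(mulr_ge0 w0)// ler_wpM2l.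
by rewrite lerXn2r ?nnegrE.
Qed.

Lemma rate_mono G tau tau' : 0 <= G -> 0 <= tau <= tau' -> rate G tau <= rate G tau'.
Proof.
move=> G0 /andP[t0 tt]; have w0 := wt_ge0 cL W_le.
apply: ler_sum => m _; apply: ler_wpM2r; first by rewrite !mulr_ge0 ?ler0n.
apply: ler_wpM2r; first by rewrite invr_ge0 ler0n.
apply: ler_wpM2l; first by rewrite mulr_ge0 ?exprn_ge0.
by rewrite lerXn2r ?nnegrE// (le_trans t0).
Qed.

Lemma mc_slope_le (x : draw -> R) b p q g G : regular N p q ->
  (forall j k, (q <= k)%N -> (k <= j <= final b p)%N -> frobenius (g j k) <= G) ->
  frobenius (slopem D N Ns x b p q g) <= sig G (nt (final b p) - nt q).
Proof.
move=> rg gG; have [qp qf qN pN fN] := usable_facts b (regular_usable rg Ns_gt0).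
rewrite /slopem mc_sumE froZr ger0_norm ?invr_ge0 ?ler0n//.
rewrite ler_pdivrMl ?ltr0n//; apply: le_trans (fro_sum _ _ _) _.
rewrite mulr_natl -[X in _ *+ X](subn0 Ns) -sumr_const_nat; apply: ler_sum => i _.
exact: (est_le t_gt0 N_gt0 W_le cL_ge0 B_le qf qN fN (good_blk t_gt0 N_gt0 x b i qp) gG).
Qed.

Lemma det_slope_le b p q g G : regular N p q ->
  (forall j k, (q <= k)%N -> (k <= j <= final b p)%N -> frobenius (g j k) <= G) ->
  frobenius (sloped D N b p q g) <= sig G (nt (final b p) - nt q).
Proof.
move=> rg; exact: (exact_sum_le t_gt0 N_gt0 B_meas W_le cL_ge0 B_le indep law (regular_usable rg Ns_gt0)).
Qed.

End SlopeBounds.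

(** * Noise and drift of one step *)

Section ErrorTerms.
Variables (R : realType) (D : model R) (N Ns : nat) (cW cL cH : R).
Hypotheses (t_gt0 : 0 < horizon D) (N_gt0 : (0 < N)%N) (B_meas : measurable_corr D).
Hypotheses (W_le : frobenius (Ws D) <= cW) (cL_ge0 : 0 <= cL)
  (B_le : forall s1 s2 : R, 0 <= s1 -> s1 <= s2 -> s2 <= 2 * horizon D ->
       Normc.normc (corr D s2 s1) <= cL).
Hypotheses (Ns_gt0 : (0 < Ns)%N) (H_le : frobenius (Hs D) <= cH) (Hs_herm : Hs D \is hermsymmx).
Hypothesis Os_norm : frobenius (Os D) = 1.
Local Notation Mbar := (max_order D).
Local Notation M := 'M[R[i]]_2.
Local Notation nt := (node_time D N).
Local Notation h := (horizon D / N%:R).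
Local Notation mi := (mesh_index N).
Local Notation J := (used_draw D N Ns).
Local Notation E := (sample_space R J).
Local Notation orders := [seq m <- index_iota 1 Mbar.+1 | odd m].
Variable Q : probability E R.
Hypothesis indep : independent_coords Q.
Hypothesis law : forall a (ab : draw_lower D N a < draw_upper D N a), J a ->
  forall A : set R, measurable A -> Q [set x | A (x a)] = uniform_prob ab A.
Local Notation sig := (sig D cW cL).
Local Notation rate := (drift_rate D cW cL).
Local Notation Gt := (Gt D N Ns).
Local Notation Gd := (Gd D N).
Local Notation stagem := (stagem D N Ns).
Local Notation staged := (staged D N).
Local Notation noisem := (@noisem R D N Ns).
Local Notation driftm := (@driftm R D N Ns).
Local Notation regular := (regular N).
Local Notation predm := (predm D N Ns).
Local Notation predd := (predd D N).
Local Notation mbm_stg := (mbm_stagem t_gt0 N_gt0 B_meas W_le cL_ge0 B_le Ns_gt0).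

(** Dependence on draws of gap less than l only, expressed by invariance under resampling of the
    others instead of a sub-sigma-algebra. *)
Definition stable l (B : E -> M) := forall (F : pred draw) (x y : E),
  (forall a, F a -> (l <= gap a)%N) -> B (merge F x y) = B x.

(** The nodes of the second stage depend on first-stage draws of the same gap, so only the block of
    one stage and one sample is resampled. *)
Lemma stage_block_stable b p q i x y j k : regular p q -> (q <= k)%N -> (k <= j <= final b p)%N ->
  stagem b p q (merge (fun a => a.1.1 == (b, p, q, i)) x y) j k = stagem b p q x j k.
Proof.
move=> rg; apply: (stagem_stable t_gt0 N_gt0 W_le cL_ge0 Ns_gt0 x y rg).
  by move=> [[[[[b' p'] q'] i'] m] c] /= /eqP[_ -> -> _].
by move=> bt i' m c /=; rewrite bt.
Qed.

Lemma mbm_noisem b p q : regular p q -> mbm (noisem b p q : E -> M).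
Proof.
move=> rg; exact: (mbm_noise t_gt0 N_gt0 B_meas W_le cL_ge0 B_le indep law (mbm_stg (b := b) rg)
  (fun i iN => regular_usable rg iN) Ns_gt0).
Qed.

Lemma noisem_mean b p q : regular p q -> Em Q (noisem b p q) = 0.
Proof.
move=> rg; exact: (noise_mean t_gt0 N_gt0 B_meas W_le cL_ge0 B_le indep law (mbm_stg (b := b) rg)
  (fun i iN => regular_usable rg iN) Ns_gt0
  (fun i x y j k h1 h2 => stage_block_stable i x y rg h1 h2)).
Qed.

Lemma noisem_orthogonal b p q (B : E -> M) : regular p q -> mbm B ->
  stable (p - q) B ->
  Ex Q (fun x => ip (B x) (noisem b p q x)) = 0.
Proof.
move=> rg mB dB; apply: (noise_orthogonal t_gt0 N_gt0 B_meas W_le cL_ge0 B_le indep law (mbm_stg (b := b) rg)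
  (fun i iN => regular_usable rg iN) Ns_gt0
  (fun i x y j k h1 h2 => stage_block_stable i x y rg h1 h2) mB) => i x y.
by apply: dB => -[[[[[b' p'] q'] i'] m] c] /= /eqP[_ -> -> _].
Qed.

Lemma mbm_driftm b p q : regular p q -> mbm (driftm b p q : E -> M).
Proof.
move=> rg; apply: mbmB; last exact: mbm_cst.
exact: (mbm_exact t_gt0 N_gt0 B_meas W_le cL_ge0 B_le indep law (mbm_stg (b := b) rg)
  (regular_usable rg Ns_gt0)).
Qed.

Section Bounds.
Variables (Gb Gs : R) (L : nat).
Local Notation tauL := (L%:R * h).
Hypothesis Gb_ge0 : 0 <= Gb.
Hypothesis Gt_le : {ae Q, forall x, forall j k, (k <= j <= (2 * N).+1)%N ->
  (mi j <= mi k + L)%N -> frobenius (Gt x j k) <= Gb}.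
Hypothesis Gd_le : forall j k, (k <= j <= (2 * N).+1)%N ->
  (mi j <= mi k + L)%N -> frobenius (Gd j k) <= Gb.
Hypothesis Gs_ge : (1 + h * cH) * Gb + h * sig Gb tauL <= Gs.

Lemma cH_ge0 : 0 <= cH. Proof. exact: le_trans (fro_ge0 _) H_le. Qed.

Lemma step_ge0 : 0 <= h. Proof. by rewrite ltW ?(step_gt0 t_gt0 N_gt0). Qed.

(** [Gb] bounds the nodal values, [Gs] in addition the predictor: [Gs_ge] is the growth of one Euler
    step. *)
Lemma Gb_le_Gs : Gb <= Gs.
Proof.
apply: le_trans Gs_ge; rewrite mulrDl mul1r -addrA lerDl.
have h0 := step_ge0. have c0 := cH_ge0.
have w0 := wt_ge0 cL W_le.
apply: addr_ge0; first exact: mulr_ge0 (mulr_ge0 h0 c0) Gb_ge0.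
apply: mulr_ge0 => //; apply: sumr_ge0 => m _; apply: mulr_ge0; last by rewrite invr_ge0 ler0n.
by apply: mulr_ge0; apply: exprn_ge0; apply: mulr_ge0; rewrite ?ler0n.
Qed.

Lemma nodes_gap p q : (q <= p)%N -> nt p - nt q = (mi p - mi q)%:R * h.
Proof. by move=> qp; rewrite /node_time -mulrBl natrB// (mi_le t_gt0 N_gt0). Qed.

Lemma regular_mi p q : regular p q -> mi p.+1 = (mi p).+1 /\ (mi q <= mi p)%N.
Proof.
by move=> /and3P[/andP[h1 _] /eqP h2 h3]; split; [exact: (miS t_gt0 N_gt0 h2)|exact: (mi_le t_gt0 N_gt0)].
Qed.

Lemma final_gap b p q : regular p q -> (mi p.+1 <= mi q + L)%N ->
  0 <= nt (final b p) - nt q <= tauL.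
Proof.
move=> rg hL; have [e1 e2] := regular_mi rg; have h0 := step_ge0.
have [qp qf qN pN fN] := usable_facts b (regular_usable rg Ns_gt0).
rewrite (nodes_gap qf) mulr_ge0// ler_wpM2r// ler_nat.
by move: hL e1 e2; case: (b); rewrite /final; clear; lia.
Qed.

Lemma stage_bound X B' : frobenius X <= B' -> forall p,
  frobenius (stage D (sgn_step D N p) X) <= (1 + h * cH) * B'.
Proof.
move=> XB p; apply: le_trans (fro_stage X (sgn_step D N p) H_le) _.
rewrite normr_sgn_step// ler_wpM2l//.
by apply: addr_ge0 => //; exact: mulr_ge0 step_ge0 cH_ge0.
Qed.

Lemma pred_bound p q (G : nat -> nat -> M) (K A : M) : regular p q -> (mi p.+1 <= mi q + L)%N ->
  (forall j k, (k <= j <= (2 * N).+1)%N -> (mi j <= mi k + L)%N -> frobenius (G j k) <= Gb) ->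
  ((forall j k, (q <= k)%N -> (k <= j <= p)%N -> frobenius (G j k) <= Gb) ->
   frobenius K <= sig Gb (nt p - nt q)) ->
  A = stage D (sgn_step D N p) (G p q) + h%:C%C *: K -> frobenius A <= Gs.
Proof.
move=> rg hL gG hK ->; have /and3P[/andP[h1 h1'] _ _] := rg; have [e1 e2] := regular_mi rg.
have gq j k : (q <= k)%N -> (k <= j <= p)%N -> frobenius (G j k) <= Gb.
  move=> qk kj; apply: gG; first by move: kj h1'; clear; lia.
  have := mi_le t_gt0 N_gt0 qk; have := mi_le t_gt0 N_gt0 (proj2 (andP kj)); move: hL e1; clear; lia.
apply: le_trans (froD _ _) _; apply: le_trans Gs_ge; apply: lerD.
  by apply: stage_bound; apply: gq; rewrite ?leqnn ?h1.
rewrite froZr ger0_norm ?step_ge0// ler_wpM2l ?step_ge0//; apply: le_trans (hK gq) _.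
apply: (sig_mono cL W_le); first by rewrite Gb_ge0 lexx.
exact: (final_gap false rg hL).
Qed.

Lemma stage_nodes_le b p q (G : nat -> nat -> M) A : regular p q -> (mi p.+1 <= mi q + L)%N ->
  (forall j k, (k <= j <= (2 * N).+1)%N -> (mi j <= mi k + L)%N -> frobenius (G j k) <= Gb) ->
  frobenius A <= Gs ->
  forall j k, (q <= k)%N -> (k <= j <= final b p)%N ->
  frobenius (if [&& b, j == p.+1 & k == q] then A else G j k) <= Gs.
Proof.
move=> rg hL gG AG j k qk kj; case: ifP => // _; apply: le_trans (gG _ _ _ _) Gb_le_Gs.
  by have [_ _ _ _ fN] := usable_facts b (regular_usable rg Ns_gt0); move: kj fN; clear; lia.
have [e1 e2] := regular_mi rg.
have := mi_le t_gt0 N_gt0 qk; have := mi_le t_gt0 N_gt0 (proj2 (andP kj)); move: hL e1.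
by move: kj; case: (b); rewrite /final; clear; lia.
Qed.

Lemma staged_le b p q : regular p q -> (mi p.+1 <= mi q + L)%N ->
  forall j k, (q <= k)%N -> (k <= j <= final b p)%N -> frobenius (staged b p q j k) <= Gs.
Proof.
move=> rg hL j k qk kj; rewrite stagedE.
apply: (stage_nodes_le rg hL Gd_le) => //; apply: (pred_bound rg hL Gd_le _ (preddE D N p q)) => gq.
exact: (det_slope_le t_gt0 N_gt0 B_meas W_le cL_ge0 B_le Ns_gt0 indep law (b := false) rg gq).
Qed.

Lemma stagem_le b p q : regular p q -> (mi p.+1 <= mi q + L)%N ->
  {ae Q, forall x, forall j k, (q <= k)%N -> (k <= j <= final b p)%N -> frobenius (stagem b p q x j k) <= Gs}.
Proof.
move=> rg hL; apply: ae_imply Gt_le => x gx j k qk kj; rewrite stagemE.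
apply: (stage_nodes_le rg hL gx) => //; apply: (pred_bound rg hL gx _ (predmE D N Ns p q x)) => gq.
exact: (mc_slope_le t_gt0 N_gt0 W_le cL_ge0 B_le Ns_gt0 x (b := false) rg gq).
Qed.

Lemma noisem_le b p q : regular p q -> (mi p.+1 <= mi q + L)%N ->
  nrm2 Q (noisem b p q) <= 2 * sig Gs tauL / Num.sqrt Ns%:R.
Proof.
move=> rg hL.
have H := noise_le t_gt0 N_gt0 B_meas W_le cL_ge0 B_le indep law (mbm_stg (b := b) rg)
  (fun i iN => regular_usable rg iN) Ns_gt0
  (fun i x y j k h1 h2 => stage_block_stable i x y rg h1 h2) (stagem_le b rg hL).
apply: (le_trans H); rewrite ler_wpM2r ?invr_ge0 ?sqrtr_ge0// ler_wpM2l//.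
apply: (sig_mono cL W_le); last exact: final_gap.
by rewrite lexx (le_trans Gb_ge0 Gb_le_Gs).
Qed.

Lemma driftm_le b p q c kappa : regular p q -> (mi p.+1 <= mi q + L)%N -> 0 <= c -> 0 < kappa ->
  (forall j k, (q <= k)%N -> (k <= j <= final b p)%N ->
    nrm2 Q (fun x => stagem b p q x j k - staged b p q j k) <=
    c * expR (kappa * (((mi j)%:R - (mi k)%:R) * h))) ->
  nrm2 Q (driftm b p q) <= c * expR (kappa * h) *
    (expR (kappa * (nt (final b p) - nt q)) / kappa * rate Gs tauL).
Proof.
move=> rg hL c0 k0 dG.
have Gs0 := le_trans Gb_ge0 Gb_le_Gs.
have H := drift_le t_gt0 N_gt0 B_meas W_le cL_ge0 B_le indep law (regular_usable rg Ns_gt0)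
  (mbm_stg (b := b) rg) Gs0 (stagem_le b rg hL) (staged_le rg hL) c0 k0 dG.
apply: (le_trans H); apply: ler_wpM2l; first by rewrite mulr_ge0 ?expR_ge0.
apply: ler_wpM2l; first by rewrite divr_ge0 ?expR_ge0 ?ltW.
apply: (rate_mono cL W_le) => //; exact: final_gap.
Qed.

Lemma driftm_bias b p q beta eps : regular p q -> (mi p.+1 <= mi q + L)%N -> 0 <= beta -> 0 <= eps ->
  (forall j k, (q <= k)%N -> (k <= j <= final b p)%N ->
    frobenius (Em Q (fun x => stagem b p q x j k - staged b p q j k)) <= beta) ->
  (forall j k, (q <= k)%N -> (k <= j <= final b p)%N ->
    nrm2 Q (fun x => stagem b p q x j k - staged b p q j k) <= eps) ->
  frobenius (Em Q (driftm b p q)) <=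
  \sum_(m <- orders) (nt (final b p) - nt q) ^+ m / (double_fact (m - 1))%:R * Num.sqrt cL ^+ m.+1 *
    (bias_cst cW Gs m * (beta + eps ^+ 2)).
Proof.
move=> rg hL b0 e0 bG eG.
have Gs0 := le_trans Gb_ge0 Gb_le_Gs.
exact: (drift_bias t_gt0 N_gt0 B_meas W_le cL_ge0 B_le indep law (regular_usable rg Ns_gt0)
  (mbm_stg (b := b) rg) Gs0 (stagem_le b rg hL) (staged_le rg hL) b0 e0 bG eG).
Qed.

End Bounds.
End ErrorTerms.

Ltac nonneg := solve [repeat first [assumption | exact: expR_ge0 | exact: sqrtr_ge0 | exact: ler0n
  | exact: nrm2_ge0 | apply: addr_ge0 | apply: exprn_ge0 | apply: mulr_ge0 | rewrite invr_ge0 | done]].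

Opaque Gt Gd predm predd stagem staged noisem driftm slopem sloped.

(** * Mean square error and bias *)

Section StepArithmetic.
Variable R : realFieldType.
Implicit Types a b c e h k m n s q r u v w x y : R.

Lemma step_noise s q a x : s * a <= s * q -> 3 * s * q <= x -> 2 * (s * a) <= 2 / 3 * x.
Proof. by move=> *; lra. Qed.

Lemma step_rate h r k : h * (12 * r) <= h * k -> k * h <= 10^-1 -> h * r <= 10^-1 / 12.
Proof. by move=> *; lra. Qed.

Lemma step_drift x e : x * e <= x * (10 / 9) -> 0 <= x -> 10^-1 / 12 * (2 * x * e) <= 3^-1 * x.
Proof. by move=> *; lra. Qed.

Lemma step_stage h c : h * c <= 4^-1 -> 1 + h * c <= 5 / 4.
Proof. by move=> *; lra. Qed.

(** Origin of the 4: twice 5 / 4 for the propagated error, 2 / 3 for the noise and 1 / 3 for the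
    drift. *)
Lemma step_predictor a b m n c h w v x : b <= h * m -> h * m <= h * (n + c) -> h * n <= h * w ->
  h * w <= 2 / 3 * x -> h * c <= v -> v <= 3^-1 * x -> a <= 5 / 4 * (2 * x) -> 0 <= x -> a + b <= 4 * x.
Proof. by move=> *; lra. Qed.

Lemma step_heun h c k : h * (h * c) <= h * (k / 2) -> 1 + h ^+ 2 * c <= 1 + k * h / 2.
Proof. by move=> *; lra. Qed.

Lemma step_martingale u v h m n w : u <= h * (5 / 4 * m) -> v <= h * n -> h * m <= w -> h * n <= w ->
  0 <= w -> u + v <= 3 * w.
Proof. by move=> *; lra. Qed.

Lemma step_half k h : 0 <= k * h -> 1 + k * h / 2 <= 1 + k * h.
Proof. by move=> *; lra. Qed.

Lemma step_rate_mul h r k x : h * (12 * r) * x <= h * k * x -> 12 * (h * r * x) <= k * h * x.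
Proof. by move=> *; lra. Qed.

(** The two drift stages cost less than 4 y, at most a third of k h x by the factor 12; the Heun
    defect costs half of k h x, and the sum stays below k h x. *)
Lemma step_final a b k h x u v c w e y : a <= (1 + k * h / 2) * x -> b <= u + v -> u <= 5 / 4 * (h / 2 * c) ->
  v <= h / 2 * w -> h / 2 * c <= y * e -> h / 2 * w <= 2 * (y * e ^+ 2) -> y * e <= 10 / 9 * y ->
  y * e ^+ 2 <= (10 / 9) ^+ 2 * y -> 12 * y <= k * h * x -> 0 <= y -> 0 <= x -> a + b <= x * (1 + k * h).
Proof. by move=> *; lra. Qed.

End StepArithmetic.

Section MeanSquareError.
Variables (R : realType) (D : model R) (N Ns : nat) (cW cL cH : R).
Hypotheses (t_gt0 : 0 < horizon D) (N_gt0 : (0 < N)%N) (B_meas : measurable_corr D).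
Hypotheses (W_le : frobenius (Ws D) <= cW) (cL_ge0 : 0 <= cL)
  (B_le : forall s1 s2 : R, 0 <= s1 -> s1 <= s2 -> s2 <= 2 * horizon D ->
       Normc.normc (corr D s2 s1) <= cL).
Hypotheses (Ns_gt0 : (0 < Ns)%N) (H_le : frobenius (Hs D) <= cH) (Hs_herm : Hs D \is hermsymmx).
Hypothesis Os_norm : frobenius (Os D) = 1.
Local Notation M := 'M[R[i]]_2.
Local Notation nt := (node_time D N).
Local Notation h := (horizon D / N%:R).
Local Notation mi := (mesh_index N).
Local Notation J := (used_draw D N Ns).
Local Notation E := (sample_space R J).
Variable Q : probability E R.
Hypothesis indep : independent_coords Q.
Hypothesis law : forall a (ab : draw_lower D N a < draw_upper D N a), J a ->
  forall A : set R, measurable A -> Q [set x | A (x a)] = uniform_prob ab A.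
Local Notation sig := (sig D cW cL).
Local Notation rate := (drift_rate D cW cL).
Local Notation Gt := (Gt D N Ns).
Local Notation Gd := (Gd D N).
Local Notation stagem := (stagem D N Ns).
Local Notation staged := (staged D N).
Local Notation noisem := (@noisem R D N Ns).
Local Notation driftm := (@driftm R D N Ns).
Local Notation regular := (regular N).
Local Notation predm := (predm D N Ns).
Local Notation predd := (predd D N).
Local Notation stable := (@stable R D N Ns).
Local Notation nrm := (nrm2 Q).
Variables (Gb Gs : R) (L : nat).
Local Notation tauL := (L%:R * h).
Hypothesis Gb_ge0 : 0 <= Gb.
Hypothesis Gt_le : {ae Q, forall x, forall j k, (k <= j <= (2 * N).+1)%N ->
  (mi j <= mi k + L)%N -> frobenius (Gt x j k) <= Gb}.
Hypothesis Gd_le : forall j k, (k <= j <= (2 * N).+1)%N ->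
  (mi j <= mi k + L)%N -> frobenius (Gd j k) <= Gb.
Hypothesis Gs_ge : (1 + h * cH) * Gb + h * sig Gb tauL <= Gs.
Hypothesis h_le1 : h <= 1.

Let h0 : 0 <= h := step_ge0 t_gt0 N_gt0.
Let cH0 : 0 <= cH := cH_ge0 H_le.
Local Notation T j k := (((mi j)%:R - (mi k)%:R) * h).
Local Notation mbmn := (mbm_noisem t_gt0 N_gt0 B_meas W_le cL_ge0 B_le Ns_gt0 indep law).
Local Notation mbmd := (mbm_driftm t_gt0 N_gt0 B_meas W_le cL_ge0 B_le Ns_gt0 indep law).

Lemma heun_nrm p (f : E -> M) : mbm f ->
  nrm (fun x => heun D (sgn_step D N p) (f x)) <= (1 + h ^+ 2 * cH ^+ 4) * nrm f.
Proof.
move=> mf; apply: nrm2_le => //; first by nonneg.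
  exact: mbm_heun.
move=> x; have := @fro_step _ (Hs D) (f x) (sgn_step D N p) cH Hs_herm H_le.
by rewrite normr_sgn_step//; apply.
Qed.

Lemma stage_nrm p (f : E -> M) : mbm f ->
  nrm (fun x => stage D (sgn_step D N p) (f x)) <= (1 + h * cH) * nrm f.
Proof.
move=> mf; apply: nrm2_le => //; first by nonneg.
  exact: mbm_stage.
by move=> x; have := fro_stage (f x) (sgn_step D N p) H_le; rewrite normr_sgn_step.
Qed.

Lemma scale_nrm (c : R) (f : E -> M) : 0 <= c -> mbm f -> nrm (fun x => c%:C%C *: f x) <= c * nrm f.
Proof. by move=> c0 mf; apply: le_trans (nrm2Z Q _ mf) _; rewrite normcR ger0_norm. Qed.

(** Both noises of the step are orthogonal to what is stable below gap p - q; for the first one the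
    half step is moved to the other side by [ip_adj]. *)
Lemma heun_noise_orthogonal p q (f : E -> M) : regular p q -> mbm f -> stable (p - q) f ->
  Ex Q (fun x => ip (heun D (sgn_step D N p) (f x))
    ((h / 2)%:C%C *: stage D (sgn_step D N p) (noisem false p q x) + (h / 2)%:C%C *: noisem true p q x)) = 0.
Proof.
move=> rg mf sf; set z := sgn_step D N p.
have -> : (fun x => ip (heun D z (f x))
    ((h / 2)%:C%C *: stage D z (noisem false p q x) + (h / 2)%:C%C *: noisem true p q x)) =
  (fun x => h / 2 * (ip (stage D (- z) (heun D z (f x))) (noisem false p q x)
    + ip (heun D z (f x)) (noisem true p q x))).
  apply/funext => x; rewrite ipDr !ipZr -mulrDr /stage (ip_adj _ _ _ Hs_herm).
  by rewrite -scaleNr -rmorphN.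
have mh : mbm (fun x => heun D z (f x)) by exact: mbm_heun.
have ms : mbm (fun x => stage D (- z) (heun D z (f x))) by exact: mbm_stage.
have b0 := bm_ip ms (mbmn false rg).
have b1 := bm_ip mh (mbmn true rg).
have orth := noisem_orthogonal t_gt0 N_gt0 B_meas W_le cL_ge0 B_le Ns_gt0 indep law.
have s0 : stable (p - q) (fun x => stage D (- z) (heun D z (f x))).
  by move=> F x y hF; exact: (congr1 (fun A => stage D (- z) (heun D z A)) (sf F x y hF)).
have s1 : stable (p - q) (fun x => heun D z (f x)).
  by move=> F x y hF; exact: (congr1 (heun D z) (sf F x y hF)).
have r0 := orth false p q _ rg ms s0.
have r1 := orth true p q _ rg mh s1.
apply: (etrans (ExZ Q (h / 2) (bmD b0 b1))).
apply: (etrans (congr1 ( *%R (h / 2)) (etrans (ExD Q b0 b1) (congr2 +%R r0 r1)))).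
by rewrite addr0 mulr0.
Qed.

Variable kappa : R.
Hypotheses (kappa_gt0 : 0 < kappa) (hcH : h * cH <= 4^-1) (hk : kappa * h <= 10^-1)
  (hcH4 : h * cH ^+ 4 <= kappa / 2) (rate_le : 12 * rate Gs tauL <= kappa ^+ 2).
Local Notation S := (sig Gs tauL).
Local Notation C1 := (3 * S * Num.sqrt (tauL * (h / Ns%:R))).
Local Notation V := (9 * S ^+ 2 * (h / Ns%:R)).

(* The martingale part [Nf] depends only on the draws of steps of gap less than j - k. *)
Definition split_error j k := exists Nf Df : E -> M,
  [/\ mbm Nf, mbm Df, (forall x, Gt x j k - Gd j k = Nf x + Df x), stable (j - k) Nf &
      nrm Nf ^+ 2 <= V * T j k * expR (kappa * T j k) ^+ 2 /\ nrm Df <= C1 * expR (kappa * T j k)].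

Let S0 : 0 <= S.
Proof.
have Gs0 := le_trans Gb_ge0 (Gb_le_Gs t_gt0 N_gt0 W_le H_le Gb_ge0 Gs_ge).
have w0 := wt_ge0 cL W_le.
apply: sumr_ge0 => m _; apply: mulr_ge0; last by rewrite invr_ge0 ler0n.
by apply: mulr_ge0; apply: exprn_ge0; apply: mulr_ge0; rewrite ?ler0n.
Qed.

Let rate0 : 0 <= rate Gs tauL.
Proof.
have Gs0 := le_trans Gb_ge0 (Gb_le_Gs t_gt0 N_gt0 W_le H_le Gb_ge0 Gs_ge).
have w0 := wt_ge0 cL W_le.
apply: sumr_ge0 => m _; apply: mulr_ge0; last by rewrite !mulr_ge0 ?ler0n.
apply: mulr_ge0; last by rewrite invr_ge0 ler0n.
by nonneg.
Qed.

Let T_ge0 j k : (k <= j)%N -> 0 <= T j k.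
Proof. by move=> kj; apply: mulr_ge0 => //; rewrite subr_ge0 ler_nat; exact: (mi_le t_gt0 N_gt0). Qed.

Let T_leL j k : (mi j <= mi k + L)%N -> T j k <= tauL.
Proof. by move=> jk; apply: ler_wpM2r => //; rewrite lerBlDl -natrD ler_nat. Qed.

Let hNs0 : 0 <= h / Ns%:R. Proof. by nonneg. Qed.

Let C1_ge0 : 0 <= C1. Proof. by nonneg. Qed.

(** The variance [V] per unit time, accumulated over the maximal gap, is [C1] squared; so both parts
    are at most [C1] times the weight. *)
Lemma split_error_le j k : (k <= j)%N -> (mi j <= mi k + L)%N -> split_error j k ->
  nrm (fun x => Gt x j k - Gd j k) <= 2 * C1 * expR (kappa * T j k).
Proof.
move=> kj jk [Nf [Df [mN mD e _ [leN leD]]]].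
have -> : (fun x => Gt x j k - Gd j k) = (fun x => Nf x + Df x) by apply/funext => x; exact: e.
apply: le_trans (nrm2D Q mN mD) _; rewrite [leRHS](_ : _ = C1 * expR (kappa * T j k) + C1 * expR (kappa * T j k)); last by ring.
apply: lerD => //.
rewrite -(@ler_pXn2r _ 2)// ?nnegrE; [|by nonneg|by nonneg].
apply: (le_trans leN); rewrite [leRHS]exprMn; apply: ler_wpM2r; first by nonneg.
rewrite !exprMn sqr_sqrtr; last by nonneg.
rewrite [leRHS](_ : _ = V * tauL); last by ring.
by apply: ler_wpM2l; [nonneg|exact: T_leL].
Qed.

Let e1 : 1 + kappa * h <= expR (kappa * h). Proof. exact: expR_ge1Dx. Qed.

Let e2 : expR (kappa * h) <= 10 / 9.
Proof.
have b1 : 9 / 10 <= expR (- (kappa * h)) by apply: le_trans (expR_ge1Dx _); move: hk; lra.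
have := ler_wpM2l (expR_ge0 (kappa * h)) b1; rewrite -expRD subrr expR0; lra.
Qed.

(** The martingale part receives only the new noise, so it keeps its stability and its mean squares
    add by Pythagoras. The drift goes entirely into the other part and is estimated through the
    total error of the nodes involved. *)
Lemma split_error_step p q : regular p q -> (mi p.+1 <= mi q + L)%N ->
  (forall j k, (k <= j <= (2 * N).+1)%N -> (mi j <= mi k + L)%N -> (j - k <= p - q)%N -> split_error j k) ->
  split_error p.+1 q /\
  nrm (fun x => predm p q x - predd p q) <= 4 * (C1 * expR (kappa * T p q)).
Proof.
move=> rg hL ih; have /and3P[/andP[qp p2] /eqP pN /eqP qN] := rg.
have [mS miqp] := regular_mi t_gt0 N_gt0 rg.
have hLp : (mi p <= mi q + L)%N by apply: leq_trans hL; rewrite mS.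
have k0 := ltW kappa_gt0.
have ex0 u : 0 <= expR (kappa * u) by exact: expR_ge0.
have TS : T p.+1 q = T p q + h by rewrite mS -natr1; ring.
have eS : expR (kappa * T p.+1 q) = expR (kappa * T p q) * expR (kappa * h).
  by rewrite TS mulrDr expRD.
have good j k : (q <= k)%N -> (k <= j <= p)%N -> split_error j k /\ (mi j <= mi k + L)%N.
  move=> qk /andP[kj jp].
  have H : (mi j <= mi k + L)%N.
    by have := mi_le t_gt0 N_gt0 qk; have := mi_le t_gt0 N_gt0 jp; move: hLp; clear; lia.
  by split=> //; apply: ih => //; move: qk kj jp p2; clear; lia.
have [Nf [Df [mN mD eND sN [leN leD]]]] := (good p q (leqnn _) (introT andP (conj qp (leqnn _)))).1.
pose X := C1 * expR (kappa * T p q).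
have X0 : 0 <= X by rewrite /X; nonneg.
have mn0 := mbmn false rg. have mn1 := mbmn true rg.
have md0 := mbmd false rg. have md1 := mbmd true rg.
have nl b := noisem_le t_gt0 N_gt0 B_meas W_le cL_ge0 B_le Ns_gt0 H_le indep law Gb_ge0 Gt_le Gs_ge b rg hL.
have dl b c := driftm_le t_gt0 N_gt0 B_meas W_le cL_ge0 B_le Ns_gt0 H_le indep law Gb_ge0 Gt_le Gd_le Gs_ge (b := b) (c := c) (kappa := kappa) rg hL.
have c20 : 0 <= 2 * C1 by nonneg.
have c40 : 0 <= 4 * C1 by nonneg.
pose rho := rate Gs tauL / kappa.
have rho0 : 0 <= rho by rewrite /rho; nonneg.
(* The weighted drift rate is rate / kappa; for kappa of the order of the square root of the rate it
   is a fraction of kappa. *)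
have rhole : 12 * rho <= kappa by rewrite /rho mulrA ler_pdivrMr// -expr2.
have gp : nt p - nt q = T p q by rewrite /node_time mulrBl.
have gp1 : nt p.+1 - nt q = T p.+1 q by rewrite /node_time mulrBl.
have d0 : nrm (driftm false p q) <= 2 * X * expR (kappa * h) * rho.
  have H0 j k : (q <= k)%N -> (k <= j <= final false p)%N ->
      nrm (fun x => stagem false p q x j k - staged false p q j k) <= 2 * C1 * expR (kappa * T j k).
    move=> qk kj; rewrite (_ : (fun _ => _) = (fun x => Gt x j k - Gd j k)); last first.
      by apply/funext => x; rewrite stagemE stagedE.
    have [s1 s2] := good j k qk kj.
    by apply: split_error_le => //; case/andP: kj.
  apply: (le_trans (dl false _ c20 kappa_gt0 H0)).
  by rewrite /final gp /X /rho le_eqVlt; apply/orP; left; apply/eqP; ring.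
have pe : nrm (fun x => predm p q x - predd p q) <= 4 * X.
  have mE : mbm (fun x : E => Gt x p q - Gd p q).
    rewrite (_ : (fun _ => _) = (fun x => Nf x + Df x)); first exact: mbmD.
    by apply/funext => x; exact: eND.
  rewrite (_ : (fun _ => _) = (fun x => stage D (sgn_step D N p) (Gt x p q - Gd p q)
    + h%:C%C *: (noisem false p q x + driftm false p q x))); last first.
    by apply/funext => x; exact: pred_err.
  have mnd : mbm (fun x : E => noisem false p q x + driftm false p q x) by exact: mbmD.
  apply: le_trans (nrm2D Q _ _) _; [exact: mbm_stage|exact: mbmZ|].
  have H1 := stage_nrm p mE.
  have H2 := split_error_le qp hLp (good p q (leqnn _) (introT andP (conj qp (leqnn _)))).1.
  have H3 := scale_nrm h0 mnd.
  have H4 := nrm2D Q mn0 md0.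
  have H5 := nl false.
  (* A single noise is below [C1] because the admissible gap contains at least one cell, so that h
     <= tauL. *)
  have H6 : h * (2 * S / Num.sqrt Ns%:R) <= 2 / 3 * X.
    have hT : h <= tauL.
      rewrite -[X in X <= _]mul1r ler_wpM2r// ler1n; move: hL; rewrite mS.
      by move: miqp; clear; lia.
    have : h / Num.sqrt Ns%:R <= Num.sqrt (tauL * (h / Ns%:R)).
      rewrite -(@ler_pXn2r _ 2)// ?nnegrE; [|by nonneg|by nonneg].
      rewrite sqr_sqrtr; last by nonneg.
      rewrite exprMn exprVn sqr_sqrtr ?ler0n// expr2 mulrA.
      by rewrite ler_wpM2r ?invr_ge0 ?ler0n// ler_wpM2r.
    move=> hh; have : X >= C1.
      rewrite -[X in X <= _]mulr1 ler_wpM2l// -[X in X <= _]expR0 ler_expR mulr_ge0//; exact: T_ge0.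
    rewrite (_ : h * (2 * S / Num.sqrt Ns%:R) = 2 * (S * (h / Num.sqrt Ns%:R))); last by ring.
    exact: (step_noise (ler_wpM2l S0 hh)).
  have hrho : h * rho * (2 * X * expR (kappa * h)) <= 3^-1 * X.
    have A1 : h * rho <= 10^-1 / 12.
      exact: (step_rate (ler_wpM2l h0 rhole) hk).
    have A2 := ler_wpM2l X0 e2.
    apply: le_trans (ler_wpM2r _ A1) _; first by nonneg.
    exact: (step_drift A2 X0).
  have H7 := ler_wpM2l h0 d0.
  have H8 := ler_wpM2l h0 H5.
  have H9 := ler_wpM2l h0 H4.
  have HA : nrm (fun x => stage D (sgn_step D N p) (Gt x p q - Gd p q)) <= 5 / 4 * (2 * X).
    apply: (le_trans H1); apply: ler_pM; [by nonneg|by nonneg|exact: step_stage|by rewrite /X mulrA].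
  have HB : h * (2 * X * expR (kappa * h) * rho) = h * rho * (2 * X * expR (kappa * h)) by ring.
  rewrite HB in H7.
  exact: (step_predictor H3 H9 H8 H6 H7 hrho HA X0).
split; last exact: pe.
have d1 : nrm (driftm true p q) <= 4 * X * expR (kappa * h) ^+ 2 * rho.
  have H0 j k : (q <= k)%N -> (k <= j <= final true p)%N ->
      nrm (fun x => stagem true p q x j k - staged true p q j k) <= 4 * C1 * expR (kappa * T j k).
    move=> qk kj; have [/andP[/eqP -> /eqP ->]|ne] := boolP ((j == p.+1) && (k == q)).
      rewrite (_ : (fun _ => _) = (fun x => predm p q x - predd p q)); last first.
        by apply/funext => x; rewrite stagemE stagedE !eqxx.
      apply: (le_trans pe); rewrite /X mulrA ler_wpM2l// ler_expR TS ler_wpM2l// lerDl//.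
    rewrite (_ : (fun _ => _) = (fun x => Gt x j k - Gd j k)); last first.
      by apply/funext => x; rewrite stagemE stagedE /= (negbTE ne).
    have jk : (mi j <= mi k + L)%N.
      have := mi_le t_gt0 N_gt0 qk; have := mi_le t_gt0 N_gt0 (proj2 (andP kj)).
      by move: hL; rewrite /final; clear; lia.
    have kj' : (k <= j)%N by case/andP: kj.
    apply: le_trans (split_error_le kj' jk _) _.
      by apply: ih => //; move: ne qk kj p2; rewrite /final; clear; lia.
    apply: ler_wpM2r; first exact: expR_ge0.
    by apply: ler_wpM2r; [exact: C1_ge0|rewrite ler_nat].
  apply: (le_trans (dl true _ c40 kappa_gt0 H0)).
  by rewrite /final gp1 eS /X /rho le_eqVlt; apply/orP; left; apply/eqP; ring.
have h20 : 0 <= h / 2 by nonneg.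
set z := sgn_step D N p.
pose eta (x : E) := (h / 2)%:C%C *: stage D z (noisem false p q x) + (h / 2)%:C%C *: noisem true p q x.
pose dlt (x : E) := (h / 2)%:C%C *: stage D z (driftm false p q x) + (h / 2)%:C%C *: driftm true p q x.
have ms0 : mbm (fun x : E => stage D z (noisem false p q x)) by apply: mbm_stage; exact: mn0.
have msd0 : mbm (fun x : E => stage D z (driftm false p q x)) by apply: mbm_stage; exact: md0.
have meta : mbm eta := mbmD (mbmZ _ ms0) (mbmZ _ mn1).
have mdlt : mbm dlt := mbmD (mbmZ _ msd0) (mbmZ _ md1).
have mhN : mbm (fun x => heun D z (Nf x)) by exact: mbm_heun.
have mhD : mbm (fun x => heun D z (Df x)) by exact: mbm_heun.
have a_le : 1 + h ^+ 2 * cH ^+ 4 <= 1 + kappa * h / 2.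
  exact: (step_heun (ler_wpM2l h0 hcH4)).
have a_ge0 : 0 <= 1 + h ^+ 2 * cH ^+ 4 by nonneg.
have st54 (f : E -> M) : mbm f -> nrm (fun x => stage D z (f x)) <= 5 / 4 * nrm f.
  by move=> mf; apply: le_trans (stage_nrm p mf) _; by apply: ler_wpM2r; [nonneg|exact: step_stage].
exists (fun x => heun D z (Nf x) + eta x), (fun x => heun D z (Df x) + dlt x); split.
- exact: mbmD.
- exact: mbmD.
- have AC (a b c1 c2 c3 c4 : M) : a + b + (c1 + c2) + (c3 + c4) = a + (c1 + c3) + (b + (c2 + c4)).
    by rewrite (addrACA a b c1 c2) (addrACA (a + c1) (b + c2) c3 c4) -!addrA.
  have alg (c : R[i]) (A a b n d n' d' : M) : A = a + b ->
      heun D z A + c *: stage D z (n + d) + c *: (n' + d') =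
      heun D z a + (c *: stage D z n + c *: n') + (heun D z b + (c *: stage D z d + c *: d')).
    by move=> ->; rewrite heunD stageD !scalerDr; exact: AC.
  move=> x; have es := err_step t_gt0 N_gt0 B_meas W_le cL_ge0 B_le Ns_gt0 indep law x rg.
  exact: (etrans es (alg _ _ _ _ _ _ _ _ (eND x))).
- move=> F x y hF; have hF' a : F a -> (p - q <= gap a)%N by move=> /hF; move: qp; clear; lia.
  have hF2 a : F a -> ((p - q).+1 <= gap a)%N by move=> /hF; move: qp; clear; lia.
  have nst b := noisem_stable t_gt0 N_gt0 B_meas W_le cL_ge0 B_le Ns_gt0 indep law b x y rg hF2.
  exact: (congr2 +%R (congr1 (heun D z) (sN F x y hF'))
    (congr2 (fun A B => (h / 2)%:C%C *: stage D z A + (h / 2)%:C%C *: B) (nst false) (nst true))).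
split.
  have ipc := Ex_ip_cross mhN meta (heun_noise_orthogonal rg mN sN).
  (* The stages contribute 5 / 4 and 1 times h S / sqrt Ns; the 3 here is the 3 of [C1] and,
     squared, the 9 of [V]. *)
  have etale : nrm eta <= 3 * h * S / Num.sqrt Ns%:R.
    apply: le_trans (nrm2D Q (mbmZ _ ms0) (mbmZ _ mn1)) _.
    have A1 := le_trans (scale_nrm h20 ms0) (ler_wpM2l h20 (st54 _ mn0)).
    have A2 := scale_nrm h20 mn1.
    have A3 := ler_wpM2l h20 (nl false). have A4 := ler_wpM2l h20 (nl true).
    have A5 : 0 <= h * (S / Num.sqrt Ns%:R) by nonneg.
    have half (a b c : R) : a / 2 * (2 * b * c) = a * (b * c) by field.
    rewrite half in A3 A4.
    rewrite -[leRHS]mulrA -[leRHS]mulrA.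
    exact: (step_martingale A1 A2 A3 A4 A5).
  have eta2 : nrm eta ^+ 2 <= V * h.
    have : nrm eta ^+ 2 <= (3 * h * S / Num.sqrt Ns%:R) ^+ 2.
      by rewrite lerXn2r ?nnegrE//; nonneg.
    rewrite [X in _ <= X -> _]exprMn exprVn (sqr_sqrtr (ler0n R Ns)) => le1; apply: (le_trans le1).
    by rewrite le_eqVlt; apply/orP; left; apply/eqP; ring.
  have hN2 : nrm (fun x => heun D z (Nf x)) ^+ 2 <= expR (kappa * h) ^+ 2 * nrm Nf ^+ 2.
    rewrite -exprMn; apply: lerXn2r; rewrite ?nnegrE; [nonneg|nonneg|].
    apply: le_trans (heun_nrm p mN) _; apply: ler_wpM2r; first exact: nrm2_ge0.
    exact: (le_trans a_le (le_trans (step_half (mulr_ge0 k0 h0)) e1)).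
  have V0 : 0 <= V by nonneg.
  rewrite [leLHS]ipc; rewrite eS TS mulrDr mulrDl exprMn; apply: lerD.
    apply: (le_trans hN2); rewrite [leRHS]mulrA [leRHS]mulrC ler_wpM2l//; nonneg.
  (* The new variance corresponds to the elapsed time h, and the weight in front of it is at least
     1. *)
  apply: (le_trans eta2); rewrite -[X in X <= _]mulr1 ler_wpM2l//; first by nonneg.
  rewrite -exprMn.
  apply: exprn_ege1; rewrite -expRD -[X in X <= _]expR0 ler_expR -mulrDr mulr_ge0// addr_ge0//.
  exact: T_ge0.
apply: le_trans (nrm2D Q mhD mdlt) _.
have B1 : nrm (fun x => heun D z (Df x)) <= (1 + kappa * h / 2) * X.
  apply: le_trans (heun_nrm p mD) _; apply: ler_pM => //; exact: nrm2_ge0.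
have B2 := nrm2D Q (mbmZ (h / 2)%:C%C msd0) (mbmZ (h / 2)%:C%C md1).
have B3 := le_trans (scale_nrm h20 msd0) (ler_wpM2l h20 (st54 _ md0)).
have B4 := scale_nrm h20 md1.
have B5 := ler_wpM2l h20 d0. have B6 := ler_wpM2l h20 d1.
set Y := h * rho * X.
have Y0 : 0 <= Y by rewrite /Y; nonneg.
have Yle : 12 * Y <= kappa * h * X.
  exact: (step_rate_mul (ler_wpM2r X0 (ler_wpM2l h0 rhole))).
have ey : Y * expR (kappa * h) <= 10 / 9 * Y by rewrite mulrC ler_wpM2r.
have ey2 : Y * expR (kappa * h) ^+ 2 <= (10 / 9) ^+ 2 * Y.
  by rewrite mulrC ler_wpM2r// lerXn2r ?nnegrE ?expR_ge0// divr_ge0.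
have -> : C1 * expR (kappa * T p.+1 q) = X * expR (kappa * h) by rewrite eS /X; ring.
apply: le_trans (ler_wpM2l X0 e1).
have hl1 (a x e r : R) : a / 2 * (2 * x * e * r) = a * r * x * e by field.
have hl2 (a x e r : R) : a / 2 * (4 * x * e ^+ 2 * r) = 2 * (a * r * x * e ^+ 2) by field.
have hl3 (a b : R) : a / 2 * (5 / 4 * b) = 5 / 4 * (a / 2 * b) by ring.
rewrite hl1 -/Y in B5. rewrite hl2 -/Y in B6. rewrite hl3 in B3.
exact: (step_final B1 B2 B3 B4 B5 B6 ey ey2 Yle Y0 X0).
Qed.

Lemma split_errorP j k : (k <= j <= (2 * N).+1)%N -> (mi j <= mi k + L)%N -> split_error j k.
Proof.
have [l] := ubnP (j - k)%N; elim: l j k => // l ih j k jkl kj jL.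
have [->|jk] := eqVneq j k.
  exists (fun=> 0), (fun=> 0); split; [exact: mbm_cst|exact: mbm_cst| |by []|].
    by move=> x; rewrite Gt_diag Gd_diag subrr addr0.
  rewrite nrm2_eq0 subrr mul0r mulr0 mul0r expr0n; split=> //.
  by nonneg.
case: j jkl kj jk jL => [|p] jkl kj jk jL; first by move: kj jk; rewrite leqn0; case: k {jkl jL}.
have kp : (k <= p)%N by move: kj jk; clear; lia.
(* A jump multiplies by O_s, of norm 1, uses no draw and takes no time: both parts of the error pass
   through it unchanged in size. *)
have jump (A B : M -> M) j' k' : (forall X Y, A (X - Y) = A X - A Y) -> (forall X Y, A (X + Y) = A X + A Y) ->
    (forall f : E -> M, mbm f -> mbm (fun x => A (f x))) -> (forall X, frobenius (A X) <= frobenius X) ->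
    (forall x, Gt x p.+1 k = A (Gt x j' k')) -> Gd p.+1 k = A (Gd j' k') ->
    T p.+1 k = T j' k' -> (j' - k' <= p.+1 - k)%N -> split_error j' k' -> split_error p.+1 k.
  move=> AB AD mA leA eG eD eT le [Nf [Df [mN mD eND sN [leN leD]]]].
  have nA (f : E -> M) : mbm f -> nrm (fun x => A (f x)) <= nrm f.
    move=> mf; rewrite -[leRHS]mul1r; apply: nrm2_le => //; first exact: mA.
    by move=> x; rewrite mul1r.
  exists (fun x => A (Nf x)), (fun x => A (Df x)); split; [exact: mA|exact: mA| | |].
  - by move=> x; rewrite eG eD -AB eND AD.
  - by move=> F x y hF; rewrite sN// => a /hF; exact: leq_trans.
  rewrite eT; split; last by apply: le_trans leD; exact: nA.
  by apply: le_trans leN; rewrite lerXn2r ?nnegrE ?nrm2_ge0// nA.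
have [kN|kN] := eqVneq k N.
  have Np : (N <= p)%N by rewrite -kN.
  apply: (jump (fun X => X *m Os D) id p.+1 N.+1) => //.
  - by move=> X Y; rewrite mulmxBl.
  - by move=> X Y; rewrite mulmxDl.
  - by move=> f mf; apply: mbmM => //; exact: mbm_cst.
  - by move=> X; apply: le_trans (froM _ _) _; rewrite Os_norm mulr1.
  - by move=> x; rewrite kN; exact: Gt_initial.
  - by rewrite kN; exact: Gd_initial.
  - by rewrite kN /mesh_index leqnn ltnn.
  - by rewrite kN; move: Np; clear; lia.
  apply: ih; [by move: jkl Np; rewrite kN; clear; lia|by move: kj Np; rewrite kN; clear; lia|].
  by move: jL; rewrite kN /mesh_index leqnn ltnn.
have [pN|pN] := eqVneq p N.
  have kN' : (k < N)%N by move: kN kp; rewrite pN; clear; lia.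
  have eN : mi N.+1 = mi N by rewrite /mesh_index leqnn ltnn.
  apply: (jump (fun X => Os D *m X) id N k) => //.
  - by move=> X Y; rewrite mulmxBr.
  - by move=> X Y; rewrite mulmxDr.
  - by move=> f mf; apply: mbmM => //; exact: mbm_cst.
  - by move=> X; apply: le_trans (froM _ _) _; rewrite Os_norm mul1r.
  - by move=> x; rewrite pN; exact: Gt_final.
  - by rewrite pN; exact: Gd_final.
  - by rewrite pN eN.
  - by rewrite pN; clear; lia.
  apply: ih; [by move: jkl kN'; rewrite pN; clear; lia|by move: kN'; clear; lia|].
  by move: jL; rewrite pN eN.
have rg : regular p k by rewrite /Submission.regular pN kN !andbT; move: kj kp; clear; lia.
apply: (proj1 (split_error_step rg jL _)) => j' k' h1 h2 h3; apply: ih => //.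
by move: jkl h3 kp; clear; lia.
Qed.

Lemma mean_square_error j k : (k <= j <= (2 * N).+1)%N -> (mi j <= mi k + L)%N ->
  nrm (fun x => Gt x j k - Gd j k) <= 2 * C1 * expR (kappa * T j k).
Proof. by move=> kj jk; apply: split_error_le; rewrite ?(proj1 (andP kj))//; exact: split_errorP. Qed.

Lemma predictor_error p q : regular p q -> (mi p.+1 <= mi q + L)%N ->
  nrm (fun x => predm p q x - predd p q) <= 4 * (C1 * expR (kappa * T p q)).
Proof.
move=> rg hL; apply: (proj2 (split_error_step rg hL _)) => j k kj jk _.
exact: split_errorP.
Qed.

End MeanSquareError.

(** * Arithmetic of the bias recursion *)

Section BiasArithmetic.
Variable R : realFieldType.
Implicit Types a b e f h l t u v w x y z : R.

Lemma bias_predictor b h z a w : w <= 5 / 4 * b + h * (z * (b + a)) -> h * z <= 4^-1 -> 0 <= b -> 0 <= a ->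
  w <= 3 / 2 * b + 4^-1 * a.
Proof.
move=> H hz b0 a0; have ba : 0 <= b + a by lra.
have := ler_wpM2r ba hz; lra.
Qed.

Lemma bias_inner b a : 0 <= b -> 0 <= a -> b <= 3 / 2 * b + 4^-1 * a.
Proof. by move=> *; lra. Qed.

Lemma bias_step x y u v w b a h z f s : x <= u + v -> u <= (1 + h * f) * b -> v <= h / 2 * (5 / 4 * y) ->
  h * y <= h * (z * (b + a)) -> h * w <= h * (z * ((3 / 2 * b + 4^-1 * a) + a)) ->
  0 <= b -> 0 <= a -> 0 <= h -> 0 <= z -> 0 <= f -> s = h / 2 * w ->
  x + s <= b * (1 + (f + 2 * z) * h) + a * (f + 2 * z) * h.
Proof.
move=> h1 h2 h3 h4 h5 b0 a0 h0 z0 f0 ->.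
have p1 : 0 <= h * z * b by do 2 (apply: mulr_ge0 => //).
have p2 : 0 <= h * z * a by do 2 (apply: mulr_ge0 => //).
have p3 : 0 <= h * f * a by do 2 (apply: mulr_ge0 => //).
lra.
Qed.

Lemma bias_growth a l t e h f : 1 + l * h <= f -> 1 <= e -> 0 <= a -> 0 <= l -> 0 <= t -> 0 <= h ->
  a * l * t * e * (1 + l * h) + a * l * h <= a * l * (t + h) * (e * f).
Proof.
move=> hf he a0 l0 t0 h0.
have al : 0 <= a * l by exact: mulr_ge0.
have e0 : 0 <= e by lra.
have alte : 0 <= a * l * t * e by nonneg.
have p1 := ler_wpM2l alte hf.
have lh : 0 <= l * h by exact: mulr_ge0.
have ef : 1 <= e * f by apply: mulr_ege1 => //; lra.
have p2 := ler_wpM2l (mulr_ge0 al h0) ef.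
rewrite mulr1 in p2.
have -> : a * l * (t + h) * (e * f) = a * l * t * e * f + a * l * h * (e * f) by ring.
lra.
Qed.

End BiasArithmetic.

(** * Recursion for the bias *)

Section BiasRecursion.
Variables (R : realType) (D : model R) (N Ns : nat) (cW cL cH : R).
Hypotheses (t_gt0 : 0 < horizon D) (N_gt0 : (0 < N)%N) (B_meas : measurable_corr D).
Hypotheses (W_le : frobenius (Ws D) <= cW) (cL_ge0 : 0 <= cL)
  (B_le : forall s1 s2 : R, 0 <= s1 -> s1 <= s2 -> s2 <= 2 * horizon D ->
       Normc.normc (corr D s2 s1) <= cL).
Hypotheses (Ns_gt0 : (0 < Ns)%N) (H_le : frobenius (Hs D) <= cH) (Hs_herm : Hs D \is hermsymmx).
Hypothesis Os_norm : frobenius (Os D) = 1.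
Local Notation M := 'M[R[i]]_2.
Local Notation orders := [seq m <- index_iota 1 (max_order D).+1 | odd m].
Local Notation nt := (node_time D N).
Local Notation h := (horizon D / N%:R).
Local Notation mi := (mesh_index N).
Local Notation J := (used_draw D N Ns).
Local Notation E := (sample_space R J).
Variable Q : probability E R.
Hypothesis indep : independent_coords Q.
Hypothesis law : forall a (ab : draw_lower D N a < draw_upper D N a), J a ->
  forall A : set R, measurable A -> Q [set x | A (x a)] = uniform_prob ab A.
Local Notation sig := (sig D cW cL).
Local Notation rate := (drift_rate D cW cL).
Local Notation Gt := (Gt D N Ns).
Local Notation Gd := (Gd D N).
Local Notation stagem := (stagem D N Ns).
Local Notation staged := (staged D N).
Local Notation noisem := (@noisem R D N Ns).
Local Notation driftm := (@driftm R D N Ns).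
Local Notation regular := (regular N).
Local Notation predm := (predm D N Ns).
Local Notation predd := (predd D N).
Local Notation stable := (@stable R D N Ns).
Local Notation nrm := (nrm2 Q).
Variables (Gb Gs : R) (L : nat).
Local Notation tauL := (L%:R * h).
Hypothesis Gb_ge0 : 0 <= Gb.
Hypothesis Gt_le : {ae Q, forall x, forall j k, (k <= j <= (2 * N).+1)%N ->
  (mi j <= mi k + L)%N -> frobenius (Gt x j k) <= Gb}.
Hypothesis Gd_le : forall j k, (k <= j <= (2 * N).+1)%N ->
  (mi j <= mi k + L)%N -> frobenius (Gd j k) <= Gb.
Hypothesis Gs_ge : (1 + h * cH) * Gb + h * sig Gb tauL <= Gs.
Hypothesis h_le1 : h <= 1.

Let h0 : 0 <= h := step_ge0 t_gt0 N_gt0.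
Let cH0 : 0 <= cH := cH_ge0 H_le.
Local Notation T j k := (((mi j)%:R - (mi k)%:R) * h).
Local Notation mbmn := (mbm_noisem t_gt0 N_gt0 B_meas W_le cL_ge0 B_le Ns_gt0 indep law).
Local Notation mbmd := (mbm_driftm t_gt0 N_gt0 B_meas W_le cL_ge0 B_le Ns_gt0 indep law).


Definition bias_rate (G tau : R) : R :=
  \sum_(m <- orders) tau ^+ m / (double_fact (m - 1))%:R * Num.sqrt cL ^+ m.+1 * bias_cst cW G m.

Lemma Em_stage z (f : E -> M) : mbm f -> Em Q (fun x => stage D z (f x)) = stage D z (Em Q f).
Proof.
move=> mf; have mH := mbmM (@mbm_cst _ E R (Hs D)) mf.
have e := EmD Q mf (mbmZ z%:C%C (mbmZ 'i%C mH)).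
by apply: (etrans e); rewrite (EmZ Q _ (mbmZ _ mH)) (EmZ Q _ mH) (EmMl Q _ mf).
Qed.

Lemma Em_heun z (f : E -> M) : mbm f -> Em Q (fun x => heun D z (f x)) = heun D z (Em Q f).
Proof.
move=> mf; have mH := mbmM (@mbm_cst _ E R (Hs D)) mf; have mHH := mbmM (@mbm_cst _ E R (Hs D)) mH.
have ms : mbm (fun x : E => stage D z (f x)) by apply: mbm_stage.
have e := EmB Q ms (mbmZ (z ^+ 2 / 2)%:C%C mHH).
apply: (etrans e); rewrite Em_stage// (EmZ Q _ mHH) (EmMl Q _ mH) (EmMl Q _ mf) //.
Qed.

Variables (A BB : R).
Hypotheses (A_ge0 : 0 <= A) (hcH : h * cH <= 4^-1) (BB_ge : bias_rate Gs tauL <= BB) (hBB : h * BB <= 4^-1).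
Hypothesis err_le : forall j k, (k <= j <= (2 * N).+1)%N -> (mi j <= mi k + L)%N ->
  nrm (fun x => Gt x j k - Gd j k) <= A.
Hypothesis pred_le : forall p q, regular p q -> (mi p.+1 <= mi q + L)%N ->
  nrm (fun x => predm p q x - predd p q) <= A.
Local Notation Lam := (cH ^+ 4 + 2 * BB).
Local Notation ebound T := (A ^+ 2 * Lam * T * expR (Lam * T)).

Let Gs_ge0 : 0 <= Gs.
Proof. exact: le_trans Gb_ge0 (Gb_le_Gs t_gt0 N_gt0 W_le H_le Gb_ge0 Gs_ge). Qed.

Let summand0 m : 0 <= Num.sqrt cL ^+ m.+1 * bias_cst cW Gs m.
Proof. by apply: mulr_ge0; [nonneg|apply: bias_cst_ge0 => //; exact: W_le]. Qed.

Let BB_ge0 : 0 <= BB.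
Proof.
apply: le_trans BB_ge; apply: sumr_ge0 => m _; rewrite -mulrA; apply: mulr_ge0; last exact: summand0.
by nonneg.
Qed.

Let T_ge0 j k : (k <= j)%N -> 0 <= T j k.
Proof. by move=> kj; apply: mulr_ge0 => //; rewrite subr_ge0 ler_nat; exact: (mi_le t_gt0 N_gt0). Qed.

Let Lam_ge0 : 0 <= Lam. Proof. by nonneg. Qed.

Let ebound_mono u v : 0 <= u <= v -> ebound u <= ebound v.
Proof.
move=> /andP[u0 uv]; apply: ler_pM; [by nonneg|by nonneg|apply: ler_wpM2l => //; by nonneg|].
by rewrite ler_expR ler_wpM2l.
Qed.

Let drift_le b p q beta : regular p q -> (mi p.+1 <= mi q + L)%N -> 0 <= beta ->
  (forall j k, (q <= k)%N -> (k <= j <= final b p)%N ->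
    frobenius (Em Q (fun x => stagem b p q x j k - staged b p q j k)) <= beta) ->
  frobenius (Em Q (driftm b p q)) <= BB * (beta + A ^+ 2).
Proof.
move=> rg hL b0 bG; have /and3P[/andP[qp p2] pN qN] := rg.
have eG j k : (q <= k)%N -> (k <= j <= final b p)%N ->
    nrm (fun x => stagem b p q x j k - staged b p q j k) <= A.
  move=> qk kj; have [/and3P[bt /eqP -> /eqP ->]|ne] := boolP [&& b, j == p.+1 & k == q].
    rewrite (_ : (fun _ => _) = (fun x => predm p q x - predd p q)); first exact: pred_le.
    by apply/funext => x; rewrite stagemE stagedE bt !eqxx.
  rewrite (_ : (fun _ => _) = (fun x => Gt x j k - Gd j k)); last first.
    by apply/funext => x; rewrite stagemE stagedE (negbTE ne).
  have [_ _ _ _ fN] := usable_facts b (regular_usable rg Ns_gt0).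
  apply: err_le; first by move: kj fN; clear; lia.
  have [mS _] := regular_mi t_gt0 N_gt0 rg.
  have fp : (final b p <= p.+1)%N by case: (b) => //; exact: leqnSn.
  have := mi_le t_gt0 N_gt0 qk; have := mi_le t_gt0 N_gt0 (leq_trans (proj2 (andP kj)) fp).
  by move: hL; clear; lia.
have H := driftm_bias t_gt0 N_gt0 B_meas W_le cL_ge0 B_le Ns_gt0 H_le indep law Gb_ge0 Gt_le Gd_le Gs_ge
  rg hL b0 A_ge0 bG eG.
apply: (le_trans H); apply: (@le_trans _ _ (bias_rate Gs tauL * (beta + A ^+ 2))); last first.
  by apply: ler_wpM2r => //; nonneg.
rewrite /bias_rate mulr_suml; apply: ler_sum => m _; rewrite mulrA; apply: ler_wpM2r; first by nonneg.
rewrite -!mulrA; apply: ler_pM => //; first by apply: exprn_ge0; case/andP: (final_gap t_gt0 N_gt0 Ns_gt0 b rg hL).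
  by apply: mulr_ge0; [nonneg|exact: summand0].
have /andP[g0 g1] := final_gap t_gt0 N_gt0 Ns_gt0 b rg hL.
by apply: lerXn2r => //; rewrite nnegrE //; exact: le_trans g0 g1.
Qed.

(** The noise has mean zero, so the bias obeys b' <= (1 + Lam h) b + A^2 Lam h, where the mean
    square error enters as a source. No sharp exponent is required, hence the largest earlier bias
    is used without a weight. *)
Lemma bias_error j k : (k <= j <= (2 * N).+1)%N -> (mi j <= mi k + L)%N ->
  frobenius (Em Q (fun x => Gt x j k - Gd j k)) <= ebound (T j k).
Proof.
have mG j1 k1 : (k1 <= j1 <= (2 * N).+1)%N -> mbm (fun x : E => Gt x j1 k1 - Gd j1 k1).
  move=> kj; exact: (mbmB (mbm_Gt t_gt0 N_gt0 B_meas W_le cL_ge0 B_le Ns_gt0 kj) (@mbm_cst _ E R _)).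
have [l] := ubnP (j - k)%N; elim: l j k => // l ih j k jkl kj jL.
have [->|jk] := eqVneq j k.
  rewrite (_ : (fun _ => _) = (fun=> 0)); last by apply/funext => x; rewrite Gt_diag Gd_diag subrr.
  by rewrite Em_cst fro0 subrr mul0r mulr0 mul0r.
case: j jkl kj jk jL => [|p] jkl kj jk jL; first by move: kj jk; rewrite leqn0; case: k {jkl jL}.
have kp : (k <= p)%N by move: kj jk; clear; lia.
have [kN|kN] := eqVneq k N.
  have Np : (N <= p)%N by rewrite -kN.
  have kj' : (N.+1 <= p.+1 <= (2 * N).+1)%N by move: kj Np; clear; lia.
  rewrite (_ : (fun _ => _) = (fun x => (Gt x p.+1 N.+1 - Gd p.+1 N.+1) *m Os D)); last first.
    by apply/funext => x; rewrite mulmxBl kN Gt_initial// Gd_initial.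
  rewrite (EmMr Q _ (mG _ _ kj')); apply: le_trans (froM _ _) _; rewrite Os_norm mulr1.
  have eN : mi N.+1 = mi N by rewrite /mesh_index leqnn ltnn.
  rewrite kN -eN; apply: ih => //; first by move: jkl Np; rewrite kN; clear; lia.
  by rewrite eN; move: jL; rewrite kN.
have [pN|pN] := eqVneq p N.
  have kN' : (k < N)%N by move: kN kp; rewrite pN; clear; lia.
  have kj' : (k <= N <= (2 * N).+1)%N by move: kN'; clear; lia.
  rewrite (_ : (fun _ => _) = (fun x => Os D *m (Gt x N k - Gd N k))); last first.
    by apply/funext => x; rewrite mulmxBr pN Gt_final// Gd_final.
  rewrite (EmMl Q _ (mG _ _ kj')); apply: le_trans (froM _ _) _; rewrite Os_norm mul1r.
  have eN : mi N.+1 = mi N by rewrite /mesh_index leqnn ltnn.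
  rewrite pN eN; apply: ih => //; first by move: jkl kN'; rewrite pN; clear; lia.
  by rewrite -eN; move: jL; rewrite pN.
have rg : regular p k by rewrite /Submission.regular pN kN !andbT; move: kj kp; clear; lia.
have [mS mkp] := regular_mi t_gt0 N_gt0 rg.
have pL : (mi p <= mi k + L)%N by apply: leq_trans jL; rewrite mS.
have kpN : (k <= p <= (2 * N).+1)%N by move: kj kp; clear; lia.
have mE := mG _ _ kpN.
have TS : T p.+1 k = T p k + h by rewrite mS -natr1; ring.
set b := ebound (T p k).
have T0 : 0 <= T p k by exact: T_ge0.
have b0 : 0 <= b by rewrite /b; nonneg.
have bp : frobenius (Em Q (fun x => Gt x p k - Gd p k)) <= b.
  by apply: ih => //; move: jkl kp; clear; lia.
(* Every node of the triangle other than the corner spans at most the time gap of (p, k), and the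
   bound is monotone in the gap. *)
have inner j1 k1 : (k <= k1)%N -> (k1 <= j1 <= p.+1)%N -> ~~ ((j1 == p.+1) && (k1 == k)) ->
    frobenius (Em Q (fun x => Gt x j1 k1 - Gd j1 k1)) <= b.
  move=> h1 h2 ne.
  have gap1 : (mi j1 <= mi p + (mi k1 - mi k))%N.
    have [jp|jp] := leqP j1 p.
      by have := mi_le t_gt0 N_gt0 jp; clear; lia.
    have k1k : (k.+1 <= k1)%N by move: ne h1 h2 jp; clear; lia.
    have := mi_le t_gt0 N_gt0 k1k; have := mi_le t_gt0 N_gt0 (proj2 (andP h2)).
    by rewrite mS (miS t_gt0 N_gt0 (elimN eqP kN)); clear; lia.
  have m1 := mi_le t_gt0 N_gt0 h1.
  have H : frobenius (Em Q (fun x => Gt x j1 k1 - Gd j1 k1)) <= ebound (T j1 k1).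
    apply: ih; [by move: ne jkl h1 h2 kp; clear; lia|by move: h2 kj; clear; lia|].
    by move: gap1 m1 pL; clear; lia.
  have T1 : 0 <= T j1 k1 by apply: T_ge0; case/andP: h2.
  apply: (le_trans H); apply: ebound_mono; rewrite T1 ler_wpM2r//.
  by rewrite lerBlDr addrAC lerBrDr -!natrD ler_nat; move: gap1 m1; clear; lia.
have d0 : frobenius (Em Q (driftm false p k)) <= BB * (b + A ^+ 2).
  apply: (drift_le rg jL b0) => j1 k1 h1 h2.
  rewrite (_ : (fun _ => _) = (fun x => Gt x j1 k1 - Gd j1 k1)); last first.
    by apply/funext => x; rewrite stagemE stagedE.
  have h5 : (k1 <= j1 <= p.+1)%N by move: h2; rewrite /final; clear; lia.
  have h6 : ~~ ((j1 == p.+1) && (k1 == k)) by move: h2; rewrite /final; clear; lia.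
  exact: (inner j1 k1 h1 h5 h6).
have mn bb := mbmn bb rg. have md bb := mbmd bb rg.
have mnd bb := mbmD (mn bb) (md bb).
have nm bb : Em Q (fun x => noisem bb p k x + driftm bb p k x) = Em Q (driftm bb p k).
  have z := noisem_mean t_gt0 N_gt0 B_meas W_le cL_ge0 B_le Ns_gt0 indep law bb rg.
  by apply: (etrans (EmD Q (mn bb) (md bb))); apply: (etrans (congr1 (+%R ^~ _) z)); rewrite add0r.
(* A power of h is given up, since the constants of the bias may contain cH. *)
have h4le : 1 + h ^+ 2 * cH ^+ 4 <= 1 + h * cH ^+ 4.
  by rewrite lerD2l; apply: ler_wpM2r; [nonneg|rewrite expr2 -[leRHS]mulr1; apply: ler_wpM2l].
have st X : frobenius (stage D (sgn_step D N p) X) <= 5 / 4 * frobenius X.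
  apply: le_trans (stage_bound t_gt0 N_gt0 H_le (lexx _) p) _.
  by apply: ler_wpM2r; [exact: fro_ge0|exact: step_stage].
have pe : frobenius (Em Q (fun x => predm p k x - predd p k)) <= 5 / 4 * b + h * (BB * (b + A ^+ 2)).
  rewrite (_ : (fun _ => _) = (fun x => stage D (sgn_step D N p) (Gt x p k - Gd p k)
    + h%:C%C *: (noisem false p k x + driftm false p k x))); last first.
    by apply/funext => x; exact: pred_err.
  have ms : mbm (fun x : E => stage D (sgn_step D N p) (Gt x p k - Gd p k)) by apply: mbm_stage.
  have e := EmD Q ms (mbmZ h%:C%C (mnd false)).
  rewrite [X in frobenius X]e (EmZ Q _ (mnd false)) nm Em_stage//.
  apply: le_trans (froD _ _) _; apply: lerD.
    by apply: le_trans (st _) _; apply: ler_wpM2l => //; nonneg.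
  by rewrite froZr ger0_norm//; apply: ler_wpM2l.
have A20 : 0 <= A ^+ 2 by nonneg.
have d1 : frobenius (Em Q (driftm true p k)) <= BB * ((3 / 2 * b + 4^-1 * A ^+ 2) + A ^+ 2).
  have bb0 : 0 <= 3 / 2 * b + 4^-1 * A ^+ 2 by nonneg.
  apply: (drift_le rg jL bb0) => j1 k1 h1 h2; have [/andP[/eqP -> /eqP ->]|ne] := boolP ((j1 == p.+1) && (k1 == k)).
    rewrite (_ : (fun _ => _) = (fun x => predm p k x - predd p k)); last first.
      by apply/funext => x; rewrite stagemE stagedE !eqxx.
    exact: (bias_predictor pe hBB b0 A20).
  rewrite (_ : (fun _ => _) = (fun x => Gt x j1 k1 - Gd j1 k1)); last first.
    by apply/funext => x; rewrite stagemE stagedE /= (negbTE ne).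
  by apply: le_trans (inner j1 k1 h1 h2 ne) _; exact: (bias_inner b0 A20).
have h20 : 0 <= h / 2 by nonneg.
have mse : mbm (fun x : E => stage D (sgn_step D N p) (noisem false p k x + driftm false p k x)).
  by apply: mbm_stage; exact: (mnd false).
have mhe : mbm (fun x : E => heun D (sgn_step D N p) (Gt x p k - Gd p k)) by apply: mbm_heun.
have eq1 : Em Q (fun x => Gt x p.+1 k - Gd p.+1 k) = heun D (sgn_step D N p) (Em Q (fun x => Gt x p k - Gd p k))
    + (h / 2)%:C%C *: stage D (sgn_step D N p) (Em Q (driftm false p k)) + (h / 2)%:C%C *: Em Q (driftm true p k).
  rewrite (_ : (fun _ => _) = (fun x => heun D (sgn_step D N p) (Gt x p k - Gd p k)
    + (h / 2)%:C%C *: stage D (sgn_step D N p) (noisem false p k x + driftm false p k x)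
    + (h / 2)%:C%C *: (noisem true p k x + driftm true p k x))); last first.
    apply/funext => x; exact: (err_step t_gt0 N_gt0 B_meas W_le cL_ge0 B_le Ns_gt0 indep law x rg).
  apply: (etrans (EmD Q (mbmD mhe (mbmZ _ mse)) (mbmZ _ (mnd true)))).
  apply: (congr2 +%R); last by apply: (etrans (EmZ Q _ (mnd true))); rewrite nm.
  apply: (etrans (EmD Q mhe (mbmZ _ mse))); apply: (congr2 +%R); first exact: Em_heun.
  apply: (etrans (EmZ Q _ mse)); apply: (congr1 (fun X => (h / 2)%:C%C *: X)).
  exact: (etrans (Em_stage (sgn_step D N p) (mnd false)) (congr1 (stage D (sgn_step D N p)) (nm false))).
rewrite eq1; apply: le_trans (froD _ _) _.
have B0 := froD (heun D (sgn_step D N p) (Em Q (fun x => Gt x p k - Gd p k)))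
  ((h / 2)%:C%C *: stage D (sgn_step D N p) (Em Q (driftm false p k))).
rewrite froZr (ger0_norm h20) in B0; rewrite froZr (ger0_norm h20).
have B1 : frobenius (heun D (sgn_step D N p) (Em Q (fun x => Gt x p k - Gd p k))) <= (1 + h * cH ^+ 4) * b.
  have := @fro_step _ (Hs D) (Em Q (fun x => Gt x p k - Gd p k)) (sgn_step D N p) cH Hs_herm H_le.
  rewrite normr_sgn_step// => /(_ h_le1) H; apply: (le_trans H).
  by apply: ler_pM => //; [nonneg|exact: fro_ge0].
have B2 := ler_wpM2l h20 (st (Em Q (driftm false p k))).
have B3 := ler_wpM2l h0 d0. have B4 := ler_wpM2l h0 d1.
have c40 : 0 <= cH ^+ 4 by nonneg.
apply: (le_trans (bias_step B0 B1 B2 B3 B4 b0 A20 h0 BB_ge0 c40 erefl)).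
have eS : expR (Lam * (T p k + h)) = expR (Lam * T p k) * expR (Lam * h) by rewrite mulrDr expRD.
rewrite TS eS.
have e1 : 1 + Lam * h <= expR (Lam * h) := expR_ge1Dx _.
have e2 : 1 <= expR (Lam * T p k) by rewrite -[X in X <= _]expR0 ler_expR; nonneg.
exact: (bias_growth e1 e2 A20 Lam_ge0 T0 h0).
Qed.

End BiasRecursion.

(** * Explicit constants *)

Section GrowthArithmetic.
Variable R : realType.
Implicit Types a b c f h s t u v w x y : R.

Lemma geometric_bound (y : R) n : 0 <= y <= 3 / 10 -> \sum_(1 <= m < n.+1) y ^+ m.+1 <= 9 / 70.
Proof.
move=> /andP[y0 y1].
(* The value 9 / 70 is (3/10)^2 / (1 - 3/10); the tail of the geometric series is kept for the
   induction. *)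
suff H : \sum_(1 <= m < n.+1) y ^+ m.+1 <= 9 / 70 - 3 / 7 * (3 / 10) ^+ n.+1.
  by apply: (le_trans H); rewrite lerBlDr lerDl mulr_ge0// exprn_ge0// divr_ge0.
elim: n => [|n ih]; first by rewrite big_nil expr1; lra.
rewrite big_nat_recr//=.
have yn : y ^+ n.+2 <= (3 / 10) ^+ n.+2 by rewrite lerXn2r ?nnegrE//; lra.
have e : (3 / 10) ^+ n.+2 = 3 / 10 * (3 / 10) ^+ n.+1 :> R by rewrite exprS.
lra.
Qed.

Lemma apriori_step e f b a c s t h w x y u v : x <= a * (e * b) -> a <= f -> u <= h / 2 * (5 / 4 * s) -> v <= h / 2 * s ->
  1 <= e -> 1 <= f -> 0 <= h -> 0 <= s -> 0 <= b -> b = c + 5 / 4 * (s * t) -> w = u + v -> y = x + w ->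
  y <= (e * f) * (c + 5 / 4 * (s * (t + h))).
Proof.
move=> hx haf hu hv he hf h0 s0 b0 hb -> ->.
have hs : 0 <= h * s by exact: mulr_ge0.
have ef : 1 <= e * f by apply: mulr_ege1.
have eb : 0 <= e * b by apply: mulr_ge0 => //; lra.
have p1 := ler_wpM2r eb haf.
have p2 := ler_wpM2r hs ef.
have -> : (e * f) * (c + 5 / 4 * (s * (t + h))) = f * (e * b) + 5 / 4 * ((e * f) * (h * s)).
  by rewrite hb; ring.
lra.
Qed.

Lemma apriori_final e b c s : 1 <= e -> e <= 11 / 10 -> c <= 283 / 200 -> s <= 9 / 70 -> b = c + 5 / 4 * s ->
  0 <= b -> e * b <= 2.
Proof.
move=> h0 h1 h2 h3 hb b0; have := ler_wpM2r b0 h1; lra.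
Qed.

Lemma apriori_pred u v h c s : u <= 5 / 4 * 2 -> v <= h * s -> h * s <= 9 / 70 -> u + v <= 3.
Proof. by move=> *; lra. Qed.

Lemma sqrt2_le : Num.sqrt 2 <= 283 / 200 :> R.
Proof.
rewrite -(@ler_pXn2r _ 2)// ?nnegrE ?sqrtr_ge0 ?divr_ge0// sqr_sqrtr//; lra.
Qed.

Lemma expR_11 x : x <= 11^-1 -> expR x <= 11 / 10.
Proof.
move=> h; have b1 : 10 / 11 <= expR (- x) by apply: le_trans (expR_ge1Dx _); lra.
have := ler_wpM2l (expR_ge0 x) b1; rewrite -expRD subrr expR0; lra.
Qed.

End GrowthArithmetic.

(** * A bound on the propagators over short gaps *)

Section AprioriBound.
Variables (R : realType) (D : model R) (N : nat) (cW cL cH : R).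
Hypotheses (t_gt0 : 0 < horizon D) (N_gt0 : (0 < N)%N).
Hypotheses (W_le : frobenius (Ws D) <= cW) (cL_ge0 : 0 <= cL).
Hypotheses (H_le : frobenius (Hs D) <= cH) (Hs_herm : Hs D \is hermsymmx) (Os_norm : frobenius (Os D) = 1).
Local Notation M := 'M[R[i]]_2.
Local Notation nt := (node_time D N).
Local Notation h := (horizon D / N%:R).
Local Notation mi := (mesh_index N).
Local Notation sig := (sig D cW cL).
Local Notation wt := (wt cW cL).
Local Notation T j k := (((mi j)%:R - (mi k)%:R) * h).
Variables (L : nat).
Local Notation tauL := (L%:R * h).
Hypotheses (h_le1 : h <= 1) (hcH : h * cH <= 4^-1) (wtau : wt * tauL <= 10^-1) (hcH4 : h * cH ^+ 4 * tauL <= 11^-1).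
Variables (G K0 K1 A : nat -> nat -> M).
Hypotheses (diag : forall k, G k k = 1%:M)
  (initial : forall p, (N <= p)%N -> G p.+1 N = G p.+1 N.+1 *m Os D)
  (final_ : forall q, (q < N)%N -> G N.+1 q = Os D *m G N q)
  (step : forall p q, regular N p q -> G p.+1 q = heun D (sgn_step D N p) (G p q)
    + (h / 2)%:C%C *: stage D (sgn_step D N p) (K0 p q) + (h / 2)%:C%C *: K1 p q)
  (AE : forall p q, A p q = stage D (sgn_step D N p) (G p q) + h%:C%C *: K0 p q)
  (K0_le : forall p q, regular N p q ->
    (forall j k, (q <= k)%N -> (k <= j <= final false p)%N -> frobenius (G j k) <= 3) ->
    frobenius (K0 p q) <= sig 3 (nt p - nt q))
  (K1_le : forall p q, regular N p q ->
    (forall j k, (q <= k)%N -> (k <= j <= final true p)%N ->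
       frobenius (if [&& true, j == p.+1 & k == q] then A p q else G j k) <= 3) ->
    frobenius (K1 p q) <= sig 3 (nt p.+1 - nt q)).

(** With propagators below 3 and w tauL <= 1/10 the order-m term is at most (3/10) to the power m +
    1. *)
Lemma sig3_le : sig 3 tauL * tauL <= 9 / 70.
Proof.
have h0 := step_ge0 t_gt0 N_gt0.
have w0 := wt_ge0 cL W_le.
have t0 : 0 <= tauL by nonneg.
have y0 : 0 <= 3 * (wt * tauL) <= 3 / 10.
  by apply/andP; split; [nonneg|move: (ler_wpM2l (ler0n R 3) wtau)].
apply: le_trans (geometric_bound (max_order D) y0).
rewrite /Submission.sig mulr_suml big_filter [leRHS](bigID odd)/=.
apply: ler_wpDr; first by apply: sumr_ge0 => m _; nonneg.
apply: ler_sum => m om.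
have gen (a b d : R) : (a * 3) ^+ m.+1 * b ^+ m * d * b = (3 * (a * b)) ^+ m.+1 * d.
  by rewrite [a * 3]mulrC !exprMn [b ^+ m.+1]exprSr; ring.
rewrite gen.
rewrite -[leRHS]mulr1; apply: ler_wpM2l; first by nonneg.
by rewrite invf_le1 ?ltr0n ?double_fact_gt0// ler1n double_fact_gt0.
Qed.

(** Bootstrap along the gap: as long as inner values stay below 2 and the predictor below 3, the
    slopes are at most s with s tauL <= 9/70, too small to lift the norm from sqrt 2, that of the
    identity, above 2. The statement is abstract in the slopes so as to serve both schemes. *)
Lemma apriori j k : (k <= j <= (2 * N).+1)%N -> (mi j <= mi k + L)%N -> frobenius (G j k) <= 2.
Proof.
have h0 := step_ge0 t_gt0 N_gt0.
have w0 := wt_ge0 cL W_le.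
have c0 := cH_ge0 H_le.
have t0 : 0 <= tauL by nonneg.
pose al := h * cH ^+ 4. have al0 : 0 <= al by rewrite /al; nonneg.
pose s := sig 3 tauL.
have s0 : 0 <= s.
  apply: sumr_ge0 => m _; apply: mulr_ge0; last by nonneg.
  by nonneg.
have s3 : s * tauL <= 9 / 70 := sig3_le.
have T_ge0 j' k' : (k' <= j')%N -> 0 <= T j' k'.
  by move=> kj; apply: mulr_ge0 => //; rewrite subr_ge0 ler_nat; exact: (mi_le t_gt0 N_gt0).
have T_leL j' k' : (mi j' <= mi k' + L)%N -> T j' k' <= tauL.
  by move=> jk'; apply: ler_wpM2r => //; rewrite lerBlDl -natrD ler_nat.
have q2 : 0 <= Num.sqrt 2 :> R by exact: sqrtr_ge0.
(* Numerically 1.1 (1.415 + 5/4 times 9/70) < 2. *)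
have small u : 0 <= u <= tauL -> expR (al * u) * (Num.sqrt 2 + 5 / 4 * (s * u)) <= 2.
  move=> /andP[u0 uL].
  have e1 : 1 <= expR (al * u) by rewrite -[X in X <= _]expR0 ler_expR mulr_ge0.
  have e2 : expR (al * u) <= 11 / 10.
    by apply: expR_11; apply: le_trans hcH4; exact: ler_wpM2l.
  have su : s * u <= 9 / 70 by apply: le_trans s3; exact: ler_wpM2l.
  have b0 : 0 <= Num.sqrt 2 + 5 / 4 * (s * u) by nonneg.
  exact: (apriori_final e1 e2 (sqrt2_le R) su erefl b0).
suff H l : forall j k, (j - k < l)%N -> (k <= j <= (2 * N).+1)%N -> (mi j <= mi k + L)%N ->
    frobenius (G j k) <= expR (al * T j k) * (Num.sqrt 2 + 5 / 4 * (s * T j k)).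
  move=> kj jk; apply: (le_trans (H _ j k (ltnSn _) kj jk)); apply: small.
  by rewrite T_ge0 ?T_leL//; case/andP: kj.
elim: l => // l ih {}j {}k jkl kj jL.
have [->|jk] := eqVneq j k.
  by rewrite diag fro1 subrr mul0r !mulr0 expR0 mul1r addr0.
case: j jkl kj jk jL => [|p] jkl kj jk jL; first by move: kj jk; rewrite leqn0; case: k {jkl jL}.
have kp : (k <= p)%N by move: kj jk; clear; lia.
have eN : mi N.+1 = mi N by rewrite /mesh_index leqnn ltnn.
have [kN|kN] := eqVneq k N.
  have Np : (N <= p)%N by rewrite -kN.
  rewrite kN initial//; apply: le_trans (froM _ _) _; rewrite Os_norm mulr1 -eN.
  apply: ih; [by move: jkl Np; rewrite kN; clear; lia|by move: kj Np; rewrite kN; clear; lia|].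
  by rewrite eN; move: jL; rewrite kN.
have [pN|pN] := eqVneq p N.
  have kN' : (k < N)%N by move: kN kp; rewrite pN; clear; lia.
  rewrite pN final_//; apply: le_trans (froM _ _) _; rewrite Os_norm mul1r eN.
  apply: ih; [by move: jkl kN'; rewrite pN; clear; lia|by move: kN'; clear; lia|].
  by rewrite -eN; move: jL; rewrite pN.
have rg : regular N p k by rewrite /Submission.regular pN kN !andbT; move: kj kp; clear; lia.
have [mS mkp] := regular_mi t_gt0 N_gt0 rg.
have pL : (mi p <= mi k + L)%N by apply: leq_trans jL; rewrite mS.
have TS : T p.+1 k = T p k + h by rewrite mS -natr1; ring.
have gp : nt p - nt k = T p k by rewrite /node_time mulrBl.
have gp1 : nt p.+1 - nt k = T p.+1 k by rewrite /node_time mulrBl.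
have le23 : 2 <= 3 :> R by rewrite ler_nat.
have le3 : 0 <= (3 : R) <= 3 by rewrite ler0n lexx.
have inner j1 k1 : (k <= k1)%N -> (k1 <= j1 <= p.+1)%N -> ~~ ((j1 == p.+1) && (k1 == k)) ->
    frobenius (G j1 k1) <= 2.
  move=> h1 h2 ne.
  have jL1 : (mi j1 <= mi k1 + L)%N.
    have := mi_le t_gt0 N_gt0 h1; have := mi_le t_gt0 N_gt0 (proj2 (andP h2)).
    by move: jL; clear; lia.
  apply: (@le_trans _ _ (expR (al * T j1 k1) * (Num.sqrt 2 + 5 / 4 * (s * T j1 k1)))).
    by apply: ih => //; [move: ne jkl h1 h2 kp; clear; lia|move: h2 kj; clear; lia].
  by apply: small; rewrite T_ge0 ?T_leL//; case/andP: h2.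
have K0s : frobenius (K0 p k) <= s.
  apply: le_trans (K0_le rg _) _.
    move=> j1 k1 h1 h2; apply: le_trans (inner j1 k1 h1 _ _) le23; move: h2; rewrite /final; clear; lia.
  by apply: (sig_mono cL W_le le3); rewrite gp T_ge0// T_leL.
have hT : h <= tauL.
  rewrite -[X in X <= _]mul1r ler_wpM2r// ler1n; move: jL; rewrite mS.
  by move: mkp; clear; lia.
have As : frobenius (A p k) <= 3.
  rewrite AE; apply: le_trans (froD _ _) _.
  have B1 : frobenius (stage D (sgn_step D N p) (G p k)) <= 5 / 4 * 2.
    have gpk : frobenius (G p k) <= 2 by apply: inner => //; move: kp; clear; lia.
    apply: le_trans (stage_bound t_gt0 N_gt0 H_le gpk p) _.
    by apply: ler_wpM2r => //; exact: step_stage.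
  have B2 : frobenius (h%:C%C *: K0 p k) <= h * s.
    by rewrite froZr ger0_norm//; apply: ler_wpM2l.
  have B3 : h * s <= 9 / 70 by apply: le_trans s3; rewrite mulrC; apply: ler_wpM2l.
  exact: (apriori_pred 0 B1 B2 B3).
have K1s : frobenius (K1 p k) <= s.
  apply: le_trans (K1_le rg _) _.
    move=> j1 k1 h1 h2 /=; have [_ //|ne] := boolP ((j1 == p.+1) && (k1 == k)).
    exact: le_trans (inner j1 k1 h1 h2 ne) le23.
  by apply: (sig_mono cL W_le le3); rewrite gp1 T_ge0 ?T_leL//; case/andP: kj.
have h20 : 0 <= h / 2 by nonneg.
rewrite step//; apply: le_trans (froD _ _) _.
have B0 := froD (heun D (sgn_step D N p) (G p k)) ((h / 2)%:C%C *: stage D (sgn_step D N p) (K0 p k)).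
have st : frobenius (stage D (sgn_step D N p) (K0 p k)) <= 5 / 4 * s.
  apply: le_trans (stage_bound t_gt0 N_gt0 H_le K0s p) _.
  by apply: ler_wpM2r => //; exact: step_stage.
have gpk : frobenius (G p k) <= expR (al * T p k) * (Num.sqrt 2 + 5 / 4 * (s * T p k)).
  by apply: ih => //; [move: jkl kp; clear; lia|move: kj kp; clear; lia].
have T0 : 0 <= T p k by exact: T_ge0.
have B1 : frobenius (heun D (sgn_step D N p) (G p k)) <=
    (1 + h ^+ 2 * cH ^+ 4) * (expR (al * T p k) * (Num.sqrt 2 + 5 / 4 * (s * T p k))).
  have := @fro_step _ (Hs D) (G p k) (sgn_step D N p) cH Hs_herm H_le.
  rewrite normr_sgn_step// => /(_ h_le1) H; apply: (le_trans H).
  by apply: ler_wpM2l => //; nonneg.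
have af : 1 + h ^+ 2 * cH ^+ 4 <= expR (al * h).
  by apply: le_trans (expR_ge1Dx _); rewrite lerD2l /al expr2 le_eqVlt; apply/orP; left; apply/eqP; ring.
have e1 : 1 <= expR (al * T p k) by rewrite -[X in X <= _]expR0 ler_expR mulr_ge0.
have f1 : 1 <= expR (al * h) by rewrite -[X in X <= _]expR0 ler_expR mulr_ge0.
have B2 := ler_wpM2l h20 st. have B3 := ler_wpM2l h20 K1s.
rewrite froZr (ger0_norm h20) in B0; rewrite froZr (ger0_norm h20).
have b0 : 0 <= Num.sqrt 2 + 5 / 4 * (s * T p k) by nonneg.
have eS : expR (al * T p.+1 k) = expR (al * T p k) * expR (al * h) by rewrite TS mulrDr expRD.
have B4 := apriori_step B1 af B2 B3 e1 f1 h0 s0 b0 erefl erefl erefl.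
rewrite addrA in B4; rewrite eS TS; apply: le_trans B4; exact: (lerD B0 (lexx _)).
Qed.
End AprioriBound.

(** * Comparison with P1 and gamma *)

Section ConstantComparison.
Variables (R : realType) (D : model R) (cW cL : R).
Hypotheses (cW_ge0 : 0 <= cW) (cL_ge0 : 0 <= cL) (order_odd : odd (max_order D)).
Local Notation Mbar := (max_order D).
Local Notation orders := [seq m <- index_iota 1 Mbar.+1 | odd m].
Local Notation wt := (wt cW cL).
Local Notation sig := (sig D cW cL).
Local Notation rate := (drift_rate D cW cL).
Local Notation P1 G := (P1 Mbar G cW cL).

Let w0 : 0 <= wt. Proof. by rewrite /Submission.wt; nonneg. Qed.

Lemma P1E G x : P1 G x = 2 * wt ^+ 2 * G + 3 * wt ^+ 3 * G ^+ 2 * (1 + x) *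
  \sum_(3 <= m < Mbar.+1 | odd m) ((m - 1) * m)%N%:R / (double_fact (m - 3))%:R * (2 * wt * G * x) ^+ (m - 2).
Proof.
have sq : Num.sqrt cL ^+ 2 = cL by rewrite sqr_sqrtr.
rewrite /Defs.P1 /Submission.wt -{1}sq; congr (_ + _); first by ring.
congr (_ * _); first by ring.
by apply: eq_bigr => m _; congr (_ * _ ^+ _); ring.
Qed.

Lemma P1_first G x : 0 <= G -> 0 <= x -> 2 * wt ^+ 2 * G <= P1 G x.
Proof.
move=> G0 x0; rewrite P1E lerDl; apply: mulr_ge0; first by nonneg.
by apply: sumr_ge0 => m _; nonneg.
Qed.

Lemma P1_ge0 G x : 0 <= G -> 0 <= x -> 0 <= P1 G x.
Proof. by move=> G0 x0; apply: le_trans (P1_first G0 x0); nonneg. Qed.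

Lemma P1_mono G G' x x' : 0 <= G <= G' -> 0 <= x <= x' -> P1 G x <= P1 G' x'.
Proof.
move=> /andP[G0 GG] /andP[x0 xx]; have G0' := le_trans G0 GG; have x0' := le_trans x0 xx.
rewrite !P1E; apply: lerD; first by apply: ler_wpM2l => //; nonneg.
apply: ler_pM; [by nonneg|by apply: sumr_ge0 => m _; nonneg| |].
  apply: ler_pM; [by nonneg|by nonneg| |by rewrite lerD2l].
  by apply: ler_wpM2l; [nonneg|rewrite lerXn2r].
apply: ler_sum => m _; apply: ler_wpM2l; first by nonneg.
apply: lerXn2r; rewrite ?nnegrE; [by nonneg|by nonneg|].
by apply: ler_pM => //; [nonneg|apply: ler_wpM2l => //; nonneg].
Qed.

(** Order 1 is compared with the leading term of P1 and every higher order with its own term of the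
    series, where 1 + x is lowered to x. *)
Lemma sum_P1_le (F : nat -> R) c G x : 0 <= c -> 0 <= G -> 0 <= x ->
  F 1%N <= c * (2 * wt ^+ 2 * G) ->
  (forall k, F k.+3 <= c * (3 * wt ^+ 3 * G ^+ 2 * x *
     (((k.+2 * k.+3)%N%:R / (double_fact k)%:R) * (2 * wt * G * x) ^+ k.+1))) ->
  \sum_(m <- orders) F m <= c * P1 G x.
Proof.
move=> c0 G0 x0 F1 F3; have M0 : (0 < Mbar)%N by case: (Mbar) order_odd.
rewrite big_filter big_ltn_cond// P1E mulrDr; apply: lerD => //.
have [->|M1] := eqVneq Mbar 1%N.
  by rewrite !big_geq//; rewrite ?mulr0.
have M3 : (2 < Mbar.+1)%N by move: M0 M1; clear; lia.
rewrite big_ltn_cond//= !mulr_sumr big_nat_cond [leRHS]big_nat_cond.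
apply: ler_sum => m /andP[/andP[m3 _] _].
have -> : m = (m - 3).+3 by move: m3; clear; lia.
apply: (le_trans (F3 _)); apply: ler_wpM2l => //; rewrite !subSS !subn0.
apply: ler_wpM2r; first by nonneg.
by apply: ler_wpM2l; [nonneg|rewrite lerDr].
Qed.

Let pow2 k : 2 <= (2 : R) ^+ k.+1.
Proof. by rewrite exprS -[X in X <= _]mulr1 ler_wpM2l// exprn_ege1// ler1n. Qed.

(** An equality at order 1, where [sig] is quadratic in G and P1 linear; this explains the factor G
    / 2. *)
Lemma sig_P1 G x : 0 <= G -> 0 <= x -> sig G x <= G / 2 * x * P1 G x.
Proof.
move=> G0 x0; apply: sum_P1_le => //; first by nonneg.
  by rewrite /= divr1 le_eqVlt; apply/orP; left; apply/eqP; field.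
move=> k; rewrite subn1 /= natrM invfM.
have k20 : 0 < k.+2%:R :> R by rewrite ltr0n.
pose a := (wt * G) ^+ k.+4 * x ^+ k.+3 / (double_fact k)%:R.
have a0 : 0 <= a by rewrite /a; nonneg.
have -> : G / 2 * x * (3 * wt ^+ 3 * G ^+ 2 * x * ((k.+2 * k.+3)%N%:R / (double_fact k)%:R *
    (2 * wt * G * x) ^+ k.+1)) = a * (3 / 2 * 2 ^+ k.+1 * k.+2%:R * k.+3%:R).
  by rewrite /a natrM !exprMn !exprS; field; rewrite pnatr_eq0 -lt0n double_fact_gt0.
have -> : (wt * G) ^+ k.+4 * x ^+ k.+3 * (k.+2%:R^-1 * (double_fact k)%:R^-1) = a * k.+2%:R^-1.
  by rewrite /a; ring.
apply: ler_wpM2l => //; apply: (@le_trans _ _ 1); first by rewrite invf_le1// ler1n.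
have p := pow2 k. have q : 1 <= k.+2%:R :> R by rewrite ler1n.
have r : 1 <= k.+3%:R :> R by rewrite ler1n.
have qr : 1 <= k.+2%:R * k.+3%:R :> R by apply: mulr_ege1.
have gen (u v y : R) : 2 <= u -> 1 <= v * y -> 1 <= 3 / 2 * u * v * y.
  by move=> h1 h2; have := ler_wpM2l (le_trans (ler0n R 2) h1) h2; lra.
exact: gen.
Qed.

(** Fixes the size of kappa. The 3 makes order 1 an equality. *)
Lemma rate_P1 G x : 0 <= G -> 0 <= x -> rate G x <= 3 * P1 G x.
Proof.
move=> G0 x0; apply: sum_P1_le => //.
  by rewrite /= divr1 le_eqVlt; apply/orP; left; apply/eqP; ring.
move=> k; rewrite subn1 /= natrM invfM.
have k20 : 0 < k.+2%:R :> R by rewrite ltr0n.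
pose a := wt ^+ k.+4 * G ^+ k.+3 * x ^+ k.+2 / (double_fact k)%:R * k.+3%:R.
have a0 : 0 <= a by rewrite /a; nonneg.
have -> : 3 * (3 * wt ^+ 3 * G ^+ 2 * x * ((k.+2 * k.+3)%N%:R / (double_fact k)%:R *
    (2 * wt * G * x) ^+ k.+1)) = a * (9 * 2 ^+ k.+1 * k.+2%:R).
  by rewrite /a natrM !exprMn !exprS; field; rewrite pnatr_eq0 -lt0n double_fact_gt0.
have -> : wt ^+ k.+4 * G ^+ k.+3 * x ^+ k.+2 * (k.+2%:R^-1 * (double_fact k)%:R^-1) * (2 * k.+3%:R * (k.+3 + 2)%:R)
   = a * (2 * (k.+3 + 2)%:R / k.+2%:R) by rewrite /a; ring.
apply: ler_wpM2l => //; rewrite ler_pdivrMr//.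
have p := pow2 k. have q : 1 <= k.+2%:R :> R by rewrite ler1n.
have q2 : k.+2%:R <= k.+2%:R * k.+2%:R :> R by rewrite -[X in X <= _]mulr1 ler_wpM2l// ltW.
have -> : (k.+3 + 2)%:R = k.+2%:R + 3 :> R by rewrite -natrD; congr (_%:R); clear; lia.
have gen (u v : R) : 2 <= u -> 1 <= v -> v <= v * v -> 2 * (v + 3) <= 9 * u * v * v.
  move=> h1 h2 h3; have vv : 0 <= v * v by lra.
  by have := ler_wpM2r vv h1; lra.
exact: gen.
Qed.

Local Notation eps := ((10 * Mbar.+1%:R)^-1 : R).

(** [eps] is chosen for this: a product of at most Mbar + 1 propagators, each enlarged by 1 + eps to
    cover the predictor, grows by at most exp (1/10). *)
Lemma eps_pow m : (m <= Mbar.+1)%N -> (1 + eps) ^+ m <= 10 / 9.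
Proof.
move=> mM; have e0 : 0 <= eps by nonneg.
have n0 : 0 < Mbar.+1%:R :> R by rewrite ltr0n.
apply: (@le_trans _ _ (expR (10^-1))).
  apply: (@le_trans _ _ (expR eps ^+ m)).
    by apply: lerXn2r; rewrite ?nnegrE ?expR_ge0 ?expR_ge1Dx//; nonneg.
  rewrite -expRM_natl ler_expR invfM mulrCA -[leRHS]mulr1; apply: ler_wpM2l => //.
  by rewrite ler_pdivrMr// mul1r ler_nat.
have b1 : 9 / 10 <= expR (- 10^-1 : R) by apply: le_trans (expR_ge1Dx _); lra.
have := ler_wpM2l (expR_ge0 (10^-1 : R)) b1; rewrite -expRD subrr expR0; lra.
Qed.

Lemma sig_eps G x : 0 <= G -> 0 <= x -> sig ((1 + eps) * G) x <= 10 / 9 * sig G x.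
Proof.
move=> G0 x0; rewrite /Submission.sig mulr_sumr big_seq [leRHS]big_seq; apply: ler_sum => m mo.
have [_ [_ mM]] := order_pos mo.
have -> : (wt * ((1 + eps) * G)) ^+ m.+1 * x ^+ m / (double_fact (m - 1))%:R =
  (1 + eps) ^+ m.+1 * ((wt * G) ^+ m.+1 * x ^+ m / (double_fact (m - 1))%:R).
  by rewrite mulrCA exprMn !mulrA.
apply: ler_wpM2r; first by nonneg.
exact: eps_pow.
Qed.

Lemma rate_eps G x : 0 <= G -> 0 <= x -> rate ((1 + eps) * G) x <= 10 / 9 * rate G x.
Proof.
move=> G0 x0; rewrite /Submission.drift_rate mulr_sumr big_seq [leRHS]big_seq; apply: ler_sum => m mo.
have [_ [_ mM]] := order_pos mo.
have -> : wt ^+ m.+1 * ((1 + eps) * G) ^+ m * x ^+ (m - 1) / (double_fact (m - 1))%:R * (2 * m%:R * (m + 2)%:R) =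
  (1 + eps) ^+ m * (wt ^+ m.+1 * G ^+ m * x ^+ (m - 1) / (double_fact (m - 1))%:R * (2 * m%:R * (m + 2)%:R)).
  by rewrite [((1 + eps) * G) ^+ m]exprMn (mulrCA (wt ^+ m.+1)) !mulrA.
by apply: ler_wpM2r; [nonneg|exact: eps_pow (leqW mM)].
Qed.

Lemma gammaE G x : gamma_bar Mbar G cW cL x = 2 * sig G x.
Proof.
rewrite /gamma_bar /Submission.sig big_filter !mulr_sumr; apply: eq_bigr => m _.
have -> : cW * G * Num.sqrt cL * x = (wt * G) * x by rewrite /Submission.wt; ring.
rewrite [(wt * G * x) ^+ m]exprMn [(wt * G) ^+ m.+1]exprS.
by move: ((wt * G) ^+ m) (x ^+ m) => u v; rewrite /Submission.wt; ring.
Qed.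

Lemma sig_first G x : 0 <= G -> 0 <= x -> (wt * G) ^+ 2 * x <= sig G x.
Proof.
move=> G0 x0; have M0 : (0 < Mbar)%N by case: (Mbar) order_odd.
rewrite /Submission.sig big_filter big_ltn_cond//= divr1 lerDl.
by apply: sumr_ge0 => m _; nonneg.
Qed.

End ConstantComparison.

(** * Arithmetic of the final constants *)

Section FinalArithmetic.
Variable R : realType.
Implicit Types a b e f g h l p q s t u v w x y z : R.

Lemma star_bound h c s e g b : h * s <= h * (g * b) -> h * (c + g) * b <= e * b ->
  (1 + h * c) * b + h * s <= (1 + e) * b.
Proof. by move=> *; lra. Qed.

Lemma kappa_half u v : u <= v -> 50 * u <= 100 * v / 2.
Proof. by move=> *; lra. Qed.

Lemma kappa_sqr r p : r <= 10 / 9 * (3 * p) -> 0 <= p -> 12 * r <= 100 ^+ 2 * p.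
Proof. by move=> *; lra. Qed.

Lemma large_gap s g t p w : s * t <= g / 2 * t * p * t -> 2 * w ^+ 2 * g * t ^+ 2 <= p * t ^+ 2 ->
  (10^-1) ^+ 2 <= (w * t) ^+ 2 -> 0 <= g -> 0 <= p * t ^+ 2 -> s * t <= p * t ^+ 2 + 25 * (p * t ^+ 2) ^+ 2.
Proof.
move=> h1 h2 h3 g0 z0.
have h4 := ler_wpM2l g0 h3.
have h5 : g <= 50 * (p * t ^+ 2) by move: h2 h4; rewrite exprMn; lra.
have := ler_wpM2r z0 h5; move: h1; rewrite expr2 [(p * _) ^+ 2]expr2; lra.
Qed.

Lemma small_gap s g t p q : s * t <= g / 2 * t * q * t -> q <= p -> g <= 2 -> 0 <= g -> 0 <= q -> 0 <= t ->
  0 <= p * t ^+ 2 -> s * t <= p * t ^+ 2 + 25 * (p * t ^+ 2) ^+ 2.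
Proof.
move=> h1 qp g2 g0 q0 t0 z0.
have t2 : 0 <= t ^+ 2 by exact: exprn_ge0.
have h2 := ler_wpM2r t2 qp. have h3 := ler_wpM2r (mulr_ge0 q0 t2) g2.
have z2 : 0 <= (p * t ^+ 2) ^+ 2 by exact: exprn_ge0.
have e : g / 2 * t * q * t = g * (q * t ^+ 2) / 2 by rewrite expr2; field.
rewrite e in h1; lra.
Qed.

(** Here z = sqrt P1 times the gap and 353 = 100 + 253. The spare factor exp (253 z) exceeds (1 + 10
    z)^2, whose square dominates z^2 + 25 z^4, hence s t; then S^2 t is controlled by g instead of
    its square. Numerically 36 (10/9)^2 < 68. *)
Lemma rms_final S s g t z u : 0 <= S -> 0 <= s -> S <= 10 / 9 * s -> s <= g ->
  s * t <= z ^+ 2 + 25 * (z ^+ 2) ^+ 2 -> 0 <= z -> 0 <= t -> 0 <= u ->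
  2 * (3 * S * Num.sqrt (t * u)) * expR (100 * z) <=
  Num.sqrt 34 * Num.sqrt (2 * g) * expR (353 * z) * Num.sqrt u.
Proof.
move=> S0 s0 Ss sg st z0 t0 u0.
have g0 := le_trans s0 sg.
have -> : expR (353 * z) = expR (100 * z) * expR (253 * z) by rewrite -expRD; congr expR; ring.
set f := expR (253 * z).
have f0 : 0 <= f by exact: expR_ge0.
have fle : (1 + 10 * z) ^+ 2 <= f.
  have -> : f = expR (253 / 2 * z) ^+ 2 by rewrite /f expr2 -expRD; congr expR; field.
  apply: lerXn2r; rewrite ?nnegrE ?expR_ge0//; first by nonneg.
  by apply: le_trans (expR_ge1Dx _); lra.
have f2 : z ^+ 2 + 25 * (z ^+ 2) ^+ 2 <= f ^+ 2.
  have z2 : 0 <= z ^+ 2 by nonneg. have z3 : 0 <= z ^+ 3 by nonneg. have z4 : 0 <= z ^+ 4 by nonneg.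
  have : ((1 + 10 * z) ^+ 2) ^+ 2 <= f ^+ 2 by apply: lerXn2r; rewrite ?nnegrE//; nonneg.
  have -> : ((1 + 10 * z) ^+ 2) ^+ 2 = 1 + 40 * z + 600 * z ^+ 2 + 4000 * z ^+ 3 + 10000 * z ^+ 4 by ring.
  have -> : (z ^+ 2) ^+ 2 = z ^+ 4 by ring.
  lra.
have main : 36 * S ^+ 2 * t <= 68 * g * f ^+ 2.
  have a1 : S ^+ 2 <= (10 / 9 * s) ^+ 2 by apply: lerXn2r; rewrite ?nnegrE//; nonneg.
  have a2 := ler_wpM2r t0 a1. have a3 := ler_wpM2l s0 (le_trans st f2).
  have a4 := ler_wpM2r (exprn_ge0 2 f0) sg.
  have e : (10 / 9 * s) ^+ 2 * t = 100 / 81 * (s * (s * t)) by rewrite expr2; field.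
  rewrite e in a2.
  have a5 : 0 <= g * f ^+ 2 by nonneg.
  lra.
have -> : 2 * (3 * S * Num.sqrt (t * u)) * expR (100 * z) = expR (100 * z) * (6 * S * Num.sqrt (t * u)) by ring.
have -> : Num.sqrt 34 * Num.sqrt (2 * g) * (expR (100 * z) * f) * Num.sqrt u =
  expR (100 * z) * (Num.sqrt 34 * Num.sqrt (2 * g) * f * Num.sqrt u) by ring.
apply: ler_wpM2l; first exact: expR_ge0.
rewrite -(@ler_pXn2r _ 2)// ?nnegrE; [|by nonneg|by nonneg].
rewrite !exprMn !sqr_sqrtr; [|by nonneg|by nonneg|by nonneg|by nonneg].
have := ler_wpM2r u0 main.
have -> : 36 * S ^+ 2 * t * u = 6 ^+ 2 * S ^+ 2 * (t * u) by ring.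
by have -> : 68 * g * f ^+ 2 * u = 34 * (2 * g) * f ^+ 2 * u by ring.
Qed.

(** The bias is c t^2 h / Ns. On the other side alpha supplies 160 t P2 and gamma at least 2 q t
    with q = (w cG)^2, so P2 >= c / q suffices. *)
Lemma bias_final (p c q s al e t u : R) : 1 + c / q <= p -> 0 < q -> 0 <= c -> q * t <= s ->
  10 * t * (16 * p) <= al -> 1 <= e -> 0 <= t -> 0 <= u ->
  c * (t ^+ 2 * u) <= 4 * 34 * al * (2 * s) * e * u.
Proof.
move=> hp q0 c0 hs ha he t0 u0.
have p0 : 0 <= p by apply: le_trans hp; rewrite addr_ge0// divr_ge0// ltW.
have cp : c <= p * q.
  have := ler_wpM2r (ltW q0) hp; rewrite mulrDl mul1r divfK ?gt_eqF//; lra.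
have s0 : 0 <= s by apply: le_trans hs; exact: mulr_ge0 (ltW q0) t0.
have a0 : 0 <= al by apply: le_trans ha; nonneg.
have h1 : (10 * t * (16 * p)) * (q * t) <= al * s.
  by apply: ler_pM => //; [nonneg|exact: mulr_ge0 (ltW q0) t0].
have tt : 0 <= t ^+ 2 by nonneg.
have h2 := ler_wpM2r tt cp.
have as0 : 0 <= al * s by nonneg.
have h3 := ler_wpM2l as0 he.
have e1 : (10 * t * (16 * p)) * (q * t) = 160 * (p * q * t ^+ 2) by rewrite expr2; ring.
rewrite e1 in h1.
have h4 : c * t ^+ 2 <= 272 * (al * s * e).
  have pq : 0 <= p * q * t ^+ 2 by apply: mulr_ge0 => //; exact: mulr_ge0 p0 (ltW q0).
  lra.
have := ler_wpM2r u0 h4.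
have -> : 272 * (al * s * e) * u = 4 * 34 * al * (2 * s) * e * u by ring.
by rewrite -[c * t ^+ 2 * u]mulrA.
Qed.

End FinalArithmetic.

(** * Thresholds *)

Section Thresholds.
Variables (R : realType) (D : model R) (cG cH cW cL : R).
Local Notation Mbar := (max_order D).
Local Notation t := (horizon D).
Local Notation eps := ((10 * Mbar.+1%:R)^-1 : R).
Local Notation Kmax := (100 * Num.sqrt (P1 Mbar cG cW cL (2 * t))).
Local Notation BBc := (bias_rate D cW cL ((1 + eps) * cG) (2 * t)).
Local Notation Lam := (cH ^+ 4 + 2 * BBc).

(** A sum of nonnegative terms, one for each smallness condition: h <= 1 / threshold makes h times
    every summand at most 1. *)
Definition threshold : R :=
  1 + 4 * cH + 10 * Mbar.+1%:R * (cH + sig D cW cL cG (2 * t)) + 10 * Kmax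
  + cH ^+ 4 / (50 * Num.sqrt (2 * wt cW cL ^+ 2 * cG)) + 2 * cH ^+ 4 + 4 * BBc + 22 * t * cH ^+ 4 + 10.

(** The bound of [bias_error] at the full horizon with gap^2 h / Ns divided out; 144 is the square
    of 4 from the predictor times 3 from the noise. *)
Definition bias_const : R :=
  144 * sig D cW cL ((1 + eps) * cG) (2 * t) ^+ 2 * expR (Kmax * (2 * t)) ^+ 2 * Lam * expR (Lam * (2 * t)).

End Thresholds.

(** * The two estimates on the sample space *)

Section ErrorEstimates.
Variables (R : realType) (D : model R) (N Ns : nat) (cW cL cH : R).
Hypotheses (t_gt0 : 0 < horizon D) (N_gt0 : (0 < N)%N) (B_meas : measurable_corr D).
Hypotheses (W_le : frobenius (Ws D) <= cW) (cL_ge0 : 0 <= cL)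
  (B_le : forall s1 s2 : R, 0 <= s1 -> s1 <= s2 -> s2 <= 2 * horizon D ->
       Normc.normc (corr D s2 s1) <= cL).
Hypotheses (Ns_gt0 : (0 < Ns)%N) (H_le : frobenius (Hs D) <= cH) (Hs_herm : Hs D \is hermsymmx).
Hypothesis Os_norm : frobenius (Os D) = 1.
Local Notation M := 'M[R[i]]_2.
Local Notation nt := (node_time D N).
Local Notation h := (horizon D / N%:R).
Local Notation mi := (mesh_index N).
Local Notation J := (used_draw D N Ns).
Local Notation E := (sample_space R J).
Variable Q : probability E R.
Hypothesis indep : independent_coords Q.
Hypothesis law : forall a (ab : draw_lower D N a < draw_upper D N a), J a ->
  forall A : set R, measurable A -> Q [set x | A (x a)] = uniform_prob ab A.
Local Notation sig := (sig D cW cL).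
Local Notation rate := (drift_rate D cW cL).
Local Notation Gt := (Gt D N Ns).
Local Notation Gd := (Gd D N).
Local Notation stagem := (stagem D N Ns).
Local Notation staged := (staged D N).
Local Notation noisem := (@noisem R D N Ns).
Local Notation driftm := (@driftm R D N Ns).
Local Notation regular := (regular N).
Local Notation predm := (predm D N Ns).
Local Notation predd := (predd D N).
Local Notation stable := (@stable R D N Ns).
Local Notation nrm := (nrm2 Q).

Local Notation Mbar := (max_order D).
Local Notation t := (horizon D).
Local Notation wt := (wt cW cL).
Local Notation orders := [seq m <- index_iota 1 Mbar.+1 | odd m].
Hypothesis order_odd : odd Mbar.
Variable cG : R.
Hypothesis cG_ge1 : 1 <= cG.
Hypothesis Gt_le : {ae Q, forall x, forall j k, (k <= j <= (2 * N).+1)%N -> frobenius (Gt x j k) <= cG}.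
Hypothesis Gd_le : forall j k, (k <= j <= (2 * N).+1)%N -> frobenius (Gd j k) <= cG.
Hypothesis h_small : h <= (threshold D cG cH cW cL)^-1.
Local Notation eps := ((10 * Mbar.+1%:R)^-1 : R).
Local Notation P1 G := (P1 Mbar G cW cL).
Local Notation Kmax := (100 * Num.sqrt (P1 cG (2 * t))).

Let cW0 : 0 <= cW. Proof. exact: le_trans (fro_ge0 _) W_le. Qed.
Let w0 : 0 <= wt. Proof. exact: wt_ge0 cL W_le. Qed.
Let cH0 : 0 <= cH. Proof. exact: cH_ge0 H_le. Qed.
Let cG0 : 0 <= cG. Proof. exact: le_trans ler01 cG_ge1. Qed.
Let h0 : 0 <= h. Proof. exact: step_ge0 t_gt0 N_gt0. Qed.
Let t0 : 0 <= 2 * t. Proof. by apply: mulr_ge0 => //; exact: ltW. Qed.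
Let e0 : 0 <= eps. Proof. by nonneg. Qed.

Let sig0 G x : 0 <= G -> 0 <= x -> 0 <= sig G x.
Proof. by move=> ? ?; apply: sumr_ge0 => m _; nonneg. Qed.

Let BB0 : 0 <= bias_rate D cW cL ((1 + eps) * cG) (2 * t).
Proof.
apply: sumr_ge0 => m _; apply: mulr_ge0; first by nonneg.
by apply: bias_cst_ge0; [exact: W_le|nonneg].
Qed.

Let small (x y : R) : x + y = threshold D cG cH cW cL -> 0 <= x -> 0 <= y -> h * x <= 1.
Proof.
move=> e x0 y0.
have Z0 : 0 < threshold D cG cH cW cL.
  rewrite lt_neqAle -e addr_ge0// andbT; apply/negP => /eqP z.
  have : 0 < h by exact: (step_gt0 t_gt0 N_gt0).
  by rewrite ltNge; move: h_small; rewrite -e -z invr0 => ->.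
apply: (@le_trans _ _ (h * threshold D cG cH cW cL)); first by rewrite ler_wpM2l// -e lerDl.
by rewrite -ler_pdivlMr// div1r.
Qed.

Let smallness : [/\ h <= 1, h * cH <= 4^-1, h * (cH + sig cG (2 * t)) <= eps, Kmax * h <= 10^-1 &
  [/\ h * (cH ^+ 4 / (50 * Num.sqrt (2 * wt ^+ 2 * cG))) <= 1, h * cH ^+ 4 <= 2^-1,
      h * bias_rate D cW cL ((1 + eps) * cG) (2 * t) <= 4^-1, h * cH ^+ 4 * (2 * t) <= 11^-1 & h <= 10^-1]].
Proof.
have := small; rewrite /threshold.
set a := 4 * cH; set b := 10 * _ * _; set c := 10 * Kmax; set d := _ / _; set e := 2 * cH ^+ 4.
set f := 4 * _; set g := 22 * _ * _.
have a0 : 0 <= a by rewrite /a; nonneg.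
have S0 := sig0 cG0 t0.
have b0 : 0 <= b by rewrite /b; nonneg.
have c0 : 0 <= c by rewrite /c; nonneg.
have d0 : 0 <= d by rewrite /d; nonneg.
have e'0 : 0 <= e by rewrite /e; nonneg.
have f0 : 0 <= f by rewrite /f; nonneg.
have g0 : 0 <= g by rewrite /g; apply: mulr_ge0; [apply: mulr_ge0 => //; exact: ltW|nonneg].
move=> H.
have H10 := H 10 (1 + a + b + c + d + e + f + g) _ _ _.
have Ha := H a (1 + b + c + d + e + f + g + 10) _ _ _.
have Hb := H b (1 + a + c + d + e + f + g + 10) _ _ _.
have Hc := H c (1 + a + b + d + e + f + g + 10) _ _ _.
have Hd := H d (1 + a + b + c + e + f + g + 10) _ _ _.
have He := H e (1 + a + b + c + d + f + g + 10) _ _ _.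
have Hf := H f (1 + a + b + c + d + e + g + 10) _ _ _.
have Hg := H g (1 + a + b + c + d + e + f + 10) _ _ _.
have {}H10 : h * 10 <= 1 by apply: H10; [ring|nonneg|nonneg].
have {}Ha : h * a <= 1 by apply: Ha; [ring|nonneg|nonneg].
have {}Hb : h * b <= 1 by apply: Hb; [ring|nonneg|nonneg].
have {}Hc : h * c <= 1 by apply: Hc; [ring|nonneg|nonneg].
have {}Hd : h * d <= 1 by apply: Hd; [ring|nonneg|nonneg].
have {}He : h * e <= 1 by apply: He; [ring|nonneg|nonneg].
have {}Hf : h * f <= 1 by apply: Hf; [ring|nonneg|nonneg].
have {}Hg : h * g <= 1 by apply: Hg; [ring|nonneg|nonneg].
have div (n x : R) : 0 < n -> n * x <= 1 -> x <= n^-1.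
  by move=> n0; rewrite -div1r ler_pdivlMr// mulrC.
have h10 : h <= 10^-1 by apply: div => //; rewrite mulrC.
split=> //.
- by apply: le_trans h10 _; rewrite invf_le1// ler1n.
- by apply: div => //; rewrite mulrCA.
- by apply: div; [rewrite mulr_gt0// ltr0n|rewrite mulrCA].
- by apply: div => //; rewrite mulrA mulrC.
split=> //.
- by apply: div => //; rewrite mulrCA.
- by apply: div => //; rewrite mulrCA.
- apply: div => //; suff <- : h * g = 11 * (h * cH ^+ 4 * (2 * t)) by [].
  by rewrite /g; ring.
Qed.

Variables (L : nat).
Hypothesis (L_le : (L <= 2 * N)%N).
Local Notation tau := (L%:R * h).

Let tau0 : 0 <= tau. Proof. by nonneg. Qed.

Let tau_le : 0 <= tau <= 2 * t.
Proof.
rewrite tau0 /=; have n0 : 0 < N%:R :> R by rewrite ltr0n.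
rewrite mulrA ler_pdivrMr// [leRHS]mulrAC; apply: ler_wpM2r; first exact: ltW.
by rewrite -natrM ler_nat.
Qed.

(** As Gb >= 1, the slope bound is a multiple of Gb, and the threshold makes the relative growth of
    one Euler step at most eps. *)
Let Gs_ok Gb : 1 <= Gb <= cG -> (1 + h * cH) * Gb + h * sig Gb tau <= (1 + eps) * Gb.
Proof.
move=> /andP[G1 GG]; have G0 := le_trans ler01 G1.
have [_ _ hs _ _] := smallness.
have s1 : sig Gb tau <= sig cG (2 * t) by apply: (sig_mono cL W_le); rewrite ?G0.
have s2 : sig Gb tau <= sig cG (2 * t) * Gb.
  by apply: (le_trans s1); rewrite -[X in X <= _]mulr1 ler_wpM2l// sig0.
have := ler_wpM2r G0 hs; have := ler_wpM2l h0 s2.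
exact: star_bound.
Qed.

Let P1c0 x : 0 <= x -> 0 <= P1 cG x. Proof. exact: P1_ge0. Qed.

(* For w = 0 the error vanishes and any positive rate will do. *)
Definition kappa : R := if wt == 0 then 1 else 100 * Num.sqrt (P1 cG tau).

(** [kappa] varies with the gap, but P1 lies between 2 w^2 cG and its value at 2t; this makes the
    conditions on h uniform in the gap. *)
Lemma kappa_ok Gb : 1 <= Gb <= cG -> [/\ 0 < kappa, kappa * h <= 10^-1, h * cH ^+ 4 <= kappa / 2 &
  12 * rate ((1 + eps) * Gb) tau <= kappa ^+ 2].
Proof.
move=> /andP[G1 GG]; have G0 := le_trans ler01 G1.
have [_ _ _ hK [hd hH _ _ h10]] := smallness.
have rle : rate ((1 + eps) * Gb) tau <= 10 / 9 * (3 * P1 cG tau).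
  apply: le_trans (rate_eps D cL cW0 G0 tau0) _; apply: ler_wpM2l; first by nonneg.
  apply: le_trans (rate_P1 cW0 cL_ge0 order_odd G0 tau0) _; apply: ler_wpM2l => //.
  by apply: (P1_mono D cW0 cL_ge0); rewrite ?G0 ?tau0 ?lexx ?GG.
rewrite /kappa; case: eqVneq => [wz|wn].
  split; [by []|by rewrite mul1r|by rewrite div1r|].
  rewrite (_ : rate _ _ = 0) ?mulr0 ?expr1n// /drift_rate big1// => m _.
  by rewrite wz expr0n /= !mul0r.
have wp : 0 < wt by rewrite lt_neqAle eq_sym wn.
have Pge := P1_first D cW0 cL_ge0 cG0 tau0.
have cGp : 0 < cG by exact: lt_le_trans ltr01 cG_ge1.
have q0 : 0 < 2 * wt ^+ 2 * cG.
  by apply: mulr_gt0 => //; apply: mulr_gt0 => //; exact: exprn_gt0.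
have P0 : 0 < P1 cG tau by exact: lt_le_trans Pge.
have sP : 0 < Num.sqrt (P1 cG tau) by rewrite sqrtr_gt0.
split; first by rewrite mulr_gt0.
- apply: le_trans hK; apply: ler_wpM2r => //; apply: ler_wpM2l => //.
  by rewrite ler_sqrt ?P1c0//; apply: (P1_mono D cW0 cL_ge0); rewrite ?cG0 ?lexx.
- have s0 : 0 < 50 * Num.sqrt (2 * wt ^+ 2 * cG) by rewrite mulr_gt0// sqrtr_gt0.
  move: hd; rewrite mulrA ler_pdivrMr// mul1r => /le_trans; apply.
  have sq : Num.sqrt (2 * wt ^+ 2 * cG) <= Num.sqrt (P1 cG tau) by rewrite ler_sqrt// ltW.
  exact: kappa_half.
have -> : (100 * Num.sqrt (P1 cG tau)) ^+ 2 = 100 ^+ 2 * P1 cG tau.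
  by rewrite exprMn (sqr_sqrtr (ltW P0)).
exact: (kappa_sqr rle (ltW P0)).
Qed.

Variables (j k : nat).
Hypotheses (kj : (k <= j <= (2 * N).+1)%N) (jk : mi j = (mi k + L)%N).

Let TE : ((mi j)%:R - (mi k)%:R) * h = tau.
Proof. by rewrite jk natrD addrC addKr. Qed.

(* P1 is linear in cG to leading order while sig is quadratic, so sig * tau is controlled by
   P1 tau^2 only if cG is.  For w tau > 1/10 one has cG <= 50 P1 tau^2; otherwise the
   propagators over the gap are bounded by 2 anyway. *)
Lemma small_bound : exists Gb, [/\ 1 <= Gb <= cG, sig Gb tau * tau <= (P1 cG tau * tau ^+ 2) + 25 * (P1 cG tau * tau ^+ 2) ^+ 2,
  {ae Q, forall x, forall j k, (k <= j <= (2 * N).+1)%N -> (mi j <= mi k + L)%N -> frobenius (Gt x j k) <= Gb} &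
  forall j k, (k <= j <= (2 * N).+1)%N -> (mi j <= mi k + L)%N -> frobenius (Gd j k) <= Gb].
Proof.
have [hle1 hcH _ _ [_ _ _ hH2 _]] := smallness.
have z0 : 0 <= P1 cG tau * tau ^+ 2 by apply: mulr_ge0; [exact: P1c0|nonneg].
have [wt10|wt10] := leP (wt * tau) 10^-1; last first.
  exists cG; split; [by rewrite cG_ge1 lexx| |by apply: ae_imply Gt_le => x H j1 k1 h1 _; exact: H|by move=> j1 k1 h1 _; exact: Gd_le].
  have sP := ler_wpM2r tau0 (sig_P1 cW0 cL_ge0 order_odd cG0 tau0).
  have Pge := ler_wpM2r (exprn_ge0 2 tau0) (P1_first D cW0 cL_ge0 cG0 tau0).
  have y2 : (10^-1) ^+ 2 <= (wt * tau) ^+ 2 by apply: lerXn2r; rewrite ?nnegrE; [nonneg|nonneg|exact: ltW].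
  exact: (large_gap sP Pge y2 cG0 z0).
have hT : h * cH ^+ 4 * tau <= 11^-1.
  by apply: le_trans hH2; apply: ler_wpM2l; [nonneg|case/andP: tau_le].
(* The minimum with cG keeps Gb within the range where P1 and the thresholds are controlled by their
   values at cG. *)
exists (Num.min 2 cG); split.
- by rewrite le_min cG_ge1 ler1n ge_min lexx orbT.
- have m0 : 0 <= Num.min 2 cG by rewrite le_min cG0 ler0n.
  have sP := ler_wpM2r tau0 (sig_P1 cW0 cL_ge0 order_odd m0 tau0).
  have Pm : P1 (Num.min 2 cG) tau <= P1 cG tau.
    by apply: (P1_mono D cW0 cL_ge0); rewrite ?m0 ?tau0 ?lexx// ge_min lexx orbT.
  have m2 : Num.min 2 cG <= 2 by rewrite ge_min lexx.
  have Pm0 := P1_ge0 D cW0 cL_ge0 m0 tau0.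
  exact: (small_gap sP Pm m2 m0 Pm0 tau0 z0).
- apply: ae_imply Gt_le => x H j1 k1 h1 h2; rewrite le_min (H j1 k1 h1) andbT.
  apply: (apriori t_gt0 N_gt0 W_le H_le Hs_herm Os_norm hle1 hcH wt10 hT (G := Gt x)
   (K0 := fun p q => slopem D N Ns x false p q (stagem false p q x))
   (K1 := fun p q => slopem D N Ns x true p q (stagem true p q x)) (A := fun p q => predm p q x) _ _ _ _ _ _ _ h1 h2).
  + by move=> k2; exact: Gt_diag.
  + by move=> p Np; exact: Gt_initial.
  + by move=> q qN; exact: Gt_final.
  + by move=> p q rg; exact: (Gt_step t_gt0 N_gt0 Ns_gt0 x rg).
  + by move=> p q; exact: predmE.
  + by move=> p q rg g3; exact: (mc_slope_le t_gt0 N_gt0 W_le cL_ge0 B_le Ns_gt0 x (b := false) rg g3).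
  move=> p q rg g3; apply: (mc_slope_le t_gt0 N_gt0 W_le cL_ge0 B_le Ns_gt0 x (b := true) rg) => j2 k2 h3 h4.
  by rewrite stagemE; exact: g3.
- move=> j1 k1 h1 h2; rewrite le_min (Gd_le h1) andbT.
  apply: (apriori t_gt0 N_gt0 W_le H_le Hs_herm Os_norm hle1 hcH wt10 hT (G := Gd)
   (K0 := fun p q => sloped D N false p q (staged false p q))
   (K1 := fun p q => sloped D N true p q (staged true p q)) (A := predd) _ _ _ _ _ _ _ h1 h2).
  + by move=> k2; exact: Gd_diag.
  + by move=> p Np; exact: Gd_initial.
  + by move=> q qN; exact: Gd_final.
  + by move=> p q rg; exact: (Gd_step t_gt0 N_gt0 B_meas W_le cL_ge0 B_le Ns_gt0 indep law rg).
  + by move=> p q; exact: preddE.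
  + by move=> p q rg g3; exact: (det_slope_le t_gt0 N_gt0 B_meas W_le cL_ge0 B_le Ns_gt0 indep law (b := false) rg g3).
  move=> p q rg g3; apply: (det_slope_le t_gt0 N_gt0 B_meas W_le cL_ge0 B_le Ns_gt0 indep law (b := true) rg) => j2 k2 h3 h4.
  by rewrite stagedE; exact: g3.
Qed.

Local Notation growth := (theta1 R * Num.sqrt (P1 cG tau) * tau).
Local Notation gamma := (gamma_bar Mbar cG cW cL tau).

Lemma sig_wt0 G : wt = 0 -> sig G tau = 0.
Proof. by move=> wz; rewrite /Submission.sig big1// => m _; rewrite wz mul0r expr0n /= !mul0r. Qed.

Let jkL : (mi j <= mi k + L)%N. Proof. by rewrite jk. Qed.
Let u0 : 0 <= h / Ns%:R. Proof. by nonneg. Qed.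

Lemma err_null : wt = 0 -> nrm (fun x => Gt x j k - Gd j k) = 0.
Proof.
move=> wz; have [Gb [Gb1 _ Gtb Gdb]] := small_bound.
have [hle1 hcH _ _ _] := smallness.
have Gb0 : 0 <= Gb by case/andP: Gb1 => /(le_trans ler01).
have [k1 k2 k3 k4] := kappa_ok Gb1.
apply/le_anti; rewrite nrm2_ge0 andbT.
have := mean_square_error t_gt0 N_gt0 B_meas W_le cL_ge0 B_le Ns_gt0 H_le Hs_herm Os_norm indep law
  Gb0 Gtb Gdb (Gs_ok Gb1) hle1 k1 hcH k2 k3 k4 kj jkL.
by rewrite (sig_wt0 _ wz) mulr0 !mul0r mulr0 mul0r.
Qed.

Lemma rms_estimate : nrm (fun x => Gt x j k - Gd j k) <=
  theta2 R * Num.sqrt gamma * expR growth * Num.sqrt (h / Ns%:R).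
Proof.
have [wz|wn] := eqVneq wt 0.
  by rewrite (err_null wz) /theta2; nonneg.
have [Gb [Gb1 sz Gtb Gdb]] := small_bound.
have [hle1 hcH _ _ _] := smallness.
have Gb0 : 0 <= Gb by case/andP: Gb1 => /(le_trans ler01).
have [k1 k2 k3 k4] := kappa_ok Gb1.
apply: le_trans (mean_square_error t_gt0 N_gt0 B_meas W_le cL_ge0 B_le Ns_gt0 H_le Hs_herm Os_norm indep law
  Gb0 Gtb Gdb (Gs_ok Gb1) hle1 k1 hcH k2 k3 k4 kj jkL) _.
rewrite TE /kappa (negbTE wn) /theta1 /theta2 gammaE.
have sle := sig_eps D cL cW0 Gb0 tau0.
have sg : sig Gb tau <= sig cG tau by apply: (sig_mono cL W_le); rewrite ?Gb0 ?tau0 ?lexx//; case/andP: Gb1.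
have z0 : 0 <= Num.sqrt (P1 cG tau) * tau by nonneg.
have z2 : P1 cG tau * tau ^+ 2 = (Num.sqrt (P1 cG tau) * tau) ^+ 2 by rewrite [RHS]exprMn (sqr_sqrtr (P1c0 tau0)).
rewrite z2 in sz.
have es0 : 0 <= (1 + eps) * Gb by nonneg.
rewrite -[100 * _ * tau]mulrA -[353 * _ * tau]mulrA.
exact: (rms_final (sig0 es0 tau0) (sig0 Gb0 tau0) sle sg sz z0 tau0 u0).
Qed.

Lemma bias_estimate (P2 : {poly R}) : 1 + bias_const D cG cH cW cL / (wt * cG) ^+ 2 <= P2.[tau] ->
  frobenius (Em Q (fun x => Gt x j k - Gd j k)) <=
  4 * theta2 R ^+ 2 * alpha_bar P2 tau * gamma * expR (3 * growth) * (h / Ns%:R).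
Proof.
move=> hP.
have sgm0 := sig0 cG0 tau0.
have mE : mbm (fun x : E => Gt x j k - Gd j k).
  exact: (mbmB (mbm_Gt t_gt0 N_gt0 B_meas W_le cL_ge0 B_le Ns_gt0 kj) (@mbm_cst _ E R _)).
have th : theta2 R ^+ 2 = 34 by rewrite sqr_sqrtr.
have bc0 : 0 <= bias_const D cG cH cW cL.
  rewrite /bias_const; set BBc := bias_rate _ _ _ _ _.
  have b0 : 0 <= BBc by exact: BB0.
  have s0 : 0 <= sig ((1 + eps) * cG) (2 * t) by apply: sig0 => //; nonneg.
  by nonneg.
have P20 : 1 <= P2.[tau] by apply: le_trans hP; rewrite lerDl; nonneg.
have P200 := le_trans ler01 P20.
have al0 : 10 * tau * (16 * P2.[tau]) <= alpha_bar P2 tau.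
  rewrite /alpha_bar mulrC; apply: ler_wpM2l; first by nonneg.
  by rewrite -!addrA lerDl; nonneg.
have g1 : 1 <= expR (3 * growth) by rewrite -[X in X <= _]expR0 ler_expR /theta1; nonneg.
(* For w = 0 the quotient by (w cG)^2 carries no information, but the error vanishes. *)
have [wz|wn] := eqVneq wt 0.
  apply: le_trans (fro_Em_le Q mE) _; rewrite (err_null wz) th gammaE.
  have a0 : 0 <= alpha_bar P2 tau by apply: le_trans al0; nonneg.
  by nonneg.
have cGc : 1 <= cG <= cG by rewrite cG_ge1 lexx.
have [hle1 hcH _ _ [_ _ hB _ _]] := smallness.
have [k1 k2 k3 k4] := kappa_ok cGc.
have Gtb : {ae Q, forall x, forall j k, (k <= j <= (2 * N).+1)%N -> (mi j <= mi k + L)%N -> frobenius (Gt x j k) <= cG}.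
  by apply: ae_imply Gt_le => x H j1 k1' h1 _; exact: H.
have Gdb j1 k1' : (k1' <= j1 <= (2 * N).+1)%N -> (mi j1 <= mi k1' + L)%N -> frobenius (Gd j1 k1') <= cG.
  by move=> h1 _; exact: Gd_le.
have Gs0 : 0 <= (1 + eps) * cG by nonneg.
pose Smax := sig ((1 + eps) * cG) (2 * t).
pose C1 := 3 * sig ((1 + eps) * cG) tau * Num.sqrt (tau * (h / Ns%:R)).
have S0 := sig0 Gs0 tau0.
have C10 : 0 <= C1 by rewrite /C1; nonneg.
(* The constant 4 covers the predictor as well as the nodal values, whose constant is 2. *)
pose A := 4 * (C1 * expR (kappa * tau)).
have A0 : 0 <= A by rewrite /A; nonneg.
have T_leL j1 k1' : (mi j1 <= mi k1' + L)%N -> ((mi j1)%:R - (mi k1')%:R) * h <= tau.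
  by move=> hh; apply: ler_wpM2r => //; rewrite lerBlDl -natrD ler_nat.
have err_le j1 k1' : (k1' <= j1 <= (2 * N).+1)%N -> (mi j1 <= mi k1' + L)%N -> nrm (fun x => Gt x j1 k1' - Gd j1 k1') <= A.
  move=> h1 h2; apply: le_trans (mean_square_error t_gt0 N_gt0 B_meas W_le cL_ge0 B_le Ns_gt0 H_le Hs_herm Os_norm indep law
    cG0 Gtb Gdb (Gs_ok cGc) hle1 k1 hcH k2 k3 k4 h1 h2) _.
  rewrite -mulrA; apply: ler_pM; [by []|by nonneg|by rewrite ler_nat|].
  by apply: ler_wpM2l => //; rewrite ler_expR; apply: ler_wpM2l; [exact: ltW|exact: T_leL].
have pred_le p q : regular p q -> (mi p.+1 <= mi q + L)%N -> nrm (fun x => predm p q x - predd p q) <= A.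
  move=> rg h2; apply: le_trans (predictor_error t_gt0 N_gt0 B_meas W_le cL_ge0 B_le Ns_gt0 H_le Hs_herm Os_norm indep law
    cG0 Gtb Gdb (Gs_ok cGc) hle1 k1 hcH k2 k3 k4 rg h2) _.
  apply: ler_wpM2l => //; apply: ler_wpM2l => //; rewrite ler_expR; apply: ler_wpM2l; first exact: ltW.
  apply: T_leL; apply: leq_trans h2; exact: (mi_le t_gt0 N_gt0 (leqnSn p)).
have BBle : bias_rate D cW cL ((1 + eps) * cG) tau <= bias_rate D cW cL ((1 + eps) * cG) (2 * t).
  apply: ler_sum => m _; apply: ler_wpM2r; first by apply: bias_cst_ge0; [exact: W_le|nonneg].
  apply: ler_wpM2r; first by nonneg.
  apply: ler_wpM2r; first by nonneg.
  by apply: lerXn2r; rewrite ?nnegrE//; case/andP: tau_le.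
have BE := bias_error t_gt0 N_gt0 B_meas W_le cL_ge0 B_le Ns_gt0 H_le Hs_herm Os_norm indep law
  cG0 Gtb Gdb (Gs_ok cGc) hle1 A0 hcH BBle hB err_le pred_le kj jkL.
apply: (le_trans BE); rewrite TE.
set BBc := bias_rate D cW cL ((1 + eps) * cG) (2 * t).
have BBc0 : 0 <= BBc by exact: BB0.
pose Lam := cH ^+ 4 + 2 * BBc.
have Lam0 : 0 <= Lam by rewrite /Lam; nonneg.
have /andP[_ tl] := tau_le.
have Sle : sig ((1 + eps) * cG) tau <= Smax by apply: (sig_mono cL W_le); rewrite ?Gs0 ?lexx.
have Smax0 := le_trans S0 Sle.
have kle : expR (kappa * tau) <= expR (Kmax * (2 * t)).
  rewrite ler_expR; apply: ler_pM => //; first exact: ltW.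
  rewrite /kappa (negbTE wn); apply: ler_wpM2l => //.
  by rewrite ler_sqrt ?P1c0//; apply: (P1_mono D cW0 cL_ge0); rewrite ?cG0 ?lexx.
have A2 : A ^+ 2 <= 144 * Smax ^+ 2 * expR (Kmax * (2 * t)) ^+ 2 * (tau * (h / Ns%:R)).
  have -> : A ^+ 2 = 144 * sig ((1 + eps) * cG) tau ^+ 2 * expR (kappa * tau) ^+ 2 * (tau * (h / Ns%:R)).
    have sq : Num.sqrt (tau * (h / Ns%:R)) ^+ 2 = tau * (h / Ns%:R) by rewrite sqr_sqrtr; [|nonneg].
    by rewrite -[X in _ = _ * X]sq /A /C1; ring.
  apply: ler_wpM2r; first by nonneg.
  apply: ler_pM; [by nonneg|by nonneg| |by apply: lerXn2r; rewrite ?nnegrE ?expR_ge0].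
  by apply: ler_wpM2l => //; apply: lerXn2r; rewrite ?nnegrE.
have Lle : expR (Lam * tau) <= expR (Lam * (2 * t)) by rewrite ler_expR ler_wpM2l.
have lhs : A ^+ 2 * Lam * tau * expR (Lam * tau) <= bias_const D cG cH cW cL * (tau ^+ 2 * (h / Ns%:R)).
  have -> : bias_const D cG cH cW cL * (tau ^+ 2 * (h / Ns%:R)) =
    144 * Smax ^+ 2 * expR (Kmax * (2 * t)) ^+ 2 * (tau * (h / Ns%:R)) * Lam * tau * expR (Lam * (2 * t)).
    by rewrite /bias_const -/Smax -/BBc -/Lam; ring.
  apply: ler_pM; [by nonneg|by nonneg| |exact: Lle].
  by apply: ler_wpM2r => //; apply: ler_wpM2r.
apply: (le_trans lhs); rewrite th gammaE.
have q0 : 0 < (wt * cG) ^+ 2.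
  apply: exprn_gt0; apply: mulr_gt0; first by rewrite lt_neqAle eq_sym wn.
  exact: lt_le_trans ltr01 cG_ge1.
have s1 := sig_first cL cW0 order_odd cG0 tau0.
exact: (bias_final hP q0 bc0 s1 al0 g1 tau0 u0).
Qed.

End ErrorEstimates.

(** * Back to the original probability space *)

Section AlmostEverywhereIntegral.
Context d (T : measurableType d) (R : realType) (P : probability T R).
Local Open Scope ereal_scope.

Lemma integral_le_any (f g : T -> \bar R) : (forall x, 0 <= f x) -> (forall x, f x <= g x) ->
  \int[P]_x f x <= \int[P]_x g x.
Proof.
move=> f0 fg; have g0 x : 0 <= g x by exact: le_trans (fg x).
rewrite !ge0_integralTE//; apply: le_ereal_sup => _ [k kf <-]; exists k => // x.
exact: le_trans (kf x) (fg x).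
Qed.

(* [f] need not be measurable: its integral is a supremum over the simple functions below it. *)
Lemma integral_ae_ge0 (f g : T -> \bar R) : (forall x, 0 <= f x) -> (forall x, 0 <= g x) ->
  measurable_fun setT g -> {ae P, forall x, f x = g x} -> \int[P]_x f x = \int[P]_x g x.
Proof.
move=> f0 g0 mg [N [mN N0 sN]].
have mb : measurable_fun setT (fun x => x \in N).
  apply: (measurable_fun_bool true); rewrite setTI (_ : _ @^-1` _ = N)//.
  by apply/seteqP; split => x /=; [move/set_mem|move/mem_set].
(* Off the null set f equals g, so f lies everywhere between these two measurable functions, which
   have the integral of g. *)
pose g1 x := if x \in N then +oo else g x. pose g2 x := if x \in N then 0 else g x.
have m1 : measurable_fun setT g1 by apply: measurable_fun_ifT => //; exact: measurable_cst.
have m2 : measurable_fun setT g2 by apply: measurable_fun_ifT => //; exact: measurable_cst.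
have p1 x : 0 <= g1 x by rewrite /g1; case: ifP.
have p2 x : 0 <= g2 x by rewrite /g2; case: ifP.
have out x : x \notin N -> f x = g x.
  by move=> xN; apply: contrapT => h; move: xN; rewrite mem_set//; exact: sN.
have e1 : \int[P]_x g1 x = \int[P]_x g x.
  apply: ge0_ae_eq_integral => //; exists N; split => // x /= h; apply: contrapT => xN; apply: h => _.
  by rewrite /g1 memNset.
have e2 : \int[P]_x g2 x = \int[P]_x g x.
  apply: ge0_ae_eq_integral => //; exists N; split => // x /= h; apply: contrapT => xN; apply: h => _.
  by rewrite /g2 memNset.
apply/le_anti/andP; split.
  rewrite -e1; apply: integral_le_any => // x; rewrite /g1; case: ifPn => [_|xN]; first by rewrite leey.
  by rewrite out.
rewrite -e2; apply: integral_le_any => // x; rewrite /g2; case: ifPn => // xN.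
by rewrite out.
Qed.

Lemma integral_ae (f g : T -> \bar R) : measurable_fun setT g -> {ae P, forall x, f x = g x} ->
  \int[P]_x f x = \int[P]_x g x.
Proof.
move=> mg fg; rewrite integralE [RHS]integralE; congr (_ - _); apply: integral_ae_ge0 => //.
- exact: measurable_funepos.
- by apply: ae_imply fg => x e; rewrite !funeposE e.
- exact: measurable_funeneg.
- by apply: ae_imply fg => x e; rewrite !funenegE e.
Qed.

End AlmostEverywhereIntegral.

(** * The law of the draws *)

Section CoordinateSpace.
Variables (R : realType) (D : model R) (N Ns : nat).
Context d (T : measurableType d) (P : probability T R) (X : draw -> T -> R).
Hypotheses (t_gt0 : 0 < horizon D) (N_gt0 : (0 < N)%N).
Hypothesis draws : valid_draws D N Ns P X.
Local Notation J := (used_draw D N Ns).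
Local Notation E := (sample_space R J).
Local Notation M := 'M[R[i]]_2.
Local Notation orders := [seq m <- index_iota 1 (max_order D).+1 | odd m].

Definition coords (w : T) : E := fun a => X a w.

Lemma measurable_coords : measurable_fun setT coords.
Proof. by have [mX _ _] := draws; apply: measurable_sample => a Ja; exact: mX. Qed.

Variable Q : probability E R.
Hypothesis QE : forall A, Q A = P (coords @^-1` A).

Lemma coords_independent : independent_coords Q.
Proof.
have [mX _ iX] := draws; move=> s A us Js mA.
have bigcapE s' : coords @^-1` (cyl s' A) = \bigcap_(a in [set` s']) (X a @^-1` A a).
  by apply/seteqP; split => w h a as_; exact: (h a as_).
rewrite QE bigcapE iX//; rewrite big_seq [RHS]big_seq; apply: eq_bigr => a as_.
rewrite QE; congr (P _); apply/seteqP; split => w /=.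
  by move=> h b; rewrite inE => /eqP ->.
by apply; rewrite inE.
Qed.

Lemma coords_law a (ab : draw_lower D N a < draw_upper D N a) : J a ->
  forall A : set R, measurable A -> Q [set x | A (x a)] = uniform_prob ab A.
Proof. by have [_ lX _] := draws; move=> Ja A mA; rewrite QE; exact: (proj1 (lX a Ja) ab A mA). Qed.

Lemma draw_le a : J a -> draw_lower D N a <= draw_upper D N a.
Proof.
case: a => [[[[[b p] q] i] m] c] /and5P[/andP[qp _] _ _ _ _]; rewrite /draw_lower /draw_upper.
by apply: (node_time_le t_gt0 N_gt0); case: b => //; exact: leqW.
Qed.

Lemma clip_ae : {ae P, forall w, forall a, J a -> clip D N a (X a w) = X a w}.
Proof.
have [mX lX _] := draws.
have one a : J a -> {ae P, forall w, clip D N a (X a w) = X a w}.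
  move=> Ja; have mXS (S : set R) : measurable S -> measurable (X a @^-1` S).
    by move=> mS; rewrite -[X in measurable X]setTI; exact: mX.
  have ok r : draw_lower D N a <= r <= draw_upper D N a -> clip D N a r = r.
    by move=> /andP[h1 h2]; rewrite /clip (min_idPr h2) (max_idPr h1).
  have := draw_le Ja; rewrite le_eqVlt => /orP[/eqP e|ab].
    (* On a degenerate interval the draw is a point mass, almost surely equal to the common end
       point. *)
    exists (X a @^-1` (~` [set draw_lower D N a])); split.
    - by apply: mXS; apply: measurableC; exact: measurable_set1.
    - rewrite (proj2 (lX a Ja) e)//; last by apply: measurableC; exact: measurable_set1.
      by rewrite diracE memNset//= => h; exact: h.
    by move=> w /= h eX; apply: h; apply: ok; rewrite -e eX lexx.
  have [S [mS S0 sS]] := uniform_ae ab.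
  exists (X a @^-1` S); split; first exact: mXS.
    by rewrite (proj1 (lX a Ja) ab).
  by move=> w /= h; apply: sS => /= hh; apply: h; exact: ok.
(* [draw] is countable: enumerating it unites the exceptional sets into one null set. *)
have H : {ae P, forall w, forall n, if unpickle n is Some a then J a -> clip D N a (X a w) = X a w else True}.
  apply: ae_foralln => n; case: (unpickle n : option draw) => [a|]; last exact: aeW.
  have [Ja|nJ] := boolP (J a); first by apply: ae_imply (one a Ja) => w h _.
  by apply: aeW.
apply: ae_imply H => w h a; have := h (pickle a); rewrite pickleK; exact.
Qed.

Hypothesis Ns_gt0 : (0 < Ns)%N.

Lemma mc_scheme_coords w : (forall a, J a -> clip D N a (X a w) = X a w) ->
  forall j k, (k <= j <= (2 * N).+1)%N -> mc_scheme D N Ns (X ^~ w) j k = Gt D N Ns (coords w) j k.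
Proof.
move=> hw j k kj.
suff H p q : (q <= p <= 2 * N)%N -> (p - q < j - k)%N -> p != N -> q != N ->
    slopes_agree
      (fun p q g => mc_sum D N Ns (sorted_sample (X ^~ w) false p q) p q g)
      (fun p q g => mc_sum D N Ns (sorted_sample (X ^~ w) true p q) p.+1 q g)
      (slopem D N Ns (coords w) false) (slopem D N Ns (coords w) true) p q.
  exact: (scheme_congr D H kj (leqnn _)).
move=> qp _ pN qN; have rg : regular N p q by rewrite /Submission.regular qp pN qN.
have key b g g' : agree q (final b p) g g' ->
    mc_sum D N Ns (sorted_sample (X ^~ w) b p q) (final b p) q g =
    mc_sum D N Ns (sorted_sample (clipped D N (coords w)) b p q) (final b p) q g'.
  move=> ag; apply: etrans (mc_sum_congr t_gt0 N_gt0 Ns_gt0 (x := coords w) rg ag (fun i iN => erefl)).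
  rewrite !mc_sumE; congr (_ *: _); apply: eq_big_seq => i; rewrite mem_index_iota => /andP[_ iN].
  have us := regular_usable rg iN.
  rewrite /est; congr (_ *: _); apply: eq_big_seq => m mo; congr (_ *: mesh_term D N _ _ _ _).
  rewrite /sorted_sample; congr (sort _ _); apply/eq_in_map => c; rewrite mem_iota => /andP[_ cm].
  by rewrite /clipped; symmetry; apply: hw; exact: usable_draw.
by split => g g' ag; [exact: (key false)|exact: (key true)].
Qed.

Lemma mc_scheme_ae : {ae P, forall w, forall j k, (k <= j <= (2 * N).+1)%N ->
  mc_scheme D N Ns (X ^~ w) j k = Gt D N Ns (coords w) j k}.
Proof. by apply: ae_imply clip_ae => w h; exact: mc_scheme_coords. Qed.

Lemma Ex_coords (f : E -> R) (F : T -> R) : bm f -> {ae P, forall w, F w = f (coords w)} ->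
  (\int[P]_w (F w)%:E = (Ex Q f)%:E)%E.
Proof.
move=> bf hF.
have bc : bm (f \o coords).
  have [mf [c fc]] := bf; split; last by exists c => w; exact: fc.
  exact: (measurableT_comp mf measurable_coords).
have e : (\int[P]_w (F w)%:E = \int[P]_w ((f \o coords) w)%:E)%E.
  apply: integral_ae; first by apply/measurable_EFinP; exact: bc.1.
  by apply: ae_imply hF => w ->.
apply: (etrans e); apply: (etrans (Ex_fin P bc)); congr (_%:E).
exact: (esym (Ex_transfer measurable_coords (fun A _ => QE A) bf)).
Qed.

Variables (cW cL cG : R).
Hypotheses (B_meas : measurable_corr D) (W_le : frobenius (Ws D) <= cW) (cL_ge0 : 0 <= cL)
  (B_le : forall s1 s2 : R, 0 <= s1 -> s1 <= s2 -> s2 <= 2 * horizon D ->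
       Normc.normc (corr D s2 s1) <= cL) (cG_ge0 : 0 <= cG).
Local Notation mG := (mbm_Gt t_gt0 N_gt0 B_meas W_le cL_ge0 B_le Ns_gt0).

(** A null set of P need not come from the sample space. The exceptional set is therefore rebuilt
    there, node by node, as a measurable event whose preimage lies in the given null set. *)
Lemma Gt_bound_ae : {ae P, forall w, forall j k, (k <= j <= (2 * N).+1)%N ->
    frobenius (mc_scheme D N Ns (X ^~ w) j k) <= cG} ->
  {ae Q, forall x, forall j k, (k <= j <= (2 * N).+1)%N -> frobenius (Gt D N Ns x j k) <= cG}.
Proof.
move=> hP.
have [S [mS S0 sS]] : {ae P, forall w, forall j k, (k <= j <= (2 * N).+1)%N ->
    frobenius (Gt D N Ns (coords w) j k) <= cG}.
  have [A [mA A0 sA]] := hP. have [B [mB B0 sB]] := mc_scheme_ae.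
  exists (A `|` B); split; [exact: measurableU|by apply/eqP; rewrite measureU0//; apply/eqP|].
  move=> w /= h; apply: contrapT => nAB; apply: h => j k kj.
  have h1 : forall j k, (k <= j <= (2 * N).+1)%N -> mc_scheme D N Ns (X ^~ w) j k = Gt D N Ns (coords w) j k.
    by apply: contrapT => h; apply: nAB; right; exact: sB.
  rewrite -h1//; move: (j) (k) kj; apply: contrapT => h; apply: nAB; left; apply: sA => /= h2.
  by apply: h => j' k'; exact: h2.
pose l := [seq (j, k) | j <- iota 0 (2 * N).+2, k <- iota 0 (2 * N).+2].
have H jk : jk \in l -> {ae Q, forall x, (jk.2 <= jk.1 <= (2 * N).+1)%N -> frobenius (Gt D N Ns x jk.1 jk.2) <= cG}.
  move=> _; have [kj|nkj] := boolP (jk.2 <= jk.1 <= (2 * N).+1)%N; last exact: aeW.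
  have bi := bm_ip (@mG _ _ kj) (@mG _ _ kj).
  pose Bad := (fun x : E => ip (Gt D N Ns x jk.1 jk.2) (Gt D N Ns x jk.1 jk.2)) @^-1` `]cG ^+ 2, +oo[%classic.
  have mBad : measurable Bad.
    by rewrite /Bad -[X in measurable X]setTI; apply: bi.1 => //; exact: measurable_itv.
  have bad x : ~ frobenius (Gt D N Ns x jk.1 jk.2) <= cG <-> Bad x.
    rewrite /Bad /= in_itv /= andbT -fro_sqr; split=> [/negP|h].
      by rewrite -ltNge => h; rewrite ltrXn2r// ?nnegrE ?fro_ge0.
    by move=> h2; move: h; apply/negP; rewrite -leNgt lerXn2r// ?nnegrE ?fro_ge0.
  have mC : measurable (coords @^-1` Bad).
    by rewrite -[X in measurable X]setTI; exact: (measurable_coords measurableT mBad).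
  have sub : coords @^-1` Bad `<=` S.
    by move=> w /bad h; apply: sS => /= h2; apply: h; exact: (h2 jk.1 jk.2 kj).
  exists Bad; split; first exact: mBad.
    exact: (etrans (QE Bad) (subset_measure0 mC mS sub S0)).
  by move=> x h; apply/bad => h2; apply: h => _; exact: h2.
apply: ae_imply (ae_all H) => x h j k kj; apply: (h (j, k)) => //.
by apply/allpairsP; exists (j, k); rewrite !mem_iota; split => //=; move: kj; clear; lia.
Qed.

Lemma mx_integral_coords j k : (k <= j <= (2 * N).+1)%N ->
  mx_integral P setT (fun w => mc_scheme D N Ns (X ^~ w) j k - det_scheme D N j k) =
  Em Q (fun x => Gt D N Ns x j k - Gd D N j k).
Proof.
move=> kj; have mE : mbm (fun x : E => Gt D N Ns x j k - Gd D N j k).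
  exact: (mbmB (@mG _ _ kj) (@mbm_cst _ E R _)).
apply: mx_co => -[b [i1 i2]].
have -> : co (b, (i1, i2)) (mx_integral P setT (fun w => mc_scheme D N Ns (X ^~ w) j k - det_scheme D N j k)) =
  Rintegral P setT (fun w => co (b, (i1, i2)) (mc_scheme D N Ns (X ^~ w) j k - det_scheme D N j k)).
  by rewrite /co /mx_integral /= mxE; case: b.
have hF : {ae P, forall w, co (b, (i1, i2)) (mc_scheme D N Ns (X ^~ w) j k - det_scheme D N j k) =
    co (b, (i1, i2)) (Gt D N Ns (coords w) j k - Gd D N j k)}.
  by apply: ae_imply mc_scheme_ae => w h; rewrite (h j k kj) GdE.
by rewrite co_Em /Rintegral (Ex_coords (mE (b, (i1, i2))) hF).
Qed.

Lemma second_moment_coords j k : (k <= j <= (2 * N).+1)%N ->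
  'E_P[fun w => (frobenius (mc_scheme D N Ns (X ^~ w) j k - det_scheme D N j k) ^+ 2)%R]%E =
  (nrm2 Q (fun x => Gt D N Ns x j k - Gd D N j k) ^+ 2)%:E.
Proof.
move=> kj; have mE : mbm (fun x : E => Gt D N Ns x j k - Gd D N j k).
  exact: (mbmB (@mG _ _ kj) (@mbm_cst _ E R _)).
have bi := bm_ip mE mE.
rewrite unlock nrm2_sqr; apply: (Ex_coords bi).
by apply: ae_imply mc_scheme_ae => w h; rewrite fro_sqr (h j k kj) GdE.
Qed.

End CoordinateSpace.

(** * Choice of P2 and conclusion *)

Lemma threshold_ge1 (R : realType) (D : model R) (cG cH cW cL : R) : 0 < horizon D ->
  frobenius (Ws D) <= cW -> 0 <= cH -> 0 <= cG -> 1 <= threshold D cG cH cW cL.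
Proof.
move=> t0 W_le cH0 cG0; have w0 := wt_ge0 cL W_le.
have cW0 := le_trans (fro_ge0 _) W_le; have t2 : 0 <= 2 * horizon D by apply: mulr_ge0 => //; exact: ltW.
have t22 : 0 <= 22 * horizon D by apply: mulr_ge0 => //; exact: ltW.
have s0 : 0 <= sig D cW cL cG (2 * horizon D) by apply: sumr_ge0 => m _; nonneg.
have b0 : 0 <= bias_rate D cW cL ((1 + (10 * (max_order D).+1%:R)^-1) * cG) (2 * horizon D).
  apply: sumr_ge0 => m _; apply: mulr_ge0; first by nonneg.
  by apply: bias_cst_ge0; [exact: W_le|nonneg].
rewrite /threshold -!addrA lerDl; nonneg.
Qed.

Lemma bias_const_ge0 (R : realType) (D : model R) (cG cH cW cL : R) : frobenius (Ws D) <= cW ->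
  0 <= cH -> 0 <= cG -> 0 < horizon D -> 0 <= bias_const D cG cH cW cL.
Proof.
move=> W_le cH0 cG0 t0; have w0 := wt_ge0 cL W_le.
have cW0 := le_trans (fro_ge0 _) W_le; have t2 : 0 <= 2 * horizon D by apply: mulr_ge0 => //; exact: ltW.
have b0 : 0 <= bias_rate D cW cL ((1 + (10 * (max_order D).+1%:R)^-1) * cG) (2 * horizon D).
  apply: sumr_ge0 => m _; apply: mulr_ge0; first by nonneg.
  by apply: bias_cst_ge0; [exact: W_le|nonneg].
have s0 : 0 <= sig D cW cL ((1 + (10 * (max_order D).+1%:R)^-1) * cG) (2 * horizon D).
  by apply: sumr_ge0 => m _; nonneg.
by rewrite /bias_const; nonneg.
Qed.

(** The constant term alone gives the lower bound; the equal higher coefficients only serve to reach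
    the prescribed degree. *)
Lemma constant_poly_horner (R : realType) (n : nat) (c x : R) : (0 < n)%N -> 0 <= c -> 0 <= x ->
  c <= (\poly_(i < n) c).[x].
Proof.
case: n => // n _ c0 x0; rewrite horner_poly big_ord_recl expr0 mulr1 lerDl.
by apply: sumr_ge0 => i _; nonneg.
Qed.

Unset Implicit Arguments.

Theorem theorem3 (R : realType) (D : model R) (Ge : R -> R -> 'M[R[i]]_2)
    (cG cH cW cL : R)
    (d : nat -> nat -> measure_display)
    (T : forall N Ns : nat, measurableType (d N Ns))
    (P : forall N Ns : nat, probability (T N Ns) R)
    (X : forall N Ns : nat, draw -> T N Ns -> R)
    (t_gt0 : 0 < horizon D)
    (order_odd : odd (max_order D))
    (Hs_herm : Hs D \is hermsymmx)
    (Ws_herm : Ws D \is hermsymmx)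
    (Os_herm : Os D \is hermsymmx)
    (Os_norm : frobenius (Os D) = 1)
    (B_meas : measurable_corr D)
    (Ge_exact : exact_solution D Ge)
    (draws : forall N Ns : nat, (0 < N)%N -> horizon D / N%:R <= 1 ->
       (0 < Ns)%N -> valid_draws D N Ns (P N Ns) (X N Ns))
    (H1_exact : forall si sf : R, 0 <= si -> si <= sf -> sf <= 2 * horizon D ->
       frobenius (Ge sf si) <= cG)
    (H1_det : forall N : nat, (0 < N)%N -> horizon D / N%:R <= 1 ->
       forall j k : nat, (k <= j <= (2 * N).+1)%N ->
         frobenius (det_scheme D N j k) <= cG)
    (H1_mc : forall N Ns : nat, (0 < N)%N -> horizon D / N%:R <= 1 ->
       (0 < Ns)%N ->
       {ae P N Ns, forall w, forall j k : nat, (k <= j <= (2 * N).+1)%N ->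
         frobenius (mc_scheme D N Ns (fun a => X N Ns a w) j k) <= cG})
    (H3_H : frobenius (Hs D) <= cH)
    (H3_W : frobenius (Ws D) <= cW)
    (H3_B : forall s1 s2 : R, 0 <= s1 -> s1 <= s2 -> s2 <= 2 * horizon D ->
       Normc.normc (corr D s2 s1) <= cL) :
  exists P2 : {poly R}, size P2 = max_order D /\
  exists h0 : R, exists N0 : nat, 0 < h0 /\
  forall N Ns : nat, (0 < N)%N -> horizon D / N%:R <= h0 -> (N0 <= Ns)%N ->
  forall n m : nat, (m <= n)%N -> (n <= 2 * N - 1)%N ->
  (* a and b range over the nodes carrying the mesh indices n+1 and m *)
  forall a b : nat, mesh_index N a = n.+1 -> mesh_index N b = m ->
  let h := horizon D / N%:R in
  let tau := (n - m).+1%:R * h in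
  let DeltaG w :=
    mc_scheme D N Ns (fun x => X N Ns x w) a b - det_scheme D N a b in
  let alpha := alpha_bar P2 tau in
  let gamma := gamma_bar (max_order D) cG cW cL tau in
  let growth := theta1 R * Num.sqrt (P1 (max_order D) cG cW cL tau) * tau in
  frobenius (mx_integral (P N Ns) setT DeltaG) <=
    4 * theta2 R ^+ 2 * alpha * gamma * expR (3 * growth) * (h / Ns%:R) /\
  (sqrte 'E_(P N Ns)[fun w => (frobenius (DeltaG w) ^+ 2)%R] <=
    (theta2 R * Num.sqrt gamma * expR growth * Num.sqrt (h / Ns%:R))%:E)%E.
Proof.
have [_ Ge_diag _ _ _] := Ge_exact.
have t2 : 0 <= 2 * horizon D by apply: mulr_ge0 => //; exact: ltW.
(* The exact propagator starts at the identity, of Frobenius norm sqrt 2. *)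
have cG1 : 1 <= cG.
  have := H1_exact 0 0 (lexx _) (lexx _) t2; rewrite Ge_diag ?lexx// fro1; apply: le_trans.
  by rewrite -[X in X <= _]sqrtr1 ler_sqrt// ler1n.
have cG0 : 0 <= cG := le_trans ler01 cG1.
have cL0 : 0 <= cL := le_trans (normc_ge0 _) (H3_B 0 0 (lexx _) (lexx _) t2).
have cH0 : 0 <= cH := le_trans (fro_ge0 _) H3_H.
have M0 : (0 < max_order D)%N by case: (max_order D) order_odd.
(* The 1 keeps the leading coefficient of P2 nonzero; C involves neither h nor Ns. *)
pose C := 1 + bias_const D cG cH cW cL / (wt cW cL * cG) ^+ 2.
have C1 : 1 <= C.
  rewrite /C lerDl; apply: mulr_ge0; last by rewrite invr_ge0 sqr_ge0.
  exact: bias_const_ge0.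
have th1 := @threshold_ge1 R D cG cH cW cL t_gt0 H3_W cH0 cG0.
exists (\poly_(i < max_order D) C); split.
  by rewrite size_poly_eq// gt_eqF// (lt_le_trans ltr01).
exists (threshold D cG cH cW cL)^-1, 1%N; split; first by rewrite invr_gt0 (lt_le_trans ltr01).
move=> N Ns N0 hs Ns0 n m mn n2 a b ma mb h tau DeltaG alpha gamma growth.
have h1 : horizon D / N%:R <= 1 by apply: (le_trans hs); rewrite invf_le1// (lt_le_trans ltr01).
have dr := draws N Ns N0 h1 Ns0.
have [Q QE] := image_law (P N Ns) (measurable_coords dr).
have ind := coords_independent dr QE.
have lw := coords_law dr QE.
have Gtb := Gt_bound_ae t_gt0 N0 dr QE Ns0 B_meas H3_W cL0 H3_B cG0 (H1_mc N Ns N0 h1 Ns0).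
have Gdb : forall j k, (k <= j <= (2 * N).+1)%N -> frobenius (Gd D N j k) <= cG := H1_det N N0 h1.
have ab : (b <= a <= (2 * N).+1)%N.
  by move: ma mb mn n2 N0; rewrite /mesh_index; case: ifP; case: ifP; clear; lia.
have LN : ((n - m).+1 <= 2 * N)%N by move: mn n2 N0; clear; lia.
have mab : mesh_index N a = (mesh_index N b + (n - m).+1)%N by rewrite ma mb; move: mn; clear; lia.
have tau0 : 0 <= tau by rewrite /tau /h; apply: mulr_ge0 => //; exact: (step_ge0 t_gt0 N0).
have rms := rms_estimate t_gt0 N0 B_meas H3_W cL0 H3_B Ns0 H3_H Hs_herm Os_norm ind lw order_odd cG1
  Gtb Gdb hs LN ab mab.
have hP : C <= (\poly_(i < max_order D) C).[tau].
  by apply: constant_poly_horner => //; exact: le_trans ler01 C1.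
have bias := bias_estimate t_gt0 N0 B_meas H3_W cL0 H3_B Ns0 H3_H Hs_herm Os_norm ind lw order_odd cG1
  Gtb Gdb hs LN ab mab hP.
split.
  have e := mx_integral_coords t_gt0 N0 dr QE Ns0 B_meas H3_W cL0 H3_B ab.
  by rewrite [X in frobenius X]e.
have e := second_moment_coords t_gt0 N0 dr QE Ns0 B_meas H3_W cL0 H3_B ab.
rewrite [X in sqrte X]e /sqrte sqrtr_sqr (ger0_norm (nrm2_ge0 _ _)) lee_fin.
exact: rms.
Qed.
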